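(* Let $p>1$ and $\mu>0$. Let $f\in C^3(\mathbb{R})$ satisfy $f(0)=f'(0)=0$ and $f''(u)>0$ for all $u\in\mathbb{R}$, and let $u_-=u_+=\tilde u\in\mathbb{R}$. Assume that $u_0-\tilde u\in L^1\cap L^2$ and $\partial_x u_0\in L^{p+1}$. Let $u$ be the unique global weak solution of the Cauchy problem $$\partial_t u+\partial_x(f(u))=\mu\,\partial_x\left(|\partial_x u|^{p-1}\partial_x u\right)\ (t>0,\ x\in\mathbb{R}),\qquad u(0,x)=u_0(x)\ (x\in\mathbb{R}),\qquad \lim_{x\to\pm\infty}u(t,x)=\tilde u\ (t\ge 0)$$ satisfying $$u-\tilde u\in C^0([0,\infty);L^2)\cap L^\infty(\mathbb{R}^+;L^2),$$ $$\partial_x u\in L^\infty(\mathbb{R}^+;L^{p+1})\cap L^{p+1}(\mathbb{R}^+_t\times\mathbb{R}_x)\cap L^{p+2}(\mathbb{R}^+_t\times\mathbb{R}_x),\qquad \partial_x\left(|\partial_x u|^{p-1}\partial_x u\right)\in L^2(\mathbb{R}^+_t\times\mathbb{R}_x).$$ Then for every $q\in[1,\infty)$ and every $\epsilon>0$ there exist constants $C(p,q,u_0)$ and $C(\epsilon,p,q,u_0,\partial_x u_0)$ such that for all $t\ge0$ $$\|u(t)-\tilde u\|_{L^q}\le C(p,q,u_0)\,(1+t)^{-\frac{1}{2p}\left(1-\frac1q\right)},$$ $$\|u(t)-\tilde u\|_{L^\infty}\le C(\epsilon,p,q,u_0,\partial_x u_0)\,(1+t)^{-\frac{1}{2p}+\epsilon}.$$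 Furthermore, for every $\epsilon>0$ there exists a constant $C(\epsilon,p,u_0,\partial_x u_0)$ such that for all $t\ge 0$ $$\|\partial_x u(t)\|_{L^{p+1}}\le C(\epsilon,p,u_0,\partial_x u_0)\,(1+t)^{-\frac{3}{2(p+1)(3p-2)}+\epsilon}.$$
   Context: $L^q=L^q(\mathbb{R})$ and $\mathbb{R}^+=(0,\infty)$. The notation $C(\alpha,\beta,\dots)$ is used for positive constants to emphasize their dependence on $\alpha,\beta,\dots$; the fixed data $\mu$, $f$ and the far field state are not listed. Weak solution has its usual meaning (the equation holds in the sense of distributions and the initial datum is attained). It is a known result of Matsumura and Nishihara that, when $u_0-\tilde u\in L^2$ and $\partial_xu_0\in L^{p+1}$, a unique global weak solution in the stated class exists (and $\sup_x|u(t,x)-\tilde u|\to0$ as $t\to\infty$). *)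

(* Defs.v *)
From HB Require Import structures.
From mathcomp Require Import all_boot all_order all_algebra.
From mathcomp Require Import all_classical all_reals all_analysis.

Set Implicit Arguments.
Unset Strict Implicit.
Unset Printing Implicit Defensive.
Import Order.TTheory GRing.Theory Num.Theory.
Import numFieldNormedType.Exports.
Local Open Scope classical_set_scope.
Local Open Scope ring_scope.

Notation leb1 R := (@lebesgue_measure R).
Notation leb2 R := (leb1 R \x leb1 R)%E.

Definition Lnorm_R (R : realType) (q : \bar R) (g : R -> R) : \bar R :=
  Lnorm (leb1 R) q (EFin \o g).

Definition half_plane (R : realType) : set (R * R) := [set z | 0 < z.1].
Arguments half_plane R : clear implicits.

(* For finite-dimensional V this is class C^oo. *)
Definition smooth (R : realType) (V : normedModType R) (phi : V -> R) : Prop :=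
  forall s : seq V,
    let g := foldr (fun v (h : V -> R) => 'D_v h) phi s in
    continuous g /\ forall x v, derivable g x v.

Definition test_function (R : realType) (V : normedModType R) (O : set V)
    (phi : V -> R) : Prop :=
  smooth phi /\
  exists2 K : set V, compact K /\ K `<=` O & forall x, ~ K x -> phi x = 0.

Definition of_class_C3 (R : realType) (f : R -> R) : Prop :=
  (forall k, (k < 3)%N -> forall x, derivable (derive1n k f) x 1) /\
  continuous (derive1n 3 f).

Definition weak_derivative (R : realType) (g dg : R -> R) : Prop :=
  [/\ locally_integrable [set: R] g, locally_integrable [set: R] dg &
   forall phi : R -> R, test_function [set: R] phi ->
     \int[leb1 R]_x (g x * derive1 phi x) = - \int[leb1 R]_x (dg x * phi x)].

(* Functions of (t, x) are curried; only their values for t > 0 matter in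
   the four definitions below. *)
Definition locally_integrable2 (R : realType) (g : R -> R -> R) : Prop :=
  measurable_fun (half_plane R) (fun z : R * R => g z.1 z.2) /\
  forall K : set (R * R), compact K -> K `<=` half_plane R ->
    (\int[leb2 R]_(z in K) `|g z.1 z.2|%:E < +oo)%E.

Definition weak_x_derivative (R : realType) (g dg : R -> R -> R) : Prop :=
  [/\ locally_integrable2 g, locally_integrable2 dg &
   forall phi : R * R -> R, test_function (half_plane R) phi ->
     \int[leb2 R]_(z in half_plane R) (g z.1 z.2 * 'D_(0, 1) phi z) =
     - \int[leb2 R]_(z in half_plane R) (dg z.1 z.2 * phi z)].

Definition in_Lspacetime (R : realType) (r : R) (g : R -> R -> R) : Prop :=
  measurable_fun (half_plane R) (fun z : R * R => g z.1 z.2) /\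
  (\int[leb2 R]_(z in half_plane R) (`|g z.1 z.2| `^ r)%:E < +oo)%E.

Definition in_Linfty_L (R : realType) (r : R) (g : R -> R -> R) : Prop :=
  measurable_fun (half_plane R) (fun z : R * R => g z.1 z.2) /\
  exists M : R, {ae leb1 R, forall t, 0 < t ->
    (Lnorm_R r%:E (g t) <= M%:E)%E}.

Definition in_C0_L (R : realType) (r : R) (g : R -> R -> R) : Prop :=
  (forall t, 0 <= t -> g t \in Lfun (leb1 R) r%:E) /\
  forall t, 0 <= t ->
    Lnorm_R r%:E (g s \- g t) @[s --> within `[0, +oo[ (nbhs t)]
      --> 0%E.

Definition flux (R : realType) (p : R) (s : R) : R := `|s| `^ (p - 1) * s.

(* [ux] is the distributional derivative of [u] in x, and [gx] that of
   [|ux|^(p-1) ux].  Elements of Lebesgue spaces are represented by functions,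
   so the initial and far field conditions are imposed up to null sets. *)
Record global_weak_solution (R : realType) (p mu : R) (f : R -> R)
    (ut : R) (u0 : R -> R) (u ux gx : R -> R -> R) : Prop := {
  gws_ux : weak_x_derivative u ux ;
  gws_gx : weak_x_derivative (fun t x => flux p (ux t x)) gx ;
  gws_fu : locally_integrable2 (fun t x => f (u t x)) ;
  gws_eq : forall phi : R * R -> R, test_function (half_plane R) phi ->
    \int[leb2 R]_(z in half_plane R)
      (u z.1 z.2 * 'D_(1, 0) phi z + f (u z.1 z.2) * 'D_(0, 1) phi z) =
    mu * \int[leb2 R]_(z in half_plane R)
      (flux p (ux z.1 z.2) * 'D_(0, 1) phi z) ;
  gws_init : {ae leb1 R, forall x, u 0 x = u0 x} ;
  gws_far : forall t, 0 <= t ->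
    exists2 U : R -> R, {ae leb1 R, forall x, U x = u t x} &
      (U x @[x --> +oo] --> ut) /\ (U x @[x --> -oo] --> ut) ;
  gws_u_C0 : in_C0_L 2 (fun t x => u t x - ut) ;
  gws_u_Linfty : in_Linfty_L 2 (fun t x => u t x - ut) ;
  gws_ux_Linfty : in_Linfty_L (p + 1) ux ;
  gws_ux_Lp1 : in_Lspacetime (p + 1) ux ;
  gws_ux_Lp2 : in_Lspacetime (p + 2) ux ;
  gws_gx_L2 : in_Lspacetime 2 gx
}.

(* Main.v *)
(** Write [v = u - ut], so that [v_t = A] with [A = mu gx - f'(ut + v) ux].  If a
    functional [Q] of the solution satisfies
    [Q(t) - Q(s) <= \int B(t) (v(t) - v(s)) dx], with [B] its gradient, then averaging
    over small time steps gives [Q(b) - Q(a) <= \int\int B A]: no time derivative of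
    the solution is needed beyond the equation itself.

    For [Q = \int eta(v)] with [eta] convex this is the entropy inequality.  Powers and
    smoothed absolute values give the maximum principle and the contraction in [L^1];
    with [|v|^(q+1) <= (q+1) \int |v|^q |ux|] the dissipation then bounds a power of
    [E = \int |v|^q], so that [E' <= - c E^(1 + 2p/(q-1))] in integrated form.  The sup
    norm is controlled by [E] for large [q] and a bound of [\int |ux|^(p+1)].

    For [Q = y / (p+1)], [y = \int |ux|^(p+1)], the dissipation is [mu \int gx^2] and
    interpolation absorbs the convection term up to
    [y(b) <= y(a) + C \int_a^b y^(1 + 2/(3p))].  As the tail [\int_t^oo y] is
    [O((1+t)^(-1/(2p)))], every time lies just after a time where [y] is small compared
    with its average, and the inequality propagates this smallness over a window of
    length [c t^(1/(p(3p-2)))]: [y = O((1+t)^(-3/(2(3p-2))))] almost everywhere, hence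
    everywhere because bounds of [\int |ux|^(p+1)] are closed under [L^2] limits. *)

Require Import Defs.
From HB Require Import structures.
From mathcomp Require Import all_boot all_order all_algebra.
From mathcomp Require Import all_classical all_reals all_analysis.
From mathcomp Require Import measurable_realfun ess_sup_inf ring lra.
Set Implicit Arguments.
Unset Strict Implicit.
Unset Printing Implicit Defensive.
Import Order.TTheory GRing.Theory Num.Theory.
Import numFieldNormedType.Exports.
Local Open Scope classical_set_scope.
Local Open Scope ring_scope.

(** * Integrals of real functions *)

Section Integral.
Context d (T : measurableType d) (R : realType) (m : {measure set T -> \bar R}).
Implicit Types f g : T -> R.

(** The exponents come from a balance. Interpolation bounds [sup |ux|^(3p+1)] by [4 y \int gx^2];
    absorbing [y sup |ux|] into [mu \int gx^2] leaves [y^(1 + sigma)] with [sigma = 2/(3p)]. On a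
    window of length [h] on which [y] starts at the size [t^(-1/(2p)) / h], this size persists while
    [h (t^(-1/(2p)) / h)^sigma] stays small, that is for [h ~ t^(1/(p(3p-2)))], and
    [1/(2p) + 1/(p(3p-2)) = 3/(2(3p-2))]. Three obstacles shape the rest. The constants are chosen
    before the solution, so decay estimates may use only bounds on the data: [m] in [L^1], [K] for
    the supremum, [Y0] for the slope; the bounds of the solution class serve for integrability and
    for terms that vanish in a limit. The slope [ux] has a meaning at almost every time only, so
    identities are proved at good times and carried to all times by [L^2] continuity, and at the
    initial time the slope is that of the datum. *)

Definition L1 f := m.-integrable setT (EFin \o f).
(** The real-valued integral is total and returns 0 for an infinite one. A bound on [I f] therefore
    carries information only next to a proof of [L1 f], and many lemmas conclude with both. *)
Definition I f : R := \int[m]_x f x.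

Lemma ae_imp (P Q : T -> Prop) : {ae m, forall x, P x} -> (forall x, P x -> Q x) ->
  {ae m, forall x, Q x}.
Proof. by move=> H PQ; move: H; apply: filterS. Qed.

Lemma ae_imp2 (P1 P2 Q : T -> Prop) : {ae m, forall x, P1 x} ->
  {ae m, forall x, P2 x} -> (forall x, P1 x -> P2 x -> Q x) -> {ae m, forall x, Q x}.
Proof. by move=> H1 H2 PQ; move: H1 H2; apply: filterS2. Qed.

Lemma ae_imp3 (P1 P2 P3 Q : T -> Prop) : {ae m, forall x, P1 x} ->
  {ae m, forall x, P2 x} -> {ae m, forall x, P3 x} ->
  (forall x, P1 x -> P2 x -> P3 x -> Q x) -> {ae m, forall x, Q x}.
Proof. by move=> H1 H2 H3 PQ; move: H1 H2 H3; apply: filterS3. Qed.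

Lemma L1_meas f : L1 f -> measurable_fun setT f.
Proof. by move=> /integrableP[/measurable_EFinP]. Qed.

Lemma L1_le f g : measurable_fun setT f -> (forall x, `|f x| <= g x) -> L1 g ->
  L1 f.
Proof.
move=> mf fg ig; apply: (le_integrable _ _ _ ig) => //; first exact/measurable_EFinP.
by move=> x _ /=; rewrite lee_fin (le_trans (fg x))// ler_norm.
Qed.

Lemma L1_aele f g : measurable_fun setT f -> {ae m, forall x, `|f x| <= g x} ->
  L1 g -> L1 f.
Proof.
move=> mf fg /integrableP[mg ig]; apply/integrableP; split; first exact/measurable_EFinP.
apply: le_lt_trans ig; apply: ae_ge0_le_integral => //.
- by apply: measurableT_comp => //; exact/measurable_EFinP.
- exact: measurableT_comp.
- move: fg; apply: filterS => x fgx _ /=.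
  by rewrite lee_fin (le_trans fgx)// ler_norm.
Qed.

Lemma eq_L1 f g : (forall x, f x = g x) -> L1 f -> L1 g.
Proof. by move=> fg; rewrite (_ : f = g)//; apply/funext. Qed.

Lemma eq_I f g : (forall x, f x = g x) -> I f = I g.
Proof. by move=> fg; rewrite (_ : f = g)//; apply/funext. Qed.

Lemma L1_0 : L1 (fun=> 0).
Proof. exact: integrable0. Qed.

Lemma L1D f g : L1 f -> L1 g -> L1 (fun x => f x + g x).
Proof. by move=> lf lg; exact: (integrableD _ lf lg). Qed.

Lemma L1Z c f : L1 f -> L1 (fun x => c * f x).
Proof. by move=> lf; exact: (integrableZl _ c lf). Qed.

Lemma L1N f : L1 f -> L1 (fun x => - f x).
Proof. by move=> /(L1Z (-1)); apply: eq_L1 => x; rewrite mulN1r. Qed.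

Lemma L1B f g : L1 f -> L1 g -> L1 (fun x => f x - g x).
Proof. by move=> lf lg; apply: L1D => //; exact: L1N. Qed.

Lemma L1_abs f : L1 f -> L1 (fun x => `|f x|).
Proof. by move=> lf; apply: integrable_norm. Qed.

Lemma I_0 : I (fun=> 0) = 0.
Proof. by rewrite /I /Rintegral integral0. Qed.

Lemma ID f g : L1 f -> L1 g -> I (fun x => f x + g x) = I f + I g.
Proof. by move=> lf lg; rewrite /I RintegralD. Qed.

Lemma IB f g : L1 f -> L1 g -> I (fun x => f x - g x) = I f - I g.
Proof. by move=> lf lg; rewrite /I RintegralB. Qed.

Lemma IZ c f : L1 f -> I (fun x => c * f x) = c * I f.
Proof. by move=> lf; rewrite /I RintegralZl. Qed.

Lemma I_ge0 f : (forall x, 0 <= f x) -> 0 <= I f.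
Proof. by move=> f0; apply: Rintegral_ge0. Qed.

Lemma I_le f g : L1 f -> L1 g -> (forall x, f x <= g x) -> I f <= I g.
Proof. by move=> lf lg fg; apply: le_Rintegral. Qed.

Lemma I_abs f : L1 f -> `|I f| <= I (fun x => `|f x|).
Proof. by move=> lf; apply: le_normr_Rintegral. Qed.

Lemma I_aeeq f g : measurable_fun setT f -> measurable_fun setT g ->
  {ae m, forall x, f x = g x} -> I f = I g.
Proof.
move=> mf mg fg; rewrite /I /Rintegral; congr fine.
apply: ae_eq_integral => //; try exact/measurable_EFinP.
by move: fg; apply: filterS => x -> _.
Qed.

Lemma L1_aeeq f g : measurable_fun setT g -> {ae m, forall x, f x = g x} ->
  L1 f -> L1 g.
Proof.
move=> mg fg lf; apply: (L1_aele _ _ (L1_abs lf)) => //.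
by move: fg; apply: filterS => x ->.
Qed.

(** Replacing [g] by [max f g], which agrees with it almost everywhere, turns the hypothesis into an
    inequality at every point. *)
Lemma I_aele f g : L1 f -> L1 g -> {ae m, forall x, f x <= g x} -> I f <= I g.
Proof.
move=> lf lg fg.
have mf := L1_meas lf; have mg := L1_meas lg.
have mM : measurable_fun setT (fun x => Num.max (f x) (g x)) by exact: measurable_maxr.
have aeM : {ae m, forall x, g x = Num.max (f x) (g x)}.
  by move: fg; apply: filterS => x fgx; rewrite (max_idPr fgx).
rewrite (I_aeeq mg mM aeM); apply: I_le => //.
- exact: L1_aeeq mM aeM lg.
- by move=> x; rewrite le_max lexx.
Qed.

Lemma I_aele_abs f g : L1 f -> L1 g -> {ae m, forall x, `|f x| <= g x} ->
  `|I f| <= I g.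
Proof. by move=> lf lg fg; rewrite (le_trans (I_abs lf))// I_aele//; exact: L1_abs. Qed.

Lemma I_le_abs f g : L1 f -> L1 g -> (forall x, `|f x| <= g x) -> `|I f| <= I g.
Proof. by move=> lf lg fg; rewrite (le_trans (I_abs lf))// I_le//; exact: L1_abs. Qed.

Lemma EFin_I f : L1 f -> (I f)%:E = (\int[m]_x (f x)%:E)%E.
Proof. by move=> lf; rewrite /I /Rintegral fineK//; exact: integrable_fin_num. Qed.

Lemma L1_ge0_fin f : measurable_fun setT f -> (forall x, 0 <= f x) ->
  (\int[m]_x (f x)%:E < +oo)%E -> L1 f.
Proof.
move=> mf f0 fi; apply/integrableP; split; first exact/measurable_EFinP.
by under eq_integral do rewrite /= ger0_norm//.
Qed.

Lemma L1_ge0_lty f : L1 f -> (forall x, 0 <= f x) -> (\int[m]_x (f x)%:E < +oo)%E.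
Proof. by move=> lf f0; rewrite -EFin_I// ltry. Qed.

Lemma I_eq0_ae f : L1 f -> {ae m, forall x, 0 <= f x} -> I f = 0 ->
  {ae m, forall x, f x = 0}.
Proof.
move=> lf f0 If0.
have mf := L1_meas lf; have mn := L1_meas (L1_abs lf).
have E : {ae m, forall x, f x = `|f x|}.
  by move: f0; apply: filterS => x x0; rewrite ger0_norm.
have In0 : (\int[m]_x `|(EFin \o f) x| = 0)%E.
  transitivity ((I (fun x => `|f x|))%:E); last by rewrite -(I_aeeq mf mn E) If0.
  by rewrite EFin_I//; exact: L1_abs.
have /ae_eq_integral_abs : measurable_fun setT (EFin \o f) by exact/measurable_EFinP.
move=> /(_ m measurableT)[+ _] => /(_ In0).
by apply: filterS => x /= /(_ Logic.I) [].
Qed.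

(** The quadratic [a -> \int (f - a g)^2] is nonnegative; its value at the minimizer [X / G] is the
    claim. *)
Lemma cauchy_schwarz f g : measurable_fun setT f -> measurable_fun setT g ->
  L1 (fun x => f x ^+ 2) -> L1 (fun x => g x ^+ 2) ->
  L1 (fun x => f x * g x) /\
  I (fun x => f x * g x) ^+ 2 <= I (fun x => f x ^+ 2) * I (fun x => g x ^+ 2).
Proof.
move=> mf mg lf lg.
have lfg : L1 (fun x => f x * g x).
  apply: L1_le (L1D lf lg); first exact: measurable_funM.
  move=> x; rewrite ler_norml; apply/andP; split; first by have := sqr_ge0 (f x + g x); nra.
  by have := sqr_ge0 (f x - g x); nra.
split => //; set X := I _; set F := I _; set G := I _.
have key (a : R) : 0 <= F - 2 * a * X + a ^+ 2 * G.
  have -> : F - 2 * a * X + a ^+ 2 * G = I (fun x => f x ^+ 2 - 2 * a * (f x * g x) + a ^+ 2 * g x ^+ 2).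
    rewrite ID ?IB ?IZ//; first exact: L1Z.
    - by apply: L1B => //; exact: L1Z.
    - exact: L1Z.
  by apply: I_ge0 => x; have := sqr_ge0 (f x - a * g x); nra.
have G0 : 0 <= G by apply: I_ge0 => x; exact: sqr_ge0.
have F0 : 0 <= F by apply: I_ge0 => x; exact: sqr_ge0.
have [G1|Gz] := ltP 0 G; last first.
  have Ge : G = 0 by apply/eqP; rewrite eq_le Gz G0.
  have [->|Xn0] := eqVneq X 0; first by rewrite expr0n/= mulr_ge0.
  (* With [G = 0] and [X != 0] the quadratic is affine in [a], and this [a] gives it the value
     -1. *)
  have := key ((F + 1) / (2 * X)); rewrite Ge mulr0 addr0.
  have -> : 2 * ((F + 1) / (2 * X)) * X = F + 1 by field.
  lra.
have := key (X / G); have -> : F - 2 * (X / G) * X + (X / G) ^+ 2 * G = F - X ^+ 2 / G.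
  by field; rewrite gt_eqF.
by rewrite subr_ge0 ler_pdivrMr.
Qed.

Lemma dct (f_ : nat -> T -> R) f g :
  (forall n, measurable_fun setT (f_ n)) -> measurable_fun setT f ->
  {ae m, forall x, f_ n x @[n --> \oo] --> f x} -> L1 g ->
  (forall n, {ae m, forall x, `|f_ n x| <= g x}) ->
  L1 f /\ I (f_ n) @[n --> \oo] --> I f.
Proof.
move=> mf_ mf cf lg fg.
have lf_ n : L1 (f_ n) by exact: L1_aele (fg n) lg.
have H := @dominated_convergence _ _ _ m setT measurableT
    (fun n => EFin \o f_ n) (EFin \o f) (EFin \o g).
have [] := H.
- by move=> n; exact/measurable_EFinP.
- exact/measurable_EFinP.
- move: cf; apply: filterS => x cfx _ /=.
  by apply/fine_cvgP; split => //; exact: nearW.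
- exact: lg.
- have : {ae m, forall x, forall n, `|f_ n x| <= g x}.
    by apply/ae_foralln.
  by apply: filterS => x K n _ /=; rewrite lee_fin.
move=> lf _ c; split => //.
have : fine (\int[m]_x (EFin \o f_ n) x)%E @[n --> \oo] -->
       fine (\int[m]_x (EFin \o f) x)%E.
  apply: fine_cvg; rewrite fineK//; exact: integrable_fin_num lf.
exact.
Qed.

(** Fatou's lemma together with integrability of the limit, for limits that come without an
    integrable majorant. *)
Lemma real_fatou (f_ : nat -> T -> R) f (C : R) :
  (forall n, L1 (f_ n)) -> (forall n x, 0 <= f_ n x) -> measurable_fun setT f ->
  (forall n, I (f_ n) <= C) ->
  {ae m, forall x, f_ n x @[n --> \oo] --> f x} ->
  L1 f /\ I f <= C.
Proof.
move=> lf_ f0 mf IC cf.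
have mf_ n := L1_meas (lf_ n).
have F : (\int[m]_x `|f x|%:E <= C%:E)%E.
  have -> : (\int[m]_x `|f x|%:E =
     \int[m]_x limn_einf (fun n => (f_ n x)%:E))%E.
    apply: ae_eq_integral => //.
    - by apply/measurable_EFinP; exact: measurableT_comp.
    - rewrite (_ : (fun x => _) =
        -%E \o (fun x => limn_esup (-%E \o (fun n => (f_ n x)%:E)))).
        apply: measurableT_comp => //; apply: measurable_fun_limn_esup => n.
        by apply/measurable_EFinP; exact: measurable_funN.
      by apply/funext => x /=; rewrite limn_esupN oppeK.
    - move: cf; apply: filterS => x cfx _.
      have fx0 : 0 <= f x.
        rewrite -(cvg_lim (@Rhausdorff R) cfx).
        apply: limr_ge; first by apply/cvg_ex; exists (f x).
        by apply: nearW => n.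
      have c : (f_ n x)%:E @[n --> \oo] --> (f x)%:E.
        by apply/fine_cvgP; split => //; exact: nearW.
      rewrite ger0_norm// -(cvg_lim (@ereal_hausdorff R) c).
      by rewrite is_cvg_limn_einfE//; apply/cvg_ex; eexists; exact: c.
  apply: le_trans.
    apply: fatou => //.
    - by move=> n; exact/measurable_EFinP.
    - by move=> n x _; rewrite lee_fin.
  rewrite limn_einf_lim; apply: lime_le; first exact: is_cvg_einfs.
  apply: nearW => n; apply: le_trans.
    by apply: ereal_inf_lbound; exists n => //=.
  by rewrite -EFin_I// lee_fin.
have lf : L1 f.
  by apply/integrableP; split; [exact/measurable_EFinP|exact: le_lt_trans F (ltry _)].
split => //; rewrite -lee_fin; apply: le_trans F.
rewrite -(EFin_I (L1_abs lf)) lee_fin; apply: I_le => //; first exact: L1_abs.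
by move=> x; exact: ler_norm.
Qed.

End Integral.

(** * Fubini and Tonelli for real-valued integrals *)

Section Product.
Context d1 d2 (T1 : measurableType d1) (T2 : measurableType d2) (R : realType).
Variables (m1 : {sigma_finite_measure set T1 -> \bar R})
          (m2 : {sigma_finite_measure set T2 -> \bar R}).
Implicit Type f : T1 * T2 -> R.
Local Notation m12 := (m1 \x m2)%E.

Lemma fubini_ae1 f : L1 m12 f -> {ae m1, forall x, L1 m2 (fun y => f (x, y))}.
Proof. by move=> lf; exact: (ae_integrable1 lf). Qed.

Lemma fubini_ae2 f : L1 m12 f -> {ae m2, forall y, L1 m1 (fun x => f (x, y))}.
Proof. by move=> lf; exact: (ae_integrable2 lf). Qed.

(** The integral is by definition the difference of the integrals of the positive and negative
    parts, and each of these is measurable by Tonelli; slices that are not integrable cause no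
    trouble. *)
Lemma measurable_I1 f : measurable_fun setT f ->
  measurable_fun setT (fun x => I m2 (fun y => f (x, y))).
Proof.
move=> mf; rewrite /I /Rintegral.
have mF : measurable_fun setT (EFin \o f) by exact/measurable_EFinP.
apply: (measurableT_comp (fine_measurable measurableT)).
rewrite (_ : (fun x => _) = (fun x => \int[m2]_y (EFin \o f)^\+ (x, y) -
  \int[m2]_y (EFin \o f)^\- (x, y))%E).
  apply: emeasurable_funB.
  - by apply: measurable_fun_fubini_tonelli_F => //; exact: measurable_funepos.
  - by apply: measurable_fun_fubini_tonelli_F => //; exact: measurable_funeneg.
apply/funext => x; rewrite [LHS]integralE.
by congr (_ - _)%E; apply: eq_integral => y _; rewrite ?unlock.
Qed.

Lemma measurable_I2 f : measurable_fun setT f ->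
  measurable_fun setT (fun y => I m1 (fun x => f (x, y))).
Proof.
move=> mf; rewrite /I /Rintegral.
have mF : measurable_fun setT (EFin \o f) by exact/measurable_EFinP.
apply: (measurableT_comp (fine_measurable measurableT)).
rewrite (_ : (fun y => _) = (fun y => \int[m1]_x (EFin \o f)^\+ (x, y) -
  \int[m1]_x (EFin \o f)^\- (x, y))%E).
  apply: emeasurable_funB.
  - by apply: measurable_fun_fubini_tonelli_G => //; exact: measurable_funepos.
  - by apply: measurable_fun_fubini_tonelli_G => //; exact: measurable_funeneg.
apply/funext => x; rewrite [LHS]integralE.
by congr (_ - _)%E; apply: eq_integral => y _; rewrite ?unlock.
Qed.

Let mfub f : L1 m12 f -> measurable_fun setT f.
Proof. exact: L1_meas. Qed.

(** [fine] sends infinite values to 0, so the real-valued inner integral is dominated by the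
    extended one. *)
Lemma fubini_L1 f : L1 m12 f -> L1 m1 (fun x => I m2 (fun y => f (x, y))).
Proof.
move=> lf; have /integrableP[mF iF] := integrable_fubini_F lf.
have mf := measurable_I1 (mfub lf).
apply/integrableP; split; first exact/measurable_EFinP.
apply: le_lt_trans iF; apply: ge0_le_integral => //.
- by apply: measurableT_comp => //; exact/measurable_EFinP.
- exact: measurableT_comp.
- move=> x _ /=; rewrite /fubini_F /I /Rintegral/=.
  by case: (\int[m2]_y (f (x, y))%:E)%E => [r| |] //=; rewrite ?normr0 ?leey.
Qed.

Lemma fubini_I f : L1 m12 f -> I m12 f = I m1 (fun x => I m2 (fun y => f (x, y))).
Proof.
move=> lf; rewrite {1}/I /Rintegral -(integral12_prod_meas1 lf).
rewrite {1}/I /Rintegral; congr fine.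
have ae := fubini_ae1 lf.
apply: ae_eq_integral => //.
- exact: (measurable_fubini_F lf).
- by apply/measurable_EFinP; exact: measurable_I1 (mfub lf).
- by move: ae; apply: filterS => x lx _; rewrite EFin_I.
Qed.

Lemma fubini_L2 f : L1 m12 f -> L1 m2 (fun y => I m1 (fun x => f (x, y))).
Proof.
move=> lf; have mf := mfub lf.
have mF : measurable_fun setT (EFin \o f) by exact/measurable_EFinP.
have mG := measurable_I2 mf.
apply/integrableP; split; first exact/measurable_EFinP.
apply: le_lt_trans ((integrable21ltyP m1 m2 mF).1 lf); apply: ge0_le_integral => //.
- by apply: measurableT_comp => //; exact/measurable_EFinP.
- apply: (measurable_fun_fubini_tonelli_G (abse \o (EFin \o f))).
    by apply: measurableT_comp.
  by move=> z; exact: abse_ge0.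
- move=> y _ /=; rewrite /I /Rintegral.
  apply: (@le_trans _ _ `|\int[m1]_x (f (x, y))%:E|%E); last first.
    by apply: le_abse_integral => //; apply/measurable_EFinP; exact: (measurableT_comp mf).
  by case: (\int[m1]_x (f (x, y))%:E)%E => [r| |] //=; rewrite ?normr0 ?leey.
Qed.

Lemma fubini_I2 f : L1 m12 f -> I m12 f = I m2 (fun y => I m1 (fun x => f (x, y))).
Proof.
move=> lf; rewrite {1}/I /Rintegral -(integral21_prod_meas1 lf).
rewrite {1}/I /Rintegral; congr fine.
have ae := fubini_ae2 lf.
apply: ae_eq_integral => //.
- exact: (measurable_fubini_G lf).
- by apply/measurable_EFinP; exact: measurable_I2 (mfub lf).
- by move: ae; apply: filterS => x lx _; rewrite EFin_I.
Qed.

Lemma tonelli_L1 f : measurable_fun setT f -> (forall z, 0 <= f z) ->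
  {ae m1, forall x, L1 m2 (fun y => f (x, y))} ->
  L1 m1 (fun x => I m2 (fun y => f (x, y))) -> L1 m12 f.
Proof.
move=> mf f0 ae lI.
have mF : measurable_fun setT (EFin \o f) by exact/measurable_EFinP.
apply/(integrable12ltyP m1 m2 mF).
rewrite (_ : (\int[m1]_x _)%E = (\int[m1]_x (I m2 (fun y => f (x, y)))%:E)%E).
  by apply: L1_ge0_lty => // x; exact: I_ge0.
apply: ae_eq_integral => //.
- apply: (measurable_fun_fubini_tonelli_F (abse \o (EFin \o f))).
    by apply: measurableT_comp.
  by move=> z; exact: abse_ge0.
- by apply/measurable_EFinP; exact: measurable_I1.
- move: ae; apply: filterS => x lx _; rewrite EFin_I//.
  by apply: eq_integral => y _ /=; rewrite ger0_norm.
Qed.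

Lemma tonelli_L2 f : measurable_fun setT f -> (forall z, 0 <= f z) ->
  {ae m2, forall y, L1 m1 (fun x => f (x, y))} ->
  L1 m2 (fun y => I m1 (fun x => f (x, y))) -> L1 m12 f.
Proof.
move=> mf f0 ae lI.
have mF : measurable_fun setT (EFin \o f) by exact/measurable_EFinP.
apply/(integrable21ltyP m1 m2 mF).
rewrite (_ : (\int[m2]_x _)%E = (\int[m2]_x (I m1 (fun y => f (y, x)))%:E)%E).
  by apply: L1_ge0_lty => // x; exact: I_ge0.
apply: ae_eq_integral => //.
- apply: (measurable_fun_fubini_tonelli_G (abse \o (EFin \o f))).
    by apply: measurableT_comp.
  by move=> z; exact: abse_ge0.
- by apply/measurable_EFinP; exact: measurable_I2.
- move: ae; apply: filterS => x lx _; rewrite EFin_I//.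
  by apply: eq_integral => y _ /=; rewrite ger0_norm.
Qed.

End Product.

(** * Integrals over half-open intervals, translation invariance *)

Section Indicator.
Variable R : realType.
Local Notation mu := (leb1 R).
Implicit Types (a b c x : R) (f g h U V : R -> R).

(** Half open, so that adjacent intervals add up exactly ([ind_split]). Integrals over intervals are
    written over the whole line against [ind], which keeps a single notion of integrability. *)
Definition ind (a b x : R) : R := if (a < x) && (x <= b) then 1 else 0.

Lemma ind_ge0 a b x : 0 <= ind a b x.
Proof. by rewrite /ind; case: ifP. Qed.

Lemma ind_le1 a b x : ind a b x <= 1.
Proof. by rewrite /ind; case: ifP. Qed.

Lemma indT a b x : a < x -> x <= b -> ind a b x = 1.
Proof. by rewrite /ind => -> ->. Qed.

Lemma indF a b x : ~~ ((a < x) && (x <= b)) -> ind a b x = 0.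
Proof. by rewrite /ind => /negbTE ->. Qed.

Lemma ind_indic a b : ind a b = \1_(`]a, b]).
Proof.
apply/funext => x; rewrite /ind indicE; case: ifP => H.
  by rewrite mem_set//= in_itv.
by rewrite memNset//= in_itv/= H.
Qed.

Lemma ind_split a b c x : a <= b -> b <= c -> ind a c x = ind a b x + ind b c x.
Proof.
move=> ab bc; rewrite /ind.
have [ax|xa] := ltP a x; have [xc|cx] := leP x c; have [xb|bx] := leP x b;
  rewrite /= ?addr0 ?add0r//.
- by have := le_lt_trans xb (le_lt_trans bc cx); rewrite ltxx.
- by have := lt_le_trans bx (le_trans xa ab); rewrite ltxx.
Qed.

Lemma ind_idem a b x : ind a b x * ind a b x = ind a b x.
Proof. by rewrite /ind; case: ifP => _; rewrite ?mulr1 ?mulr0. Qed.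

Lemma ind_sub a b a' b' x : a' <= a -> b <= b' -> ind a b x * ind a' b' x = ind a b x.
Proof.
move=> a'a bb'; rewrite /ind; case: ifP => [/andP[ax xb]|]; last by rewrite mul0r.
by rewrite (le_lt_trans a'a ax) (le_trans xb bb') mulr1.
Qed.

Lemma measurable_ind d (T : measurableType d) (f g k : T -> R) :
  measurable_fun setT f -> measurable_fun setT g -> measurable_fun setT k ->
  measurable_fun setT (fun z => ind (f z) (g z) (k z)).
Proof.
move=> mf mg mk; rewrite /ind; apply: measurable_fun_ifT => //.
by apply: measurable_and; [exact: measurable_fun_ltr|exact: measurable_fun_ler].
Qed.

Lemma I_ind a b : a <= b -> L1 mu (ind a b) /\ I mu (ind a b) = b - a.
Proof.
move=> ab; rewrite ind_indic.
have E : (\int[mu]_x (\1_(`]a, b]) x)%:E = (b - a)%:E)%E.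
  rewrite integral_indic// setIT.
  transitivity (mu (`]a, b]%classic : set R)) => //; rewrite lebesgue_measure_itv/= lte_fin.
  by have [//|ba] := ltP a b; rewrite (@le_anti _ _ a b) ?ab// subrr.
split; last by rewrite /I /Rintegral E.
by apply: L1_ge0_fin => //; rewrite E ltry.
Qed.

Lemma L1_indM a b f : L1 mu f -> L1 mu (fun x => ind a b x * f x).
Proof.
move=> lf; apply: L1_le (L1_abs lf).
  by apply: measurable_funM; [exact: measurable_ind|exact: L1_meas lf].
by move=> x; rewrite normrM (ger0_norm (ind_ge0 _ _ _)) ler_piMl// ind_le1.
Qed.

Lemma L1_ind_sub a b a' b' f : a' <= a -> b <= b' ->
  L1 mu (fun x => ind a' b' x * f x) -> L1 mu (fun x => ind a b x * f x).
Proof.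
move=> aa bb /(L1_indM a b); apply: eq_L1 => x.
by rewrite mulrA ind_sub.
Qed.

Lemma L1_bnd a b c f : measurable_fun setT f ->
  (forall x, a < x -> x <= b -> `|f x| <= c) -> L1 mu (fun x => ind a b x * f x).
Proof.
move=> mf fc; have [ab|/ltW ba] := leP a b; last first.
  apply: eq_L1 (L1_0 mu) => x; rewrite indF ?mul0r//.
  by apply/negP => /andP[ax xb]; have := lt_le_trans ax (le_trans xb ba); rewrite ltxx.
apply: L1_le (L1Z c (I_ind ab).1).
  by apply: measurable_funM => //; exact: measurable_ind.
move=> x; rewrite normrM (ger0_norm (ind_ge0 _ _ _)) mulrC /ind.
by case: ifP => [/andP[ax xb]|_]; rewrite ?mulr1 ?mulr0//; exact: fc.
Qed.

Lemma I_ind_split a b c f : a <= b -> b <= c -> L1 mu (fun x => ind a c x * f x) ->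
  I mu (fun x => ind a c x * f x) =
  I mu (fun x => ind a b x * f x) + I mu (fun x => ind b c x * f x).
Proof.
move=> ab bc lf; rewrite -ID; first by apply: eq_I => x; rewrite (ind_split _ ab bc) mulrDl.
- exact: L1_ind_sub lf.
- exact: L1_ind_sub lf.
Qed.

Lemma L1_ind_split a b c f : a <= b -> b <= c -> L1 mu (fun x => ind a b x * f x) ->
  L1 mu (fun x => ind b c x * f x) -> L1 mu (fun x => ind a c x * f x).
Proof.
move=> ab bc l1 l2; apply: eq_L1 (L1D l1 l2) => x.
by rewrite (ind_split _ ab bc) mulrDl.
Qed.

Definition locL1 f := forall a b, a <= b -> L1 mu (fun x => ind a b x * f x).

Lemma locL1_meas f : locL1 f -> measurable_fun setT f.
Proof.
move=> lf; apply: (@measurable_fun_cvg _ _ _ setT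
   (fun n (x : measurableTypeR R) => ind (- n%:R) n%:R x * f x)).
- by move=> n; apply: L1_meas (lf _ _ _); rewrite lerNl (le_trans _ (ler0n _ n))// oppr_le0.
- move=> x _; apply: cvg_near_cst; near=> n.
  rewrite indT ?mul1r//.
    rewrite ltrNl; near: n; exact: nbhs_infty_gtr.
  by near: n; exact: nbhs_infty_ger.
Unshelve. all: by end_near. Qed.

(** The translated measure gives half-open intervals their length, and Lebesgue measure is the only
    one that does. *)
Lemma lebesgue_shift (c : R) (A : set R) : measurable A ->
  mu ((fun x => x + c) @^-1` A) = mu A.
Proof.
have ms : measurable_fun setT (fun x : R => x + c).
  by apply: measurable_funD => //; exact: measurable_cst.
move=> mA; pose nu := pushforward mu (fun x : measurableTypeR R => (x + c : measurableTypeR R)).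
rewrite -[LHS]/(nu A).
apply/esym/(@lebesgue_measure_unique R nu) => // _ [[a b] _ <-].
have E : (fun x : R => x + c) @^-1` (`]a, b]%classic : set R) = `]a - c, b - c]%classic.
  by apply/seteqP; split => x /=; rewrite !in_itv/= ltrBlDr lerBrDr.
transitivity (mu (`]a, b]%classic : set R)) => //.
transitivity (mu (`]a - c, b - c]%classic : set R)); last by rewrite -E.
rewrite !lebesgue_measure_itv/= !lte_fin ltrD2r.
by case: ifP => // _; rewrite -!EFinD opprD addrACA subrr addr0.
Qed.

Lemma L1_shift c f : L1 mu f -> L1 mu (fun x => f (x + c)) /\
  I mu (fun x => f (x + c)) = I mu f.
Proof.
have ms : measurable_fun setT (fun x : measurableTypeR R => (x + c : measurableTypeR R)).
  by apply: measurable_funD => //; exact: measurable_cst.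
pose nu := pushforward mu (fun x : measurableTypeR R => (x + c : measurableTypeR R)).
have E (g : R -> \bar R) : (\int[nu]_x g x = \int[mu]_x g x)%E.
  by apply: eq_measure_integral => A mA _; exact: lebesgue_shift.
move=> lf; have mf := L1_meas lf.
have lfc : L1 mu (fun x => f (x + c)).
  apply/integrableP; split; first by apply/measurable_EFinP; exact: measurableT_comp mf ms.
  have /integrableP[_] := lf; rewrite -E.
  rewrite ge0_integral_pushforward//; last first.
    by do 2 apply: measurableT_comp => //; exact/measurable_EFinP.
split => //; rewrite /I /Rintegral; congr fine.
have mF : measurable_fun [set: measurableTypeR R] (EFin \o f) by exact/measurable_EFinP.
transitivity (\int[nu]_x (EFin \o f) x)%E; last exact: E.
have li : mu.-integrable ((fun x => x + c) @^-1` setT)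
    ((EFin \o f) \o (fun x => x + c)) by rewrite preimage_setT.
by have /esym := integral_pushforward ms mF li measurableT; rewrite preimage_setT.
Qed.

End Indicator.

(** * Absolutely continuous functions *)

Section AC.
Variable R : realType.
Local Notation mu := (leb1 R).
Implicit Types (a b c x : R) (f g h k U V : R -> R).

(** Continuous induction: the supremum of the points reached from [a] has a neighbourhood on which
    [P] holds, so it is itself reached, and passed unless it is [b]. This adds up local estimates
    without partitions. *)
Lemma local_to_global (P : R -> R -> Prop) a b : a <= b ->
  (forall x y z, x <= y -> y <= z -> P x y -> P y z -> P x z) ->
  (forall x, a <= x -> x <= b -> exists2 d, 0 < d &
     forall y z, x - d < y -> y <= z -> z < x + d -> P y z) -> P a b.
Proof.
move=> ab Ptr Ploc; pose S := [set y | [/\ a <= y, y <= b & P a y]].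
have Sa : S a.
  split=> //; have [d d0] := Ploc a (lexx a) ab; apply; rewrite ?lexx//.
    by rewrite ltrBlDr ltrDl.
  by rewrite ltrDl.
have hS : has_sup S by split; [exists a|exists b => y []].
have as_ : a <= sup S by apply: ub_le_sup => //; case: hS.
have sb : sup S <= b by apply: ge_sup; [exists a|move=> y []].
have [d d0 dP] := Ploc _ as_ sb.
have [y [ay yb Pay] sy] := sup_adherent d0 hS.
have ys : y <= sup S by apply: ub_le_sup => //; case: hS.
have Pz z : y <= z -> z < sup S + d -> P a z.
  by move=> yz zs; apply: (Ptr a y z) => //; exact: dP.
have [bs|sb'] := leP b (sup S).
  by apply: Pz => //; rewrite (le_lt_trans bs)// ltrDl.
pose z := Num.min b (sup S + d / 2).
have sz : sup S < z by rewrite lt_min sb' ltrDl divr_gt0.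
have : z <= sup S; last by rewrite leNgt sz.
apply: ub_le_sup; first by case: hS.
split; first by rewrite (le_trans as_)// ltW.
- by rewrite ge_min lexx.
- apply: Pz; first by rewrite (le_trans ys)// ltW.
  rewrite (le_lt_trans (y := sup S + d / 2))//; first by rewrite ge_min lexx orbT.
  by rewrite ltrD2l; lra.
Qed.

Lemma ae_neq c : {ae mu, forall x, x != c}.
Proof.
exists [set c]; split => //; first exact: lebesgue_measure_set1.
by move=> x /= /negP; rewrite negbK => /eqP.
Qed.

(** Absolute continuity encoded by the fundamental theorem of calculus, with the derivative [h] as
    data. It holds between all pairs of points, so [U] is a true function while [h] is only
    integrated. *)
Definition ac U h := forall a b, a <= b ->
  L1 mu (fun x => ind a b x * h x) /\ U b - U a = I mu (fun x => ind a b x * h x).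

Lemma ac_loc U h : ac U h -> locL1 h.
Proof. by move=> H a b /H[]. Qed.

Lemma ac_I U h a b : ac U h -> a <= b -> U b - U a = I mu (fun x => ind a b x * h x).
Proof. by move=> H /H[]. Qed.

Lemma ac_meas U h : ac U h -> measurable_fun setT h.
Proof. by move=> /ac_loc/locL1_meas. Qed.

Lemma cvg_ind_r a x (u : nat -> R) s : u n @[n --> \oo] --> x -> s != x ->
  ind a (u n) s @[n --> \oo] --> ind a x s.
Proof.
move=> ux sx; apply: cvg_near_cst; rewrite /ind.
case: (ltgtP s x) sx => // H _.
- have : \forall n \near \oo, s < u n by exact: (cvgr_gt x).
  by apply: filterS => n /ltW ->.
- have : \forall n \near \oo, u n < s by exact: (cvgr_lt x).
  by apply: filterS => n; rewrite ltNge => /negbTE ->.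
Qed.

Lemma continuous_seq U x :
  (forall u : nat -> R, u n @[n --> \oo] --> x -> U (u n) @[n --> \oo] --> U x) ->
  {for x, continuous U}.
Proof.
move=> H; apply/continuous_withinNx; apply/cvgr_dnbhsP => u [_ ux]; exact: H.
Qed.

Lemma ac_cont U h : ac U h -> continuous U.
Proof.
move=> H x; apply: continuous_seq => u ux.
have lh := ac_loc H.
(* Clamping keeps all points in one interval, whose indicator provides the majorant, and changes
   only finitely many terms. *)
pose v n := Num.max (x - 1) (Num.min (u n) (x + 1)).
have vE : \forall n \near \oo, v n = u n.
  have h1 : \forall n \near \oo, x - 1 < u n by apply: (cvgr_gt x) => //; lra.
  have h2 : \forall n \near \oo, u n < x + 1 by apply: (cvgr_lt x) => //; lra.
  move: h1 h2; apply: filterS2 => n h1 h2; rewrite /v.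
  by rewrite (min_idPl (ltW h2)) (max_idPr (ltW h1)).
have vx : v n @[n --> \oo] --> x.
  apply: cvg_trans ux; apply: near_eq_cvg.
  by move: vE; apply: filterS => n ->.
suff : U (v n) @[n --> \oo] --> U x.
  apply: cvg_trans; apply: near_eq_cvg.
  by move: vE; apply: filterS => n ->.
have v1 n : x - 1 <= v n by rewrite le_max lexx.
have v2 n : v n <= x + 1.
  by rewrite ge_max; apply/andP; split; [lra|rewrite ge_min lexx orbT].
have E y : x - 1 <= y -> U y = U (x - 1) + I mu (fun s => ind (x - 1) y s * h s).
  by move=> /(ac_I H) <-; rewrite addrC subrK.
rewrite E; last by lra.
rewrite (_ : (fun n => U (v n)) =
   (fun n => U (x - 1) + I mu (fun s => ind (x - 1) (v n) s * h s))); last first.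
  by apply/funext => n; rewrite E.
apply: cvgD; first exact: cvg_cst.
have l2 : L1 mu (fun s => ind (x - 1) (x + 1) s * h s) by apply: lh; lra.
have mh := ac_meas H.
apply: (dct _ _ _ (L1_abs l2) _).2.
- by move=> n; apply: measurable_funM => //; exact: measurable_ind.
- by apply: measurable_funM => //; exact: measurable_ind.
- apply: (ae_imp (ae_neq x)) => s sx.
  by apply: cvgM; [exact: cvg_ind_r|exact: cvg_cst].
- move=> n; apply: aeW => s; rewrite !normrM ler_wpM2r//.
  rewrite !ger0_norm ?ind_ge0// /ind; case: ifP => [/andP[-> sv]|_].
    by rewrite (le_trans sv (v2 n)).
  by case: ifP.
Qed.

Lemma ac_measU U h : ac U h -> measurable_fun setT U.
Proof. by move=> /ac_cont; exact: continuous_measurable_fun. Qed.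

Lemma acD U V h k : ac U h -> ac V k -> ac (fun x => U x + V x) (fun x => h x + k x).
Proof.
move=> H K a b ab; have [lh eh] := H a b ab; have [lk ek] := K a b ab.
have E x : ind a b x * h x + ind a b x * k x = ind a b x * (h x + k x).
  by rewrite mulrDr.
split; first by apply: eq_L1 (L1D lh lk).
by rewrite -(eq_I mu E) ID// -eh -ek; lra.
Qed.

Lemma acZ c U h : ac U h -> ac (fun x => c * U x) (fun x => c * h x).
Proof.
move=> H a b ab; have [lh eh] := H a b ab.
have E x : c * (ind a b x * h x) = ind a b x * (c * h x) by rewrite mulrCA.
split; first by apply: eq_L1 (L1Z c lh).
by rewrite -(eq_I mu E) IZ// -eh mulrBr.
Qed.

Lemma ac_ext U V h k : ac U h -> (forall x, U x = V x) -> (forall x, h x = k x) -> ac V k.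
Proof. by move=> H /funext <- /funext <-. Qed.

Lemma ac_id : ac id (fun=> 1).
Proof.
move=> a b ab; have [l e] := I_ind ab.
split; first by apply: eq_L1 l => x; rewrite mulr1.
by rewrite -e; apply: eq_I => x; rewrite mulr1.
Qed.

Lemma ac_cst c : ac (fun=> c) (fun=> 0).
Proof.
move=> a b ab; rewrite subrr; split; first by apply: eq_L1 (L1_0 mu) => x; rewrite mulr0.
by rewrite -[LHS](I_0 mu); apply: eq_I => x; rewrite /= mulr0.
Qed.

Lemma mvt (P p : R -> R) (x y : R) : (forall z : R, is_derive z 1 P (p z)) ->
  exists c, [/\ Num.min x y <= c, c <= Num.max x y & P y - P x = p c * (y - x)].
Proof.
move=> dP.
have cP : continuous P.
  move=> z; apply: differentiable_continuous; apply/derivable1_diffP.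
  by have [] := dP z.
have [xy|yx] := leP x y.
  have [|c] := @MVT_segment R P p x y xy (fun z _ => dP z).
    exact: continuous_subspaceT.
  by rewrite in_itv/= => /andP[c1 c2] e; exists c.
have [|c] := @MVT_segment R P p y x (ltW yx) (fun z _ => dP z).
  exact: continuous_subspaceT.
rewrite in_itv/= => /andP[c1 c2] e; exists c; split => //.
by rewrite -[LHS]opprB e -mulrN opprB.
Qed.

Lemma I_ind_abs a b h : a <= b -> L1 mu (fun x => ind a b x * h x) ->
  L1 mu (fun x => ind a b x * `|h x|).
Proof.
move=> ab /L1_abs; apply: eq_L1 => x.
by rewrite normrM ger0_norm// ind_ge0.
Qed.

(** On a short interval the mean value theorem replaces [p (U s)] by a constant up to [e], so the
    defect [D] of the formula is at most [e \int |h|]. Both the defect and its bound are additive in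
    the interval, hence the bound holds on all of [[a, b]]; then [e] tends to 0. *)
Lemma ac_chain (P p : R -> R) U h : (forall z : R, is_derive z 1 P (p z)) -> continuous p ->
  ac U h -> ac (fun x => P (U x)) (fun x => p (U x) * h x).
Proof.
move=> dP cp H.
have cU := ac_cont H; have mh := ac_meas H; have mU := ac_measU H.
have mp : measurable_fun setT (fun x => p (U x)).
  by apply: continuous_measurable_fun => x; apply: continuous_comp; [exact: cU|exact: cp].
pose D y z := P (U z) - P (U y) - I mu (fun x => ind y z x * (p (U x) * h x)).
have key (e : R) a b : 0 < e -> a <= b ->
    L1 mu (fun x => ind a b x * (p (U x) * h x)) /\
    `|D a b| <= e * I mu (fun x => ind a b x * `|h x|).
  move=> e0 ab; pose Q y z := y <= z -> L1 mu (fun x => ind y z x * (p (U x) * h x)) /\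
    `|D y z| <= e * I mu (fun x => ind y z x * `|h x|).
  apply: (@local_to_global Q a b) => //.
    move=> x y z xy yz /(_ xy)[l1 d1] /(_ yz)[l2 d2] xz.
    have l3 := L1_ind_split xy yz l1 l2.
    split => //; rewrite (_ : D x z = D x y + D y z); last first.
      by rewrite /D (I_ind_split xy yz l3); lra.
    rewrite (I_ind_split xy yz) ?mulrDr; last exact: I_ind_abs (ac_loc H xz).
    by rewrite (le_trans (ler_normD _ _))// lerD.
  move=> x _ _.
  have e2 : 0 < e / 2 by rewrite divr_gt0.
  have /cvgrPdist_lt/(_ _ e2) := cp (U x).
  move=> /nbhs_ballP[r r0 rP].
  have /cvgrPdist_lt/(_ _ r0) := cU x.
  move=> /nbhs_ballP[d d0 dd].
  exists d => // y z xy yz zx _.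
  have inU s : y <= s -> s <= z -> `|U x - U s| < r.
    move=> ys sz; apply: dd; rewrite /ball/= ltr_norml; apply/andP; split; lra.
  have pU c : `|U x - c| < r -> `|p (U x) - p c| < e / 2 by move=> ?; exact: rP.
  have [c [c1 c2 cE]] := mvt (U y) (U z) dP.
  have pc : `|p (U x) - p c| < e / 2.
    apply: pU; have := inU y (lexx y) yz; have := inU z yz (lexx z).
    rewrite !ltr_norml => /andP[? ?] /andP[? ?]; apply/andP.
    by move: c1 c2; case: (ltP (U y) (U z)) => _ ? ?; split; lra.
  have bnd s : y <= s -> s <= z -> `|p c - p (U s)| <= e.
    move=> ys sz; have := pU _ (inU s ys sz); move: pc.
    rewrite ler_norml !ltr_norml => /andP[? ?] /andP[? ?]; apply/andP; split; lra.
  have [lh eU] := H y z yz.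
  have lD : L1 mu (fun s => (p c - p (U s)) * (ind y z s * h s)).
    apply: L1_le (L1Z e (L1_abs lh)).
      apply: measurable_funM; last exact: L1_meas lh.
      by apply: measurable_funB => //; exact: measurable_cst.
    move=> s; rewrite normrM /ind; case: ifP => [/andP[ys sz]|_].
      by rewrite !mul1r ler_wpM2r// bnd// ltW.
    by rewrite mul0r normr0 !mulr0.
  have lph : L1 mu (fun s => ind y z s * (p (U s) * h s)).
    apply: eq_L1 (L1B (L1Z (p c) lh) lD) => s; ring.
  split => //.
  have DE : D y z = I mu (fun s => (p c - p (U s)) * (ind y z s * h s)).
    rewrite /D cE eU -IZ// -IB//; last exact: L1Z.
    by apply: eq_I => s; ring.
  rewrite DE -IZ; last exact: I_ind_abs.
  apply: I_le_abs => //; first exact: L1Z (I_ind_abs yz lh).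
  move=> s; rewrite normrM /ind; case: ifP => [/andP[ys sz]|_].
    by rewrite !mul1r ler_wpM2r// bnd// ltW.
  by rewrite !mul0r normr0 !mulr0.
move=> a b ab; split; first exact: (key 1 a b ltr01 ab).1.
apply/eqP; rewrite -subr_eq0 -/(D a b) -normr_eq0.
rewrite eq_le normr_ge0 andbT.
have J0 : 0 <= I mu (fun x => ind a b x * `|h x|).
  by apply: I_ge0 => x; rewrite mulr_ge0// ind_ge0.
apply/ler_addgt0Pr => e e0; rewrite add0r.
have e0' : 0 < e / (I mu (fun x => ind a b x * `|h x|) + 1).
  by rewrite divr_gt0// ltr_wpDl.
apply: le_trans (key _ a b e0' ab).2 _.
by rewrite mulrAC ler_pdivrMr ?ltr_wpDl// ler_pM2l// lerDl.
Qed.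

Lemma ac_C1 (F f : R -> R) : (forall x : R, is_derive x 1 F (f x)) -> continuous f -> ac F f.
Proof.
move=> dF cf; apply: ac_ext (ac_chain dF cf ac_id) _ _ => // x; by rewrite mulr1.
Qed.

Lemma is_derive_sqr (z : R) : is_derive z 1 (fun x : R => x ^+ 2) (2 * z).
Proof.
have H := @is_deriveX R R id 2 z 1 1 (is_derive_id z 1).
by apply: (is_derive_eq H); rewrite /GRing.scale/= expr1 mulr1.
Qed.

(** Polarization: twice the product is [(U + V)^2 - U^2 - V^2], and squares are covered by the chain
    rule. *)
Lemma acM U V h k : ac U h -> ac V k ->
  ac (fun x => U x * V x) (fun x => h x * V x + U x * k x).
Proof.
move=> H K.
have c2 : continuous (fun z : R => 2 * z).
  by move=> z; apply: cvgM; [exact: cvg_cst|exact: cvg_id].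
have sq W w (L : ac W w) := ac_chain is_derive_sqr c2 L.
have := acZ (2^-1) (acD (sq _ _ (acD H K)) (acZ (-1) (acD (sq _ _ H) (sq _ _ K)))).
by move=> L; apply: ac_ext L _ _ => x /=; field => //.
Qed.

Lemma ac_supp V k (L : R) : ac V k -> (forall x, L <= `|x| -> V x = 0) ->
  (forall x, L <= `|x| -> k x = 0) -> L1 mu k /\ I mu k = 0.
Proof.
move=> H V0 k0; pose M := Num.max L 1.
have LM : L <= M by rewrite le_max lexx.
have M0 : 0 < M by rewrite lt_max ltr01 orbT.
have MM : - M <= M by lra.
have [l e] := H _ _ MM.
have LaM : L <= `|M| by rewrite ger0_norm// ltW.
have E x : ind (- M) M x * k x = k x.
  have [Mx|xM] := leP M `|x|; first by rewrite k0 ?mulr0// (le_trans LM).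
  move: xM; rewrite ltr_norml => /andP[x1 x2].
  by rewrite indT ?mul1r// ltW.
split; first exact: eq_L1 l.
by rewrite -(eq_I mu E) -e !V0 ?subrr// normrN.
Qed.

(** Lebesgue differentiation, applied to the primitives based at [-N] for all [N]; at a given [x]
    some [N] is far enough to the left. The intervals lie to the left of [x] because all time
    averages below look backward. *)
Lemma ae_deriv f : locL1 f -> {ae mu, forall x, forall u : nat -> R,
  (forall n, 0 < u n) -> u n @[n --> \oo] --> 0 ->
  (u n)^-1 * I mu (fun s => ind (x - u n) x s * f s) @[n --> \oo] --> f x}.
Proof.
move=> lf; have mf := locL1_meas lf.
have mfE : measurable_fun [set: R] (EFin \o f) by exact/measurable_EFinP.
have li (a y : R) : mu.-integrable [set` `]a, y]] (EFin \o f).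
  have [ay|ya] := leP a y; last by rewrite set_itv_ge ?bnd_simp -?leNgt ?ltW//; exact: integrable_set0.
  apply/integrable_mkcond => //.
  rewrite (_ : (EFin \o f) \_ _ = EFin \o (fun x => ind a y x * f x)); first exact: lf.
  apply/funext => x /=; rewrite ind_indic indicE patchE.
  by case: ifP => _; rewrite ?mul1r ?mul0r.
have IE (a y : R) : \int[mu]_(t in [set` `]a, y]]) f t = I mu (fun s => ind a y s * f s).
  rewrite Rintegral_mkcond; apply: eq_I => x.
  by rewrite ind_indic indicE patchE; case: ifP => _; rewrite ?mul1r ?mul0r.
have loc : locally_integrable [set: R] f.
  split => //; first exact: openT.
  move=> K _ /[dup] /compact_bounded[M [Mr MK]].
  pose N := `|M| + 1.
  have KN : K `<=` [set` `]- N - 1, N]].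
    move=> x Kx /=; rewrite in_itv/=.
    have : `|x| <= N by apply: MK => //; rewrite /N (le_lt_trans (ler_norm M))// ltrDl.
    by rewrite ler_norml => /andP[? ?]; apply/andP; split; lra.
  move=> cK; have /integrableP[_] := li (- N - 1) N; apply: le_lt_trans.
  apply: ge0_subset_integral => //; first exact: compact_measurable.
  by apply/measurable_EFinP; apply: measurableT_comp => //; exact: measurable_funTS.
have : {ae mu, forall x, forall N : nat, - N%:R < x ->
    derivable (fun x => \int[mu]_(t in [set` `](- N%:R), x]]) f t) x 1 /\
    derive1 (fun x => \int[mu]_(t in [set` `](- N%:R), x]]) f t) x = f x}.
  by apply/ae_foralln => N; have := FTC1 (a := BRight (- N%:R)) (fun y => li _ y) loc.
move=> HH; apply: (ae_imp HH) => x H u u0 ux.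
have [N xN] : exists N : nat, - N%:R < x - 1.
  exists (Num.truncn `|x - 1|).+1; rewrite ltrNl (le_lt_trans (ler_norm _))// normrN.
  by rewrite truncnS_gt.
have [dF eF] := H N (lt_trans xN (ltac:(lra) : x - 1 < x)).
move: dF eF; set F := (fun x => _) => dF eF.
have /cvgr_dnbhsP/(_ (fun n => - u n)) :
    h^-1 *: (F (h *: 1 + x) - F x) @[h --> 0^'] --> f x.
  by rewrite -eF derive1E; exact: dF.
have un : - u n @[n --> \oo] --> (0 : R) by rewrite -oppr0; exact: cvgN.
move=> C; apply: cvg_trans (C _); last by split => // n; rewrite oppr_eq0 gt_eqF.
apply: near_eq_cvg.
have : \forall n \near \oo, u n < 1 by apply: (cvgr_lt 0).
apply: filterS => n un1.
have E : F x - F (x - u n) = I mu (fun s => ind (x - u n) x s * f s).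
  rewrite /F !IE (@I_ind_split _ (- N%:R) (x - u n) x); first by lra.
  - lra.
  - by have := u0 n; lra.
  - by apply: lf; lra.
rewrite -E /GRing.scale/= mulr1 (addrC (- u n)) invrN mulNr -mulrN opprB.
by [].
Qed.
End AC.

(** * Test functions *)

Section Smooth.
Variable R : realType.
Implicit Types (a b c x : R) (f g h : R -> R).

(** Infinite differentiability as a greatest fixed point: [g] belongs to some class stable under
    derivation. A proof of smoothness thus consists of exhibiting a class. *)
Definition smooth1 g := exists2 C : (R -> R) -> Prop, C g &
  forall h, C h -> exists2 h', C h' & forall x : R, is_derive x 1 h (h' x).

Lemma smooth1_deriv g : smooth1 g ->
  exists2 g', smooth1 g' & forall x : R, is_derive x 1 g (g' x).
Proof.
move=> [C Cg Cd]; have [g' Cg' dg] := Cd _ Cg; exists g' => //.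
by exists C.
Qed.

Lemma is_derive_cont (g g' : R -> R) : (forall x : R, is_derive x 1 g (g' x)) -> continuous g.
Proof.
move=> dg x; apply: differentiable_continuous; apply/derivable1_diffP.
by have [] := dg x.
Qed.

Lemma smooth1_cont g : smooth1 g -> continuous g.
Proof. by move=> /smooth1_deriv[g' _]; exact: is_derive_cont. Qed.

Lemma is_derive_aff (c d x : R) : is_derive x 1 (fun s => c * s + d) c.
Proof.
have H := is_deriveD (is_deriveZ c (is_derive_id x (1 : R))) (is_derive_cst d x 1).
by apply: (is_derive_eq H); rewrite addr0 /GRing.scale/= mulr1.
Qed.

Lemma is_derive_comp_aff (g : R -> R) (c d x l : R) : is_derive (c * x + d) 1 g l ->
  is_derive x 1 (fun s => g (c * s + d)) (c * l).
Proof.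
move=> H; have D := @is_derive1_comp R g (fun s => c * s + d) x l c H (is_derive_aff c d x).
by apply: (is_derive_eq D); rewrite mulrC.
Qed.

Lemma is_derive_mul (g h : R -> R) (x dg dh : R) : is_derive x 1 g dg ->
  is_derive x 1 h dh -> is_derive x 1 (fun s => g s * h s) (dg * h x + g x * dh).
Proof.
move=> Hg Hh; apply: (is_derive_eq (is_deriveM Hg Hh)).
by rewrite /GRing.scale/= addrC mulrC.
Qed.

Lemma is_derive_add (g h : R -> R) (x dg dh : R) : is_derive x 1 g dg ->
  is_derive x 1 h dh -> is_derive x 1 (fun s => g s + h s) (dg + dh).
Proof. by move=> Hg Hh; exact: is_deriveD. Qed.

Lemma is_derive_scale (g : R -> R) (c x dg : R) : is_derive x 1 g dg ->
  is_derive x 1 (fun s => c * g s) (c * dg).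
Proof. by move=> Hg; exact: is_deriveZ. Qed.

(** The class that witnesses stability of [smooth1] under the algebraic operations: derivatives of
    its members are again of this form. *)
Inductive salg : (R -> R) -> Prop :=
| salg_base g : smooth1 g -> salg g
| salg_add g h : salg g -> salg h -> salg (fun x => g x + h x)
| salg_mul g h : salg g -> salg h -> salg (fun x => g x * h x)
| salg_scale c g : salg g -> salg (fun x => c * g x)
| salg_aff c d g : salg g -> salg (fun x => g (c * x + d)).

Lemma salg_smooth g : salg g -> smooth1 g.
Proof.
move=> sg; exists salg => // h; elim=> {sg g h}.
- by move=> g /smooth1_deriv[g' sg' dg]; exists g' => //; exact: salg_base.
- move=> g h sg [g' sg' dg] sh [h' sh' dh]; exists (fun x => g' x + h' x).
    exact: salg_add.
  by move=> x; exact: is_derive_add.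
- move=> g h sg [g' sg' dg] sh [h' sh' dh].
  exists (fun x => g' x * h x + g x * h' x).
    by apply: salg_add; exact: salg_mul.
  by move=> x; exact: is_derive_mul.
- move=> c g sg [g' sg' dg]; exists (fun x => c * g' x); first exact: salg_scale.
  by move=> x; exact: is_derive_scale.
- move=> c d g sg [g' sg' dg]; exists (fun x => c * g' (c * x + d)).
    by apply: salg_scale; exact: salg_aff.
  by move=> x; exact: is_derive_comp_aff.
Qed.

(** The classical flat function [exp(-1/x)] with a polynomial factor in [1/x]; the factor makes the
    family stable under derivation, [P] becoming [(P - P') X^2]. *)
Definition pexp (P : {poly R}) x : R := if 0 < x then P.[x^-1] * expR (- x^-1) else 0.

Lemma horner_bound (P : {poly R}) : exists k : nat, exists2 C : R, 0 <= C &
  forall y, 1 <= y -> `|P.[y]| <= C * y ^+ k.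
Proof.
elim/poly_ind: P => [|P c [k [C C0 H]]].
  by exists 0%N, 0 => // y _; rewrite horner0 normr0 mul0r.
exists k.+1, (C + `|c|); first by rewrite addr_ge0.
move=> y y1; rewrite hornerMXaddC (le_trans (ler_normD _ _))// mulrDl lerD//.
  rewrite normrM exprSr mulrA (ger0_norm (le_trans ler01 y1)) ler_wpM2r//.
    exact: le_trans y1.
  exact: H.
by rewrite ler_peMr// exprn_ege1.
Qed.

Lemma expR_ge_pow (n : nat) (y : R) : 0 <= y -> (y / n.+1%:R) ^+ n.+1 <= expR y.
Proof.
move=> y0; rewrite -[y in expR y](divfK (_ : n.+1%:R != 0))//.
rewrite expRM_natr; apply: lerXn2r; rewrite ?nnegrE ?divr_ge0 ?expR_ge0//.
by rewrite (le_trans _ (expR_ge1Dx _))// lerDr.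
Qed.

Lemma pexp_bound (P : {poly R}) : exists2 C : R, 0 <= C &
  forall x, `|x| <= 1 -> `|pexp P x| <= C * x ^+ 2.
Proof.
have [k [C C0 H]] := horner_bound P.
(* The exponential is compared with the power [n + 1 = k + 2]: degree [k] kills the polynomial and
   the remaining two give the factor [x ^+ 2], hence a zero derivative at the origin. *)
pose n := k.+1.
exists (C * n.+1%:R ^+ n.+1); first by rewrite mulr_ge0// exprn_ge0.
move=> x x1; rewrite /pexp; case: ifPn => [x0|_]; last first.
  by rewrite normr0 mulr_ge0// ?sqr_ge0// mulr_ge0// exprn_ge0.
have y1 : 1 <= x^-1 by rewrite invf_ge1// (le_trans (ler_norm _)).
set y := x^-1 in y1 *; have y0 : 0 < y by rewrite invr_gt0.
have -> : x = y^-1 by rewrite invrK.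
rewrite normrM (ger0_norm (expR_ge0 _)) expRN.
rewrite ler_pdivrMr ?expR_gt0//.
apply: le_trans (H _ y1) _.
have N0 : (0 : R) < n.+1%:R by [].
have := expR_ge_pow n (ltW y0); rewrite expr_div_n ler_pdivrMr ?exprn_gt0// => e.
have yE : y ^+ k = y ^+ n.+1 * y^-1 ^+ 2.
  by rewrite /n !exprS expr0; field; rewrite gt_eqF.
have -> : C * n.+1%:R ^+ n.+1 * y^-1 ^+ 2 * expR y =
    C * (expR y * n.+1%:R ^+ n.+1 * y^-1 ^+ 2) by ring.
by rewrite ler_wpM2l// yE ler_wpM2r// sqr_ge0.
Qed.

Lemma is_derive_pexp P x : is_derive x 1 (pexp P) (pexp ((P - P^`()) * 'X^2) x).
Proof.
have [x0|x0|->] := ltgtP x 0.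
- have D : is_derive x 1 (fun=> 0 : R) 0 by exact: is_derive_cst.
  rewrite {2}/pexp ltNge (ltW x0)/=.
  apply: near_eq_is_derive D.
  have : \forall z \near x, z < 0 by exact: (cvgr_lt x cvg_id).
  by apply: filterS => z z0; rewrite /pexp ltNge (ltW z0).
- have xn0 : x != 0 by rewrite gt_eqF.
  have dV : is_derive x 1 (fun z : R => z^-1) (- x ^- 2).
    have H := @is_deriveV R id x 1 1 xn0 (is_derive_id x 1).
    by apply: (is_derive_eq H); rewrite /GRing.scale/= mulr1.
  have dP := is_derive1_comp (is_derive_poly P x^-1) dV.
  have dE := @is_derive1_comp R expR (fun z => - z^-1) x _ _ (is_derive_expR (- x^-1)) (is_deriveN dV).
  have D := is_derive_mul dP dE.
  have E : \forall z \near x, P.[z^-1] * expR (- z^-1) = pexp P z.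
    have : \forall z \near x, 0 < z by exact: (cvgr_gt x cvg_id).
    by apply: filterS => z z0; rewrite /pexp z0.
  apply: (near_eq_is_derive E); apply: (is_derive_eq D); rewrite /pexp x0 hornerM hornerD hornerN hornerXn.
  by rewrite /= exprVn; ring.
- apply/is_derive1_caratheodory.
  have [C C0 HC] := pexp_bound P.
  exists (fun z => pexp P z / z); split.
  + move=> z; rewrite subr0 {2}/pexp ltxx subr0.
    have [->|z0] := eqVneq z 0; first by rewrite /pexp ltxx mulr0.
    by rewrite divfK.
  + apply: continuous_seq => u u0; rewrite invr0 mulr0.
    apply/cvgr0Pnorm_lt => e e0.
    have h1 : \forall n \near \oo, `|u n| < 1.
      by move/cvgr0Pnorm_lt : u0 => /(_ 1 ltr01).
    have h2 : \forall n \near \oo, `|u n| < e / (C + 1).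
      by move/cvgr0Pnorm_lt : u0; apply; rewrite divr_gt0// ltr_wpDl.
    move: h1 h2; apply: filterS2 => n h1 h2.
    have [un0|un0] := eqVneq (u n) 0; first by rewrite un0 invr0 mulr0 normr0.
    rewrite normrM normfV ltr_pdivrMr ?normr_gt0//.
    apply: le_lt_trans (HC _ (ltW h1)) _.
    rewrite -real_normK ?num_real// expr2 mulrA ltr_pM2r ?normr_gt0//.
    rewrite ltr_pdivlMr ?ltr_wpDl// in h2.
    by apply: le_lt_trans h2; rewrite mulrC ler_wpM2l// lerDl.
  + by rewrite invr0 mulr0 /pexp ltxx.
Qed.

Lemma smooth1_pexp P : smooth1 (pexp P).
Proof.
exists (fun g => exists P, g = pexp P); first by exists P.
move=> h [Q ->]; exists (pexp ((Q - Q^`()) * 'X^2)); first by eexists.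
by move=> x; exact: is_derive_pexp.
Qed.

(* equals 1 minus O(1/n) inside ]a, b[ and vanishes outside *)
Definition cutoff a b (n : nat) x := pexp 1 (n.+1%:R * x + - (n.+1%:R * a)) *
  pexp 1 (- n.+1%:R * x + n.+1%:R * b).

Lemma pexp1_01 x : 0 <= pexp 1 x <= 1.
Proof.
rewrite /pexp; case: ifP => x0; last by rewrite lexx ler01.
rewrite hornerC mul1r expR_ge0/= -expR0 ler_expR oppr_le0 invr_ge0; exact: ltW.
Qed.

Lemma smooth1_bump a b n : smooth1 (cutoff a b n).
Proof.
by apply: salg_smooth; apply: salg_mul; apply: salg_aff; apply: salg_base; exact: smooth1_pexp.
Qed.

Lemma bump_ge0 a b n x : 0 <= cutoff a b n x.
Proof. by apply: mulr_ge0; apply: (andP (pexp1_01 _)).1. Qed.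

Lemma bump_le1 a b n x : cutoff a b n x <= 1.
Proof.
rewrite /cutoff -[leRHS]mulr1; by apply: ler_pM; first [apply: (andP (pexp1_01 _)).1|apply: (andP (pexp1_01 _)).2].
Qed.

Lemma bump_out a b n x : ~~ ((a < x) && (x < b)) -> cutoff a b n x = 0.
Proof.
have N0 : (0 : R) < n.+1%:R by [].
rewrite negb_and -!leNgt /cutoff => /orP[xa|bx].
  by rewrite {1}/pexp ltNge -mulrBr pmulr_rle0// subr_le0 xa/= mul0r.
have -> : - n.+1%:R * x + n.+1%:R * b = n.+1%:R * (b - x) by ring.
by rewrite [X in _ * X]/pexp ltNge pmulr_rle0// subr_le0 bx/= mulr0.
Qed.

Lemma pexp1_cvg y : 0 < y -> pexp 1 (n.+1%:R * y) @[n --> \oo] --> (1 : R).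
Proof.
move=> y0.
rewrite (_ : (fun n => _) = (fun n : nat => expR (- (n.+1%:R^-1 * y^-1)))); last first.
  by apply/funext => n; rewrite /pexp mulr_gt0// hornerC mul1r invfM.
rewrite -[X in _ --> X]expR0; apply: continuous_cvg; first exact: continuous_expR.
rewrite -oppr0 -(mul0r y^-1); apply: cvgN; apply: cvgMl; exact: cvg_harmonic.
Qed.

Lemma bump_cvg a b x : x != b -> cutoff a b n x @[n --> \oo] --> ind a b x.
Proof.
move=> xb; have [/andP[ax xb']|H] := boolP ((a < x) && (x < b)); last first.
  rewrite indF; last first.
    by move: H; rewrite (lt_neqAle x) xb.
  by apply: cvg_near_cst; apply: nearW => n; rewrite bump_out.
rewrite indT ?(ltW xb')//.
rewrite (_ : (fun n => _) = (fun n : nat => pexp 1 (n.+1%:R * (x - a)) * pexp 1 (n.+1%:R * (b - x)))).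
  by rewrite -[X in _ --> X]mulr1; apply: cvgM; apply: pexp1_cvg; rewrite subr_gt0.
by apply/funext => n; rewrite /cutoff; congr (pexp _ _ * pexp _ _); ring.
Qed.

End Smooth.

(** * Tensor-product tests and primitives *)

Section TestFunctions.
Variable R : realType.
Local Notation mu := (leb1 R).
Implicit Types (a b c x : R) (f g h m n U : R -> R).

Lemma dirder (V : normedModType R) (F : V -> R) (z v : V) (d : R) :
  is_derive (0 : R) 1 (fun s : R => F (s *: v + z)) d -> is_derive z v F d.
Proof.
move=> [H1 H2].
have E : (fun h : R => h^-1 *: (((fun s : R => F (s *: v + z)) \o shift (0 : R)) (h *: (1 : R)) - F ((0 : R) *: v + z))) =
         (fun h : R => h^-1 *: ((F \o shift z) (h *: v) - F z)).
  apply/funext => h /=; rewrite addr0 scale0r add0r.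
  by have -> : h *: (1 : R) = h by exact: mulr1.
by split; [rewrite /derivable -E|rewrite /derive -E].
Qed.

Lemma smooth1_smooth g : smooth1 g -> smooth g.
Proof.
move=> sg s /=; have : smooth1 (foldr (fun v (h : R -> R) => 'D_v h) g s).
  elim: s => //= v s /smooth1_deriv; set h := foldr _ _ _ => -[h' sh' dh].
  have -> : 'D_v h = (fun x => v * h' x).
    apply/funext => x; apply: derive_val; apply: dirder.
    have D : is_derive (v * 0 + x) 1 h (h' x) by rewrite mulr0 add0r.
    have := is_derive_comp_aff D.
    by under eq_fun do rewrite mulrC.
  by apply: salg_smooth; apply: salg_scale; exact: salg_base.
set h := foldr _ _ _ => sh; split; first exact: smooth1_cont.
have [h' sh' dh] := smooth1_deriv sh.
move=> x v; have : is_derive x v h (v * h' x); last by case.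
apply: dirder.
have D : is_derive (v * 0 + x) 1 h (h' x) by rewrite mulr0 add0r.
have := is_derive_comp_aff D.
by under eq_fun do rewrite mulrC.
Qed.

Lemma tens_der a' b' (a b : R -> R) (z v : R * R) :
  is_derive z.1 1 a a' -> is_derive z.2 1 b b' ->
  is_derive z v (fun z : R * R => a z.1 * b z.2) (v.1 * a' * b z.2 + a z.1 * (v.2 * b')).
Proof.
move=> da db; apply: dirder.
have D1 : is_derive (v.1 * 0 + z.1) 1 a a' by rewrite mulr0 add0r.
have D2 : is_derive (v.2 * 0 + z.2) 1 b b' by rewrite mulr0 add0r.
have := is_derive_mul (is_derive_comp_aff D1) (is_derive_comp_aff D2).
rewrite !mulr0 !add0r => D.
have -> : (fun s : R => a (s *: v + z).1 * b (s *: v + z).2) =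
  (fun s => a (v.1 * s + z.1) * b (v.2 * s + z.2)).
  by apply/funext => s; rewrite /= /GRing.scale/= !(mulrC s).
exact: D.
Qed.

(** The span of products of smooth functions of one variable. A single product is not stable under
    derivation in an oblique direction, the span is. *)
Inductive tens2 : (R * R -> R) -> Prop :=
| tens_base (a b : R -> R) : smooth1 a -> smooth1 b -> tens2 (fun z => a z.1 * b z.2)
| tens_add (g h : R * R -> R) : tens2 g -> tens2 h -> tens2 (fun z => g z + h z)
| tens_scale (c : R) (g : R * R -> R) : tens2 g -> tens2 (fun z => c * g z).

Lemma tens2_deriv (g : R * R -> R) (v : R * R) : tens2 g -> exists2 g', tens2 g' & forall z, is_derive z v g (g' z).
Proof.
elim=> {g}.
- move=> a b sa sb; have [a' sa' da] := smooth1_deriv sa.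
  have [b' sb' db] := smooth1_deriv sb.
  exists (fun z => v.1 * (a' z.1 * b z.2) + v.2 * (a z.1 * b' z.2)).
    by apply: tens_add; apply: tens_scale; exact: tens_base.
  by move=> z; apply: (is_derive_eq (tens_der v (da _) (db _))); ring.
- move=> g h _ [g' tg' dg] _ [h' th' dh]; exists (fun z => g' z + h' z).
    exact: tens_add.
  by move=> z; exact: is_deriveD (dg z) (dh z).
- move=> c g _ [g' tg' dg]; exists (fun z => c * g' z); first exact: tens_scale.
  by move=> z; have := @is_deriveZ R (R * R)%type R g c z v (g' z) (dg z); apply.
Qed.

Lemma tens2_cont (g : R * R -> R) : tens2 g -> continuous g.
Proof.
elim=> {g}.
- move=> a b /smooth1_cont ca /smooth1_cont cb z.
  apply: (@cvgM _ _ (nbhs z) _ (a \o fst) (b \o snd) (a z.1) (b z.2)).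
    by apply: continuous_comp; [exact: cvg_fst|exact: ca].
  by apply: continuous_comp; [exact: cvg_snd|exact: cb].
- by move=> g h _ cg _ ch z; apply: cvgD; [exact: cg|exact: ch].
- by move=> c g _ cg z; apply: cvgM; [exact: cvg_cst|exact: cg].
Qed.

Lemma tens2_smooth (g : R * R -> R) : tens2 g -> smooth g.
Proof.
move=> tg s /=; have : tens2 (foldr (fun v (h : R * R -> R) => 'D_v h) g s).
  elim: s => //= v s; set h := foldr _ _ _ => /(tens2_deriv v)[h' th' dh].
  rewrite (_ : 'D_v h = h')//; apply/funext => z; exact: derive_val.
set h := foldr _ _ _ => th; split; first exact: tens2_cont.
by move=> z v; have [h' th' dh] := tens2_deriv v th; case: (dh z).
Qed.

Lemma test_function_smooth1 g a b : smooth1 g -> (forall x, ~~ ((a <= x) && (x <= b)) -> g x = 0) ->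
  test_function [set: R] g.
Proof.
move=> sg g0; split; first exact: smooth1_smooth.
exists `[a, b]%classic; first by split => //; exact: segment_compact.
by move=> x /= /negP; rewrite in_itv/=; exact: g0.
Qed.

Lemma test_function_tensor (p q : R -> R) a b c d : smooth1 p -> smooth1 q -> 0 < a ->
  (forall x, ~~ ((a <= x) && (x <= b)) -> p x = 0) ->
  (forall x, ~~ ((c <= x) && (x <= d)) -> q x = 0) ->
  test_function (half_plane R) (fun z => p z.1 * q z.2).
Proof.
move=> sp sq a0 p0 q0; split; first by apply: tens2_smooth; exact: tens_base.
exists (`[a, b]%classic `*` `[c, d]%classic).
  split; first by apply: compact_setX; exact: segment_compact.
  by move=> [x y] [/= + _]; rewrite in_itv/= /half_plane/= => /andP[ax _]; exact: lt_le_trans ax.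
move=> [x y] /= H.
have [xab|xab] := boolP ((a <= x) && (x <= b)); last by rewrite p0// mul0r.
have [ycd|ycd] := boolP ((c <= y) && (y <= d)); last by rewrite q0// mulr0.
by exfalso; apply: H; split; rewrite /= in_itv.
Qed.

Definition prim n x : R := if 0 <= x then I mu (fun s => ind 0 x s * n s)
  else - I mu (fun s => ind x 0 s * n s).

Lemma ac_prim n : locL1 n -> ac (prim n) n.
Proof.
move=> ln a b ab; split; first exact: ln.
have E x y z : x <= y -> y <= z -> I mu (fun s => ind x z s * n s) =
   I mu (fun s => ind x y s * n s) + I mu (fun s => ind y z s * n s).
  by move=> xy yz; apply: I_ind_split => //; apply: ln; exact: le_trans yz.
rewrite /prim; have [b0|b0] := leP 0 b; have [a0|a0] := leP 0 a.
- by rewrite (E 0 a b a0 ab); lra.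
- by rewrite (E a 0 b (ltW a0) b0); lra.
- by have := lt_le_trans b0 (le_trans a0 ab); rewrite ltxx.
- by rewrite (E a b 0 ab (ltW b0)); lra.
Qed.

Lemma cont_bnd g a b : continuous g -> exists2 C, 0 <= C & forall x, a <= x -> x <= b -> `|g x| <= C.
Proof.
move=> cg.
have /compact_bounded[M [_ HM]] := continuous_compact (continuous_subspaceT cg) (@segment_compact _ a b).
exists (`|M| + 1); first by rewrite addr_ge0.
move=> x ax xb; apply: (HM (`|M| + 1)); first by rewrite (le_lt_trans (ler_norm M))// ltrDl.
by exists x => //=; rewrite in_itv/= ax xb.
Qed.

Lemma cont_locL1 g : continuous g -> locL1 g.
Proof.
move=> cg a b ab; have [C C0 HC] := cont_bnd a b cg.
apply: (L1_bnd (c := C)); first exact: continuous_measurable_fun.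
by move=> x /ltW ax xb; exact: HC.
Qed.

Lemma I_ind_bnd f a b c : a <= b -> L1 mu (fun x => ind a b x * f x) ->
  (forall x, a < x -> x <= b -> `|f x| <= c) ->
  `|I mu (fun x => ind a b x * f x)| <= c * (b - a).
Proof.
move=> ab lf fc; have [li <-] := I_ind ab; rewrite -IZ//.
apply: I_le_abs => //; first exact: L1Z.
move=> x; rewrite normrM (ger0_norm (ind_ge0 _ _ _)) mulrC /ind.
by case: ifP => [/andP[ax xb]|_]; rewrite ?mulr1 ?mulr0//; exact: fc.
Qed.

Lemma is_derive_prim n x : continuous n -> is_derive x 1 (prim n) (n x).
Proof.
move=> cn; have ln := cont_locL1 cn; have ac := ac_prim ln.
apply/is_derive1_caratheodory.
exists (fun z => if z == x then n x else (prim n z - prim n x) / (z - x)).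
split; last by rewrite eqxx.
  move=> z; case: eqP => [->|/eqP zx]; first by rewrite !subrr mulr0.
  by rewrite divfK// subr_eq0.
rewrite /prop_for /continuous_at /= eqxx.
apply/cvgrPdist_le => e e0.
have /cvgrPdist_le/(_ _ e0)/nbhs_ballP[d d0 dP] := cn x.
apply/nbhs_ballP; exists d => // z xz.
have bnd s : `|x - s| < d -> `|n x - n s| <= e by move=> ?; exact: dP.
case: eqP => [_|/eqP zx]; first by rewrite subrr normr0 ltW.
rewrite /ball/= ltr_norml in xz; move/andP: xz => [xz1 xz2].
have key a b : a <= b -> (forall s, a < s -> s <= b -> `|x - s| < d) ->
    `|prim n b - prim n a - n x * (b - a)| <= e * (b - a).
  move=> ab H; have [l ->] := ac a b ab; have [li li1] := I_ind ab.
  rewrite -li1 -IZ// -IB//; last exact: L1Z.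
  rewrite (@eq_I _ _ _ mu _ (fun s => ind a b s * (n s - n x))); last by move=> s; ring.
  rewrite li1; apply: I_ind_bnd => //.
    by apply: eq_L1 (L1B l (L1Z (n x) li)) => s; ring.
  by move=> s as_ sb; rewrite distrC; apply: bnd; exact: H.
have zx' : z - x != 0 by rewrite subr_eq0.
have -> : n x - (prim n z - prim n x) / (z - x) =
   - ((prim n z - prim n x - n x * (z - x)) / (z - x)) by field.
rewrite normrN normrM normfV ler_pdivrMr ?normr_gt0//.
have [xz|/ltW zlx] := leP x z.
  rewrite (ger0_norm (_ : 0 <= z - x)) ?subr_ge0//; apply: key => // s ? ?.
  by rewrite ltr_norml; apply/andP; split; lra.
rewrite (ler0_norm (_ : z - x <= 0)) ?subr_le0// opprB.
have -> : prim n z - prim n x - n x * (z - x) = - (prim n x - prim n z - n x * (x - z)) by ring.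
rewrite normrN; apply: key => // s ? ?.
by rewrite ltr_norml; apply/andP; split; lra.
Qed.

End TestFunctions.

Lemma ae_countable d (T : measurableType d) (R : realType) (m : {measure set T -> \bar R})
  (K : countType) (P : K -> T -> Prop) :
  (forall k, {ae m, forall x, P k x}) -> {ae m, forall x, forall k, P k x}.
Proof.
move=> H.
have : {ae m, forall x, forall i : nat, forall k, unpickle i = Some k -> P k x}.
  apply/ae_foralln => i; case E : (unpickle i) => [k|].
    by apply: (ae_imp (H k)) => x Px k' [<-].
  exact: aeW.
by move=> HH; apply: (ae_imp HH) => x Hx k; apply: (Hx (pickle k)); rewrite pickleK.
Qed.

(** * Functions with a prescribed weak derivative *)

Section DuBoisReymond.
Variable R : realType.
Local Notation mu := (leb1 R).
Implicit Types (a b c x : R) (f g h m U : R -> R) (n : nat) (l : \bar R).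

Lemma bump_le_ind a b n x : cutoff a b n x <= ind a b x.
Proof.
rewrite /ind; case: ifP => H; first exact: bump_le1.
rewrite bump_out//; apply/negP => /andP[ax xb].
by move: H; rewrite ax ltW.
Qed.

Lemma measurable_bump a b n : measurable_fun setT (cutoff a b n).
Proof. apply: continuous_measurable_fun; exact: smooth1_cont (smooth1_bump a b n). Qed.

Lemma L1_bump a b n m : measurable_fun setT m -> L1 mu (fun x => ind a b x * m x) ->
  L1 mu (fun x => cutoff a b n x * m x).
Proof.
move=> mm lm; apply: L1_le (L1_abs lm).
  by apply: measurable_funM => //; exact: measurable_bump.
move=> x; rewrite normrM [leRHS]normrM ler_wpM2r// (ger0_norm (ind_ge0 _ _ _)) (ger0_norm (bump_ge0 _ _ _ _)).
exact: bump_le_ind.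
Qed.

Lemma I_bump_cvg a b m : measurable_fun setT m -> L1 mu (fun x => ind a b x * m x) ->
  I mu (fun x => cutoff a b n x * m x) @[n --> \oo] --> I mu (fun x => ind a b x * m x).
Proof.
move=> mm lm; apply: (dct _ _ _ (L1_abs lm) _).2.
- by move=> n; apply: measurable_funM => //; exact: measurable_bump.
- exact: L1_meas lm.
- apply: (ae_imp (ae_neq b)) => x xb.
  by apply: cvgM; [exact: bump_cvg|exact: cvg_cst].
- move=> n; apply: aeW => x.
  rewrite normrM [leRHS]normrM ler_wpM2r// (ger0_norm (ind_ge0 _ _ _)) (ger0_norm (bump_ge0 _ _ _ _)).
  exact: bump_le_ind.
Qed.

(** The primitive takes equal values at rational points, so it is constant by continuity, and
    Lebesgue differentiation recovers [f]. *)
Lemma loc_zero f : locL1 f -> (forall p q : rat, ratr p < ratr q :> R ->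
   I mu (fun x => ind (ratr p) (ratr q) x * f x) = 0) -> {ae mu, forall x, f x = 0}.
Proof.
move=> lf H; have aF := ac_prim lf; have cF := ac_cont aF.
have F0 (p q : rat) : prim f (ratr p) = prim f (ratr q).
  have [pq|qp|->//] := ltgtP (ratr p : R) (ratr q).
    by apply/eqP; rewrite eq_sym -subr_eq0 (ac_I aF (ltW pq)) H.
  by apply/eqP; rewrite -subr_eq0 (ac_I aF (ltW qp)) H.
have Fc x : prim f x = prim f (ratr 0).
  apply/eqP/negP => /negP ne.
  have : \forall z \near x, prim f z != prim f (ratr 0).
    have e0 : 0 < `|prim f x - prim f (ratr 0)| by rewrite normr_gt0 subr_eq0.
    have /cvgrPdist_lt/(_ _ e0) := cF x.
    by apply: filterS => z; apply: contraTN => /eqP ->; rewrite ltxx.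
  move=> /nbhs_ballP[d /= d0 dP].
  have [q] : exists q : rat, ratr q \in `]x, (x + d)[ by apply: rat_in_itvoo; rewrite ltrDl.
  rewrite in_itv/= => /andP[q1 q2].
  have : prim f (ratr q) != prim f (ratr 0).
    by apply: dP; rewrite /ball/= distrC gtr0_norm ?subr_gt0//; lra.
  by rewrite (F0 q 0) eqxx.
apply: (ae_imp (ae_deriv lf)) => x Hx.
have u0 (n : nat) : (0 : R) < n.+1%:R^-1 by rewrite invr_gt0.
have := Hx (fun n => n.+1%:R^-1) u0 (@cvg_harmonic R).
move=> Hl.
have : (n.+1%:R^-1)^-1 * I mu (fun s => ind (x - n.+1%:R^-1) x s * f s) @[n --> \oo] --> (0 : R).
  apply: cvg_near_cst; apply: nearW => n.
  rewrite -(ac_I aF); last by rewrite gerBl.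
  by rewrite !Fc subrr mulr0.
by move=> /(cvg_unique _ Hl); apply.
Qed.

Definition rbump (p q : rat) n x : R := cutoff (ratr p) (ratr q) n x.

(** [l] is the left end of the domain: [-oo] in space, 0 in time, where integrability is known only
    away from the end. The bumps tend to indicators of rational intervals, and [loc_zero] applies to
    [m] cut off below each rational point beyond [l]. *)
Lemma bump_zero l m : measurable_fun setT m ->
  (forall a b, (l < a%:E)%E -> a <= b -> L1 mu (fun x => ind a b x * m x)) ->
  (forall (p q : rat) n, (l < (ratr p)%:E)%E -> ratr p < ratr q :> R ->
     I mu (fun x => rbump p q n x * m x) = 0) ->
  {ae mu, forall x, (l < x%:E)%E -> m x = 0}.
Proof.
move=> mm lm H.
have Z (s q : rat) : (l < (ratr s)%:E)%E -> I mu (fun x => ind (ratr s) (ratr q) x * m x) = 0.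
  move=> ls; have [sq|qs] := ltP (ratr s : R) (ratr q); last first.
    rewrite -[RHS](I_0 mu); apply: eq_I => x; rewrite indF ?mul0r//.
    by apply/negP => /andP[H1 H2]; have := lt_le_trans H1 (le_trans H2 qs); rewrite ltxx.
  have C := I_bump_cvg mm (lm _ _ ls (ltW sq)).
  have : I mu (fun x => cutoff (ratr s) (ratr q) n x * m x) @[n --> \oo] --> (0 : R).
    by apply: cvg_near_cst; apply: nearW => n; exact: H.
  by move=> /(cvg_unique _ C); apply.
have key (r : rat) : (l < (ratr r)%:E)%E -> {ae mu, forall x, ratr r < x -> m x = 0}.
  move=> lr; pose f x := if ratr r < x then m x else 0.
  have E a b x : ind a b x * f x = ind (Num.max a (ratr r)) b x * m x.
    rewrite /f /ind gt_max; case: (ratr r < x); last by rewrite andbF/= mulr0 mul0r.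
    by rewrite andbT.
  have lf : locL1 f.
    move=> a b ab; have [rb|br] := leP (Num.max a (ratr r)) b.
      by apply: eq_L1 (lm _ _ _ rb) => [x|]; rewrite ?E// (lt_le_trans lr)// lee_fin le_max lexx orbT.
    apply: eq_L1 (L1_0 mu) => x; rewrite E indF ?mul0r//.
    by apply/negP => /andP[H1 H2]; have := lt_trans (lt_le_trans H1 H2) br; rewrite ltxx.
  have f0 : {ae mu, forall x, f x = 0}.
    apply: loc_zero => // p q pq; rewrite (eq_I mu (E _ _)).
    have [pr|rp] := leP (ratr p : R) (ratr r); apply: Z => //.
    by rewrite (lt_trans lr)// lte_fin.
  apply: (ae_imp f0) => x; rewrite /f => + rx; by rewrite rx.
have : {ae mu, forall x, forall r : rat, (l < (ratr r)%:E)%E -> ratr r < x -> m x = 0}.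
  apply: ae_countable => r; have [lr|lr] := boolP (l < (ratr r : R)%:E)%E.
    by apply: (ae_imp (key _ lr)) => x Hx _.
  exact: aeW.
move=> HH; apply: (ae_imp HH) => x Hx lx.
have [y ly yx] : exists2 y, (l <= y%:E)%E & y < x.
  move: lx; case: l {lm H key HH Hx Z} => [l| |]//=; first by rewrite lte_fin => lx; exists l.
  by move=> _; exists (x - 1) => //; [exact: leNye|rewrite ltrBlDr ltrDl].
have [q] := rat_in_itvoo yx; rewrite in_itv/= => /andP[yq qx].
by apply: (Hx q) => //; rewrite (le_lt_trans ly).
Qed.

(** A bump minus the multiple of a fixed bump on [[c, c + 1]] that makes its mean zero. Its
    primitive [tst], normalized to vanish on the left, then has compact support and is an admissible
    test. *)
Definition dtst c a b n x : R :=
  cutoff a b n x + - (I mu (cutoff a b n) / I mu (cutoff c (c + 1) 0)) * cutoff c (c + 1) 0 x.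
Definition tst c a b n x : R := prim (dtst c a b n) x - prim (dtst c a b n) (Num.min a c).

Lemma smooth1_dtst c a b n : smooth1 (dtst c a b n).
Proof.
apply: salg_smooth; apply: salg_add; first by apply: salg_base; exact: smooth1_bump.
by apply: salg_scale; apply: salg_base; exact: smooth1_bump.
Qed.

Lemma is_derive_tst c a b n x : is_derive x 1 (tst c a b n) (dtst c a b n x).
Proof.
have D := is_derive_prim x (smooth1_cont (smooth1_dtst c a b n)).
have H := is_deriveB D (is_derive_cst (prim (dtst c a b n) (Num.min a c)) x (1 : R)).
by apply: (is_derive_eq H); rewrite subr0.
Qed.

Lemma smooth1_tst c a b n : smooth1 (tst c a b n).
Proof.
exists (fun g => g = tst c a b n \/ smooth1 g); first by left.
move=> h [->|/smooth1_deriv[h' sh' dh]]; last by exists h' => //; right.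
exists (dtst c a b n); last by move=> x; exact: is_derive_tst.
by right; exact: smooth1_dtst.
Qed.

Lemma L1_bump1 a b n : L1 mu (cutoff a b n).
Proof.
have [ab|ba] := ltP a b; last first.
  apply: eq_L1 (L1_0 mu) => x; rewrite bump_out//.
  by apply/negP => /andP[H1 H2]; have := lt_le_trans (lt_trans H1 H2) ba; rewrite ltxx.
have l : L1 mu (fun x => ind a b x * 1) by apply: eq_L1 (I_ind (ltW ab)).1 => x; rewrite mulr1.
have H := @L1_bump a b n (fun=> 1) (measurable_cst (1 : R)) l.
by apply: eq_L1 H => x; rewrite mulr1.
Qed.

Lemma I_bump_gt0 c : 0 < I mu (cutoff c (c + 1) 0).
Proof.
rewrite lt_def I_ge0 ?andbT; last by move=> x; exact: bump_ge0.
apply/negP => /eqP I0.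
have ae : {ae mu, forall x, cutoff c (c + 1) 0 x = 0}.
  by apply: I_eq0_ae => //; [exact: L1_bump1|apply: aeW => x; exact: bump_ge0].
have Z : {ae mu, forall x, ind c (c + 1) x = 0}.
  apply: (ae_imp2 ae (ae_neq (c + 1))) => x b0 xc.
  apply: indF; apply/negP => /andP[cx xc1].
  have xc1' : x < c + 1 by rewrite lt_neqAle xc.
  move: b0; have -> : cutoff c (c + 1) 0 x = pexp 1 (x - c) * pexp 1 (c + 1 - x).
    by rewrite /cutoff; congr (pexp _ _ * pexp _ _); ring.
  move/eqP; rewrite /pexp !subr_gt0 cx xc1' !hornerC !mul1r mulf_eq0.
  by rewrite !gt_eqF ?expR_gt0.
have [l1 l2] := I_ind (ltac:(lra) : c <= c + 1).
have : I mu (ind c (c + 1)) = I mu (fun=> 0 : R).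
  by apply: I_aeeq => //; exact: L1_meas l1.
by rewrite l2 I_0; lra.
Qed.

Lemma dtst_out c a b n x : ~~ ((Num.min a c < x) && (x < Num.max b (c + 1))) ->
  dtst c a b n x = 0.
Proof.
rewrite negb_and -!leNgt le_min ge_max => /orP[|] /andP[H1 H2].
  have O1 : cutoff a b n x = 0 by apply: bump_out; rewrite negb_and -!leNgt H1.
  have O2 : cutoff c (c + 1) 0 x = 0 by apply: bump_out; rewrite negb_and -!leNgt H2.
  by rewrite /dtst O1 O2 mulr0 addr0.
have O1 : cutoff a b n x = 0 by apply: bump_out; rewrite negb_and -!leNgt H1 orbT.
have O2 : cutoff c (c + 1) 0 x = 0 by apply: bump_out; rewrite negb_and -!leNgt H2 orbT.
by rewrite /dtst O1 O2 mulr0 addr0.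
Qed.

Lemma I_dtst c a b n : L1 mu (dtst c a b n) /\ I mu (dtst c a b n) = 0.
Proof.
have l1 := L1_bump1 a b n; have l2 := L1_bump1 c (c + 1) 0.
have l3 := L1Z (- (I mu (cutoff a b n) / I mu (cutoff c (c + 1) 0))) l2.
split; first exact: L1D.
rewrite ID// IZ// mulNr divfK ?subrr// gt_eqF//; exact: I_bump_gt0.
Qed.

Lemma tst_out c a b n x : a <= b -> ~~ ((Num.min a c <= x) && (x <= Num.max b (c + 1))) ->
  tst c a b n x = 0.
Proof.
move=> ab; have aP := ac_prim (cont_locL1 (smooth1_cont (smooth1_dtst c a b n))).
rewrite negb_and -!ltNge => /orP[H|H].
  rewrite /tst -opprB (ac_I aP (ltW H)) -[RHS]oppr0 -(I_0 mu); congr (- _).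
  apply: eq_I => s; have [ms|sm] := ltP (Num.min a c) s.
    by rewrite indF ?mul0r// negb_and -!ltNge ms orbT.
  by rewrite dtst_out ?mulr0// negb_and -!leNgt sm.
have mM : Num.min a c <= Num.max b (c + 1) by rewrite ge_min le_max ab.
rewrite /tst (ac_I aP (le_trans mM (ltW H))) -[RHS](I_dtst c a b n).2.
apply: eq_I => s; have [ms|sm] := ltP (Num.min a c) s.
  have [sx|xs] := leP s x; first by rewrite indT// mul1r.
  by rewrite dtst_out ?mulr0// negb_and -!leNgt (ltW (lt_trans H xs)) orbT.
by rewrite dtst_out ?mulr0// negb_and -!leNgt sm.
Qed.

(* Countably many test functions suffice: the hypothesis can thus be checked for
   almost every value of a parameter, simultaneously for all of them. *)
Lemma du_bois_reymond l c m N k : measurable_fun setT m -> (l < c%:E)%E ->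
  (forall a b, (l < a%:E)%E -> a <= b -> L1 mu (fun x => ind a b x * m x)) ->
  ac N k ->
  (forall (p q : rat) n, (l < (ratr p)%:E)%E -> ratr p < ratr q :> R ->
     I mu (fun x => dtst c (ratr p) (ratr q) n x * m x) =
     - I mu (fun x => tst c (ratr p) (ratr q) n x * k x)) ->
  exists K, {ae mu, forall x, (l < x%:E)%E -> m x = N x + K}.
Proof.
move=> mm lc lm aN H.
have cN := ac_cont aN; have mN := ac_measU aN.
pose D x := m x - N x.
have mD : measurable_fun setT D by exact: measurable_funB.
have lD a b : (l < a%:E)%E -> a <= b -> L1 mu (fun x => ind a b x * D x).
  by move=> la ab; apply: eq_L1 (L1B (lm a b la ab) (cont_locL1 cN ab)) => x; rewrite /D mulrBr.
have c1 : c <= c + 1 by lra.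
pose J := I mu (cutoff c (c + 1) 0).
have J0 : J != 0 by rewrite gt_eqF// I_bump_gt0.
(* The constant is the mean of [m - N] against the compensating bump; the hypothesis says that every
   other bump gives the same mean. *)
pose K := I mu (fun x => cutoff c (c + 1) 0 x * D x) / J.
exists K.
have lbD a b n : (l < a%:E)%E -> a <= b -> L1 mu (fun x => cutoff a b n x * D x).
  by move=> la ab; apply: L1_bump => //; exact: lD.
suff : {ae mu, forall x, (l < x%:E)%E -> D x - K = 0}.
  by move=> HH; apply: (ae_imp HH) => x Hx /Hx; rewrite /D; lra.
apply: bump_zero.
- by apply: measurable_funB => //; exact: measurable_cst.
- move=> a b la ab; apply: eq_L1 (L1B (lD a b la ab) (L1Z K (I_ind ab).1)) => x.
  by ring.
move=> p q n lp pq; have := H p q n lp pq; have pq' := ltW pq.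
set d := dtst _ _ _ _; set t := tst _ _ _ _ => Hd.
have at_ : ac t d.
  by apply: ac_C1 => [x|]; [exact: is_derive_tst|exact: smooth1_cont (smooth1_dtst _ _ _ _)].
pose M := `|Num.min (ratr p) c| + `|Num.max (ratr q) (c + 1)| + 1.
have out x : M <= `|x| -> ~~ ((Num.min (ratr p) c <= x) && (x <= Num.max (ratr q) (c + 1))).
  move=> Mx; apply/negP => /andP[x1 x2]; move: Mx; apply/negP; rewrite -ltNge.
  rewrite /M ltr_norml; apply/andP; split.
    by move: x1; have := ler_norm (- Num.min (ratr p) c); rewrite normrN;
      have := normr_ge0 (Num.max (ratr q) (c + 1)); lra.
  by move: x2; have := ler_norm (Num.max (ratr q) (c + 1));
     have := normr_ge0 (Num.min (ratr p) c); lra.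
have t0 x : M <= `|x| -> t x = 0 by move=> Mx; apply: tst_out => //; exact: out.
have d0 x : M <= `|x| -> d x = 0 by move=> Mx; apply: dtst_out; move: (out _ Mx); apply: contra => /andP[/ltW -> /ltW ->].
have P1 x : M <= `|x| -> t x * N x = 0 by move=> Mx; rewrite t0// mul0r.
have P2 x : M <= `|x| -> d x * N x + t x * k x = 0.
  by move=> Mx; rewrite d0// t0// !mul0r addr0.
have [l1 i1] := ac_supp (acM at_ aN) P1 P2.
have lp1 := lbD _ _ n lp pq'; have lc1 := lbD _ _ 0%N lc c1.
have dE x : d x * D x = cutoff (ratr p) (ratr q) n x * D x +
    (- (I mu (cutoff (ratr p) (ratr q) n) / J)) * (cutoff c (c + 1) 0 x * D x).
  by rewrite /d /dtst -/J; ring.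
have ldD : L1 mu (fun x => d x * D x).
  by apply: eq_L1 (L1D lp1 (L1Z (- (I mu (cutoff (ratr p) (ratr q) n) / J)) lc1)) => x; rewrite dE.
have cB g : (forall x, M <= `|x| -> g x = 0) -> continuous g -> exists2 C, 0 <= C & forall x, `|g x| <= C.
  move=> g0 cg; have [C C0 HC] := cont_bnd (- M) M cg; exists C => // x.
  have [Mx|/ltW] := leP M `|x|; first by rewrite g0// normr0.
  by rewrite ler_norml => /andP[? ?]; exact: HC.
have M0 : - M <= M.
  by rewrite /M; have := normr_ge0 (Num.max (ratr q) (c + 1)); have := normr_ge0 (Num.min (ratr p) c); lra.
have lg g h : (forall x, M <= `|x| -> g x = 0) -> continuous g -> locL1 h -> L1 mu (fun x => g x * h x).
  move=> g0 cg lh; have [C C0 HC] := cB g g0 cg.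
  apply: L1_le (L1Z C (L1_abs (lh _ _ M0))).
    by apply: measurable_funM; [exact: continuous_measurable_fun|exact: locL1_meas].
  move=> x; rewrite normrM; have [Mx|/[dup] Mx] := leP M `|x|; first by rewrite g0// normr0 mul0r mulr_ge0.
  rewrite ltr_norml => /andP[x1 x2]; rewrite indT ?(ltW x2)// mul1r ler_wpM2r//.
have ct : continuous t := ac_cont at_.
have cd : continuous d := smooth1_cont (smooth1_dtst _ _ _ _).
have ldN := lg _ _ d0 cd (cont_locL1 cN).
have ltk := lg _ _ t0 ct (ac_loc aN).
rewrite ID// in i1.
have ldm : L1 mu (fun x => d x * m x).
  by apply: eq_L1 (L1D ldD ldN) => x; rewrite /D; ring.
have : I mu (fun x => d x * D x) = 0.
  transitivity (I mu (fun x => d x * m x) - I mu (fun x => d x * N x)).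
    by rewrite -IB//; apply: eq_I => x; rewrite /D mulrBr.
  by rewrite Hd; lra.
rewrite (eq_I mu dE) ID//; last exact: L1Z.
rewrite IZ// => E.
have lb1 := L1_bump1 (ratr p) (ratr q) n.
rewrite (@eq_I _ _ _ mu _ (fun x => cutoff (ratr p) (ratr q) n x * D x - K * cutoff (ratr p) (ratr q) n x)); last first.
  by move=> x; rewrite /rbump; ring.
rewrite IB// ?IZ//; last exact: L1Z.
by move: E; rewrite /K; set A := I _ _; set B := I _ _; set C' := I _ _ => <-; field.
Qed.


End DuBoisReymond.

(** * Time slices of weak derivatives *)

Section Slices.
Variable R : realType.
Local Notation mu := (leb1 R).
Local Notation mu2 := (leb2 R).
Implicit Types (G H : R -> R -> R) (t x a b c d : R) (q : R -> R).

(** Extension by 0 to [t <= 0], which turns integrals over the open half plane into integrals over a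
    product space, where Fubini applies. *)
Definition zext G t x : R := if 0 < t then G t x else 0.

Lemma measurable_half_plane : measurable (half_plane R).
Proof.
rewrite (_ : half_plane R = setT `&` (fst @^-1` `]0, +oo[%classic)).
  by apply: (@measurable_fst _ _ R R measurableT).
by apply/seteqP; split => z; rewrite /half_plane/= in_itv/= andbT; first [by split|by case].
Qed.

Lemma zext_meas G : measurable_fun (half_plane R) (fun z : R * R => G z.1 z.2) ->
  measurable_fun setT (fun z : R * R => zext G z.1 z.2).
Proof.
move/(measurable_restrictT _ measurable_half_plane).
rewrite (_ : (_ \_ _) = (fun z : R * R => zext G z.1 z.2))//.
apply/funext => z; rewrite patchE /zext; case: ifPn => [/set_mem|/negP H].
  by rewrite /half_plane/= => ->.
by case: ifP => // z0; exfalso; apply: H; apply/mem_set.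
Qed.

Definition box a b L (z : R * R) : R := ind a b z.1 * ind (- L) L z.2.

Lemma measurable_box a b L : measurable_fun setT (box a b L).
Proof.
by apply: measurable_funM; apply: measurable_ind.
Qed.

Lemma box_ge0 a b L z : 0 <= box a b L z.
Proof. by rewrite mulr_ge0// ind_ge0. Qed.

(** Boxes stay away from the line [t = 0], since local integrability is assumed in the open half
    plane only. *)
Definition loc2 G := forall a b L, 0 < a -> L1 mu2 (fun z => box a b L z * G z.1 z.2).

Lemma zext_loc2 G : locally_integrable2 G -> loc2 (zext G) /\
  measurable_fun setT (fun z : R * R => zext G z.1 z.2).
Proof.
move=> [mG iG]; have mz := zext_meas mG; split => // a b L a0.
pose K : set (R * R) := `[a, b]%classic `*` `[- L, L]%classic.
have cK : compact K by apply: compact_setX; exact: segment_compact.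
have KH : K `<=` half_plane R.
  by move=> [t x] [/=]; rewrite in_itv/= /half_plane/= => /andP[at_ _] _; exact: lt_le_trans at_.
have mK : measurable K by apply: measurableX; exact: measurable_itv.
have := iG K cK KH; rewrite integral_mkcond => fin.
apply/integrableP; split.
  by apply/measurable_EFinP; apply: measurable_funM => //; exact: measurable_box.
apply: le_lt_trans fin; apply: ge0_le_integral => //.
- by do 2 apply: measurableT_comp => //; apply: measurable_funM => //; exact: measurable_box.
- apply/(measurable_restrictT _ mK); apply/measurable_EFinP; apply: measurableT_comp => //.
  by apply: measurable_funS mG => //; exact: measurable_half_plane.
- move=> [t x] _; rewrite patchE /box /ind /=.
  case: ifPn => [/andP[at_ tb]|_]; last by rewrite !mul0r normr0; case: ifP => _; rewrite ?lee_fin.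
  case: ifPn => [/andP[x1 x2]|_]; last by rewrite mulr0 mul0r normr0; case: ifP => _; rewrite ?lee_fin.
  rewrite !mul1r mem_set ?/K/= ?in_itv/= ?(ltW at_) ?tb ?(ltW x1) ?x2//.
  by rewrite lee_fin /zext (lt_trans a0 at_).
Qed.

Definition supp q L := forall x, L <= `|x| -> q x = 0.

Lemma supp_bnd q L : continuous q -> supp q L -> exists2 C, 0 <= C & forall x, `|q x| <= C * ind (- L) L x.
Proof.
move=> cq sq; have [C C0 HC] := cont_bnd (- L) L cq; exists C => // x.
have [Lx|] := leP L `|x|; first by rewrite sq// normr0 mulr_ge0// ind_ge0.
by rewrite ltr_norml => /andP[x1 x2]; rewrite indT ?(ltW x2)// mulr1 HC// ltW.
Qed.

Lemma L1_suppM q L h : continuous q -> supp q L -> measurable_fun setT h ->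
  L1 mu (fun x => ind (- L) L x * h x) -> L1 mu (fun x => q x * h x).
Proof.
move=> cq sq mh lh; have [C C0 HC] := supp_bnd cq sq.
apply: L1_le (L1Z C (L1_abs lh)).
  by apply: measurable_funM => //; exact: continuous_measurable_fun.
by move=> x; rewrite normrM [X in C * X]normrM (ger0_norm (ind_ge0 _ _ _)) mulrA ler_wpM2r.
Qed.

Lemma tensor_L1 G (p q : R -> R) a b L : 0 < a -> continuous p -> continuous q ->
  (forall t, ~~ ((a < t) && (t < b)) -> p t = 0) -> supp q L ->
  measurable_fun setT (fun z : R * R => G z.1 z.2) -> loc2 G ->
  [/\ L1 mu2 (fun z => p z.1 * (q z.2 * G z.1 z.2)),
  I mu2 (fun z => p z.1 * (q z.2 * G z.1 z.2)) =
  I mu (fun t => p t * I mu (fun x => q x * G t x)) &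
  L1 mu (fun t => p t * I mu (fun x => q x * G t x))].
Proof.
move=> a0 cp cq p0 sq mG lG.
have [Cp Cp0 HCp] := cont_bnd a b cp; have [Cq Cq0 HCq] := supp_bnd cq sq.
have l : L1 mu2 (fun z => p z.1 * (q z.2 * G z.1 z.2)).
  apply: L1_le (L1Z (Cp * Cq) (L1_abs (lG a b L a0))).
    apply: measurable_funM.
      by apply: (measurableT_comp (continuous_measurable_fun cp)); exact: measurable_fst.
    apply: measurable_funM => //.
    by apply: (measurableT_comp (continuous_measurable_fun cq)); exact: measurable_snd.
  move=> [t x] /=; rewrite !normrM /= !(ger0_norm (ind_ge0 _ _ _)).
  have pt : `|p t| <= Cp * ind a b t.
    have [/andP[at_ tb]|H] := boolP ((a < t) && (t < b)).
      by rewrite (indT at_ (ltW tb)) mulr1 (HCp _ (ltW at_) (ltW tb)).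
    by rewrite p0// normr0 mulr_ge0// ind_ge0.
  have -> : Cp * Cq * (ind a b t * ind (- L) L x * `|G t x|) =
    (Cp * ind a b t) * ((Cq * ind (- L) L x) * `|G t x|) by ring.
  by apply: ler_pM => //; apply: ler_wpM2r.
have mI : measurable_fun setT (fun t => p t * I mu (fun x => q x * G t x)).
  apply: measurable_funM; first exact: continuous_measurable_fun.
  apply: (@measurable_I1 _ _ _ _ _ mu (fun z => q z.2 * G z.1 z.2)).
  apply: measurable_funM => //.
  by apply: (measurableT_comp (continuous_measurable_fun cq)); exact: measurable_snd.
(* The slice is known to be integrable only after multiplication by [p t], so this factor is pulled
   out where it does not vanish; elsewhere both sides are 0. *)
have E : {ae mu, forall t, I mu (fun x => p t * (q x * G t x)) = p t * I mu (fun x => q x * G t x)}.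
  have ae := fubini_ae1 l; apply: (ae_imp ae) => t /= lt_.
  have [->|pt0] := eqVneq (p t) 0.
    by rewrite mul0r -[RHS](I_0 mu); apply: eq_I => x; rewrite mul0r.
  rewrite -IZ//; apply: eq_L1 (L1Z (p t)^-1 lt_) => x.
  by rewrite mulrA mulVf// mul1r.
split => //; last exact: L1_aeeq (fubini_L1 l).
rewrite fubini_I//; apply: I_aeeq => //; exact: L1_meas (fubini_L1 l).
Qed.

Lemma loc2_slice G : measurable_fun setT (fun z : R * R => G z.1 z.2) -> loc2 G ->
  {ae mu, forall t, 0 < t -> locL1 (G t)}.
Proof.
move=> mG lG.
have : {ae mu, forall t, forall N : nat, L1 mu (fun x => box N.+1%:R^-1 N.+1%:R N.+1%:R (t, x) * G t x)}.
  by apply/ae_foralln => N; apply: (fubini_ae1 (lG _ _ _ _)); rewrite invr_gt0.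
move=> HH; apply: (ae_imp HH) => t Ht t0 a b ab.
pose m := Num.max (Num.max t t^-1) (Num.max `|a| `|b|).
pose N := Num.truncn m.
have mN : m < N.+1%:R by rewrite truncnS_gt.
move: mN; rewrite !gt_max => /andP[/andP[tN tiN] /andP[aN bN]].
apply: (@L1_ind_sub _ a b (- N.+1%:R) N.+1%:R).
- by rewrite lerNl (le_trans _ (ltW aN))// -normrN ler_norm.
- by rewrite (le_trans (ler_norm b))// ltW.
apply: eq_L1 (Ht N) => x; rewrite /box/= [ind _ _ t]indT ?mul1r//.
  by rewrite invf_plt// posrE.
exact: ltW.
Qed.

Lemma slice_I_meas G q : measurable_fun setT (fun z : R * R => G z.1 z.2) -> continuous q ->
  measurable_fun setT (fun t => I mu (fun x => q x * G t x)).
Proof.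
move=> mG cq; apply: (@measurable_I1 _ _ _ _ _ mu (fun z => q z.2 * G z.1 z.2)).
apply: measurable_funM => //.
by apply: (measurableT_comp (continuous_measurable_fun cq)); exact: measurable_snd.
Qed.

Lemma slice_I_L1 G q L a b : measurable_fun setT (fun z : R * R => G z.1 z.2) ->
  L1 mu2 (fun z => box a b L z * G z.1 z.2) -> continuous q -> supp q L ->
  L1 mu2 (fun z => ind a b z.1 * (q z.2 * G z.1 z.2)) /\
  L1 mu (fun t => ind a b t * I mu (fun x => q x * G t x)).
Proof.
move=> mG lG cq sq.
have mqG : measurable_fun setT (fun z : R * R => q z.2 * G z.1 z.2).
  apply: measurable_funM => //.
  by apply: (measurableT_comp (continuous_measurable_fun cq)); exact: measurable_snd.
have mI := slice_I_meas mG cq; have [C C0 HC] := supp_bnd cq sq.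
have l : L1 mu2 (fun z => ind a b z.1 * (q z.2 * G z.1 z.2)).
  apply: L1_le (L1Z C (L1_abs lG)).
    by apply: measurable_funM => //; apply: measurable_ind => //; exact: measurable_fst.
  move=> [t x] /=; rewrite !normrM /= !(ger0_norm (ind_ge0 _ _ _)).
  have -> : C * (ind a b t * ind (- L) L x * `|G t x|) =
    ind a b t * ((C * ind (- L) L x) * `|G t x|) by ring.
  by apply: ler_wpM2l; [exact: ind_ge0|apply: ler_wpM2r].
split => //; apply: L1_aeeq (fubini_L1 l).
  by apply: measurable_funM => //; exact: measurable_ind.
have := fubini_ae1 l => ae; apply: (ae_imp ae) => t /= lt_.
have [i0|i0] := eqVneq (ind a b t) 0.
  by rewrite i0 mul0r -[RHS](I_0 mu); apply: eq_I => x; rewrite mul0r.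
rewrite -IZ//; apply: eq_L1 (L1Z (ind a b t)^-1 lt_) => x.
by rewrite mulrA mulVf// mul1r.
Qed.

Lemma slice_I_loc G q L : measurable_fun setT (fun z : R * R => G z.1 z.2) -> loc2 G ->
  continuous q -> supp q L ->
  measurable_fun setT (fun t => I mu (fun x => q x * G t x)) /\
  forall a b, 0 < a -> L1 mu (fun t => ind a b t * I mu (fun x => q x * G t x)).
Proof.
move=> mG lG cq sq; split; first exact: slice_I_meas.
by move=> a b a0; exact: (slice_I_L1 mG (lG a b L a0) cq sq).2.
Qed.

Lemma tst_supp c (p q : rat) n : ratr p < ratr q :> R ->
  let L := `|Num.min (ratr p) c| + `|Num.max (ratr q) (c + 1)| + 1 in
  supp (tst c (ratr p) (ratr q) n) L /\ supp (dtst c (ratr p) (ratr q) n) L.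
Proof.
move=> pq L.
have out x : L <= `|x| -> ~~ ((Num.min (ratr p) c <= x) && (x <= Num.max (ratr q) (c + 1))).
  move=> Mx; apply/negP => /andP[x1 x2]; move: Mx; apply/negP; rewrite -ltNge.
  rewrite /L ltr_norml; apply/andP; split.
    by move: x1; have := ler_norm (- Num.min (ratr p) c); rewrite normrN;
      have := normr_ge0 (Num.max (ratr q) (c + 1)); lra.
  by move: x2; have := ler_norm (Num.max (ratr q) (c + 1));
     have := normr_ge0 (Num.min (ratr p) c); lra.
split => x Lx; first by apply: tst_out; [exact: ltW|exact: out].
by apply: dtst_out; move: (out _ Lx); apply: contra => /andP[/ltW -> /ltW ->].
Qed.

Lemma Rint_half_plane (F : R * R -> R) (F' : R * R -> R) :
  (forall z, 0 < z.1 -> F z = F' z) -> (forall z, ~~ (0 < z.1) -> F' z = 0) ->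
  \int[mu2]_(z in half_plane R) F z = I mu2 F'.
Proof.
move=> E E0; rewrite Rintegral_mkcond; apply: eq_I => z.
rewrite patchE; case: ifPn => [/set_mem|/negP H]; first exact: E.
by rewrite E0//; apply/negP => z0; apply: H; apply/mem_set.
Qed.

Lemma weak_x_tensor G H (p q q' : R -> R) a b L : weak_x_derivative G H ->
  smooth1 p -> smooth1 q -> (forall x : R, is_derive x 1 q (q' x)) -> continuous q' ->
  0 < a -> (forall t, ~~ ((a < t) && (t < b)) -> p t = 0) -> supp q L -> supp q' L ->
  I mu (fun t => p t * I mu (fun x => q' x * zext G t x)) =
  - I mu (fun t => p t * I mu (fun x => q x * zext H t x)).
Proof.
move=> [lG lH Hw] sp sq dq cq' a0 p0 q0 q'0.
have [zlG mG] := zext_loc2 lG; have [zlH mH] := zext_loc2 lH.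
have cp := smooth1_cont sp; have cq := smooth1_cont sq.
have [_ <- _] := tensor_L1 a0 cp cq' p0 q'0 mG zlG.
have [_ <- _] := tensor_L1 a0 cp cq p0 q0 mH zlH.
have T : test_function (half_plane R) (fun z => p z.1 * q z.2).
  apply: (@test_function_tensor _ p q a b (- L) L) => //.
    by move=> t H1; apply: p0; move: H1; apply: contra => /andP[/ltW -> /ltW ->].
  move=> x H1; apply: q0; rewrite leNgt; move: H1; apply: contra.
  by rewrite ltr_norml => /andP[/ltW -> /ltW ->].
have [p' _ dp] := smooth1_deriv sp.
have pz t : ~~ (0 < t) -> p t = 0.
  by move=> t0; apply: p0; apply: contra t0 => /andP[at_ _]; exact: lt_trans at_.
have D z : 'D_(0, 1) (fun z : R * R => p z.1 * q z.2) z = p z.1 * q' z.2.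
  have := tens_der ((0, 1) : R * R) (dp z.1) (dq z.2) => -[_ ->] /=.
  by rewrite !mul0r mul1r add0r.
have := Hw _ T.
rewrite (@Rint_half_plane _ (fun z => p z.1 * (q' z.2 * zext G z.1 z.2))); last 2 first.
- by move=> z z0; rewrite D /zext z0; ring.
- by move=> z z0; rewrite pz// mul0r.
rewrite (@Rint_half_plane _ (fun z => p z.1 * (q z.2 * zext H z.1 z.2)))//.
- by move=> z z0; rewrite /zext z0; ring.
- by move=> z z0; rewrite pz// mul0r.
Qed.

(** For each of countably many spatial tests, the tested identity is a function of time orthogonal
    to all bumps in time, hence zero almost everywhere by [bump_zero]. Outside one null set all
    tests are thus available at once, and du Bois-Reymond applies in [x]. *)
Lemma weak_x_slice G H : weak_x_derivative G H ->
  {ae mu, forall t, 0 < t -> exists2 U, ac U (H t) & {ae mu, forall x, G t x = U x}}.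
Proof.
move=> W; have [lG lH _] := W.
have [zlG mG] := zext_loc2 lG; have [zlH mH] := zext_loc2 lH.
pose m (k : rat * rat * nat) t :=
  I mu (fun x => dtst 0 (ratr k.1.1) (ratr k.1.2) k.2 x * zext G t x) +
  I mu (fun x => tst 0 (ratr k.1.1) (ratr k.1.2) k.2 x * zext H t x).
have m0 : {ae mu, forall t, forall k, ratr k.1.1 < ratr k.1.2 :> R -> 0 < t -> m k t = 0}.
  apply: ae_countable => -[[p q] n]; have [pq|pq] := boolP (ratr p < ratr q :> R); last first.
    by apply: aeW => t /= pq'; case/negP: pq.
  have [s1 s2] := tst_supp 0 n pq.
  have sm1 := smooth1_tst 0 (ratr p) (ratr q : R) n.
  have sm2 := smooth1_dtst 0 (ratr p) (ratr q : R) n.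
  have c1 := smooth1_cont sm1; have c2 := smooth1_cont sm2.
  have [mm1 ll1] := slice_I_loc mG zlG c2 s2.
  have [mm2 ll2] := slice_I_loc mH zlH c1 s1.
  have Z : {ae mu, forall t, (0%:E < t%:E)%E -> m (p, q, n) t = 0}.
    apply: bump_zero.
    - exact: measurable_funD.
    - move=> a b; rewrite lte_fin => a0 ab.
      by apply: eq_L1 (L1D (ll1 a b a0) (ll2 a b a0)) => t; rewrite mulrDr.
    - move=> p' q' n'; rewrite lte_fin => p0 pq'.
      have sc := smooth1_bump (ratr p') (ratr q' : R) n'.
      have := weak_x_tensor W sc sm1 (fun x => is_derive_tst 0 (ratr p) (ratr q) n x) c2 p0
         (fun t => @bump_out R _ _ n' t) s1 s2 => E.
      rewrite (@eq_I _ _ _ mu _ (fun t => cutoff (ratr p') (ratr q') n' t * I mu (fun x => dtst 0 (ratr p) (ratr q) n x * zext G t x) + cutoff (ratr p') (ratr q') n' t * I mu (fun x => tst 0 (ratr p) (ratr q) n x * zext H t x))); last first.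
        by move=> t; rewrite /m/= mulrDr.
      have la := ll1 _ (ratr q') p0; have lb := ll2 _ (ratr q') p0.
      by rewrite ID ?E ?addNr//; apply: L1_bump.
  by apply: (ae_imp Z) => t Ht _ t0; apply: Ht.
apply: (ae_imp3 m0 (loc2_slice mG zlG) (loc2_slice mH zlH)) => t Hm lGt lHt t0.
have zG : zext G t = G t by apply/funext => x; rewrite /zext t0.
have zH : zext H t = H t by apply/funext => x; rewrite /zext t0.
have lg := lGt t0; have lh := lHt t0; rewrite zG in lg; rewrite zH in lh.
have [K HK] : exists K, {ae mu, forall x, (-oo < x%:E)%E -> G t x = prim (H t) x + K}.
  apply: (@du_bois_reymond _ _ 0 _ _ (H t)) => //.
  - exact: locL1_meas.
  - by rewrite ltNye.
  - by move=> a b _ ab; exact: lg.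
  - exact: ac_prim.
  - move=> p q n _ pq; have := Hm (p, q, n) pq t0; rewrite /m/= zG zH => /eqP.
    by rewrite addr_eq0 => /eqP.
exists (fun x => prim (H t) x + K).
  by apply: ac_ext (acD (ac_prim lh) (ac_cst K)) _ _ => // x; rewrite /= addr0.
by apply: (ae_imp HK) => x; apply; rewrite ltNye.
Qed.

End Slices.

(** * Norms, supremum bounds and limits along good times *)

Section Conversions.
Variable R : realType.
Local Notation mu := (leb1 R).
Local Notation mu2 := (leb2 R).
Implicit Types (f g h : R -> R) (r M t x a b : R).

Lemma Lnorm_powR r g : 0 < r ->
  (Lnorm_R r%:E g `^ r = \int[mu]_x (`|g x| `^ r)%:E)%E.
Proof.
move=> r0; by rewrite /Lnorm_R powR_Lnorm ?gt_eqF.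
Qed.

Lemma measurable_absX r g : measurable_fun setT g -> measurable_fun setT (fun x => `|g x| `^ r).
Proof.
move=> mg; apply: (measurableT_comp (@measurable_powR R r)).
exact: measurableT_comp.
Qed.

Lemma Lnorm_L1 r g M : 0 < r -> 0 <= M -> measurable_fun setT g ->
  (Lnorm_R r%:E g <= M%:E)%E ->
  L1 mu (fun x => `|g x| `^ r) /\ I mu (fun x => `|g x| `^ r) <= M `^ r.
Proof.
move=> r0 M0 mg H.
have E : (\int[mu]_x (`|g x| `^ r)%:E <= (M `^ r)%:E)%E.
  rewrite -Lnorm_powR// -poweR_EFin; apply: gt0_ler_poweR => //; first exact: ltW.
  - by rewrite in_itv/= /Lnorm_R Lnorm_ge0 leey.
  - by rewrite in_itv/= lee_fin M0 leey.
have l : L1 mu (fun x => `|g x| `^ r).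
  apply: L1_ge0_fin; [exact: measurable_absX|by move=> x; exact: powR_ge0|].
  exact: le_lt_trans E (ltry _).
by split => //; rewrite -lee_fin EFin_I.
Qed.

Lemma L1_Lnorm r g M : 0 < r -> 0 <= M -> L1 mu (fun x => `|g x| `^ r) ->
  I mu (fun x => `|g x| `^ r) <= M -> (Lnorm_R r%:E g <= (M `^ r^-1)%:E)%E.
Proof.
move=> r0 M0 l; rewrite -lee_fin EFin_I// => E.
have E2 : (Lnorm_R r%:E g `^ r <= M%:E)%E by rewrite Lnorm_powR.
rewrite -poweR_EFin.
have -> : (Lnorm_R r%:E g = (Lnorm_R r%:E g `^ r) `^ r^-1)%E.
  by rewrite -poweRrM mulfV ?gt_eqF// poweRe1// /Lnorm_R Lnorm_ge0.
apply: gt0_ler_poweR => //; first by rewrite invr_ge0 ltW.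
- by rewrite in_itv/= poweR_ge0 leey.
- by rewrite in_itv/= lee_fin M0 leey.
Qed.

Lemma Lfun_L1 r g : 1 <= r -> g \in Lfun mu r%:E ->
  measurable_fun setT g /\ L1 mu (fun x => `|g x| `^ r).
Proof.
move=> r1 H; split; last exact: Lfun_integrable.
by move: (sub_Lfun_mfun H); rewrite inE.
Qed.

Lemma sqr_powR x : `|x| `^ 2 = x ^+ 2.
Proof. by rewrite powR_mulrn// real_normK ?num_real. Qed.

Lemma ae_pick (P : R -> Prop) a b : {ae mu, forall t, 0 < t -> P t} -> 0 <= a -> a < b ->
  exists2 t, a < t < b & P t.
Proof.
move=> [N [mN N0 PN]] a0 ab; apply: contrapT => H.
have sub : (`]a, b[%classic : set R) `<=` N.
  move=> t /=; rewrite in_itv/= => atb; apply: PN => /= Pt.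
  apply: H; exists t => //; apply: Pt; case/andP: atb => at_ _; exact: le_lt_trans at_.
have : (mu (`]a, b[%classic : set R) <= mu N)%E by apply: le_measure => //; rewrite inE.
by rewrite N0 lebesgue_measure_itv/= lte_fin ab -EFinD lee_fin leNgt subr_gt0 ab.
Qed.

(** Good times accumulate from the right at every time, 0 included; limits along such sequences
    extend statements from almost every time to every time. *)
Lemma ae_seq (P : R -> Prop) a : {ae mu, forall t, 0 < t -> P t} -> 0 <= a ->
  exists t_ : nat -> R, (forall n, a < t_ n /\ P (t_ n)) /\ t_ n @[n --> \oo] --> a.
Proof.
move=> H a0.
have K (n : nat) : exists t, a < t < a + n.+1%:R^-1 /\ P t.
  by have [|t ? ?] := ae_pick H a0 (_ : a < a + n.+1%:R^-1); [rewrite ltrDl invr_gt0|exists t].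
exists (fun n => sval (cid (K n))); split.
  by move=> n; have [/andP[? ?] ?] := svalP (cid (K n)).
apply: (@squeeze_cvgr _ _ _ _ (fun=> a) (fun n => a + n.+1%:R^-1)).
- by apply: nearW => n; have [/andP[h1 h2] _] := svalP (cid (K n)); rewrite (ltW h1) (ltW h2).
- exact: cvg_cst.
- by rewrite -[X in _ --> X]addr0; apply: cvgD; [exact: cvg_cst|exact: cvg_harmonic].
Qed.

Lemma powR_ge1D s r : 0 <= s -> 1 <= r -> s <= 1 + s `^ r.
Proof.
move=> s0 r1; have [s1|/ltW s1] := leP s 1.
  by rewrite (le_trans s1)// lerDl powR_ge0.
by rewrite (le_trans (le1r_powR s1 r1))// lerDr.
Qed.

Lemma sqr_ge1D (s : R) : `|s| <= 1 + s ^+ 2.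
Proof.
have [s0|s0] := leP 0 s; last by rewrite ltr0_norm//; nra.
by rewrite ger0_norm//; nra.
Qed.

(** On the unit interval to the right of [x], [|z x|] is at most the mean of [|z|] plus [\int |w|],
    and [s <= 1 + s^r] bounds both by the given integrals. The bound does not decay; it only
    supplies boundedness. *)
Lemma ac_sup_gen r r2 (z w : R -> R) (A Y : R) : 1 <= r -> 1 <= r2 -> ac z w ->
  L1 mu (fun x => `|z x| `^ r2) -> I mu (fun x => `|z x| `^ r2) <= A -> L1 mu (fun x => `|w x| `^ r) ->
  I mu (fun x => `|w x| `^ r) <= Y -> forall x, `|z x| <= 2 + A + Y.
Proof.
move=> r1 r21 aw lz IA lw IY x.
have x1 : x <= x + 1 by lra.
have [lI iI] := I_ind x1.
have cz := ac_cont aw.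
have mw := ac_meas aw.
have lz1 := cont_locL1 cz x1.
have lwx := (aw _ _ x1).1.
have bz : I mu (fun y => ind x (x + 1) y * `|z y|) <= 1 + A.
  have -> : 1 + A = (x + 1 - x) + A by lra.
  rewrite -iI (le_trans _ (lerD (lexx _) IA))// -ID//; apply: I_le.
  - exact: I_ind_abs.
  - exact: L1D.
  - move=> y; rewrite /ind; case: ifP => _; last by rewrite mul0r add0r powR_ge0.
    by rewrite mul1r powR_ge1D.
have bw : I mu (fun y => ind x (x + 1) y * `|w y|) <= 1 + Y.
  have -> : 1 + Y = (x + 1 - x) + Y by lra.
  rewrite -iI (le_trans _ (lerD (lexx _) IY))// -ID//; apply: I_le.
  - exact: I_ind_abs.
  - exact: L1D.
  - move=> y; rewrite /ind; case: ifP => _; last by rewrite mul0r add0r powR_ge0.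
    by rewrite mul1r powR_ge1D.
have step y : x < y -> y <= x + 1 -> `|z x| <= `|z y| + I mu (fun y => ind x (x + 1) y * `|w y|).
  move=> xy yx1; have E := ac_I aw (ltW xy).
  have -> : z x = z y - (z y - z x) by lra.
  rewrite (le_trans (ler_normB _ _))// lerD2l E.
  apply: I_le_abs; [exact: (aw _ _ (ltW xy)).1|exact: I_ind_abs|].
  move=> s; rewrite normrM (ger0_norm (ind_ge0 _ _ _)) ler_wpM2r// /ind.
  case: ifP => [/andP[-> sy]|_]; first by rewrite (le_trans sy).
  by case: ifP.
set W := I mu _ in bw step.
have : `|z x| - W <= 1 + A.
  apply: le_trans bz; rewrite -[leLHS]mulr1 -[X in _ * X](_ : x + 1 - x = 1); last by lra.
  rewrite -iI -IZ//; apply: I_le; [exact: L1Z|exact: I_ind_abs|].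
  move=> y; rewrite mulrC /ind; case: ifP => [/andP[xy yx]|_]; last by rewrite !mul0r.
  by rewrite !mul1r lerBlDr step.
by move: bw; lra.
Qed.

Lemma ac_sup r (z w : R -> R) (A Y : R) : 1 <= r -> ac z w -> L1 mu (fun x => z x ^+ 2) ->
  I mu (fun x => z x ^+ 2) <= A -> L1 mu (fun x => `|w x| `^ r) ->
  I mu (fun x => `|w x| `^ r) <= Y -> forall x, `|z x| <= 2 + A + Y.
Proof.
move=> r1 aw lz IA; apply: (@ac_sup_gen r 2) => //; first by rewrite ler1n.
  by apply: eq_L1 lz => x; rewrite sqr_powR.
by under eq_I do rewrite sqr_powR.
Qed.

Lemma cvg_ge_cst (u : nat -> R) (c l : R) : u n @[n --> \oo] --> l -> (forall n, c <= u n) -> c <= l.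
Proof.
move=> ul cu; rewrite -(cvg_lim (@Rhausdorff R) ul).
by apply: limr_ge; [apply/cvg_ex; exists l|exact: nearW].
Qed.

Lemma cvg_le_cst (u : nat -> R) (c l : R) : u n @[n --> \oo] --> l -> (forall n, u n <= c) -> l <= c.
Proof.
move=> ul cu; rewrite -(cvg_lim (@Rhausdorff R) ul).
by apply: limr_le; [apply/cvg_ex; exists l|exact: nearW].
Qed.

(** The square of the excess of [|z|] over [M] is at most [(z_n - z)^2], since [|z_n| <= M]; its
    integral therefore vanishes. *)
Lemma L2_close_bnd (z : R -> R) (z_ : nat -> R -> R) M : 0 <= M ->
  measurable_fun setT z -> (forall n, L1 mu (fun x => (z_ n x - z x) ^+ 2)) ->
  (forall n, {ae mu, forall x, `|z_ n x| <= M}) ->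
  I mu (fun x => (z_ n x - z x) ^+ 2) @[n --> \oo] --> 0 ->
  {ae mu, forall x, `|z x| <= M}.
Proof.
move=> M0 mz l2 Hn cv.
pose k x := (Num.max (`|z x| - M) 0) ^+ 2.
have mk : measurable_fun setT k.
  apply: measurable_funX; apply: measurable_maxr; last exact: measurable_cst.
  by apply: measurable_funB; [exact: measurableT_comp|exact: measurable_cst].
have kle n : {ae mu, forall x, `|k x| <= (z_ n x - z x) ^+ 2}.
  apply: (ae_imp (Hn n)) => x H; rewrite ger0_norm ?sqr_ge0// /k.
  rewrite -[leRHS]real_normK ?num_real// lerXn2r// ?nnegrE ?le_max ?lexx ?orbT//.
  rewrite ge_max normr_ge0 andbT lerBlDr.
  by rewrite (le_trans _ (lerD (lexx _) H))// -lerBlDr distrC lerB_dist.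
have lk : L1 mu k by exact: L1_aele (kle 0%N) (l2 0%N).
have k0 : forall x, 0 <= k x by move=> x; exact: sqr_ge0.
have Ik : I mu k = 0.
  apply/eqP; rewrite eq_le I_ge0// andbT.
  apply: (cvg_ge_cst cv) => n.
  by rewrite (le_trans (ler_norm _))// I_aele_abs//; exact: kle.
have k0a : {ae mu, forall x, 0 <= k x} by exact: aeW.
have kz := I_eq0_ae lk k0a Ik.
apply: (ae_imp kz) => x /eqP; rewrite sqrf_eq0 => /eqP H.
have : `|z x| - M <= 0 by rewrite -H le_max lexx.
by rewrite subr_le0.
Qed.

End Conversions.

(** * Solutions as evolutions in L2 *)

Section Solution.
Variable R : realType.
Local Notation mu := (leb1 R).
Local Notation mu2 := (leb2 R).
Implicit Types (v ux gx : R -> R -> R) (t x a b M L : R).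

Definition rhs (mv : R) (f1 : R -> R) v ux gx t x := mv * gx t x - f1 (v t x) * ux t x.

(** At such times the slices are handled through the absolutely continuous representatives [U] and
    [W]; the second one makes integration by parts of the flux meaningful. *)
Record good_time (p : R) v ux gx t : Prop := GoodTime {
  gt_U : exists2 U, ac U (ux t) & {ae mu, forall x, v t x = U x} ;
  gt_W : exists2 W, ac W (gx t) & {ae mu, forall x, flux p (ux t x) = W x} ;
  gt_y : L1 mu (fun x => `|ux t x| `^ (p + 1)) ;
  gt_g : L1 mu (fun x => gx t x ^+ 2) }.

(* [v] is [u - ut] truncated at its essential bound [M], so that bounds hold
   everywhere; [ux] and [gx] are extended by [0] to [t <= 0]. *)
Record sol (p mv : R) (f1 f2 : R -> R) M v ux gx : Prop := Sol {
  s_mv : measurable_fun setT (fun z : R * R => v z.1 z.2) ;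
  s_mux : measurable_fun setT (fun z : R * R => ux z.1 z.2) ;
  s_mgx : measurable_fun setT (fun z : R * R => gx z.1 z.2) ;
  s_M : forall t x, `|v t x| <= M ;
  s_v2 : forall t, 0 <= t -> L1 mu (fun x => v t x ^+ 2) ;
  s_v2b : exists B, forall t, 0 <= t -> I mu (fun x => v t x ^+ 2) <= B ;
  s_cont : forall t (tn : nat -> R), 0 <= t -> (forall n, 0 <= tn n) ->
    tn n @[n --> \oo] --> t ->
    I mu (fun x => (v (tn n) x - v t x) ^+ 2) @[n --> \oo] --> 0 ;
  s_good : {ae mu, forall t, 0 < t -> good_time p v ux gx t} ;
  s_y : L1 mu2 (fun z => `|ux z.1 z.2| `^ (p + 1)) ;
  s_yb : exists Y, {ae mu, forall t, 0 < t -> I mu (fun x => `|ux t x| `^ (p + 1)) <= Y} ;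
  s_g : L1 mu2 (fun z => gx z.1 z.2 ^+ 2) ;
  s_neg : forall t x, t <= 0 -> ux t x = 0 /\ gx t x = 0 ;
  s_E2 : forall s t, 0 <= s -> s <= t -> {ae mu, forall x,
    L1 mu (fun r => ind s t r * rhs mv f1 v ux gx r x) /\
    v t x - v s x = I mu (fun r => ind s t r * rhs mv f1 v ux gx r x)} ;
  s_f1 : forall x : R, is_derive x 1 f1 (f2 x) ;
  s_f2 : continuous f2 }.

Lemma measurable_slice (G : R -> R -> R) t :
  measurable_fun setT (fun z : R * R => G z.1 z.2) -> measurable_fun setT (G t).
Proof.
by move=> mG; exact: (measurable_fun_pair2 t mG).
Qed.

Lemma ibp (q q' U h : R -> R) L : ac q q' -> continuous q' -> supp q L -> supp q' L ->
  ac U h -> [/\ L1 mu (fun x => q' x * U x), L1 mu (fun x => q x * h x) &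
  I mu (fun x => q' x * U x) = - I mu (fun x => q x * h x)].
Proof.
move=> aq cq' sq sq' aU; have cU := ac_cont aU; have cq := ac_cont aq.
have P1 x : `|L| <= `|x| -> q x * U x = 0 by move=> Mx; rewrite sq ?mul0r// (le_trans (ler_norm L)).
have P2 x : `|L| <= `|x| -> q' x * U x + q x * h x = 0.
  by move=> Mx; rewrite sq' ?sq ?mul0r ?addr0// (le_trans (ler_norm L)).
have [l1 i1] := ac_supp (acM aq aU) P1 P2.
have sq_ : supp q `|L| by move=> x Lx; apply: sq; rewrite (le_trans (ler_norm L)).
have sq'_ : supp q' `|L| by move=> x Lx; apply: sq'; rewrite (le_trans (ler_norm L)).
have LL : - `|L| <= `|L| by rewrite (@le_trans _ _ 0)// oppr_le0.
have lU : L1 mu (fun x => q' x * U x).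
  by apply: (L1_suppM cq' sq'_); [exact: ac_measU aU|exact: cont_locL1].
have lh : L1 mu (fun x => q x * h x).
  by apply: (L1_suppM cq sq_); [exact: ac_meas aU|exact: (aU _ _ LL).1].
by split => //; apply/eqP; rewrite -addr_eq0 -ID// i1.
Qed.

Lemma L1_box a b L : L1 mu2 (@box R a b L).
Proof.
have [ab|/ltW ba] := leP a b; last first.
  apply: eq_L1 (L1_0 _) => z; rewrite /box indF ?mul0r//.
  by apply/negP => /andP[H1 H2]; have := lt_le_trans H1 (le_trans H2 ba); rewrite ltxx.
have [LL|/ltW LL] := leP (- L) L; last first.
  apply: eq_L1 (L1_0 _) => z; rewrite /box [X in _ * X]indF ?mulr0//.
  by apply/negP => /andP[H1 H2]; have := lt_le_trans H1 (le_trans H2 LL); rewrite ltxx.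
have [lx ix] := I_ind LL; have [lt_ it] := I_ind ab.
apply: tonelli_L1; [exact: measurable_box|exact: box_ge0| |].
  by apply: aeW => t; apply: eq_L1 (L1Z (ind a b t) lx) => x.
apply: eq_L1 (L1Z (I mu (ind (- L) L)) lt_) => t.
by rewrite mulrC -IZ.
Qed.

Lemma cvg_L2_weak (q : R -> R) (d : nat -> R -> R) : measurable_fun setT q ->
  L1 mu (fun x => q x ^+ 2) -> (forall n, measurable_fun setT (d n)) ->
  (forall n, L1 mu (fun x => d n x ^+ 2)) -> I mu (fun x => d n x ^+ 2) @[n --> \oo] --> 0 ->
  I mu (fun x => q x * d n x) @[n --> \oo] --> 0.
Proof.
move=> mq lq md ld cv.
have H n := (@cauchy_schwarz _ _ _ mu _ _ mq (md n) lq (ld n)).2.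
have c0 : I mu (fun x => q x ^+ 2) * I mu (fun x => d n x ^+ 2) @[n --> \oo] --> (0 : R).
  by rewrite -[X in _ --> X](mulr0 (I mu (fun x => q x ^+ 2))); apply: cvgM => //; exact: cvg_cst.
have s0 : I mu (fun x => q x * d n x) ^+ 2 @[n --> \oo] --> (0 : R).
  apply: (squeeze_cvgr _ (cvg_cst 0) c0); apply: nearW => n.
  by rewrite sqr_ge0 H.
apply/cvgr0Pnorm_lt => e e0.
have /cvgr0Pnorm_lt/(_ (e ^+ 2)) := s0.
rewrite exprn_gt0// => /(_ isT); apply: filterS => n.
by rewrite normrX ltr_pXn2r// ?nnegrE// ltW.
Qed.

Lemma L1_sqrB (f g : R -> R) : measurable_fun setT f -> measurable_fun setT g ->
  L1 mu (fun x => f x ^+ 2) -> L1 mu (fun x => g x ^+ 2) -> L1 mu (fun x => (f x - g x) ^+ 2).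
Proof.
move=> mf mg lf lg; apply: L1_le (L1D (L1Z 2 lf) (L1Z 2 lg)).
  by apply: measurable_funX; exact: measurable_funB.
move=> x; rewrite ger0_norm ?sqr_ge0//; have := sqr_ge0 (f x + g x); nra.
Qed.

Let ltr0Sn2 : (0 : R) < 2. Proof. by []. Qed.

(** * From the weak formulation to an evolution equation *)

Section Build.
Variables (p mv ut : R) (f u0 : R -> R) (u ux gx : R -> R -> R).
Hypotheses (p1 : 1 < p) (fC3 : of_class_C3 f).
Hypothesis S : global_weak_solution p mv f ut u0 u ux gx.
Let f1 w := derive1n 1 f (ut + w).
Let f2 w := derive1n 2 f (ut + w).

Let dn k : (k < 3)%N -> forall x : R, is_derive x 1 (derive1n k f) (derive1n k.+1 f x).
Proof.
move=> k3 x; have D := fC3.1 k k3 x.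
rewrite derive1nS derive1E; exact: derivableP.
Qed.

Let is_derive_shift (g g' : R -> R) : (forall x : R, is_derive x 1 g (g' x)) ->
  forall x : R, is_derive x 1 (fun w => g (ut + w)) (g' (ut + x)).
Proof.
move=> dg x; have D : is_derive (1 * x + ut) 1 g (g' (ut + x)) by rewrite mul1r addrC.
have := is_derive_comp_aff D; rewrite mul1r.
by under eq_fun do rewrite mul1r addrC.
Qed.

Let f1d : forall x : R, is_derive x 1 f1 (f2 x).
Proof. by apply: is_derive_shift; exact: dn. Qed.

Let f2c : continuous f2.
Proof. by apply: is_derive_cont; apply: is_derive_shift; exact: (@dn 2). Qed.

Let dF : forall x : R, is_derive x 1 f (derive1n 1 f x).
Proof. exact: (@dn 0). Qed.

Let cf1 : continuous (derive1n 1 f).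
Proof. by apply: is_derive_cont; exact: (@dn 1). Qed.

Let d0 t x := u t x - ut.

Let d0_L2 t : 0 <= t -> measurable_fun setT (d0 t) /\ L1 mu (fun x => d0 t x ^+ 2).
Proof.
move=> t0; have [m l] := Lfun_L1 (ltac:(by rewrite ler1n) : (1 : R) <= 2) ((gws_u_C0 S).1 t t0).
by split => //; apply: eq_L1 l => x; rewrite sqr_powR.
Qed.

Let mu_t t : 0 <= t -> measurable_fun setT (u t).
Proof.
move=> /d0_L2[m _]; have := measurable_funD m (measurable_cst ut).
by apply: eq_measurable_fun => x _; rewrite /d0/= subrK.
Qed.

Let d0_cont t (tn : nat -> R) : 0 <= t -> (forall n, 0 <= tn n) ->
  tn n @[n --> \oo] --> t -> I mu (fun x => (d0 (tn n) x - d0 t x) ^+ 2) @[n --> \oo] --> 0.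
Proof.
move=> t0 tn0 tnt; have /fine_cvgP[Hf Hc] := (gws_u_C0 S).2 t t0.
apply/cvgr0Pnorm_lt => e e0.
(* With [e1 <= 1] and [e1 <= e / 2], a norm below [e1] has its square below [e]. *)
pose e1 := Num.min (e / 2) 1.
have e10 : 0 < e1 by rewrite lt_min divr_gt0//=.
have /cvgrPdist_lt/(_ _ e10) He := Hc.
have H1 : \forall n \near \oo, tn n \in `[0, +oo[ ->
    Lnorm_R 2%:E (d0 (tn n) \- d0 t) \is a fin_num by exact: (tnt _ Hf).
have H2 : \forall n \near \oo, tn n \in `[0, +oo[ ->
    `|0 - fine (Lnorm_R 2%:E (d0 (tn n) \- d0 t))| < e1 by exact: (tnt _ He).
move: H1 H2; apply: filterS2 => n; rewrite in_itv/= andbT tn0 => /(_ isT) Hfin /(_ isT) Hlt.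
have [m1 l1] := d0_L2 (tn0 n); have [m2 l2] := d0_L2 t0.
have [||||l I1] := @Lnorm_L1 R 2 (d0 (tn n) \- d0 t) e1.
- by [].
- exact: ltW.
- exact: measurable_funB.
- rewrite -(fineK Hfin) lee_fin; move: Hlt; rewrite sub0r normrN => /ltW.
  by apply: le_trans; exact: ler_norm.
have E x : `|(d0 (tn n) \- d0 t) x| `^ 2 = (d0 (tn n) x - d0 t x) ^+ 2 by rewrite sqr_powR.
rewrite (eq_I mu E) in I1.
rewrite ger0_norm; last by apply: I_ge0 => x; exact: sqr_ge0.
apply: le_lt_trans I1 _; rewrite powR_mulrn ?(ltW e10)//.
have h1 : e1 <= 1 by rewrite ge_min lexx orbT.
have h2 : e1 <= e / 2 by rewrite ge_min lexx.
by rewrite expr2; nra.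
Qed.

Let lgx := (zext_loc2 (let: And3 _ h _ := gws_gx S in h)).
Let lux := (zext_loc2 (let: And3 _ h _ := gws_ux S in h)).
Let lu := (zext_loc2 (let: And3 h _ _ := gws_ux S in h)).
Let lW := (zext_loc2 (let: And3 h _ _ := gws_gx S in h)).
Let lf := (zext_loc2 (gws_fu S)).

Let spacetime r g : 0 < r -> in_Lspacetime r g -> L1 mu2 (fun z => `|zext g z.1 z.2| `^ r).
Proof.
move=> r0 [mg ig]; have mz := zext_meas mg.
apply: L1_ge0_fin; last 2 first.
- by move=> z; exact: powR_ge0.
- rewrite integral_mkcond in ig; apply: le_lt_trans ig.
  rewrite le_eqVlt; apply/orP; left; apply/eqP; apply: eq_integral => z _.
  rewrite patchE /zext; case: ifPn => [z0|z0]; case: ifPn => //.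
    by move=> /negP H; exfalso; apply: H; apply/mem_set.
  by move=> /set_mem; rewrite /half_plane/= (negbTE z0).
  by rewrite normr0 powR0// gt_eqF.
by apply: (measurableT_comp (@measurable_powR R r)); exact: measurableT_comp.
Qed.

Let L1y : L1 mu2 (fun z => `|zext ux z.1 z.2| `^ (p + 1)).
Proof.
have p0 : 0 < p + 1 by move: p1; lra.
exact: spacetime p0 (gws_ux_Lp1 S).
Qed.

Let L1g : L1 mu2 (fun z => zext gx z.1 z.2 ^+ 2).
Proof.
by apply: eq_L1 (spacetime _ (gws_gx_L2 S)) => // z; rewrite sqr_powR.
Qed.

Let slices : exists A Y : R, {ae mu, forall t, 0 < t ->
  [/\ good_time p u (zext ux) (zext gx) t,
   I mu (fun x => d0 t x ^+ 2) <= A & I mu (fun x => `|zext ux t x| `^ (p + 1)) <= Y]}.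
Proof.
have [_ [A HA]] := gws_u_Linfty S; have [_ [Y HY]] := gws_ux_Linfty S.
exists (`|A| `^ 2), (`|Y| `^ (p + 1)).
have s1 := weak_x_slice (gws_ux S); have s2 := weak_x_slice (gws_gx S).
have g2 := fubini_ae1 L1g.
apply: (ae_imp3 (ae_imp2 HA HY (fun _ => @conj _ _)) (ae_imp2 s1 s2 (fun _ => @conj _ _)) g2).
move=> t [hA hY] [h1 h2] hg t0.
have zU : zext ux t = ux t by apply/funext => x; rewrite /zext t0.
have zG : zext gx t = gx t by apply/funext => x; rewrite /zext t0.
have [U aU uU] := h1 t0; have [W aW uW] := h2 t0.
have p0 : 0 < p + 1 by move: p1; lra.
have [|||ly iy] := @Lnorm_L1 R (p + 1) (ux t) `|Y| p0.
- by [].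
- exact: ac_meas aU.
- by apply: le_trans (hY t0) _; rewrite lee_fin ler_norm.
have [|||la ia] := @Lnorm_L1 R 2 (d0 t) `|A| ltr0Sn2.
- by [].
- exact: (d0_L2 (ltW t0)).1.
- by apply: le_trans (hA t0) _; rewrite lee_fin ler_norm.
split.
- split; rewrite ?zU ?zG//; [by exists U|by exists W|].
  by move: hg; rewrite /= zG.
- by apply: le_trans ia; rewrite le_eqVlt; apply/orP; left; apply/eqP; apply: eq_I => x; rewrite sqr_powR.
- by rewrite zU.
Qed.

(** At almost every time [ac_sup] applies with the uniform bounds of the solution class;
    [L2_close_bnd] carries the bound to every time, in particular to 0. *)
Let bound : exists2 M, 0 <= M & forall t, 0 <= t -> {ae mu, forall x, `|d0 t x| <= M}.
Proof.
have [A [Y sl]] := slices.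
exists (`|2 + A + Y|) => // t t0.
have ae : {ae mu, forall t, 0 < t -> {ae mu, forall x, `|d0 t x| <= `|2 + A + Y|}}.
  apply: (ae_imp sl) => r Hr r0; have [[[U aU uU] _ ly _] iA iY] := Hr r0.
  have [md ld] := d0_L2 (ltW r0).
  have aUd : ac (fun x => U x + - ut) (zext ux r).
    by apply: ac_ext (acD aU (ac_cst (- ut))) _ _ => // x; rewrite addr0.
  have E : {ae mu, forall x, d0 r x ^+ 2 = (U x + - ut) ^+ 2}.
    by apply: (ae_imp uU) => x; rewrite /d0 => ->.
  have mU : measurable_fun setT (fun x => (U x + - ut) ^+ 2).
    by apply: measurable_funX; exact: ac_measU aUd.
  have lU := @L1_aeeq _ _ _ mu _ _ mU E ld.
  have iU : I mu (fun x => (U x + - ut) ^+ 2) <= A.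
    by rewrite -(@I_aeeq _ _ _ mu _ _ (L1_meas ld) mU E).
  have p1' : 1 <= p + 1 by move: p1; lra.
  have := ac_sup p1' aUd lU iU ly iY => H.
  by apply: (ae_imp uU) => x; rewrite /d0 => ->; exact: le_trans (H x) (ler_norm _).
have [tn [tnP tnt]] := ae_seq ae t0.
have tn0 n : 0 <= tn n by apply: (le_trans t0); apply/ltW; exact: (tnP n).1.
have [md ld] := d0_L2 t0.
apply: (@L2_close_bnd R (d0 t) (fun n => d0 (tn n))) => //.
- by move=> n; have [m l] := d0_L2 (tn0 n); exact: L1_sqrB.
- by move=> n; exact: (tnP n).2.
- exact: d0_cont.
Qed.

Lemma u_cutoff_cont (q : R -> R) L t (tn : nat -> R) : continuous q -> supp q L -> 0 <= t ->
  (forall n, 0 <= tn n) -> tn n @[n --> \oo] --> t ->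
  L1 mu (fun x => q x * u t x) /\
  I mu (fun x => q x * u (tn n) x) @[n --> \oo] --> I mu (fun x => q x * u t x).
Proof.
move=> cq sq t0 tn0 tnt.
have mq := continuous_measurable_fun cq.
have [C C0 HC] := supp_bnd cq sq.
have cq2 : continuous (fun x => q x ^+ 2) by move=> x; apply: cvgM; exact: cq.
have lqq (h : R -> R) : locL1 h -> L1 mu (fun x => q x * h x).
  move=> lh; have sq' : supp q `|L| by move=> x Lx; apply: sq; rewrite (le_trans (ler_norm L)).
  apply: (L1_suppM cq sq'); first exact: locL1_meas.
  by apply: lh; rewrite (@le_trans _ _ 0)// oppr_le0.
have lq2 : L1 mu (fun x => q x ^+ 2) by have := lqq _ (cont_locL1 cq).
have lqu s : 0 <= s -> L1 mu (fun x => q x * u s x).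
  move=> s0; have [md ld] := d0_L2 s0.
  have l1 := (@cauchy_schwarz _ _ _ mu _ _ mq md lq2 ld).1.
  have l2 : L1 mu (fun x => q x * ut) by apply: lqq; apply: cont_locL1 => x; exact: cvg_cst.
  by apply: eq_L1 (L1D l1 l2) => x; rewrite /d0; ring.
split; first exact: lqu.
have [mdt ldt] := d0_L2 t0.
have md n : measurable_fun setT (fun x => d0 (tn n) x - d0 t x).
  by apply: measurable_funB => //; exact: (d0_L2 (tn0 n)).1.
have ld n : L1 mu (fun x => (d0 (tn n) x - d0 t x) ^+ 2).
  by have [m l] := d0_L2 (tn0 n); exact: L1_sqrB.
have W := cvg_L2_weak mq lq2 md ld (d0_cont t0 tn0 tnt).
rewrite (_ : (fun n => _) = (fun n => I mu (fun x => q x * (d0 (tn n) x - d0 t x)) + I mu (fun x => q x * u t x))).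
  by rewrite -[X in _ --> X]add0r; apply: cvgD => //; exact: cvg_cst.
apply/funext => n; rewrite -ID; last 2 first.
- by have := (@cauchy_schwarz _ _ _ mu _ _ mq (md n) lq2 (ld n)).1.
- exact: lqu.
by apply: eq_I => x; rewrite /d0; ring.
Qed.

Let zgE t x : t <= 0 -> zext ux t x = 0 /\ zext gx t x = 0.
Proof. by rewrite /zext ltNge => ->. Qed.

Section Clamped.
Variable M : R.
Hypotheses (M0 : 0 <= M) (HM : forall t, 0 <= t -> {ae mu, forall x, `|d0 t x| <= M}).

(** Joint measurability of [u] is known in the open half plane only, so all times [t <= 0] carry the
    slice at time 0. At nonnegative times the clamping changes nothing up to null sets. *)
Definition clamped t x : R := Num.max (- M) (Num.min M (if 0 < t then d0 t x else d0 0 x)).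
Let v := clamped.

Let vM t x : `|v t x| <= M.
Proof.
rewrite ler_norml /v /clamped le_max lexx/= ge_max ge_min lexx/= andbT.
by rewrite (@le_trans _ _ 0)// oppr_le0.
Qed.

Let vE t : 0 <= t -> {ae mu, forall x, v t x = d0 t x}.
Proof.
move=> t0; have [->|tn0] := eqVneq t 0.
  apply: (ae_imp (HM (lexx 0))) => x; rewrite /v /clamped ltxx ler_norml => /andP[h1 h2].
  by rewrite (min_idPr h2) (max_idPr h1).
apply: (ae_imp (HM t0)) => x; rewrite /v /clamped lt_def tn0 t0/= ler_norml => /andP[h1 h2].
by rewrite (min_idPr h2) (max_idPr h1).
Qed.

Let mv2 : measurable_fun setT (fun z : R * R => v z.1 z.2).
Proof.
apply: measurable_maxr; first exact: measurable_cst.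
apply: measurable_minr; first exact: measurable_cst.
rewrite (_ : (fun z : R * R => _) = (fun z : R * R => if 0 < z.1 then zext u z.1 z.2 - ut else d0 0 z.2)).
  apply: measurable_fun_ifT.
  - by apply: measurable_fun_ltr; [exact: measurable_cst|exact: measurable_fst].
  - by apply: measurable_funB; [exact: lu.2|exact: measurable_cst].
  - by apply: (measurableT_comp (d0_L2 (lexx 0)).1); exact: measurable_snd.
by apply/funext => z; rewrite /zext; case: ifP.
Qed.

Let A := rhs mv f1 v (zext ux) (zext gx).

Let cf1' : continuous f1. Proof. exact: is_derive_cont f1d. Qed.

Let A_meas : measurable_fun setT (fun z : R * R => A z.1 z.2).
Proof.
apply: measurable_funB.
  by apply: measurable_funM; [exact: measurable_cst|exact: lgx.2].
apply: measurable_funM; last exact: lux.2.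
exact: (measurableT_comp (continuous_measurable_fun cf1')).
Qed.

Let A_box a b L : L1 mu2 (fun z => box a b L z * A z.1 z.2).
Proof.
have [K K0 HK] := cont_bnd (- M) M cf1'.
have lb := L1_box a b L.
apply: L1_le (L1D (L1Z `|mv| (L1D lb L1g)) (L1Z K (L1D lb L1y))).
  by apply: measurable_funM => //; exact: measurable_box.
move=> z; rewrite /A /rhs normrM (ger0_norm (box_ge0 _ _ _ _)).
have fK : `|f1 (v z.1 z.2)| <= K by apply: HK; have := vM z.1 z.2; rewrite ler_norml => /andP[].
have b0 := box_ge0 a b L z.
have b1 : box a b L z <= 1.
  rewrite /box -[leRHS]mulr1; apply: ler_pM; rewrite ?ind_ge0 ?ind_le1//.
set g := zext gx _ _; set w := zext ux _ _.
have hg : `|g| <= 1 + g ^+ 2 := sqr_ge1D g.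
have p1' : 1 <= p + 1 by move: p1; lra.
have hw : `|w| <= 1 + `|w| `^ (p + 1) := powR_ge1D (normr_ge0 w) p1'.
have hw0 : 0 <= `|w| `^ (p + 1) by exact: powR_ge0.
apply: (@le_trans _ _ (box a b L z * (`|mv| * (1 + g ^+ 2) + K * (1 + `|w| `^ (p + 1))))).
  apply: ler_wpM2l => //; rewrite (le_trans (ler_normB _ _))// !normrM lerD//.
    by apply: ler_wpM2l.
  by apply: ler_pM.
have h1 : box a b L z * (`|mv| * (1 + g ^+ 2)) <= `|mv| * (box a b L z + g ^+ 2).
  rewrite mulrCA; apply: ler_wpM2l => //.
  by rewrite mulrDr mulr1 lerD2l ler_piMl// sqr_ge0.
have h2 : box a b L z * (K * (1 + `|w| `^ (p + 1))) <= K * (box a b L z + `|w| `^ (p + 1)).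
  rewrite mulrCA; apply: ler_wpM2l => //.
  by rewrite mulrDr mulr1 lerD2l ler_piMl.
by rewrite mulrDr lerD.
Qed.

Section OneTest.
Variables (q q' : R -> R) (L : R).
Hypotheses (sq : smooth1 q) (dq : forall x : R, is_derive x 1 q (q' x)) (cq' : continuous q')
  (q0 : supp q L) (q'0 : supp q' L).
Let k t := I mu (fun x => q x * A t x).
Let m t := I mu (fun x => q x * zext u t x).
Let cq : continuous q. Proof. exact: smooth1_cont. Qed.

Let lk : locL1 k.
Proof. by move=> a b _; exact: (slice_I_L1 A_meas (A_box a b L) cq q0).2. Qed.

(** At a good time both [f (U x)] and [W] are absolutely continuous, so the two spatial derivatives
    move back from the test to the solution. *)
Let k_eq : {ae mu, forall t, 0 < t ->
  k t = I mu (fun x => q' x * zext (fun t x => f (u t x)) t x) -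
        mv * I mu (fun x => q' x * zext (fun t x => flux p (ux t x)) t x)}.
Proof.
have [B [Y sl]] := slices; apply: (ae_imp sl) => t Ht t0.
have [[[U aU uU] [W aW uW] _ _] _ _] := Ht t0.
have aq : ac q q' by apply: ac_C1.
have afU := ac_chain dF cf1 aU.
have [l1 l2 e1] := ibp aq cq' q0 q'0 afU.
have [l3 l4 e2] := ibp aq cq' q0 q'0 aW.
have zf x : zext (fun t x => f (u t x)) t x = f (u t x) by rewrite /zext t0.
have zw x : zext (fun t x => flux p (ux t x)) t x = flux p (zext ux t x) by rewrite /zext t0.
have mq' : measurable_fun setT q' by exact: continuous_measurable_fun.
have mq : measurable_fun setT q by exact: continuous_measurable_fun.
have sl2 (G : R -> R -> R) : measurable_fun setT (fun z : R * R => G z.1 z.2) ->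
    measurable_fun setT (fun x => q' x * G t x).
  by move=> mG; apply: measurable_funM => //; exact: measurable_slice.
have -> : I mu (fun x => q' x * zext (fun t x => f (u t x)) t x) = I mu (fun x => q' x * f (U x)).
  apply: (@I_aeeq _ _ _ mu); [exact: sl2 lf.2|exact: L1_meas l1|].
  by apply: (ae_imp uU) => x; rewrite zf => ->.
have -> : I mu (fun x => q' x * zext (fun t x => flux p (ux t x)) t x) = I mu (fun x => q' x * W x).
  apply: (@I_aeeq _ _ _ mu); [exact: sl2 lW.2|exact: L1_meas l3|].
  by apply: (ae_imp uW) => x; rewrite zw => ->.
rewrite e1 e2 mulrN opprK addrC -IZ// -IB//; last exact: L1Z.
apply: (@I_aeeq _ _ _ mu).
- by apply: measurable_funM => //; exact: measurable_slice A_meas.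
- by apply: (L1_meas (L1B (L1Z mv l4) l2)).
- apply: (ae_imp2 uU (vE (ltW t0))) => x ux_ vx.
  rewrite /A /rhs vx /f1 /d0 ux_ [ut + _]addrC subrK; ring.
Qed.

(** Tested with [P t * q x], the equation says that [m] has the weak derivative [k] in time; du
    Bois-Reymond on the half line makes [m] a primitive of [k]. *)
Let m_prim : exists K, {ae mu, forall t, 0 < t -> m t = prim k t + K}.
Proof.
have [ml ll] := slice_I_loc lu.2 lu.1 cq q0.
have [K HK] : exists K, {ae mu, forall t, (0%:E < t%:E)%E -> m t = prim k t + K}.
  apply: (@du_bois_reymond _ _ 1 _ (prim k) k) => //.
  - by move=> a b; rewrite lte_fin => a0 _; exact: ll.
  - exact: ac_prim.
  - move=> r s n; rewrite lte_fin => r0 rs.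
    set P := tst 1 (ratr r) (ratr s : R) n; set P' := dtst 1 (ratr r) (ratr s : R) n.
    have sP : smooth1 P := smooth1_tst _ _ _ _.
    have cP := smooth1_cont sP.
    have dP x : is_derive x 1 P (P' x) := is_derive_tst _ _ _ _ _.
    have cP' : continuous P' := smooth1_cont (smooth1_dtst _ _ _ _).
    (* Half of the left end of the support of the time test: still positive, so the product is
       compactly supported in the open half plane. *)
    pose lo := Num.min (ratr r) 1 / 2 : R; pose hi := Num.max (ratr s) (1 + 1) + 1 : R.
    have m0 : 0 < Num.min (ratr r) 1 :> R by rewrite lt_min r0 ltr01.
    have lo0 : 0 < lo by rewrite divr_gt0.
    have out t : ~~ ((lo < t) && (t < hi)) -> ~~ ((Num.min (ratr r) 1 <= t) && (t <= Num.max (ratr s) (1 + 1))).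
      apply: contra => /andP[h1 h2]; apply/andP; split; rewrite /lo /hi; last by move: h2; lra.
      by move: h1 m0; lra.
    have P0 t : ~~ ((lo < t) && (t < hi)) -> P t = 0 by move=> /out; apply: tst_out; exact: ltW.
    have P'0 t : ~~ ((lo < t) && (t < hi)) -> P' t = 0.
      by move=> /out H; apply: dtst_out; move: H; apply: contra => /andP[/ltW -> /ltW ->].
    have T : test_function (half_plane R) (fun z => P z.1 * q z.2).
      apply: (@test_function_tensor _ P q lo hi (- L) L) => //.
        by move=> t H1; apply: P0; move: H1; apply: contra => /andP[/ltW -> /ltW ->].
      move=> x H1; apply: q0; rewrite leNgt; move: H1; apply: contra.
      by rewrite ltr_norml => /andP[/ltW -> /ltW ->].
    have D1 z : 'D_(1, 0) (fun z : R * R => P z.1 * q z.2) z = P' z.1 * q z.2.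
      have := tens_der ((1, 0) : R * R) (dP z.1) (dq z.2) => -[_ ->] /=.
      by rewrite !mul0r mul1r mulr0 addr0.
    have D2 z : 'D_(0, 1) (fun z : R * R => P z.1 * q z.2) z = P z.1 * q' z.2.
      have := tens_der ((0, 1) : R * R) (dP z.1) (dq z.2) => -[_ ->] /=.
      by rewrite !mul0r mul1r add0r.
    have pz t : ~~ (0 < t) -> P t = 0.
      by move=> t0; apply: P0; apply: contra t0 => /andP[lt_ _]; exact: lt_trans lt_.
    have pz' t : ~~ (0 < t) -> P' t = 0.
      by move=> t0; apply: P'0; apply: contra t0 => /andP[lt_ _]; exact: lt_trans lt_.
    have [a1 a2 a3] := tensor_L1 lo0 cP' cq P'0 q0 lu.2 lu.1.
    have [b1 b2 b3] := tensor_L1 lo0 cP cq' P0 q'0 lf.2 lf.1.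
    have [c1 c2 c3] := tensor_L1 lo0 cP cq' P0 q'0 lW.2 lW.1.
    have := gws_eq S T.
    rewrite (@Rint_half_plane _ _ (fun z => P' z.1 * (q z.2 * zext u z.1 z.2) +
       P z.1 * (q' z.2 * zext (fun t x => f (u t x)) z.1 z.2))); last 2 first.
    + by move=> z z0; rewrite D1 D2 /zext z0; ring.
    + by move=> z z0; rewrite pz// pz'// !mul0r addr0.
    rewrite (@Rint_half_plane _ _ (fun z => P z.1 * (q' z.2 * zext (fun t x => flux p (ux t x)) z.1 z.2))); last 2 first.
    + by move=> z z0; rewrite D2 /zext z0; ring.
    + by move=> z z0; rewrite pz// mul0r.
    rewrite (ID a1 b1) a2 b2 c2 => E.
    have -> : I mu (fun t => P t * k t) =
       I mu (fun t => P t * I mu (fun x => q' x * zext (fun t x => f (u t x)) t x)) -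
       mv * I mu (fun t => P t * I mu (fun x => q' x * zext (fun t x => flux p (ux t x)) t x)).
      rewrite -(IZ mv c3) -(IB b3 (L1Z mv c3)).
      apply: (@I_aeeq _ _ _ mu).
      * apply: measurable_funM; first exact: continuous_measurable_fun.
        exact: slice_I_meas A_meas cq.
      * by apply: (L1_meas (L1B b3 (L1Z mv c3))).
      * apply: (ae_imp k_eq) => t Ht; have [t0|t0] := boolP (0 < t).
          by rewrite (Ht t0); ring.
        by rewrite (pz t t0); ring.
    move: E; set X1 := I mu _; set X2 := I mu _; set X3 := I mu _ => E.
    rewrite -E; ring.
by exists K; apply: (ae_imp HK) => t Ht t0; apply: Ht; rewrite lte_fin.
Qed.

(** [L^2] continuity extends the primitive identity of [m_prim] from almost every time to all times,
    0 included; Fubini then moves the time integral inside. *)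
Lemma test_increment s t : 0 <= s -> s <= t ->
  I mu (fun x => q x * v t x) - I mu (fun x => q x * v s x) =
  I mu (fun x => q x * I mu (fun r => ind s t r * A r x)).
Proof.
move=> s0 st; have t0 := le_trans s0 st.
have [K HK] := m_prim.
have ak := ac_prim lk; have ck := ac_cont ak.
have mE r : 0 <= r -> I mu (fun x => q x * u r x) = prim k r + K.
  move=> r0; have [tn [tnP tnr]] := ae_seq HK r0.
  have tn0 n : 0 < tn n by apply: (le_lt_trans r0); exact: (tnP n).1.
  have C := (u_cutoff_cont cq q0 r0 (fun n => ltW (tn0 n)) tnr).2.
  have C2 : prim k (tn n) + K @[n --> \oo] --> prim k r + K.
    by apply: cvgD; [apply: (cvg_comp _ _ tnr); exact: ck|exact: cvg_cst].
  apply: (cvg_unique _ C) => //; apply: cvg_trans C2; apply: near_eq_cvg; apply: nearW => n.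
  rewrite -(tnP n).2; apply: eq_I => x; by rewrite /zext tn0.
have lqu r : 0 <= r -> L1 mu (fun x => q x * u r x).
  by move=> r0; have [] := u_cutoff_cont cq q0 r0 (fun _ => r0) (cvg_cst r).
have mq : measurable_fun setT q by exact: continuous_measurable_fun.
have vI r : 0 <= r -> I mu (fun x => q x * v r x) = I mu (fun x => q x * u r x) - I mu (fun x => q x * ut).
  move=> r0.
  have lqc : L1 mu (fun x => q x * ut).
    have sq_ : supp q `|L| by move=> x Lx; apply: q0; rewrite (le_trans (ler_norm L)).
    apply: (L1_suppM cq sq_); first exact: measurable_cst.
    apply: (cont_locL1 (fun x => cvg_cst ut)); by rewrite (@le_trans _ _ 0)// oppr_le0.
  rewrite -IB//; last exact: lqu.
  apply: (@I_aeeq _ _ _ mu).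
  - by apply: measurable_funM => //; exact: measurable_slice mv2.
  - exact: (L1_meas (L1B (lqu _ r0) lqc)).
  - by apply: (ae_imp (vE r0)) => x ->; rewrite /d0; ring.
rewrite !vI// !mE//.
have -> : prim k t + K - I mu (fun x => q x * ut) - (prim k s + K - I mu (fun x => q x * ut)) =
  prim k t - prim k s by ring.
rewrite (ac_I ak st).
have [l _] := slice_I_L1 A_meas (A_box s t L) cq q0.
have E1 := fubini_I l; have E2 := fubini_I2 l.
have ae1 := fubini_ae1 l; have ae2 := fubini_ae2 l.
transitivity (I mu2 (fun z => ind s t z.1 * (q z.2 * A z.1 z.2))).
  rewrite E1; apply: (@I_aeeq _ _ _ mu).
  - apply: measurable_funM; first exact: measurable_ind.
    exact: slice_I_meas A_meas cq.
  - exact: (L1_meas (fubini_L1 l)).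
  - apply: (ae_imp ae1) => r /= lr.
    have [->|i0] := eqVneq (ind s t r) 0.
      by rewrite mul0r -[LHS](I_0 mu); apply: eq_I => x; rewrite mul0r.
    rewrite -IZ//; apply: eq_L1 (L1Z (ind s t r)^-1 lr) => x.
    by rewrite mulrA mulVf// mul1r.
rewrite E2; apply: (@I_aeeq _ _ _ mu).
- exact: (L1_meas (fubini_L2 l)).
- apply: measurable_funM => //.
  apply: (@measurable_I2 _ _ _ _ _ mu (fun z => ind s t z.1 * A z.1 z.2)).
  by apply: measurable_funM => //; apply: measurable_ind => //; exact: measurable_fst.
- apply: (ae_imp ae2) => x /= lx.
  have [->|qx0] := eqVneq (q x) 0.
    by rewrite mul0r -[RHS](I_0 mu); apply: eq_I => r; rewrite mul0r mulr0.
  rewrite -IZ; first by apply: eq_I => r; ring.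
  by apply: eq_L1 (L1Z (q x)^-1 lx) => r; rewrite mulrCA mulKf.
Qed.

End OneTest.

(** [test_increment] holds against every bump in [x], so [bump_zero] yields the identity at almost
    every point. The exceptional set depends on [s] and [t]. *)
Let E2 s t : 0 <= s -> s <= t -> {ae mu, forall x,
    L1 mu (fun r => ind s t r * A r x) /\ v t x - v s x = I mu (fun r => ind s t r * A r x)}.
Proof.
move=> s0 st.
pose J x := I mu (fun r => ind s t r * A r x).
have mJ : measurable_fun setT J.
  apply: (@measurable_I2 _ _ _ _ _ mu (fun z => ind s t z.1 * A z.1 z.2)).
  by apply: measurable_funM => //; apply: measurable_ind => //; exact: measurable_fst.
have lx : {ae mu, forall x, forall N : nat, L1 mu (fun r => box s t N%:R (r, x) * A r x)}.
  by apply/ae_foralln => N; exact: (fubini_ae2 (A_box s t N%:R)).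
have aeL : {ae mu, forall x, L1 mu (fun r => ind s t r * A r x)}.
  apply: (ae_imp lx) => x Hx; pose N := (Num.truncn `|x|).+1.
  have xN : `|x| < N%:R by rewrite truncnS_gt.
  apply: eq_L1 (Hx N) => r; rewrite /box/= [ind (- _) _ _]indT ?mulr1//.
    by move: xN; rewrite ltr_norml => /andP[].
  by apply: ltW; move: xN; rewrite ltr_norml => /andP[].
pose h x := v t x - v s x - J x.
have mh : measurable_fun setT h.
  by apply: measurable_funB => //; apply: measurable_funB; exact: measurable_slice mv2.
have lJ (N : nat) : L1 mu (fun x => ind (- N%:R) N%:R x * J x).
  apply: L1_aeeq (fubini_L2 (A_box s t N%:R)).
    by apply: measurable_funM => //; exact: measurable_ind.
  apply: (ae_imp aeL) => x lr; rewrite -IZ//; apply: eq_I => r; rewrite /box/=; ring.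
have lh a b : a <= b -> L1 mu (fun x => ind a b x * h x).
  move=> ab.
  have l1 : L1 mu (fun x => ind a b x * (v t x - v s x)).
    apply: (L1_bnd (c := M + M)).
      by apply: measurable_funB; exact: measurable_slice mv2.
    by move=> x _ _; rewrite (le_trans (ler_normB _ _))// lerD.
  pose N := (Num.truncn (Num.max `|a| `|b|)).+1.
  have : Num.max `|a| `|b| < N%:R by rewrite truncnS_gt.
  rewrite gt_max => /andP[aN bN].
  have l2 : L1 mu (fun x => ind a b x * J x).
    apply: L1_ind_sub (lJ N).
      by rewrite lerNl (le_trans _ (ltW aN))// -normrN ler_norm.
    by rewrite (le_trans (ler_norm b))// ltW.
  by apply: eq_L1 (L1B l1 l2) => x; rewrite /h; ring.
have h0 : {ae mu, forall x, (-oo < x%:E)%E -> h x = 0}.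
  apply: bump_zero => //; first by move=> a b _; exact: lh.
  move=> r s' n _ rs; pose q x := rbump r s' n x.
  have sq : smooth1 q by exact: smooth1_bump.
  have [q' sq' dq] := smooth1_deriv sq.
  pose L := `|ratr r| + `|ratr s'| + 1 : R.
  have out x : L <= `|x| -> q x = 0.
    move=> Lx; apply: bump_out; apply/negP => /andP[h1 h2]; move: Lx; apply/negP; rewrite -ltNge.
    rewrite /L ltr_norml; apply/andP; split.
      by have := ler_norm (- (ratr r : R)); rewrite normrN; have := normr_ge0 (ratr s' : R); lra.
    by have := ler_norm (ratr s' : R); have := normr_ge0 (ratr r : R); lra.
  have sL : supp q (L + 1) by move=> x Lx; apply: out; rewrite (le_trans _ Lx)// lerDl.
  have sL' : supp q' (L + 1).
    move=> x Lx.
    have E : \forall z \near x, (fun=> 0 : R) z = q z.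
      apply/nbhs_ballP; exists 1 => //= z; rewrite /ball/= => xz; rewrite out//.
      have := lerB_dist x z; lra.
    have D0 : is_derive x 1 q 0 by apply: (near_eq_is_derive E); exact: is_derive_cst.
    by have [_ <-] := dq x; case: D0.
  have := test_increment sq dq (smooth1_cont sq') sL sL' s0 st.
  have lq g : locL1 g -> L1 mu (fun x => q x * g x).
    move=> lg; have LL : - (L + 1) <= L + 1.
      by rewrite /L; have := normr_ge0 (ratr r : R); have := normr_ge0 (ratr s' : R); lra.
    by apply: (L1_suppM (smooth1_cont sq) sL); [exact: locL1_meas|exact: lg].
  have lv r' : locL1 (v r').
    move=> a b ab; apply: (L1_bnd (c := M)); first exact: measurable_slice mv2.
    by move=> x _ _; exact: vM.
  have lJ' : locL1 J.
    by move=> a b ab; apply: eq_L1 (L1B (L1B (lv t a b ab) (lv s a b ab)) (lh a b ab)) => x; rewrite /h; ring.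
  rewrite -/J => E.
  rewrite (@eq_I _ _ _ mu _ (fun x => (q x * v t x - q x * v s x) - q x * J x)); last first.
    by move=> x; rewrite /h /q; ring.
  have l1 := lq _ (lv t); have l2 := lq _ (lv s); have l3 := lq _ lJ'.
  by rewrite IB//; [rewrite IB// E subrr|exact: L1B].
apply: (ae_imp2 aeL h0) => x lr hx; split => //.
by apply/eqP; rewrite -subr_eq0; apply/eqP; apply: hx; rewrite ltNye.
Qed.

Lemma clamped_sol : sol p mv f1 f2 M v (zext ux) (zext gx) /\
  forall t, 0 <= t -> {ae mu, forall x, v t x = u t x - ut}.
Proof.
have [B [Y sl]] := slices.
have mvt t : measurable_fun setT (v t) by exact: measurable_slice mv2.
have lv2 t : 0 <= t -> L1 mu (fun x => v t x ^+ 2) /\ I mu (fun x => v t x ^+ 2) = I mu (fun x => d0 t x ^+ 2).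
  move=> t0; have [md ld] := d0_L2 t0.
  have m2 : measurable_fun setT (fun x => v t x ^+ 2) by exact: measurable_funX.
  have E : {ae mu, forall x, d0 t x ^+ 2 = v t x ^+ 2} by apply: (ae_imp (vE t0)) => x ->.
  split; first exact: (@L1_aeeq _ _ _ mu _ _ m2 E ld).
  exact: (esym (@I_aeeq _ _ _ mu _ _ (L1_meas ld) m2 E)).
have vd t s : 0 <= t -> 0 <= s -> I mu (fun x => (v t x - v s x) ^+ 2) = I mu (fun x => (d0 t x - d0 s x) ^+ 2).
  move=> t0 s0; have [m1 _] := d0_L2 t0; have [m2 _] := d0_L2 s0.
  apply: (@I_aeeq _ _ _ mu).
  - by apply: measurable_funX; apply: measurable_funB; exact: mvt.
  - by apply: measurable_funX; exact: measurable_funB.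
  - by apply: (ae_imp2 (vE t0) (vE s0)) => x -> ->.
split; last exact: vE.
split.
- exact: mv2.
- exact: lux.2.
- exact: lgx.2.
- exact: vM.
- by move=> t /lv2[].
(* [B] bounds the good times only; any time has a good one at squared [L^2] distance less than 1. *)
- exists (2 * B + 2) => t t0; rewrite (lv2 t t0).2.
  have [tn [tnP tnt]] := ae_seq sl t0.
  have tn0 n : 0 <= tn n by apply: (le_trans t0); apply/ltW; exact: (tnP n).1.
  have C := d0_cont t0 tn0 tnt.
  have [n] : exists n, `|I mu (fun x => (d0 (tn n) x - d0 t x) ^+ 2)| < 1.
    by have /cvgr0Pnorm_lt/(_ 1 ltr01)[n _ Hn] := C; exists n; apply: Hn => /=.
  move=> Hn; have [_ iB _] := (tnP n).2.
  have [m1 l1] := d0_L2 t0; have [m2 l2] := d0_L2 (tn0 n).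
  have l3 := L1_sqrB m2 m1 l2 l1.
  apply: (@le_trans _ _ (2 * I mu (fun x => d0 (tn n) x ^+ 2) + 2 * I mu (fun x => (d0 (tn n) x - d0 t x) ^+ 2))).
    rewrite -IZ// -IZ// -ID; [|exact: L1Z|exact: L1Z].
    apply: I_le => //; first by apply: L1D; exact: L1Z.
    by move=> x; have := sqr_ge0 (d0 t x - 2 * d0 (tn n) x); nra.
  by move: Hn; rewrite ltr_norml => /andP[_]; lra.
- move=> t tn t0 tn0 tnt; have := d0_cont t0 tn0 tnt.
  by apply: cvg_trans; apply: near_eq_cvg; apply: nearW => n; rewrite vd.
- apply: (ae_imp sl) => t Ht t0; have [[[U aU uU] W ly lg] _ _] := Ht t0.
  split => //; exists (fun x => U x + - ut).
    by apply: ac_ext (acD aU (ac_cst (- ut))) _ _ => // x; rewrite addr0.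
  by apply: (ae_imp2 (vE (ltW t0)) uU) => x ->; rewrite /d0 => ->.
- exact: L1y.
- by exists Y; apply: (ae_imp sl) => t Ht t0; have [] := Ht t0.
- exact: L1g.
- exact: zgE.
- exact: E2.
- exact: f1d.
- exact: f2c.
Qed.

End Clamped.

Lemma gws_sol : exists M w uX gX, sol p mv f1 f2 M w uX gX /\
  forall t, 0 <= t -> {ae mu, forall x, w t x = u t x - ut}.
Proof.
have [M M0 HM] := bound.
by exists M, (clamped M), (zext ux), (zext gx); exact: clamped_sol.
Qed.

End Build.
End Solution.

(** * Energy inequalities *)

Section Steklov.
Variable R : realType.
Local Notation mu := (leb1 R).
Local Notation mu2 := (leb2 R).
Implicit Types (a b h t x : R) (g f : R -> R).

Lemma not_cvg0 (a_ : nat -> R) : (forall n, 0 <= a_ n) -> ~ (a_ n @[n --> \oo] --> (0 : R)) ->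
  exists2 e : R, 0 < e & forall N, exists n, (N <= n)%N /\ e <= a_ n.
Proof.
move=> a0 H; apply: contrapT => K; apply: H; apply/cvgr0Pnorm_lt => e e0.
apply: contrapT => H; apply: K; exists e => // N.
apply: contrapT => K; apply: H; exists N => // n /= Nn.
by rewrite ltNge; apply/negP => en; apply: K; exists n; rewrite ger0_norm// in en.
Qed.

(* Fatou's lemma for 2 f_n^2 + 2 f^2 - (f_n - f)^2 >= 0 *)
Lemma strong_conv (f_ : nat -> R -> R) f : (forall n, measurable_fun setT (f_ n)) ->
  measurable_fun setT f -> (forall n, L1 mu (fun x => f_ n x ^+ 2)) ->
  L1 mu (fun x => f x ^+ 2) ->
  (forall n, I mu (fun x => f_ n x ^+ 2) <= I mu (fun x => f x ^+ 2)) ->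
  {ae mu, forall x, f_ n x @[n --> \oo] --> f x} ->
  I mu (fun x => (f_ n x - f x) ^+ 2) @[n --> \oo] --> 0.
Proof.
move=> mf_ mf lf_ lf If cf; apply: contrapT => /(not_cvg0 _)[].
  by move=> n; apply: I_ge0 => x; exact: sqr_ge0.
move=> e e0 He.
pose s N := sval (cid (He N)).
have sN N : (N <= s N)%N by have [] := svalP (cid (He N)).
have se N : e <= I mu (fun x => (f_ (s N) x - f x) ^+ 2) by have [] := svalP (cid (He N)).
have ld n : L1 mu (fun x => (f_ n x - f x) ^+ 2) by exact: L1_sqrB.
pose F N x := 2 * f_ (s N) x ^+ 2 + 2 * f x ^+ 2 - (f_ (s N) x - f x) ^+ 2.
have lF N : L1 mu (F N) by apply: L1B => //; apply: L1D; exact: L1Z.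
have := @real_fatou _ _ _ mu F (fun x => 4 * f x ^+ 2) (4 * I mu (fun x => f x ^+ 2) - e) lF.
case.
- by move=> N x; rewrite /F; have := sqr_ge0 (f_ (s N) x + f x); nra.
- by apply: measurable_funM; [exact: measurable_cst|exact: measurable_funX].
- move=> N; rewrite /F IB//; last by apply: L1D; exact: L1Z.
  rewrite ID; [|exact: L1Z|exact: L1Z].
  rewrite !IZ//; have := If (s N); have := se N; lra.
- apply: (ae_imp cf) => x cx.
  have cs : f_ (s N) x @[N --> \oo] --> f x.
    have cvs : s N @[N --> \oo] --> \oo.
      by move=> A [N0 _ HA]; exists N0 => // n /= Nn; apply: HA => /=; exact: leq_trans Nn (sN n).
    exact: (cvg_comp _ _ cvs cx).
  have -> : 4 * f x ^+ 2 = 2 * (f x) ^+ 2 + 2 * f x ^+ 2 - (f x - f x) ^+ 2 by ring.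
  rewrite /F; apply: cvgB; last by under eq_fun do rewrite expr2; rewrite expr2; apply: cvgM; (apply: cvgB; [exact: cs|exact: cvg_cst]).
  apply: cvgD; last exact: cvg_cst.
  by apply: cvgM; [exact: cvg_cst|under eq_fun do rewrite expr2; rewrite expr2; apply: cvgM; exact: cs].
by move=> _; rewrite IZ// => H; lra.
Qed.

(** The average looks backward, so for [g] the right-hand side of the equation [h * avg h g t] is
    the increment of the solution from [t - h] to [t]. *)
Definition avg h g t : R := h^-1 * I mu (fun r => ind (t - h) t r * g r).

Lemma L2_locL1 g : measurable_fun setT g -> L1 mu (fun x => g x ^+ 2) -> locL1 g.
Proof.
move=> mg lg a b ab; apply: L1_le (L1D (I_ind ab).1 lg).
  by apply: measurable_funM => //; exact: measurable_ind.
move=> x; rewrite normrM (ger0_norm (ind_ge0 _ _ _)) /ind; case: ifP => _.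
  by rewrite mul1r sqr_ge1D.
by rewrite mul0r add0r sqr_ge0.
Qed.

Lemma measurable_avg h g : measurable_fun setT g -> measurable_fun setT (avg h g).
Proof.
move=> mg; apply: measurable_funM; first exact: measurable_cst.
apply: (@measurable_I1 _ _ _ _ _ mu (fun z : R * R => ind (z.1 - h) z.1 z.2 * g z.2)).
apply: measurable_funM.
  apply: measurable_ind => //; first by apply: measurable_funB => //; exact: measurable_cst.
by apply: (measurableT_comp mg); exact: measurable_snd.
Qed.

Lemma avg_sqr h g t : 0 < h -> measurable_fun setT g -> L1 mu (fun x => g x ^+ 2) ->
  avg h g t ^+ 2 <= h^-1 * I mu (fun r => ind (t - h) t r * g r ^+ 2).
Proof.
move=> h0 mg lg.
have th : t - h <= t by lra.
have [li ii] := I_ind th.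
have lii : L1 mu (fun r => ind (t - h) t r ^+ 2).
  by apply: eq_L1 li => r; rewrite expr2 ind_idem.
have lig : L1 mu (fun r => (ind (t - h) t r * g r) ^+ 2).
  by apply: eq_L1 (L1_indM (t - h) t lg) => r; rewrite exprMn !expr2 ind_idem.
have mi : measurable_fun setT (ind (t - h) t) by exact: L1_meas li.
have mig : measurable_fun setT (fun r => ind (t - h) t r * g r) by exact: measurable_funM.
have [_] := @cauchy_schwarz _ _ _ mu _ _ mi mig lii lig.
rewrite (@eq_I _ _ _ mu _ (fun r => ind (t - h) t r * g r)); last by move=> r; rewrite mulrA ind_idem.
rewrite (@eq_I _ _ _ mu (fun r => ind (t - h) t r ^+ 2) (ind (t - h) t)); last by move=> r; rewrite expr2 ind_idem.
rewrite (@eq_I _ _ _ mu (fun r => (ind (t - h) t r * g r) ^+ 2) (fun r => ind (t - h) t r * g r ^+ 2)); last by move=> r; rewrite exprMn !expr2 ind_idem.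
rewrite ii => H; rewrite /avg exprMn.
have -> : h^-1 * I mu (fun r => ind (t - h) t r * g r ^+ 2) =
  h^-1 ^+ 2 * ((t - (t - h)) * I mu (fun r => ind (t - h) t r * g r ^+ 2)).
  by field; rewrite gt_eqF.
by rewrite ler_wpM2l// sqr_ge0.
Qed.

(** Jensen in the form [avg_sqr], then Tonelli: each point [r] is counted by the times in
    [[r, r + h]], of total length [h]. This norm bound is what [strong_conv] asks for. *)
Lemma avg_L2 h g : 0 < h -> measurable_fun setT g -> L1 mu (fun x => g x ^+ 2) ->
  L1 mu (fun t => avg h g t ^+ 2) /\ I mu (fun t => avg h g t ^+ 2) <= I mu (fun x => g x ^+ 2).
Proof.
move=> h0 mg lg.
pose F (z : R * R) := h^-1 * (ind (z.1 - h) z.1 z.2 * g z.2 ^+ 2).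
have mF : measurable_fun setT F.
  apply: measurable_funM; first exact: measurable_cst.
  apply: measurable_funM.
    apply: measurable_ind => //; first by apply: measurable_funB => //; exact: measurable_cst.
  by apply: measurable_funX; apply: (measurableT_comp mg); exact: measurable_snd.
have F0 z : 0 <= F z by rewrite /F mulr_ge0 ?invr_ge0 ?(ltW h0)// mulr_ge0 ?ind_ge0// sqr_ge0.
have It r : L1 mu (fun t => ind (t - h) t r) /\ I mu (fun t => ind (t - h) t r) = h.
  have rh : r <= r + h by lra.
  have [li ii] := I_ind rh.
  have mi : measurable_fun setT (fun t : R => ind (t - h) t r).
    by apply: measurable_ind => //; first by apply: measurable_funB => //; exact: measurable_cst.
  have E : {ae mu, forall t, ind r (r + h) t = ind (t - h) t r}.
    apply: (ae_imp2 (ae_neq r) (ae_neq (r + h))) => t tr trh; rewrite /ind.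
    have -> : (r < t) = (r <= t) by rewrite lt_def tr.
    have -> : (t <= r + h) = (t - h < r) by rewrite ltrBlDr lt_neqAle trh.
    by rewrite andbC.
  split; first exact: (@L1_aeeq _ _ _ mu _ _ mi E li).
  by rewrite -(@I_aeeq _ _ _ mu _ _ (L1_meas li) mi E) ii; lra.
have EF r : I mu (fun t => F (t, r)) = g r ^+ 2.
  rewrite (@eq_I _ _ _ mu _ (fun t => (h^-1 * g r ^+ 2) * ind (t - h) t r)); last first.
    by move=> t; rewrite /F/=; ring.
  by rewrite IZ ?(It r).1// (It r).2; field; rewrite gt_eqF.
have lF : L1 mu2 F.
  apply: tonelli_L2 => //.
    apply: aeW => r; apply: eq_L1 (L1Z (h^-1 * g r ^+ 2) (It r).1) => t.
    by rewrite /F/=; ring.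
  by apply: eq_L1 lg => r; rewrite EF.
have FI t : I mu (fun r => F (t, r)) = h^-1 * I mu (fun r => ind (t - h) t r * g r ^+ 2).
  by rewrite -IZ//; exact: L1_indM.
have lP : L1 mu (fun t => avg h g t ^+ 2).
  apply: L1_le (fubini_L1 lF); first by apply: measurable_funX; exact: measurable_avg.
  by move=> t; rewrite ger0_norm ?sqr_ge0// FI; exact: avg_sqr.
split => //.
have <- : I mu (fun t => I mu (fun r => F (t, r))) = I mu (fun x => g x ^+ 2).
  by rewrite -fubini_I// fubini_I2//; apply: eq_I => r; exact: EF.
apply: I_le => //; first exact: fubini_L1.
by move=> t; rewrite FI; exact: avg_sqr.
Qed.

Lemma steklov1 g (B : R -> R) : measurable_fun setT g -> L1 mu (fun x => g x ^+ 2) ->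
  measurable_fun setT B -> L1 mu (fun x => B x ^+ 2) ->
  I mu (fun t => B t * avg n.+1%:R^-1 g t) @[n --> \oo] --> I mu (fun t => B t * g t).
Proof.
move=> mg lg mB lB.
have h0 (n : nat) : 0 < n.+1%:R^-1 :> R by rewrite invr_gt0.
have ma n := measurable_avg n.+1%:R^-1 mg.
have la n := (avg_L2 (h0 n) mg lg).1.
have C : I mu (fun x => (avg n.+1%:R^-1 g x - g x) ^+ 2) @[n --> \oo] --> 0.
  apply: strong_conv => //; first by move=> n; exact: (avg_L2 (h0 n) mg lg).2.
  by apply: (ae_imp (ae_deriv (L2_locL1 mg lg))) => t; apply => //; exact: cvg_harmonic.
have md n : measurable_fun setT (fun x => avg n.+1%:R^-1 g x - g x) by exact: measurable_funB.
have ld n := L1_sqrB (ma n) mg (la n) lg.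
have W := cvg_L2_weak mB lB md ld C.
rewrite (_ : (fun n => _) = (fun n => I mu (fun x => B x * (avg n.+1%:R^-1 g x - g x)) + I mu (fun t => B t * g t))).
  by rewrite -[X in _ --> X]add0r; apply: cvgD => //; exact: cvg_cst.
apply/funext => n; rewrite -ID.
- by apply: eq_I => x; ring.
- exact: (@cauchy_schwarz _ _ _ mu _ _ mB (md n) lB (ld n)).1.
- exact: (@cauchy_schwarz _ _ _ mu _ _ mB mg lB lg).1.
Qed.

(** For almost every [x], [steklov1] applies in time; the integrals over [t] are dominated by
    [\int B^2 + \int A^2], which is integrable in [x]. *)
Lemma steklov2 (A B : R -> R -> R) : measurable_fun setT (fun z : R * R => A z.1 z.2) ->
  measurable_fun setT (fun z : R * R => B z.1 z.2) ->
  L1 mu2 (fun z => A z.1 z.2 ^+ 2) -> L1 mu2 (fun z => B z.1 z.2 ^+ 2) ->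
  (forall n : nat, L1 mu2 (fun z => B z.1 z.2 * avg n.+1%:R^-1 (A ^~ z.2) z.1)) /\
  I mu2 (fun z => B z.1 z.2 * avg n.+1%:R^-1 (A ^~ z.2) z.1) @[n --> \oo] -->
  I mu2 (fun z => B z.1 z.2 * A z.1 z.2).
Proof.
move=> mA mB lA lB.
have h0 (n : nat) : 0 < n.+1%:R^-1 :> R by rewrite invr_gt0.
pose Z n (z : R * R) := avg n.+1%:R^-1 (A ^~ z.2) z.1.
have mZ n : measurable_fun setT (Z n).
  apply: measurable_funM; first exact: measurable_cst.
  apply: (@measurable_I1 _ _ _ _ _ mu (fun w : (R * R) * R => ind (w.1.1 - n.+1%:R^-1) w.1.1 w.2 * A w.2 w.1.2)).
  have m11 : measurable_fun setT (fun w : (R * R) * R => w.1.1).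
    by apply: measurableT_comp => //; exact: measurable_fst.
  have m12 : measurable_fun setT (fun w : (R * R) * R => w.1.2).
    by apply: (measurableT_comp (@measurable_snd _ _ R R)); exact: measurable_fst.
  have m2 : measurable_fun setT (fun w : (R * R) * R => w.2) by exact: measurable_snd.
  apply: measurable_funM.
    by apply: measurable_ind => //; apply: measurable_funB => //; exact: measurable_cst.
  exact: (measurableT_comp mA (measurable_fun_pair m2 m12)).
have mAx x : measurable_fun setT (A ^~ x) by exact: (measurable_fun_pair1 x mA).
have mBx x : measurable_fun setT (B ^~ x) by exact: (measurable_fun_pair1 x mB).
have aA := fubini_ae2 lA; have aB := fubini_ae2 lB.
have lZ n : L1 mu2 (fun z => Z n z ^+ 2).
  apply: tonelli_L2.
  - by apply: measurable_funX; exact: mZ.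
  - by move=> z; exact: sqr_ge0.
  - by apply: (ae_imp aA) => x lx; exact: (avg_L2 (h0 n) (mAx x) lx).1.
  - apply: (L1_aele _ _ (fubini_L2 lA)).
      by apply: (@measurable_I2 _ _ _ _ _ mu (fun z => Z n z ^+ 2)); apply: measurable_funX; exact: mZ.
    apply: (ae_imp aA) => x lx; rewrite ger0_norm; last by apply: I_ge0 => t; exact: sqr_ge0.
    exact: (avg_L2 (h0 n) (mAx x) lx).2.
have lBZ n : L1 mu2 (fun z => B z.1 z.2 * Z n z).
  exact: (@cauchy_schwarz _ _ _ mu2 _ _ mB (mZ n) lB (lZ n)).1.
have lBA : L1 mu2 (fun z => B z.1 z.2 * A z.1 z.2).
  exact: (@cauchy_schwarz _ _ _ mu2 _ _ mB mA lB lA).1.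
split => //.
rewrite (fubini_I2 lBA).
rewrite (_ : (fun n => _) = (fun n => I mu (fun x => I mu (fun t => B t x * Z n (t, x))))); last first.
  by apply/funext => n; rewrite (fubini_I2 (lBZ n)).
apply: (dct _ _ _ (L1D (fubini_L2 lB) (fubini_L2 lA)) _).2.
- by move=> n; exact: L1_meas (fubini_L2 (lBZ n)).
- exact: L1_meas (fubini_L2 lBA).
- by apply: (ae_imp2 aA aB) => x la lb; exact: (@steklov1 (A ^~ x) (B ^~ x) (mAx x) la (mBx x) lb).
- move=> n; apply: (ae_imp2 aA aB) => x la lb /=.
  have [lz iz] := avg_L2 (h0 n) (mAx x) la.
  have mz := measurable_avg n.+1%:R^-1 (mAx x).
  apply: (@le_trans _ _ (I mu (fun t => B t x ^+ 2) + I mu (fun t => avg n.+1%:R^-1 (A ^~ x) t ^+ 2))); last first.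
    by rewrite lerD2l.
  rewrite -ID//; apply: I_le_abs.
  + exact: (@cauchy_schwarz _ _ _ mu _ _ (mBx x) mz lb lz).1.
  + exact: L1D.
  + move=> t; rewrite /Z/= ler_norml; set c := avg _ _ _.
    by apply/andP; split; have := sqr_ge0 (B t x + c); have := sqr_ge0 (B t x - c); nra.
Qed.

(** [w^2 <= 1 + |w|^(p + 1)] because [p > 1]; the constant 1 is the reason for the box. *)
Lemma L1_sqr_rhs p mv f1 f2 M (v ux gx : R -> R -> R) a b L : 1 < p -> sol p mv f1 f2 M v ux gx ->
  measurable_fun setT (fun z : R * R => rhs mv f1 v ux gx z.1 z.2) /\
  L1 mu2 (fun z => (box a b L z * rhs mv f1 v ux gx z.1 z.2) ^+ 2).
Proof.
move=> p1 S; have cf1 : continuous f1 := is_derive_cont (s_f1 S).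
have mA : measurable_fun setT (fun z : R * R => rhs mv f1 v ux gx z.1 z.2).
  apply: measurable_funB.
    by apply: measurable_funM; [exact: measurable_cst|exact: s_mgx S].
  apply: measurable_funM; last exact: s_mux S.
  exact: (measurableT_comp (continuous_measurable_fun cf1) (s_mv S)).
split => //.
have [K K0 HK] := cont_bnd (- M) M cf1.
apply: L1_le (L1D (L1Z (2 * mv ^+ 2) (s_g S)) (L1Z (2 * K ^+ 2) (L1D (L1_box a b L) (s_y S)))).
  by apply: measurable_funX; apply: measurable_funM => //; exact: measurable_box.
move=> z; rewrite ger0_norm ?sqr_ge0// exprMn.
have b2 : box a b L z ^+ 2 = box a b L z.
  by rewrite /box exprMn !expr2 !ind_idem.
rewrite b2 /rhs.
have b0 := box_ge0 a b L z.
have b1 : box a b L z <= 1.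
  by rewrite -b2 /box exprMn !expr2 !ind_idem -[leRHS]mulr1; apply: ler_pM; rewrite ?ind_ge0 ?ind_le1.
have fK : f1 (v z.1 z.2) ^+ 2 <= K ^+ 2.
  rewrite -[leLHS]real_normK ?num_real// lerXn2r ?nnegrE//.
  by apply: HK; have := s_M S z.1 z.2; rewrite ler_norml => /andP[].
set g := gx _ _; set w := ux _ _ in fK *; set c := f1 _ in fK *; set bb := box _ _ _ _ in b0 b1 *.
have hw : w ^+ 2 <= 1 + `|w| `^ (p + 1).
  rewrite -[leLHS]real_normK ?num_real//; have [w1|/ltW w1] := leP `|w| 1.
    rewrite (@le_trans _ _ 1)//; last by rewrite lerDl powR_ge0.
    by rewrite expr_le1.
  rewrite (@le_trans _ _ (`|w| `^ (p + 1)))//; last by rewrite lerDr.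
  by rewrite -powR_mulrn//; apply: ler_powR => //; move: p1; lra.
have hw0 : 0 <= `|w| `^ (p + 1) by exact: powR_ge0.
set y := `|w| `^ _ in hw hw0 *.
have cw : (c * w) ^+ 2 <= K ^+ 2 * (1 + y).
  by rewrite exprMn; apply: ler_pM => //; exact: sqr_ge0.
have s1 : (mv * g - c * w) ^+ 2 <= 2 * (mv ^+ 2 * g ^+ 2) + 2 * (K ^+ 2 * (1 + y)).
  by have := sqr_ge0 (mv * g + c * w); nra.
have g0 : 0 <= mv ^+ 2 * g ^+ 2 by rewrite mulr_ge0// sqr_ge0.
have K2 : 0 <= K ^+ 2 * y by rewrite mulr_ge0// sqr_ge0.
have K3 : 0 <= K ^+ 2 by exact: sqr_ge0.
have := ler_wpM2l b0 s1.
have h1 : bb * (mv ^+ 2 * g ^+ 2) <= mv ^+ 2 * g ^+ 2 by rewrite ler_piMl.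
have h2 : bb * (K ^+ 2 * y) <= K ^+ 2 * y by rewrite ler_piMl.
by nra.
Qed.

(* Testing the last hypothesis with the step [h = t - s] and averaging over [t] yields the
   inequality for Steklov averages of [rhs], which converge in [L^2]; [Q] has its
   value at [a] before time [a], so that averages at [a] are exact. *)
Lemma energy p mv f1 f2 M (v ux gx B : R -> R -> R) (Q : R -> R) (G : R -> Prop) a b L :
  1 < p -> sol p mv f1 f2 M v ux gx -> 0 <= a -> a < b ->
  measurable_fun setT (fun z : R * R => B z.1 z.2) ->
  (forall t x, ~~ ((a < t) && (t <= b)) -> B t x = 0) ->
  (forall t x, ~~ ((- L < x) && (x <= L)) -> B t x = 0) ->
  L1 mu2 (fun z => B z.1 z.2 ^+ 2) ->
  locL1 Q -> (forall t, t <= a -> Q t = Q a) ->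
  (n.+1%:R^-1)^-1 * I mu (fun t => ind (b - n.+1%:R^-1) b t * Q t) @[n --> \oo] --> Q b ->
  {ae mu, forall t, 0 < t -> G t} ->
  (forall t s, a < t -> t <= b -> a <= s -> s <= t -> G t -> G s \/ s = a ->
     Q t - Q s <= I mu (fun x => B t x * (v t x - v s x))) ->
  L1 mu2 (fun z => B z.1 z.2 * rhs mv f1 v ux gx z.1 z.2) /\
  Q b - Q a <= I mu2 (fun z => B z.1 z.2 * rhs mv f1 v ux gx z.1 z.2).
Proof.
move=> p1 S a0 ab mB B0 BL lB lQ Qa Qb aeG HQ.
have [mA lA] := L1_sqr_rhs a b L p1 S.
set A0 := rhs mv f1 v ux gx in mA lA *.
pose A t x := box a b L (t, x) * A0 t x.
have mA' : measurable_fun setT (fun z : R * R => A z.1 z.2).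
  rewrite (_ : (fun z => _) = (fun z : R * R => box a b L z * A0 z.1 z.2)); last by apply/funext; case.
  by apply: measurable_funM => //; exact: measurable_box.
have lA' : L1 mu2 (fun z => A z.1 z.2 ^+ 2) by apply: eq_L1 lA => -[t x].
have BA t x : B t x * A t x = B t x * A0 t x.
  rewrite /A /box/=; have [H1|H1] := boolP ((a < t) && (t <= b)); last by rewrite B0// !mul0r.
  have [H2|H2] := boolP ((- L < x) && (x <= L)); last by rewrite BL// !mul0r.
  by case/andP: H1 => ? ?; case/andP: H2 => ? ?; rewrite !indT// !mul1r.
have [lZ cZ] := steklov2 mA' mB lA' lB.
have lBA : L1 mu2 (fun z => B z.1 z.2 * A0 z.1 z.2).
  apply: eq_L1 (@cauchy_schwarz _ _ _ mu2 _ _ mB mA' lB lA').1 => z; exact: BA.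
split => //.
rewrite (@eq_I _ _ _ mu2 (fun z => B z.1 z.2 * A0 z.1 z.2) (fun z => B z.1 z.2 * A z.1 z.2)); last first.
  by move=> z; rewrite BA.
pose h (n : nat) : R := n.+1%:R^-1.
have h0 n : 0 < h n by rewrite invr_gt0.
have key n : (h n)^-1 * I mu (fun t => ind (b - h n) b t * Q t) - Q a <=
    I mu2 (fun z => B z.1 z.2 * avg (h n) (A ^~ z.2) z.1).
  have lsh c d : c <= d -> L1 mu (fun t => ind c d t * Q (t - h n)) /\
     I mu (fun t => ind c d t * Q (t - h n)) = I mu (fun t => ind (c - h n) (d - h n) t * Q t).
    move=> cd; have cdh : c - h n <= d - h n by lra.
    have [l e] := L1_shift (- h n) (lQ _ _ cdh).
    have E t : ind (c - h n) (d - h n) (t + - h n) * Q (t + - h n) = ind c d t * Q (t - h n).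
      by rewrite /ind ltrD2r lerD2r.
    by split; [apply: eq_L1 l|rewrite -(eq_I mu E)].
  have [l1 e1] := lsh a b (ltW ab).
  have l2 := lQ a b (ltW ab).
  (* The integral telescopes into the last average minus the first one, and the first is exactly
     [h n * Q a] because [Q] is constant before [a]. *)
  have lhs : I mu (fun t => ind a b t * Q t - ind a b t * Q (t - h n)) =
     I mu (fun t => ind (b - h n) b t * Q t) - h n * Q a.
    rewrite IB// e1.
    have hn := h0 n.
    have x1 : a - h n <= a by lra.
    have x2 : b - h n <= b by lra.
    have x3 : a - h n <= b - h n by lra.
    have lab : L1 mu (fun t => ind (a - h n) b t * Q t) by apply: lQ; lra.
    have s1 := I_ind_split x1 (ltW ab) lab.
    have s2 := I_ind_split x3 x2 lab.
    have ea : I mu (fun t => ind (a - h n) a t * Q t) = h n * Q a.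
      have [li ii] := I_ind x1.
      rewrite (@eq_I _ _ _ mu _ (fun t => Q a * ind (a - h n) a t)); last first.
        by move=> t; rewrite /ind mulrC; case: ifP => [/andP[_ ta]|_]; rewrite ?mulr0// Qa.
      by rewrite IZ// ii; ring.
    by move: s1 s2; rewrite ea; lra.
  have -> : (h n)^-1 * I mu (fun t => ind (b - h n) b t * Q t) - Q a =
     (h n)^-1 * I mu (fun t => ind a b t * Q t - ind a b t * Q (t - h n)).
    by rewrite lhs; field; rewrite gt_eqF.
  have l3 := L1B l2 l1.
  rewrite -IZ// (fubini_I (lZ n)); apply: I_aele; [exact: L1Z|exact: fubini_L1 (lZ n)|].
  have aeGs : {ae mu, forall t, 0 < t - h n -> G (t - h n)}.
    have [N [mN N0 PN]] := aeG.
    exists ((fun t => t + - h n) @^-1` N); split.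
    - rewrite -[X in measurable X]setTI; apply: (@measurable_funD _ _ _ setT) => //; exact: measurable_cst.
    - by rewrite lebesgue_shift.
    - by move=> t /= Ht; apply: PN => /=.
  apply: (ae_imp3 aeG aeGs (fubini_ae1 (lZ n))) => t Gt Gs lt_ /=.
  have [/andP[at_ tb]|H] := boolP ((a < t) && (t <= b)); last first.
    rewrite indF// !mul0r subrr mulr0 -[leLHS](I_0 mu) le_eqVlt; apply/orP; left; apply/eqP.
    by apply: eq_I => x; rewrite B0// mul0r.
  rewrite indT// !mul1r.
  (* Steps that would start before [a] are shortened to start at [a]; [Q] does not see the
     difference. *)
  pose s := Num.max (t - h n) a.
  have Qs : Q (t - h n) = Q s.
    by rewrite /s; have [ta|//] := leP (t - h n) a; rewrite Qa.
  have hn := h0 n.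
  have st : s <= t by rewrite ge_max (ltW at_) andbT; lra.
  have as_ : a <= s by rewrite le_max lexx orbT.
  have Gss : G s \/ s = a.
    rewrite /s; have [ta|ta] := leP (t - h n) a; [by right|left].
    by apply: Gs; exact: le_lt_trans a0 ta.
  have HH := HQ t s at_ tb as_ st (Gt (le_lt_trans a0 at_)) Gss.
  rewrite Qs ler_pdivrMl//; apply: le_trans HH _.
  (* The box in [A] removes the times before [a], so the average over []t - h n, t]] integrates the
     right-hand side over []s, t]], which is [v t - v s]. *)
  have BvE : {ae mu, forall x, h n * (B t x * avg (h n) (A ^~ x) t) = B t x * (v t x - v s x)}.
    apply: (ae_imp (s_E2 S (le_trans a0 as_) st)) => x [_ ->].
    have [/andP[x1 x2]|H2] := boolP ((- L < x) && (x <= L)); last by rewrite BL// !mul0r mulr0.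
    have avE J : h n * (B t x * ((h n)^-1 * J)) = B t x * J by field; rewrite gt_eqF.
    rewrite /avg avE; congr (_ * _).
    apply: eq_I => r; rewrite /A /box/= [ind (- L) L x]indT// mulr1 mulrA; congr (_ * _).
    rewrite /s /ind gt_max; case: (a < r); rewrite ?andbF ?andbT//=; last by rewrite mulr0.
    case: ifP => [/andP[tr rt]|]; last by rewrite mul0r.
    by rewrite (le_trans rt tb) mulr1.
  rewrite -IZ// le_eqVlt; apply/orP; left; apply/eqP.
  apply/esym; apply: (@I_aeeq _ _ _ mu) => //.
  - exact: L1_meas (L1Z (h n) lt_).
  - apply: measurable_funM; first exact: measurable_slice mB.
    by apply: measurable_funB; exact: measurable_slice (s_mv S).
have C : (h n)^-1 * I mu (fun t => ind (b - h n) b t * Q t) - Q a @[n --> \oo] --> Q b - Q a.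
  by apply: cvgB; [exact: Qb|exact: cvg_cst].
rewrite -subr_ge0.
apply: (@cvg_ge_cst _ (fun n => I mu2 (fun z => B z.1 z.2 * avg (h n) (A ^~ z.2) z.1) -
   ((h n)^-1 * I mu (fun t => ind (b - h n) b t * Q t) - Q a))).
  exact: (cvgB cZ C).
by move=> n; rewrite subr_ge0 key.
Qed.

End Steklov.

(** * Spatial cutoffs and averages of continuous functions *)

Section Cutoff.
Variable R : realType.
Local Notation mu := (leb1 R).

(** Every error term of the localization contains [c'], hence a factor [K / (n + 1)], and is lost in
    the limit. *)
Record cutoff_family (c : nat -> R -> R) (c' : nat -> R -> R) (K : R) : Prop := {
  cf_d : forall n (x : R), is_derive x 1 (c n) (c' n x) ;
  cf_c : forall n, continuous (c' n) ;
  cf_s : forall n, supp (c n) (2 * n.+1%:R) ;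
  cf_s' : forall n, supp (c' n) (2 * n.+1%:R) ;
  cf_0 : forall n x, 0 <= c n x ;
  cf_K : forall n x, c n x <= K ;
  cf_b : forall n x, `|c' n x| <= K / n.+1%:R ;
  cf_1 : forall x, c n x @[n --> \oo] --> (1 : R) }.

Lemma cutoff_exists : exists c c' K, cutoff_family c c' K.
Proof.
pose g (x : R) := cutoff (-1) 1 0 x.
have [g' sg' dg] := smooth1_deriv (smooth1_bump (-1 : R) 1 0).
have cg' := smooth1_cont sg'; have cg := is_derive_cont dg.
have g0 : 0 < g 0.
  rewrite /g /cutoff /pexp; have -> : 1%:R * 0 + - (1%:R * -1) = 1 :> R by ring.
  have -> : - 1%:R * 0 + 1%:R * 1 = 1 :> R by ring.
  by rewrite ltr01 hornerC mul1r mulr_gt0// expR_gt0.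
have gout x : 1 < `|x| -> g x = 0.
  move=> x1; apply: bump_out; apply/negP => /andP[h1 h2]; move: x1.
  by rewrite ltNge ltW// ltr_norml h1.
have g'out x : 2 <= `|x| -> g' x = 0.
  move=> x1; have D := dg x.
  have D2 : is_derive x 1 (cutoff (-1 : R) 1 0) 0.
    have D0 : is_derive x 1 (fun=> 0 : R) 0 by exact: is_derive_cst.
    apply: near_eq_is_derive D0.
    have : \forall z \near x, 1 < `|z|.
      have cn : `|z| @[z --> x] --> `|x| by apply: cvg_norm; exact: cvg_id.
      by apply: (cvgr_gt _ cn); move: x1; lra.
    by apply: filterS => z /gout.
  by case: D D2 => _ <- [_ <-].
have [C C0 HC] := cont_bnd (-2) 2 cg'.
(* The cutoffs are [g (x / (n + 1)) / g 0] with [g] a fixed bump, and [K] bounds both their height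
   [1 / g 0] and the constant [C / g 0] of their slope. *)
pose K := (1 + C) / g 0.
have K0 : 0 <= K by rewrite divr_ge0// ?(ltW g0)//; lra.
have n0 (n : nat) : 0 < n.+1%:R :> R by [].
have big (n : nat) (x : R) : 2 * n.+1%:R <= `|x| -> 2 <= `|n.+1%:R^-1 * x + 0|.
  move=> h; rewrite addr0 normrM gtr0_norm ?invr_gt0//.
  by rewrite mulrC ler_pdivlMr.
exists (fun n x => (g 0)^-1 * g (n.+1%:R^-1 * x + 0)),
  (fun n x => (g 0)^-1 * (n.+1%:R^-1 * g' (n.+1%:R^-1 * x + 0))), K; split.
- by move=> n x; apply: is_derive_scale; apply: is_derive_comp_aff; exact: dg.
- move=> n x; apply: cvgM; [exact: cvg_cst|apply: cvgM; first exact: cvg_cst].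
  apply: continuous_comp; last exact: cg'.
  exact: (is_derive_cont (fun x => is_derive_aff _ _ x)).
- move=> n x /big h; have h1 : 1 < `|n.+1%:R^-1 * x + 0| by apply: lt_le_trans h; rewrite ltr1n.
  by rewrite (gout _ h1) mulr0.
- by move=> n x /big h; rewrite g'out ?mulr0//.
- by move=> n x; rewrite mulr_ge0// ?bump_ge0// invr_ge0 ltW.
- move=> n x; rewrite mulrC /K ler_wpM2r ?invr_ge0 ?(ltW g0)//.
  by rewrite (le_trans (bump_le1 _ _ _ _))//; lra.
- move=> n x; rewrite !normrM [`|_^-1|]gtr0_norm ?invr_gt0// [`|n.+1%:R^-1|]gtr0_norm ?invr_gt0//.
  have : `|g' (n.+1%:R^-1 * x + 0)| <= 1 + C.
    set z := _ + 0; have [z2|z2] := leP 2 `|z|; first by rewrite g'out// normr0; lra.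
    move: z2; rewrite ltr_norml => /andP[z1 z2].
    by rewrite (le_trans (HC _ (ltW z1) (ltW z2)))//; lra.
  move=> h; rewrite /K mulrCA mulrC ler_wpM2r ?invr_ge0 ?ler0n//.
  by rewrite mulrC ler_wpM2r// invr_ge0 ltW.
- move=> x.
  have E : (g 0)^-1 * g (0 * x + 0) = 1 by rewrite mul0r addr0 mulVf// gt_eqF.
  rewrite -[X in _ --> X]E.
  apply: cvgM; first exact: cvg_cst.
  apply: continuous_cvg; first exact: cg.
  apply: cvgD; last exact: cvg_cst.
  by apply: cvgMl; exact: cvg_harmonic.
Qed.

Lemma cont_avg (Q : R -> R) b : continuous Q ->
  (n.+1%:R^-1)^-1 * I mu (fun t => ind (b - n.+1%:R^-1) b t * Q t) @[n --> \oo] --> Q b.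
Proof.
move=> cQ; apply/cvgrPdist_le => e e0.
have /cvgrPdist_le/(_ _ e0)/nbhs_ballP[d d0 dP] := cQ b.
have hd : \forall n \near \oo, n.+1%:R^-1 < d :> R.
  by apply: (cvgr_lt 0); [exact: cvg_harmonic|].
apply: filterS hd => n; set h := n.+1%:R^-1 => hd.
have h0 : 0 < h by rewrite invr_gt0.
have bb : b - h <= b by lra.
have [li ii] := I_ind bb; have lQ := cont_locL1 cQ bb.
have -> : Q b - h^-1 * I mu (fun t => ind (b - h) b t * Q t) =
   h^-1 * I mu (fun t => ind (b - h) b t * (Q b - Q t)).
  have E t : Q b * ind (b - h) b t - ind (b - h) b t * Q t = ind (b - h) b t * (Q b - Q t) by ring.
  rewrite -(eq_I mu E) (IB (L1Z (Q b) li) lQ) (IZ _ li) ii; field; exact: lt0r_neq0.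
rewrite normrM gtr0_norm ?invr_gt0// ler_pdivrMl// mulrC.
have -> : e * h = e * (b - (b - h)) by ring.
apply: I_ind_bnd => //.
  apply: eq_L1 (L1B (L1Z (Q b) li) lQ) => t; ring.
move=> t t1 t2; apply: dP => /=; rewrite /ball/= ltr_norml; apply/andP; split; lra.
Qed.

End Cutoff.

(** * Elementary inequalities for powers and the flux *)

Section Flux.
Variable R : realType.
Implicit Types p r s w : R.

Lemma powRS w r : 0 <= w -> 0 < r -> w `^ (r + 1) = w `^ r * w.
Proof.
move=> w0 r0; rewrite powRD ?powRr1//.
by apply/implyP => /eqP h; exfalso; move: r0 h; lra.
Qed.

Lemma norm_flux p w : 1 < p -> `|flux p w| = `|w| `^ p.
Proof.
move=> p1; rewrite /flux normrM (ger0_norm (powR_ge0 _ _)) -powRS//; last by move: p1; lra.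
by rewrite subrK.
Qed.

Lemma flux_mul p w : 1 < p -> w * flux p w = `|w| `^ (p + 1).
Proof.
move=> p1; have p0 : 0 < p by move: p1; lra.
rewrite powRS// -[in RHS](subrK 1 p) powRS//; last by move: p1; lra.
by rewrite /flux mulrCA -expr2 -mulrA -expr2 real_normK ?num_real.
Qed.

Lemma mul_powR_le r s w : 0 <= s -> 0 <= w -> 0 < r ->
  s * w `^ r <= s `^ (r + 1) + w `^ (r + 1).
Proof.
move=> s0 w0 r0; rewrite !powRS//.
have r0' := ltW r0.
have h1 : 0 <= s `^ r * s by rewrite mulr_ge0// powR_ge0.
have h2 : 0 <= w `^ r * w by rewrite mulr_ge0// powR_ge0.
have [sw|/ltW ws] := leP s w.
  by have := ler_wpM2r (powR_ge0 w r) sw; lra.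
have : w `^ r <= s `^ r by apply: ge0_ler_powR.
by move=> h; have := ler_wpM2l s0 h; lra.
Qed.

Lemma powR_le_sqr r M s : 1 <= r -> `|s| <= M -> `|s| `^ (r + 1) <= M `^ (r - 1) * s ^+ 2.
Proof.
move=> r1 sM; have [->|s0] := eqVneq s 0.
  rewrite normr0 powR0; first by rewrite expr0n/= mulr0.
  by apply/negP => /eqP; move: r1; lra.
have -> : r + 1 = (r - 1) + 2 by ring.
rewrite powRD ?normr_eq0 ?s0 ?implybT// sqr_powR ler_wpM2r ?sqr_ge0//.
apply: ge0_ler_powR => //; rewrite ?nnegrE//; [move: r1; lra|exact: le_trans sM].
Qed.

End Flux.

(** * Entropy inequality *)

Section Entropy.
Variable R : realType.
Local Notation mu := (leb1 R).
Local Notation mu2 := (leb2 R).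
Variables (p mv : R) (f1 f2 : R -> R) (M : R) (v ux gx : R -> R -> R).
Hypotheses (p1 : 1 < p) (S : sol p mv f1 f2 M v ux gx).
Variables e e1 e2 : R -> R.
Hypotheses (de : forall x : R, is_derive x 1 e (e1 x)) (de1 : forall x : R, is_derive x 1 e1 (e2 x)).
Hypotheses (ce2 : continuous e2) (e20 : forall x, 0 <= e2 x) (e0 : e 0 = 0) (e10 : e1 0 = 0).
Hypothesis mv0 : 0 <= mv.

Let M0 : 0 <= M. Proof. exact: le_trans (s_M S 0 0). Qed.
Let ce : continuous e. Proof. exact: is_derive_cont de. Qed.
Let ce1 : continuous e1. Proof. exact: is_derive_cont de1. Qed.
Let cf1 : continuous f1. Proof. exact: is_derive_cont (s_f1 S). Qed.

Let between (a b c : R) : `|a| <= M -> `|b| <= M -> Num.min a b <= c -> c <= Num.max a b -> `|c| <= M.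
Proof.
rewrite !ler_norml => /andP[a1 a2] /andP[b1 b2] c1 c2; apply/andP; split.
  by apply: le_trans c1; rewrite le_min a1.
by apply: le_trans c2 _; rewrite ge_max a2.
Qed.

(** On [[-M, M]] an entropy that vanishes to second order at 0 is dominated by the square, so square
    integrability of [v] gives all integrability needed. *)
Lemma entropy_bnd : exists2 K, 0 <= K & forall a, `|a| <= M ->
  [/\ `|e2 a| <= K, `|e1 a| <= K * `|a|, `|e a| <= K * a ^+ 2, 0 <= e a &
   forall b, `|b| <= M -> `|e b - e a| <= K * M * `|b - a|].
Proof.
have [K K0 HK] := cont_bnd (- M) M ce2; exists K => //.
have H2 a : `|a| <= M -> `|e2 a| <= K by rewrite ler_norml => /andP[]; exact: HK.
have zM : `|0 : R| <= M by rewrite normr0.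
have H1 a : `|a| <= M -> `|e1 a| <= K * `|a|.
  move=> aM; have [c [c1 c2 E]] := mvt 0 a de1.
  have -> : e1 a = e2 c * (a - 0) by rewrite -E e10 subr0.
  by rewrite subr0 normrM ler_wpM2r// H2// (between zM aM c1 c2).
have H0 a : `|a| <= M -> `|e a| <= K * a ^+ 2.
  move=> aM; have [c [c1 c2 E]] := mvt 0 a de.
  have -> : e a = e1 c * (a - 0) by rewrite -E e0 subr0.
  have cM := between zM aM c1 c2.
  rewrite subr0 normrM -real_normK ?num_real// expr2 mulrA ler_wpM2r//.
  apply: le_trans (H1 _ cM) _; rewrite ler_wpM2l//.
  have a0 := normr_ge0 a; rewrite ler_norml; apply/andP; split.
    apply: le_trans c1; rewrite le_min oppr_le0 a0/=; by rewrite lerNl -normrN ler_norm.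
  by apply: (le_trans c2); rewrite ge_max a0 ler_norm.
have mono a b : a <= b -> e1 a <= e1 b.
  move=> ab; have [c [_ _ E]] := mvt a b de1.
  by rewrite -subr_ge0 E mulr_ge0// subr_ge0.
move=> a aM; split; [exact: H2|exact: H1|exact: H0| |].
  have [c [c1 c2 E]] := mvt 0 a de.
  have -> : e a = e1 c * a by move: E; rewrite e0 !subr0.
  have [a0|/ltW a0] := leP 0 a.
    by rewrite mulr_ge0// -e10 mono//; move: c1; rewrite (min_idPl a0).
  by rewrite mulr_le0// -e10 mono//; move: c2; rewrite (max_idPl a0).
move=> b bM; have [c [c1 c2 E]] := mvt a b de.
have cM := between aM bM c1 c2.
rewrite E normrM ler_wpM2r// (le_trans (H1 _ cM))// ler_wpM2l//.
Qed.

Lemma entropy_convex a b : e b - e a <= e1 b * (b - a).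
Proof.
have [c [c1 c2 ->]] := mvt a b de.
have mono x y : x <= y -> e1 x <= e1 y.
  move=> xy; have [d [_ _ E]] := mvt x y de1.
  by rewrite -subr_ge0 E mulr_ge0// subr_ge0.
have [ab|/ltW ba] := leP a b.
  by rewrite ler_wpM2r ?subr_ge0// mono//; move: c2; rewrite (max_idPr ab).
by rewrite ler_wnM2r ?subr_le0// mono//; move: c1; rewrite (min_idPr ba).
Qed.

Lemma L1_entropy t : 0 <= t -> L1 mu (fun x => e (v t x)).
Proof.
move=> t0; have [K K0 HK] := entropy_bnd.
apply: L1_le (L1Z K (s_v2 S t0)).
  apply: (measurableT_comp (continuous_measurable_fun ce)).
  exact: measurable_slice (s_mv S).
by move=> x; have [] := HK _ (s_M S t x).
Qed.

Lemma L1_dissipation : L1 mu2 (fun z => e2 (v z.1 z.2) * `|ux z.1 z.2| `^ (p + 1)).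
Proof.
have [K K0 HK] := entropy_bnd.
apply: L1_le (L1Z K (s_y S)).
  apply: measurable_funM.
    by apply: (measurableT_comp (continuous_measurable_fun ce2)); exact: (s_mv S).
  exact: L1_meas (s_y S).
move=> z; rewrite normrM [`|_ `^ _|]ger0_norm ?powR_ge0// ler_wpM2r ?powR_ge0//.
by have [] := HK _ (s_M S z.1 z.2).
Qed.

(** Tested with [c * e1 v], the diffusion yields the dissipation and a term with [c']. The
    convection [e1 v * f1 v * ux] is the derivative of [Q v] with [Q' = e1 f1], so only [c' * Q v]
    survives. The constant [C] is independent of the cutoff, and [k] is a bound for [c']. *)
Lemma flux_entropy : exists2 C, 0 <= C & forall (c c' : R -> R) L k t, good_time p v ux gx t -> 0 <= t ->
  (forall x : R, is_derive x 1 c (c' x)) -> continuous c' -> supp c L -> supp c' L ->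
  (forall x, `|c' x| <= k) ->
  L1 mu (fun x => c x * e1 (v t x) * rhs mv f1 v ux gx t x) ->
  L1 mu (fun x => c x * (e2 (v t x) * `|ux t x| `^ (p + 1))) ->
  I mu (fun x => c x * e1 (v t x) * rhs mv f1 v ux gx t x) <=
  - mv * I mu (fun x => c x * (e2 (v t x) * `|ux t x| `^ (p + 1))) +
  k * C * (I mu (fun x => v t x ^+ 2) + I mu (fun x => `|ux t x| `^ (p + 1))).
Proof.
have [K K0 HK] := entropy_bnd.
pose n x := e1 x * f1 x; pose Q x := prim n x - prim n 0.
have cn : continuous n by move=> x; apply: cvgM; [exact: ce1|exact: cf1].
have dQ (x : R) : is_derive x 1 Q (n x).
  have H := is_deriveB (is_derive_prim x cn) (is_derive_cst (prim n 0) x (1 : R)).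
  by apply: (is_derive_eq H); rewrite subr0.
have [F F0 HF] := cont_bnd (- M) M cf1.
have zM : `|0 : R| <= M by rewrite normr0.
have QK a : `|a| <= M -> `|Q a| <= K * F * a ^+ 2.
  move=> aM; have [x [c1 c2 E]] := mvt 0 a dQ.
  have -> : Q a = n x * (a - 0) by rewrite -E /Q subrr subr0.
  have xM := between zM aM c1 c2.
  have xa : `|x| <= `|a|.
    have a0 := normr_ge0 a; rewrite ler_norml; apply/andP; split.
      apply: le_trans c1; rewrite le_min oppr_le0 a0/=; by rewrite lerNl -normrN ler_norm.
    by apply: (le_trans c2); rewrite ge_max a0 ler_norm.
  have [_ h1 _ _ _] := HK _ xM.
  have h2 : `|f1 x| <= F by move: xM; rewrite ler_norml => /andP[? ?]; exact: HF.
  rewrite subr0 normrM /n normrM -real_normK ?num_real//.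
  have -> : K * F * `|a| ^+ 2 = K * `|a| * F * `|a| by ring.
  rewrite ler_wpM2r//; apply: ler_pM => //; apply: le_trans h1 _; exact: ler_wpM2l.
(* First summand: [|e1 v| |ux|^p <= K (|v|^(p + 1) + |ux|^(p + 1))] and
   [|v|^(p + 1) <= M^(p - 1) v^2]. Second summand: [|Q v| <= K F v^2]. *)
pose C := mv * K * (M `^ (p - 1) + 1) + K * F.
have MP := powR_ge0 M (p - 1).
have C0 : 0 <= C by rewrite /C addr_ge0// !mulr_ge0// addr_ge0.
exists C => // c c' L k t G t0 dc cc' sc sc' ck lA lD.
have [[U aU vU] [W aW fW] ly lg] := G.
have cU := ac_cont aU.
have ac_c := ac_C1 dc cc'.
have ac_e1 := ac_chain de1 ce2 aU.
have ac_Q := ac_chain dQ cn aU.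
pose P1 x := c x * e1 (U x); pose P1' x := c' x * e1 (U x) + c x * (e2 (U x) * ux t x).
have aP1 : ac P1 P1' by exact: acM ac_c ac_e1.
have aPW := acM aP1 aW.
have aPQ := acM ac_c ac_Q.
have [l1 i1] : L1 mu (fun x => P1' x * W x + P1 x * gx t x) /\
    I mu (fun x => P1' x * W x + P1 x * gx t x) = 0.
  apply: (ac_supp aPW (L := L)) => x Lx; rewrite /P1 /P1'.
    by rewrite sc// !mul0r.
  by rewrite sc// sc'// !mul0r add0r !mul0r addr0.
have [l2 i2] : L1 mu (fun x => c' x * Q (U x) + c x * (n (U x) * ux t x)) /\
    I mu (fun x => c' x * Q (U x) + c x * (n (U x) * ux t x)) = 0.
  apply: (ac_supp aPQ (L := L)) => x Lx.
    by rewrite sc// !mul0r.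
  by rewrite sc// sc'// !mul0r addr0.
have k0 : 0 <= k by exact: le_trans (ck 0).
have lv := s_v2 S t0.
set D := I mu (fun x => c x * _).
(* The two total derivatives have zero integral; adding them to the right side makes the comparison
   pointwise. *)
have E : - mv * D + k * C * (I mu (fun x => v t x ^+ 2) + I mu (fun x => `|ux t x| `^ (p + 1))) =
  I mu (fun x => (mv * (P1' x * W x + P1 x * gx t x) - (c' x * Q (U x) + c x * (n (U x) * ux t x))) +
    (- mv * (c x * (e2 (v t x) * `|ux t x| `^ (p + 1))) + k * C * (v t x ^+ 2 + `|ux t x| `^ (p + 1)))).
  have la := L1B (L1Z mv l1) l2; have lvy := L1D lv ly.
  have lb := L1D (L1Z (- mv) lD) (L1Z (k * C) lvy).
  rewrite (ID la lb) (IB (L1Z mv l1) l2) (IZ mv l1) i1 i2 (ID (L1Z (- mv) lD) (L1Z (k * C) lvy)).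
  by rewrite (IZ _ lD) (IZ _ lvy) (ID lv ly) -/D; ring.
rewrite E; apply: I_aele => //.
  exact: L1D (L1B (L1Z mv l1) l2) (L1D (L1Z (- mv) lD) (L1Z (k * C) (L1D lv ly))).
apply: (ae_imp2 vU fW) => x vx fx; rewrite -vx -fx /rhs /P1' /P1 -vx.
have [_ h1 _ _ _] := HK _ (s_M S t x).
have hQ := QK _ (s_M S t x).
have hf : ux t x * flux p (ux t x) = `|ux t x| `^ (p + 1) by exact: flux_mul.
have p0 : 0 < p by move: p1; lra.
have b1 : `|e1 (v t x) * flux p (ux t x)| <= K * (M `^ (p - 1) + 1) * (v t x ^+ 2 + `|ux t x| `^ (p + 1)).
  rewrite normrM norm_flux//.
  apply: (@le_trans _ _ (K * (`|v t x| * `|ux t x| `^ p))).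
    by rewrite mulrA ler_wpM2r ?powR_ge0.
  rewrite -mulrA ler_wpM2l// (le_trans (mul_powR_le _ _ p0))//.
  have := powR_le_sqr (ltW p1) (s_M S t x).
  by have := sqr_ge0 (v t x); have := powR_ge0 `|ux t x| (p + 1); nra.
move: hf b1 hQ; rewrite /n.
set w := ux t x; set fl := flux p w; set y := _ `^ (p + 1); set s := v t x; set a1 := e1 s.
set q := Q s; set V := s ^+ 2 => hf b1 hQ.
have V0 : 0 <= V by exact: sqr_ge0.
have y0 : 0 <= y by exact: powR_ge0.
have b2 : `|c' x * (q - mv * (a1 * fl))| <= k * (C * (V + y)).
  rewrite normrM; apply: ler_pM => //.
  apply: (le_trans (ler_normB _ _)); rewrite normrM (ger0_norm mv0).
  have := ler_wpM2l mv0 b1; have : K * F * V <= K * F * (V + y).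
    by rewrite ler_wpM2l ?mulr_ge0// lerDl.
  by rewrite /C; move: hQ; nra.
move: b2; rewrite ler_norml => /andP[_ b2].
have h3 : mv * (c x * (e2 s * (w * fl))) = mv * (c x * (e2 s * y)) by rewrite hf.
by move: b2 h3; clear; lra.
Qed.

Lemma cvg_max_cst (u : nat -> R) (t a : R) : u n @[n --> \oo] --> t ->
  Num.max (u n) a @[n --> \oo] --> Num.max t a.
Proof.
move=> ut; apply/cvgrPdist_le => eps eps0; move/cvgrPdist_le/(_ _ eps0): ut.
apply: filterS => n; apply: le_trans.
have [ta|ta] := leP t a; have [ua|ua] := leP (u n) a.
- by rewrite subrr normr0.
- by rewrite !ler0_norm; lra.
- by rewrite !ger0_norm; lra.
- by [].
Qed.

Lemma entropy_cut_cont (c : R -> R) (L s : R) (sn : nat -> R) : continuous c -> supp c L -> 0 <= s ->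
  (forall n, 0 <= sn n) -> sn n @[n --> \oo] --> s ->
  I mu (fun x => c x * e (v (sn n) x)) @[n --> \oo] --> I mu (fun x => c x * e (v s x)).
Proof.
move=> cc sc s0 sn0 sns; have [K K0 HK] := entropy_bnd.
have mc : measurable_fun setT c by exact: continuous_measurable_fun.
have mv_ t : measurable_fun setT (v t) by exact: measurable_slice (s_mv S).
have lce t : 0 <= t -> L1 mu (fun x => c x * e (v t x)).
  move=> t0; apply: (L1_suppM cc sc); first exact: L1_meas (L1_entropy t0).
  exact: L1_indM (L1_entropy t0).
have l2c : L1 mu (fun x => `|c x| ^+ 2).
  apply: eq_L1 (L1_suppM cc sc mc _) => [x|].
    by rewrite real_normK ?num_real// expr2.
  have [LL|/ltW LL] := leP (- L) L; first exact: cont_locL1.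
  apply: eq_L1 (L1_0 mu) => x; rewrite indF ?mul0r//.
  by apply/negP => /andP[H1 H2]; have := lt_le_trans H1 (le_trans H2 LL); rewrite ltxx.
have mabsc : measurable_fun setT (fun x => `|c x|) by exact: measurableT_comp.
pose d n x := `|v (sn n) x - v s x|.
have md n : measurable_fun setT (d n) by apply: measurableT_comp => //; exact: measurable_funB.
have d2 n x : (v (sn n) x - v s x) ^+ 2 = d n x ^+ 2 by rewrite /d real_normK ?num_real.
have ld n : L1 mu (fun x => d n x ^+ 2).
  by apply: eq_L1 (L1_sqrB (mv_ (sn n)) (mv_ s) (s_v2 S (sn0 n)) (s_v2 S s0)) => x; rewrite d2.
have cd : I mu (fun x => d n x ^+ 2) @[n --> \oo] --> 0.
  rewrite (_ : (fun n => _) = (fun n => I mu (fun x => (v (sn n) x - v s x) ^+ 2))).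
    exact: (s_cont S s0 sn0 sns).
  by apply/funext => n; apply: eq_I => x; rewrite d2.
have W := cvg_L2_weak mabsc l2c md ld cd.
have lcd n := (@cauchy_schwarz _ _ _ mu _ _ mabsc (md n) l2c (ld n)).1.
have KW : K * M * I mu (fun x => `|c x| * d n x) @[n --> \oo] --> (0 : R).
  by rewrite -[X in _ --> X](mulr0 (K * M)); apply: cvgM; [exact: cvg_cst|exact: W].
apply/cvgrPdist_le => eps eps0; move/cvgr0Pnorm_le/(_ _ eps0): KW; apply: filterS => n.
rewrite ger0_norm; last first.
  by apply: mulr_ge0; [exact: mulr_ge0|apply: I_ge0 => x; rewrite mulr_ge0// /d].
apply: le_trans; rewrite -IZ// distrC -(IB (lce _ (sn0 n)) (lce _ s0)).
apply: I_le_abs; [exact: L1B (lce _ (sn0 n)) (lce _ s0)|exact: L1Z|].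
move=> x; rewrite -mulrBr normrM mulrCA ler_wpM2l//.
by have [_ _ _ _] := HK _ (s_M S s x); apply; exact: s_M S _ _.
Qed.

(** [energy] is applied to [Q = \int c_n e(v)] with gradient [c_n e1(v)], its hypothesis being
    convexity with the gradient taken at the later time. [flux_entropy] bounds the right side, and
    [n] tends to infinity by dominated convergence. *)
Theorem entropy_ineq a b : 0 <= a -> a <= b ->
  I mu (fun x => e (v b x)) +
  mv * I mu2 (fun z => ind a b z.1 * (e2 (v z.1 z.2) * `|ux z.1 z.2| `^ (p + 1))) <=
  I mu (fun x => e (v a x)).
Proof.
move=> a0; rewrite le_eqVlt => /predU1P[<-|ab].
  rewrite (_ : I mu2 _ = 0) ?mulr0 ?addr0// -[RHS](I_0 mu2); apply: eq_I => z.
  by rewrite indF ?mul0r//; apply/negP => /andP[H1 H2]; have := lt_le_trans H1 H2; rewrite ltxx.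
have b0 := le_trans a0 (ltW ab).
have [K K0 HK] := entropy_bnd; have [C C0 HC] := flux_entropy.
have [c [c' [k F]]] := @cutoff_exists R.
have cc n := is_derive_cont (cf_d F n).
have mc n : measurable_fun setT (c n) by exact: continuous_measurable_fun.
have k0 : 0 <= k by exact: le_trans (cf_0 F 0 0) (cf_K F 0 0).
pose D z := ind a b z.1 * (e2 (v z.1 z.2) * `|ux z.1 z.2| `^ (p + 1)).
have lDz : L1 mu2 D.
  apply: L1_le (L1_abs L1_dissipation).
    apply: measurable_funM; last exact: L1_meas L1_dissipation.
    by apply: measurable_ind.
  by move=> z; rewrite /D normrM (ger0_norm (ind_ge0 _ _ _)) ler_piMl// ind_le1.
have D0 z : 0 <= D z by rewrite /D !mulr_ge0// ?ind_ge0 ?powR_ge0.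
have [B HB] := s_v2b S.
pose Yt t := I mu (fun x => `|ux t x| `^ (p + 1)).
have lY : L1 mu Yt := fubini_L1 (s_y S).
have Y0 t : 0 <= Yt t by apply: I_ge0 => x; exact: powR_ge0.
have lcD n : L1 mu2 (fun z => c n z.2 * D z).
  apply: L1_le (L1Z k (L1_abs lDz)).
    apply: measurable_funM; last exact: L1_meas lDz.
    by apply: (measurableT_comp (mc n)); exact: measurable_snd.
  move=> z; rewrite normrM (ger0_norm (cf_0 F n _)) (ger0_norm (D0 z)) ler_wpM2r//; exact: cf_K F _ _.
have lce n t : 0 <= t -> L1 mu (fun x => c n x * e (v t x)).
  move=> t0; apply: (L1_suppM (cc n) (@cf_s _ _ _ _ F n)).
    exact: L1_meas (L1_entropy t0).
  exact: L1_indM (L1_entropy t0).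
pose q n t := I mu (fun x => c n x * e (v t x)).
have key n : q n b - q n a <= - mv * I mu2 (fun z => c n z.2 * D z) +
    (k / n.+1%:R) * (C * (B * (b - a) + I mu Yt)).
  pose L := 2 * n.+1%:R : R.
  pose Bz t x := ind a b t * (c n x * e1 (v t x)).
  (* Frozen at its value at [a] for earlier times, as [energy] requires; it stays continuous. *)
  pose Q t := q n (Num.max t a).
  have cQ : continuous Q.
    move=> t; apply: continuous_seq => u ut.
    apply: (entropy_cut_cont (cc n) (@cf_s _ _ _ _ F n)).
    - by rewrite le_max a0 orbT.
    - by move=> m; rewrite le_max a0 orbT.
    - exact: cvg_max_cst.
  have Qa t : a <= t -> Q t = q n t by move=> at_; rewrite /Q (max_idPl at_).
  have lQ := cont_locL1 cQ.
  have mB : measurable_fun setT (fun z : R * R => Bz z.1 z.2).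
    apply: measurable_funM; first exact: measurable_ind.
    apply: measurable_funM; first by apply: (measurableT_comp (mc n)); exact: measurable_snd.
    exact: (measurableT_comp (continuous_measurable_fun ce1) (s_mv S)).
  have BL t x : ~~ ((- L < x) && (x <= L)) -> Bz t x = 0.
    move=> H; rewrite /Bz (@cf_s _ _ _ _ F n) ?mul0r ?mulr0//.
    move: H; rewrite negb_and -!leNgt -ltNge => /orP[H|/ltW H].
      by rewrite -normrN (le_trans _ (ler_norm _))// lerNr.
    by rewrite (le_trans H)// ler_norm.
  have B0 t x : ~~ ((a < t) && (t <= b)) -> Bz t x = 0 by move=> H; rewrite /Bz indF// mul0r.
  have hB t x : `|Bz t x ^+ 2| <= (k * (K * M)) ^+ 2 * (ind a b t * ind (- L) L x).
    rewrite ger0_norm ?sqr_ge0//.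
    have [H1|H1] := boolP ((a < t) && (t <= b)); last by rewrite B0// indF// mul0r mulr0 expr0n.
    have [H2|H2] := boolP ((- L < x) && (x <= L)); last first.
      by rewrite BL// [ind (- L) L x]indF// !mulr0 expr0n.
    case/andP: H1 => h1 h2; case/andP: H2 => h3 h4; rewrite /Bz !indT// !mul1r mulr1.
    rewrite -[leLHS]real_normK ?num_real// lerXn2r ?nnegrE ?mulr_ge0//.
    rewrite normrM (ger0_norm (cf_0 F n _)); apply: ler_pM => //; [exact: cf_0 F _ _|exact: cf_K F _ _|].
    have [_ h _ _ _] := HK _ (s_M S t x).
    by apply: le_trans h _; rewrite ler_wpM2l// (s_M S).
  have LL : - L <= L by rewrite -subr_ge0 opprK addr_ge0// mulr_ge0.
  have lB : L1 mu2 (fun z => Bz z.1 z.2 ^+ 2).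
    by apply: L1_le (L1Z ((k * (K * M)) ^+ 2) (L1_box a b L)) => //; exact: measurable_funX.
  have lBt t : L1 mu (fun x => Bz t x ^+ 2).
    apply: L1_le (L1Z ((k * (K * M)) ^+ 2 * ind a b t) (I_ind LL).1).
      by apply: measurable_funX; exact: measurable_slice mB.
    by move=> x; rewrite -mulrA.
  have HQ t s : a < t -> t <= b -> a <= s -> s <= t -> good_time p v ux gx t -> good_time p v ux gx s \/ s = a ->
     Q t - Q s <= I mu (fun x => Bz t x * (v t x - v s x)).
    move=> at_ tb as_ st _ _.
    have t0 := le_trans a0 (ltW at_); have s0 := le_trans a0 as_.
    rewrite !Qa// ?(ltW at_)// /q -(IB (lce n t t0) (lce n s s0)); apply: I_le.
    - exact: L1B (lce n t t0) (lce n s s0).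
    - have mvt_ t' := measurable_slice t' (s_mv S).
      exact: (@cauchy_schwarz _ _ _ mu _ _ (measurable_slice t mB)
        (measurable_funB (mvt_ t) (mvt_ s)) (lBt t)
        (L1_sqrB (mvt_ t) (mvt_ s) (s_v2 S t0) (s_v2 S s0))).1.
    - move=> x; rewrite /Bz indT// mul1r -mulrBr -mulrA ler_wpM2l//; first exact: cf_0 F _ _.
      exact: entropy_convex.
  have Qca t : t <= a -> Q t = Q a by move=> ta; rewrite /Q (max_idPr ta) maxxx.
  have [l i] := energy p1 S a0 ab mB B0 BL lB lQ Qca (cont_avg (b := b) cQ) (s_good S) HQ.
  move: i; rewrite !Qa ?(ltW ab)// => /le_trans; apply.
  rewrite (fubini_I l) (fubini_I (lcD n)).
  have lV : L1 mu (fun t => ind a b t * B) by apply: eq_L1 (L1Z B (I_ind (ltW ab)).1) => t; rewrite mulrC.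
  have iV : I mu (fun t => ind a b t * B) = B * (b - a).
    by rewrite -(I_ind (ltW ab)).2 -IZ ?(I_ind (ltW ab)).1//; apply: eq_I => t; rewrite mulrC.
  have lcDt := fubini_L1 (lcD n).
  have lYt := L1_indM a b lY.
  have kC0 : 0 <= k / n.+1%:R * C by rewrite !mulr_ge0// invr_ge0.
  apply: (@le_trans _ _ (I mu (fun t => - mv * I mu (fun x => c n x * D (t, x)) +
     (k / n.+1%:R * C) * (ind a b t * B + ind a b t * Yt t)))); last first.
    have lVY := L1D lV lYt.
    rewrite (ID (L1Z (- mv) lcDt) (L1Z (k / n.+1%:R * C) lVY)) (IZ _ lcDt) (IZ _ lVY) (ID lV lYt) iV.
    rewrite lerD2l mulrA ler_wpM2l// lerD2l; apply: I_le => // t.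
    by rewrite ler_piMl// ind_le1.
  apply: I_aele; [exact: fubini_L1 l|exact: L1D (L1Z _ lcDt) (L1Z _ (L1D lV lYt))|].
  apply: (ae_imp3 (fubini_ae1 l) (fubini_ae1 (lcD n)) (s_good S)) => t lt_ lDt gt_ /=.
  have [H1|H1] := boolP ((a < t) && (t <= b)); last first.
    rewrite [ind a b t]indF// !mul0r addr0 mulr0 addr0 -[leLHS]/(I mu _).
    rewrite (@eq_I _ _ _ mu _ (fun=> 0)); last by move=> x; rewrite B0// mul0r.
    rewrite I_0 (@eq_I _ _ _ mu _ (fun=> 0)); last by move=> x; rewrite /D indF// mul0r mulr0.
    by rewrite I_0 mulr0.
  case/andP: H1 => at_ tb; have t0 := le_lt_trans a0 at_.
  have := HC (c n) (c' n) _ (k / n.+1%:R) t (gt_ t0) (ltW t0) (cf_d F n) (@cf_c _ _ _ _ F n)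
    (@cf_s _ _ _ _ F n) (@cf_s' _ _ _ _ F n) (cf_b F n).
  have i1 : ind a b t = 1 by rewrite indT.
  move: lt_ lDt; rewrite /Bz /D /= i1 !mul1r.
  have E1 x : 1 * (c n x * e1 (v t x)) * rhs mv f1 v ux gx t x = c n x * e1 (v t x) * rhs mv f1 v ux gx t x.
    by rewrite mul1r.
  have E2 x : c n x * (1 * (e2 (v t x) * `|ux t x| `^ (p + 1))) = c n x * (e2 (v t x) * `|ux t x| `^ (p + 1)).
    by rewrite mul1r.
  move=> l1 l2 /(_ (@eq_L1 _ _ _ mu _ _ E1 l1) (@eq_L1 _ _ _ mu _ _ E2 l2)) H.
  rewrite (eq_I mu E1) (eq_I mu E2); apply: le_trans H _.
  by rewrite lerD2l ler_wpM2l// lerD2r HB// ltW.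
have cq t : 0 <= t -> q n t @[n --> \oo] --> I mu (fun x => e (v t x)).
  move=> t0; apply: (dct _ _ _ (L1Z k (L1_entropy t0)) _).2.
  - by move=> n; exact: L1_meas (lce n t t0).
  - exact: L1_meas (L1_entropy t0).
  - apply: aeW => x; rewrite -[X in _ --> X]mul1r; apply: cvgMl; exact: cf_1 F x.
  - move=> n; apply: aeW => x; have [_ _ _ ge _] := HK _ (s_M S t x).
    by rewrite normrM (ger0_norm (cf_0 F n _)) (ger0_norm ge) ler_wpM2r//; exact: cf_K F _ _.
have cD : I mu2 (fun z => c n z.2 * D z) @[n --> \oo] --> I mu2 D.
  apply: (dct _ _ _ (L1Z k lDz) _).2.
  - by move=> n; exact: L1_meas (lcD n).
  - exact: L1_meas lDz.
  - apply: aeW => z; rewrite -[X in _ --> X]mul1r; apply: cvgMl; exact: cf_1 F z.2.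
  - move=> n; apply: aeW => z.
    by rewrite normrM (ger0_norm (cf_0 F n _)) (ger0_norm (D0 z)) ler_wpM2r//; exact: cf_K F _ _.
rewrite -/D; set W := C * _ in key.
have ch : (k / n.+1%:R) * W @[n --> \oo] --> k * 0 * W.
  by apply: cvgMl; apply: cvgMr; exact: cvg_harmonic.
have Lim := cvgB (cvgB (cq b b0) (cq a a0)) (cvgD (cvgM (cvg_cst (- mv)) cD) ch).
suff : I mu (fun x => e (v b x)) - I mu (fun x => e (v a x)) - (- mv * I mu2 D + k * 0 * W) <= 0 by lra.
apply: (@cvg_le_cst _ (fun n => q n b - q n a - (- mv * I mu2 (fun z => c n z.2 * D z) + k / n.+1%:R * W))).
  exact: Lim.
by move=> n; rewrite subr_le0 key.
Qed.

End Entropy.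

(** * Decay of Lebesgue norms *)

Section Monotone.
Variable R : realType.
Local Notation mu := (leb1 R).
Local Notation mu2 := (leb2 R).
Variables (p mv : R) (f1 f2 : R -> R) (M : R) (v ux gx : R -> R -> R).
Hypotheses (p1 : 1 < p) (S : sol p mv f1 f2 M v ux gx) (mv0 : 0 < mv).

Let cexp k : continuous (fun x : R => x ^+ k).
Proof. exact: exprn_continuous. Qed.

Lemma even_pow_ge0 k (x : R) : 0 <= x ^+ k.*2.
Proof. by rewrite -mul2n exprM exprn_ge0// sqr_ge0. Qed.

Lemma is_derive_exprn k (x : R) : is_derive x 1 (fun x : R => x ^+ k.+1) (k.+1%:R * x ^+ k).
Proof.
elim: k => [|k IH].
  rewrite expr0 mulr1 (_ : (fun x => _) = id); first exact: is_derive_id.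
  by apply/funext => y; rewrite expr1.
rewrite (_ : (fun x => _) = (fun x : R => x * x ^+ k.+1)).
  apply: (is_derive_eq (is_derive_mul (is_derive_id x 1) IH)).
  by rewrite mul1r mulrCA -exprS -[in RHS]natr1 mulrDl mul1r addrC.
by apply/funext => y; rewrite exprS.
Qed.

(** The exponents [2 k + 2] are even, so the entropies are polynomials with continuous second
    derivative. *)
Lemma power_entropy k a b : 0 <= a -> a <= b ->
  I mu (fun x => v b x ^+ (k.*2.+2)) +
  mv * I mu2 (fun z => ind a b z.1 * (k.*2.+2%:R * k.*2.+1%:R * v z.1 z.2 ^+ k.*2 * `|ux z.1 z.2| `^ (p + 1))) <=
  I mu (fun x => v a x ^+ (k.*2.+2)).
Proof.
apply: (@entropy_ineq R p mv f1 f2 M v ux gx p1 S (fun x => x ^+ k.*2.+2) (fun x => k.*2.+2%:R * x ^+ k.*2.+1)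
  (fun x => k.*2.+2%:R * k.*2.+1%:R * x ^+ k.*2)).
- by move=> x; exact: is_derive_exprn.
- by move=> x; rewrite -mulrA; apply: is_derive_scale; exact: is_derive_exprn.
- by move=> x; apply: cvgM; [exact: cvg_cst|exact: cexp].
- by move=> x; rewrite mulr_ge0// -mul2n exprM exprn_ge0// sqr_ge0.
- by rewrite expr0n.
- by rewrite expr0n mulr0.
- exact: ltW.
Qed.

Lemma power_L1 k t : 0 <= t -> L1 mu (fun x => v t x ^+ (k.*2.+2)).
Proof.
apply: (@L1_entropy R p mv f1 f2 M v ux gx S (fun x => x ^+ k.*2.+2) (fun x => k.*2.+2%:R * x ^+ k.*2.+1)
  (fun x => k.*2.+2%:R * k.*2.+1%:R * x ^+ k.*2)).
- by move=> x; exact: is_derive_exprn.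
- by move=> x; rewrite -mulrA; apply: is_derive_scale; exact: is_derive_exprn.
- by move=> x; apply: cvgM; [exact: cvg_cst|exact: cexp].
- by move=> x; rewrite mulr_ge0// -mul2n exprM exprn_ge0// sqr_ge0.
- by rewrite expr0n.
- by rewrite expr0n mulr0.
Qed.

Lemma power_noninc k a b : 0 <= a -> a <= b ->
  I mu (fun x => v b x ^+ (k.*2.+2)) <= I mu (fun x => v a x ^+ (k.*2.+2)).
Proof.
move=> a0 ab; apply: le_trans (power_entropy k a0 ab); rewrite lerDl mulr_ge0 ?(ltW mv0)//.
apply: I_ge0 => z; apply: mulr_ge0; first exact: ind_ge0.
by rewrite !mulr_ge0// ?powR_ge0// even_pow_ge0.
Qed.

(** The even power norms do not increase, so [\int v^(2k+2) <= K^(2k) \int v(0)^2]. Chebyshev bounds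
    the set where [|v| >= K + e] by a multiple of [(K / (K + e))^(2k)], which tends to 0 with
    [k]. *)
Lemma max_principle K t : 0 <= K -> {ae mu, forall x, `|v 0 x| <= K} -> 0 <= t ->
  {ae mu, forall x, `|v t x| <= K}.
Proof.
move=> K0 HK t0.
have mvt := measurable_slice t (s_mv S).
pose A := I mu (fun x => v 0 x ^+ 2).
have A0 : 0 <= A by apply: I_ge0 => x; exact: sqr_ge0.
have EK k : I mu (fun x => v t x ^+ k.*2.+2) <= (K ^+ 2) ^+ k * A.
  apply: le_trans (power_noninc k (lexx 0) t0) _; rewrite -IZ; last exact: (s_v2 S).
  apply: I_aele; [exact: power_L1|exact: L1Z (s_v2 S _)|apply: (ae_imp HK) => x xK].
  rewrite -[k.*2.+2]addn2 exprD ler_wpM2r ?sqr_ge0// -mul2n exprM -[X in X ^+ k]real_normK ?num_real//.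
  by rewrite lerXn2r ?nnegrE ?exprn_ge0// lerXn2r ?nnegrE.
have : {ae mu, forall x, forall n : nat, `|v t x| < K + n.+1%:R^-1}.
  apply/ae_foralln => n; set e := n.+1%:R^-1.
  have e0 : 0 < e by rewrite invr_gt0.
  have Ke : 0 < K + e by lra.
  pose g x : R := if K + e <= `|v t x| then 1 else 0.
  have mg : measurable_fun setT g.
    apply: measurable_fun_ifT => //.
    by apply: measurable_fun_ler; [exact: measurable_cst|exact: measurableT_comp].
  have g0 x : 0 <= g x by rewrite /g; case: ifP.
  have gle k x : g x <= ((K + e) ^+ k.*2.+2)^-1 * v t x ^+ k.*2.+2.
    rewrite /g; case: ifPn => [h|_]; last first.
      apply: mulr_ge0; last exact: (even_pow_ge0 k.+1).
      by rewrite invr_ge0 exprn_ge0// ltW.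
    rewrite ler_pdivlMl ?exprn_gt0// mulr1 -[k.*2.+2]/(k.+1.*2) -mul2n !exprM.
    by rewrite -[X in _ <= X ^+ _]real_normK ?num_real// lerXn2r ?nnegrE ?exprn_ge0 ?(ltW Ke)// lerXn2r ?nnegrE ?(ltW Ke).
  have lg : L1 mu g.
    apply: L1_le (L1Z ((K + e) ^+ 0.*2.+2)^-1 (power_L1 0 t0)) => // x.
    by rewrite ger0_norm.
  pose r := (K / (K + e)) ^+ 2.
  have r0 : 0 <= r by exact: sqr_ge0.
  have r1 : `|r| < 1.
    rewrite ger0_norm// /r expr_lt1// ?divr_ge0 ?(ltW Ke)//.
    by rewrite ltr_pdivrMr// mul1r ltrDl.
  have Ig : I mu g = 0.
    apply/eqP; rewrite eq_le I_ge0// andbT.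
    have C : (K + e) ^- 2 * A * r ^+ n @[n --> \oo] --> (K + e) ^- 2 * A * 0.
      by apply: cvgM; [exact: cvg_cst|exact: cvg_expr].
    rewrite mulr0 in C; apply: (cvg_ge_cst C) => k.
    apply: (@le_trans _ _ (((K + e) ^+ k.*2.+2)^-1 * I mu (fun x => v t x ^+ k.*2.+2))).
      by rewrite -IZ; [apply: I_le => //; exact: L1Z (power_L1 k t0)|exact: power_L1].
    apply: le_trans (ler_wpM2l _ (EK k)) _; first by rewrite invr_ge0 exprn_ge0// ltW.
    rewrite le_eqVlt; apply/orP; left; apply/eqP.
    rewrite /r -[k.*2.+2]addn2 exprD -mul2n exprM expr_div_n expr_div_n; field.
    by rewrite !expf_neq0 ?gt_eqF.
  have g0a : {ae mu, forall x, 0 <= g x} by exact: aeW.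
  apply: (ae_imp (I_eq0_ae lg g0a Ig)) => x; rewrite /g; case: ltP => //= _ /eqP.
  by rewrite oner_eq0.
move=> H; apply: (ae_imp H) => x Hx; apply/ler_addgt0Pr => e e0.
have [n ne] : exists n : nat, n.+1%:R^-1 < e.
  have [n _ /(_ n (leqnn n)) h] : \forall n \near \oo, n.+1%:R^-1 < e.
    by apply: (cvgr_lt 0) => //; exact: cvg_harmonic.
  by exists n.
by rewrite ltW// (lt_trans (Hx n))// ltrD2l.
Qed.

(** The entropies [sqrt(w^2 + d^2) - d] are convex, vanish to second order at 0 and increase to
    [|w|] as [d] tends to 0; Fatou gives integrability at time [t] along with the bound. *)
Lemma L1_contraction t : L1 mu (v 0) -> 0 <= t ->
  L1 mu (v t) /\ I mu (fun x => `|v t x|) <= I mu (fun x => `|v 0 x|).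
Proof.
move=> l0 t0; have mvt := measurable_slice t (s_mv S).
pose d n : R := n.+1%:R^-1.
have d0 n : 0 < d n by rewrite invr_gt0.
pose s n (w : R) := Num.sqrt (w ^+ 2 + d n ^+ 2).
have sd0 n w : 0 < w ^+ 2 + d n ^+ 2.
  have := sqr_ge0 w; have : 0 < d n ^+ 2 by rewrite exprn_gt0.
  by lra.
have s0 n w : 0 < s n w by rewrite sqrtr_gt0.
have s2 n w : s n w ^+ 2 = w ^+ 2 + d n ^+ 2 by rewrite sqr_sqrtr// ltW.
have sn0 n w : s n w != 0 by rewrite gt_eqF.
have ds n (w : R) : is_derive w 1 (s n) (w * (s n w)^-1).
  have H1 : is_derive w 1 (fun w : R => w ^+ 2 + d n ^+ 2) (2 * w).
    have H := is_derive_add (is_derive_sqr w) (is_derive_cst (d n ^+ 2) w (1 : R)).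
    by apply: (is_derive_eq H); rewrite addr0.
  have H := @is_derive1_comp R Num.sqrt (fun w : R => w ^+ 2 + d n ^+ 2) w _ _ (is_derive1_sqrt (sd0 n w)) H1.
  apply: (is_derive_eq H); rewrite -[Num.sqrt _]/(s n w); field; exact: sn0.
have dV n (w : R) : is_derive w 1 (fun w => (s n w)^-1) (- (s n w) ^- 2 * (w * (s n w)^-1)).
  exact: (is_deriveV (sn0 n w) (ds n w)).
pose e2 n w := d n ^+ 2 * ((s n w)^-1 * (s n w)^-1 * (s n w)^-1).
have de1 n (w : R) : is_derive w 1 (fun w => w * (s n w)^-1) (e2 n w).
  apply: (is_derive_eq (is_derive_mul (is_derive_id w 1) (dV n w))).
  have -> : e2 n w = (s n w ^+ 2 - w ^+ 2) * ((s n w)^-1 * (s n w)^-1 * (s n w)^-1).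
    by rewrite s2 /e2; ring.
  by field; exact: sn0.
have cV n := is_derive_cont (dV n).
have ce2 n : continuous (e2 n).
  move=> w; apply: cvgM; first exact: cvg_cst.
  by apply: cvgM; [apply: cvgM|]; exact: cV.
have e20 n w : 0 <= e2 n w.
  by rewrite /e2 mulr_ge0 ?sqr_ge0// !mulr_ge0// invr_ge0 ltW.
have de n (w : R) : is_derive w 1 (fun w => s n w - d n) (w * (s n w)^-1).
  by apply: (is_derive_eq (is_deriveB (ds n w) (is_derive_cst (d n) w (1 : R)))); rewrite subr0.
have e0 n : s n 0 - d n = 0.
  by rewrite /s expr0n add0r sqrtr_sqr ger0_norm ?subrr// ltW.
have e10 n : 0 * (s n 0)^-1 = 0 by rewrite mul0r.
have sge n w : d n <= s n w.
  rewrite -(@ler_pXn2r _ 2)// ?nnegrE ?(ltW (d0 n)) ?(ltW (s0 n w))// s2.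
  by rewrite lerDr sqr_ge0.
have sgw n w : `|w| <= s n w.
  rewrite -(@ler_pXn2r _ 2)// ?nnegrE ?(ltW (s0 n w))// s2 real_normK ?num_real//.
  by rewrite lerDl sqr_ge0.
have sle n w : s n w <= `|w| + d n.
  rewrite -(@ler_pXn2r _ 2)// ?nnegrE ?(ltW (s0 n w)) ?addr_ge0 ?(ltW (d0 n))// s2 sqrrD.
  rewrite real_normK ?num_real// lerD2r lerDl.
  by apply: mulrn_wge0; apply: mulr_ge0 => //; exact: ltW.
have la := L1_abs l0.
have le n r : 0 <= r -> L1 mu (fun x => s n (v r x) - d n).
  by move=> r0; apply: (L1_entropy S (de n) (de1 n) (ce2 n) (e20 n) (e0 n) (e10 n) r0).
have K n : I mu (fun x => s n (v t x) - d n) <= I mu (fun x => `|v 0 x|).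
  have := @entropy_ineq _ _ _ _ _ _ _ _ _ p1 S _ _ _ (de n) (de1 n) (ce2 n) (e20 n) (e0 n) (e10 n) (ltW mv0) 0 t (lexx 0) t0.
  move/(le_trans _) => H; apply: le_trans (H _ _) _; last first.
  - by apply: I_le => // [|x]; [exact: le|rewrite lerBlDr].
  - rewrite lerDl mulr_ge0 ?(ltW mv0)//; apply: I_ge0 => z.
    apply: mulr_ge0; first exact: ind_ge0.
    by apply: mulr_ge0; [exact: e20|exact: powR_ge0].
have [l i] : L1 mu (fun x => `|v t x|) /\ I mu (fun x => `|v t x|) <= I mu (fun x => `|v 0 x|).
  apply: (@real_fatou _ _ _ mu (fun n x => s n (v t x) - d n)) => //.
  - by move=> n; exact: le.
  - by move=> n x; rewrite subr_ge0.
  - exact: measurableT_comp.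
  - apply: aeW => x; apply/cvgrPdist_le => eps eps0.
    have : \forall n \near \oo, d n <= eps.
      by apply: (cvgr_le 0) => //; exact: cvg_harmonic.
    apply: filterS => n; apply: le_trans; rewrite ler_norml.
    have h1 := sgw n (v t x); have h2 := sle n (v t x); have h3 := sge n (v t x).
    by have h4 := d0 n; apply/andP; split; lra.
split => //; apply: L1_le l => // x; rewrite //.
Qed.

End Monotone.

(** * Scalar inequalities and the power differential inequality *)

Section RealLemmas.
Variable R : realType.
Local Notation mu := (leb1 R).
Implicit Types (a b c p r s x y m : R).

Lemma powRK x r : 0 <= x -> 0 < r -> (x `^ r) `^ r^-1 = x.
Proof. by move=> x0 r0; rewrite -powRrM divff ?gt_eqF// powRr1. Qed.

Lemma powRVK x r : 0 <= x -> 0 < r -> (x `^ r^-1) `^ r = x.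
Proof. by move=> x0 r0; rewrite -powRrM mulVf ?gt_eqF// powRr1. Qed.

(* [b t = t^(1/a) E t] for a solution [E] of [E' <= - c E^(1 + a)]. *)
Lemma bootstrap (b : R -> R) (a K T B : R) : 0 < a -> 0 <= K ->
  (forall t, 0 < t -> t <= T -> 0 <= b t /\ b t <= B) ->
  (forall t, 0 < t -> t <= T -> b t `^ (1 + a) <= K * b (t / 2)) ->
  forall t, 0 < t -> t <= T -> b t <= K `^ a^-1.
Proof.
move=> a0 K0 bB H t t0 tT.
pose A := [set b s | s in [set s | 0 < s /\ s <= T]].
have At s : 0 < s -> s <= T -> A (b s) by move=> s0 sT; exists s.
have hA : has_sup A.
  split; first by exists (b t); exact: At.
  by exists B => _ [s [s0 sT] <-]; have [] := bB s s0 sT.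
set Z := sup A.
have bZ s : 0 < s -> s <= T -> b s <= Z by move=> s0 sT; exact: (sup_upper_bound hA (At _ s0 sT)).
have Z0 : 0 <= Z by apply: le_trans (bZ t t0 tT); have [] := bB t t0 tT.
have a1 : 0 < 1 + a by lra.
(* The supremum inherits [Z^(1 + a) <= K Z]; the a priori bound [B] serves only to make it finite
   and leaves no trace in the conclusion. *)
have ZK : Z <= (K * Z) `^ (1 + a)^-1.
  apply: ge_sup; first by exists (b t); exact: At.
  move=> _ [s [s0 sT] <-].
  have [bs0 _] := bB s s0 sT.
  rewrite -[leLHS](powRK bs0 a1).
  apply: ge0_ler_powR; rewrite ?nnegrE ?invr_ge0 ?(ltW a1) ?powR_ge0 ?mulr_ge0//.
  by apply: le_trans (H s s0 sT) _; rewrite ler_wpM2l// bZ//; lra.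
apply: le_trans (bZ t t0 tT) _.
have [->|Zn] := eqVneq Z 0; first exact: powR_ge0.
have Zp : 0 < Z by rewrite lt_neqAle eq_sym Zn.
have Za : Z `^ a <= K.
  have : Z `^ (1 + a) <= K * Z.
    rewrite -[leRHS](@powRVK _ (1 + a)) ?mulr_ge0//.
    by apply: ge0_ler_powR; rewrite ?nnegrE ?(ltW a1) ?powR_ge0.
  by rewrite addrC powRS// ler_pM2r.
rewrite -[leLHS](powRK Z0 a0).
by apply: ge0_ler_powR; rewrite ?nnegrE ?invr_ge0 ?(ltW a0) ?powR_ge0.
Qed.

(** Either [s <= c], or [s <= s (s / c)^p]. The level [c] remains free, to be chosen so that one of
    the terms can be absorbed. *)
Lemma young1 p c s : 0 < p -> 0 < c -> 0 <= s -> s <= c + (c `^ p)^-1 * s `^ (p + 1).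
Proof.
move=> p0 c0 s0; have cp := powR_gt0 p c0.
have t0 : 0 <= (c `^ p)^-1 * s `^ (p + 1) by rewrite mulr_ge0 ?invr_ge0 ?powR_ge0.
have [sc|/ltW cs] := leP s c; first by lra.
apply: (@le_trans _ _ ((c `^ p)^-1 * s `^ (p + 1))); last by rewrite lerDr ltW.
rewrite ler_pdivlMl// powRS// ler_wpM2r//.
by apply: ge0_ler_powR; rewrite ?nnegrE ?(ltW p0) ?(ltW c0).
Qed.

(** Otherwise [|U|^r] would exceed a positive constant on a half line. This stands in for decay at
    [-oo]. *)
Lemma far_small r (U : R -> R) e x : 0 < r -> L1 mu (fun x => `|U x| `^ r) -> 0 < e ->
  exists2 a, a <= x & `|U a| <= e.
Proof.
move=> r0 lU e0; apply: contrapT => H.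
have HU a : a <= x -> e < `|U a|.
  by move=> ax; rewrite ltNge; apply/negP => Ua; apply: H; exists a.
have er : 0 < e `^ r by exact: powR_gt0.
have bound (n : nat) : e `^ r * n%:R <= I mu (fun x => `|U x| `^ r).
  have xx : x - n%:R <= x by rewrite lerBlDr lerDl.
  have [l i] := I_ind xx.
  have -> : n%:R = x - (x - n%:R) by lra.
  rewrite -i -IZ//; apply: I_le => //; first exact: L1Z.
  move=> y; rewrite /ind; case: ifP => [/andP[_ yx]|_]; last by rewrite mulr0 powR_ge0.
  rewrite mulr1; apply: ge0_ler_powR; rewrite ?nnegrE ?(ltW r0) ?(ltW e0)//.
  exact: ltW (HU _ yx).
set J := I mu _ in bound.
have := bound (Num.bound (J / e `^ r)).
have J0 : 0 <= J by apply: I_ge0 => y; exact: powR_ge0.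
have := archi_boundP (divr_ge0 J0 (ltW er)).
by rewrite ltr_pdivrMr// => h1 h2; have := lt_le_trans h1 (le_trans _ h2); rewrite mulrC lexx ltxx => /(_ isT).
Qed.

(** The fundamental theorem for [U^(q+1)] from a far point where [U] is arbitrarily small. *)
Lemma sup_pow (U h : R -> R) q : ac U h ->
  (forall e x, 0 < e -> exists2 a, a <= x & `|U a| <= e) ->
  L1 mu (fun x => `|U x| ^+ q * `|h x|) ->
  forall x, `|U x| ^+ q.+1 <= q.+1%:R * I mu (fun x => `|U x| ^+ q * `|h x|).
Proof.
move=> aU fU lq x; apply/ler_addgt0Pr => e e0.
pose d := Num.min 1 e.
have d0 : 0 < d by rewrite lt_min ltr01.
have [a ax Ua] := fU d x d0.
have ce : continuous (fun x : R => q.+1%:R * x ^+ q).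
  by move=> y; apply: cvgM; [exact: cvg_cst|exact: exprn_continuous].
have aP := ac_chain (@is_derive_exprn R q) ce aU.
have [lP eP] := aP _ _ ax.
have Ue : `|U a| ^+ q.+1 <= e.
  apply: (@le_trans _ _ d); last by rewrite ge_min lexx orbT.
  apply: (@le_trans _ _ (d ^+ q.+1)); first by rewrite lerXn2r ?nnegrE ?(ltW d0).
  rewrite exprS ler_piMr ?(ltW d0)// exprn_ile1 ?(ltW d0)//.
  by rewrite ge_min lexx.
rewrite -normrX -[U x ^+ _](subrK (U a ^+ q.+1)) (le_trans (ler_normD _ _))// lerD//; last by rewrite normrX.
rewrite eP -IZ//; apply: I_le_abs => //; first exact: L1Z.
move=> y; rewrite !normrM normrX (ger0_norm (ind_ge0 _ _ _)) ger0_norm// -mulrA.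
by rewrite ler_piMl// ?ind_le1// !mulr_ge0// exprn_ge0.
Qed.

(* With [N] the supremum of [|U|], [|h|] is split by [young1] at the level
   [N^2 / (2 (q + 1) m)], which makes the first part half of [N^(q + 1)]. *)
Lemma lq_ode p m (M : R) (U h : R -> R) k : 1 < p -> 0 < m -> ac U h ->
  L1 mu U -> I mu (fun x => `|U x|) <= m -> (forall x, `|U x| <= M) ->
  L1 mu (fun x => `|h x| `^ (p + 1)) ->
  I mu (fun x => U x ^+ k.*2.+2) `^ (1 + 2 * p / k.*2.+1%:R) <=
  m * m `^ (2 * p / k.*2.+1%:R) * (2 * k.*2.+3%:R * (2 * k.*2.+3%:R * m) `^ p) *
  I mu (fun x => U x ^+ k.*2 * `|h x| `^ (p + 1)).
Proof.
move=> p1 m0 aU lU Im UM lh.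
pose q := k.*2.+2; rewrite -[k.*2.+3]/(q.+1) -[k.*2.+2]/q; set a := 2 * p / _.
have p0 : 0 < p by lra.
have M0 : 0 <= M by exact: le_trans (UM 0).
have mU := ac_measU aU; have mh := ac_meas aU.
have la := L1_abs lU.
have ev j x : U x ^+ j.*2 = `|U x| ^+ j.*2.
  by rewrite -mul2n !exprM real_normK ?num_real.
have lUj j : L1 mu (fun x => `|U x| ^+ j.+1).
  apply: L1_le (L1Z (M ^+ j) la).
    by apply: measurable_funX; exact: measurableT_comp.
  by move=> x; rewrite ger0_norm ?exprn_ge0// exprSr ler_wpM2r// lerXn2r ?nnegrE.
have lUh j : L1 mu (fun x => `|U x| ^+ j * `|h x| `^ (p + 1)).
  apply: L1_le (L1Z (M ^+ j) lh).
    apply: measurable_funM; last exact: measurable_absX.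
    by apply: measurable_funX; exact: measurableT_comp.
  by move=> x; rewrite ger0_norm ?mulr_ge0 ?exprn_ge0 ?powR_ge0// ler_wpM2r ?powR_ge0// lerXn2r ?nnegrE.
have lJ : L1 mu (fun x => `|U x| ^+ q * `|h x|).
  apply: L1_le (L1D (lUj q.-1) (lUh q)).
    by apply: measurable_funM; [apply: measurable_funX|]; exact: measurableT_comp.
  move=> x; have pp : 1 <= p + 1 by lra.
  have U0 : 0 <= `|U x| ^+ q := exprn_ge0 q (normr_ge0 (U x)).
  rewrite (ger0_norm (mulr_ge0 U0 (normr_ge0 (h x)))).
  by have := ler_wpM2l U0 (powR_ge1D (normr_ge0 (h x)) pp); rewrite mulrDr mulr1.
have fU e x : 0 < e -> exists2 a, a <= x & `|U a| <= e.
  by apply: (@far_small 1) => //; apply: eq_L1 la => y; rewrite powRr1.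
have SP := sup_pow aU fU lJ.
set J := I mu _ in SP.
have -> : I mu (fun x => U x ^+ q) = I mu (fun x => `|U x| ^+ q).
  by apply: eq_I => x; exact: (ev k.+1).
have -> : I mu (fun x => U x ^+ k.*2 * `|h x| `^ (p + 1)) = I mu (fun x => `|U x| ^+ k.*2 * `|h x| `^ (p + 1)).
  by apply: eq_I => x; rewrite ev.
set E := I mu _; set D := I mu _.
have J0 : 0 <= J by apply: I_ge0 => x; exact: (mulr_ge0 (exprn_ge0 q (normr_ge0 (U x))) (normr_ge0 (h x))).
have E0 : 0 <= E by apply: I_ge0 => x; exact: (exprn_ge0 q (normr_ge0 (U x))).
have D0 : 0 <= D by apply: I_ge0 => x; rewrite mulr_ge0 ?exprn_ge0 ?powR_ge0.
have q0 : 0 < q.+1%:R :> R by [].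
have a0 : 0 < a by rewrite divr_gt0// mulr_gt0.
(* The majorant of [|U|] from [sup_pow], taken with equality [N^(q+1) = (q + 1) J], so that a bound
   on [J] is a bound on [N]. *)
pose N := (q.+1%:R * J) `^ q.+1%:R^-1.
have N0 : 0 <= N by exact: powR_ge0.
have NE : N ^+ q.+1 = q.+1%:R * J.
  rewrite -powR_mulrn// -powRrM mulVf ?powRr1// ?mulr_ge0//; exact: lt0r_neq0.
have UN x : `|U x| <= N.
  by rewrite -(@ler_pXn2r _ q.+1)// ?nnegrE// NE.
have EN : E <= N ^+ k.*2.+1 * m.
  apply: (@le_trans _ _ (N ^+ k.*2.+1 * I mu (fun x => `|U x|))); last by rewrite ler_wpM2l ?exprn_ge0.
  rewrite -IZ//; apply: I_le => //; [exact: (lUj q.-1)|exact: L1Z|].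
  by move=> x; rewrite /q [X in X <= _]exprSr ler_wpM2r// lerXn2r ?nnegrE.
have RHS0 : 0 <= m * m `^ a * (2 * q.+1%:R * (2 * q.+1%:R * m) `^ p) * D.
  by rewrite !mulr_ge0// ?powR_ge0// ltW.
have [Nz|Nn] := eqVneq N 0.
  have -> : E = 0 by apply/eqP; rewrite eq_le E0 andbT (le_trans EN)// Nz expr0n mul0r.
  by rewrite powR0// gt_eqF//; lra.
have Np : 0 < N by rewrite lt_neqAle eq_sym Nn.
pose c := N ^+ 2 / (2 * q.+1%:R * m).
have qm0 : 0 < 2 * q.+1%:R * m by rewrite !mulr_gt0.
have c0 : 0 < c by rewrite divr_gt0// exprn_gt0.
have JD : J <= c * E + (c `^ p)^-1 * (N ^+ 2 * D).
  rewrite mulrA -(IZ c (lUj q.-1)) -(IZ _ (lUh k.*2)) -(ID (L1Z c (lUj q.-1)) (L1Z _ (lUh k.*2))).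
  apply: I_le => //; first exact: (L1D (L1Z c (lUj q.-1)) (L1Z _ (lUh k.*2))).
  move=> x; have y1 := young1 p0 c0 (normr_ge0 (h x)).
  have Uq0 : 0 <= `|U x| ^+ q := exprn_ge0 q (normr_ge0 (U x)).
  apply: le_trans (ler_wpM2l Uq0 y1) _.
  rewrite mulrDr mulrC lerD2l mulrCA -[leRHS]mulrA ler_wpM2l ?invr_ge0 ?powR_ge0//.
  rewrite mulrA ler_wpM2r ?powR_ge0// /q -[k.*2.+2]addn2 exprD mulrC ler_wpM2r ?exprn_ge0//.
  by rewrite lerXn2r ?nnegrE.
have cE : q.+1%:R * (c * E) <= N ^+ q.+1 / 2.
  apply: (@le_trans _ _ (q.+1%:R * (c * (N ^+ k.*2.+1 * m)))).
    by rewrite !ler_wpM2l// ltW.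
  rewrite le_eqVlt; apply/orP; left; apply/eqP.
  rewrite /c /q -[in RHS]addn2 exprD; field.
  by rewrite (lt0r_neq0 m0) lt0r_neq0.
have main : N ^+ k.*2.+1 * (N ^+ 2) `^ p <= 2 * q.+1%:R * (2 * q.+1%:R * m) `^ p * D.
  have cp : (c `^ p)^-1 = (2 * q.+1%:R * m) `^ p * ((N ^+ 2) `^ p)^-1.
    rewrite /c powRM ?invr_ge0 ?exprn_ge0 ?(ltW qm0)// invfM.
    by rewrite -powR_inv1 ?(ltW qm0)// -powRrM mulN1r powRN invrK mulrC.
  have h1 : N ^+ q.+1 <= 2 * q.+1%:R * ((c `^ p)^-1 * (N ^+ 2 * D)).
    have := ler_wpM2l (ltW q0) JD; rewrite -NE mulrDr => hN.
    by rewrite -mulrA; move: hN cE; lra.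
  have N2 : 0 < N ^+ 2 by rewrite exprn_gt0.
  have N2p : 0 < (N ^+ 2) `^ p by exact: powR_gt0.
  rewrite -(@ler_pM2r _ (N ^+ 2 / (N ^+ 2) `^ p)) ?divr_gt0//.
  have -> : N ^+ k.*2.+1 * (N ^+ 2) `^ p * (N ^+ 2 / (N ^+ 2) `^ p) = N ^+ q.+1.
    rewrite /q -[in RHS]addn2 exprD; field; exact: lt0r_neq0.
  by apply: le_trans h1 _; rewrite cp le_eqVlt; apply/orP; left; apply/eqP; ring.
rewrite addrC powRS//.
(* The exponent [a = 2p / (2k + 1)] is chosen so that the power [a] of [N^(2k+1)] is [N^(2p)], the
   factor left by the choice of [c]. *)
have Ea : E `^ a <= (N ^+ 2) `^ p * m `^ a.
  have -> : (N ^+ 2) `^ p = (N ^+ k.*2.+1) `^ a.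
    rewrite -(powR_mulrn 2 N0) -(powR_mulrn k.*2.+1 N0) -powRrM -powRrM; congr (_ `^ _).
    by rewrite /a [RHS]mulrC divfK// pnatr_eq0.
  rewrite -powRM ?exprn_ge0// ?(ltW m0)//.
  by apply: ge0_ler_powR; rewrite ?nnegrE ?(ltW a0)// mulr_ge0 ?exprn_ge0// ltW.
have := ler_pM (powR_ge0 _ _) E0 Ea EN => /le_trans; apply.
have ma : 0 <= m * m `^ a by rewrite mulr_ge0 ?powR_ge0// ltW.
have := ler_wpM2l ma main; congr (_ <= _); ring.
Qed.

End RealLemmas.

(** * Decay rates of the power norms *)

Section Decay.
Variable R : realType.
Local Notation mu := (leb1 R).
Local Notation mu2 := (leb2 R).
Variables (p mv : R) (f1 f2 : R -> R) (m K : R).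
Hypotheses (p1 : 1 < p) (mv0 : 0 < mv) (m0 : 0 < m) (K0 : 0 <= K).
Implicit Types (v ux gx : R -> R -> R) (t s M : R).

Let p0 : 0 < p. Proof. exact: lt_trans p1. Qed.
Let p11 : 1 <= p + 1. Proof. by rewrite lerDr ltW. Qed.

Lemma power_diss_L1 M v ux gx k a b : sol p mv f1 f2 M v ux gx ->
  L1 mu2 (fun z => ind a b z.1 * (k.*2.+2%:R * k.*2.+1%:R * v z.1 z.2 ^+ k.*2 * `|ux z.1 z.2| `^ (p + 1))).
Proof.
move=> S.
have l : L1 mu2 (fun z => (fun x => k.*2.+2%:R * k.*2.+1%:R * x ^+ k.*2) (v z.1 z.2) * `|ux z.1 z.2| `^ (p + 1)).
  apply: (@L1_dissipation R p mv f1 f2 M v ux gx S (fun x => x ^+ k.*2.+2) (fun x => k.*2.+2%:R * x ^+ k.*2.+1)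
     (fun x => k.*2.+2%:R * k.*2.+1%:R * x ^+ k.*2)).
  - by move=> x; exact: is_derive_exprn.
  - by move=> x; rewrite -mulrA; apply: is_derive_scale; exact: is_derive_exprn.
  - by move=> x; apply: cvgM; [exact: cvg_cst|exact: exprn_continuous].
  - by move=> x; rewrite mulr_ge0// even_pow_ge0.
  - by rewrite expr0n.
  - by rewrite expr0n mulr0.
apply: L1_le (L1_abs l).
  by apply: measurable_funM; [exact: measurable_ind|exact: L1_meas l].
by move=> z; rewrite normrM (ger0_norm (ind_ge0 _ _ _)) ler_piMl// ind_le1.
Qed.

Let Kc k : R := m * m `^ (2 * p / k.*2.+1%:R) * (2 * k.*2.+3%:R * (2 * k.*2.+3%:R * m) `^ p).

Lemma good_ode M v ux gx k t : sol p mv f1 f2 M v ux gx -> L1 mu (v 0) ->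
  I mu (fun x => `|v 0 x|) <= m -> 0 <= t -> good_time p v ux gx t ->
  I mu (fun x => v t x ^+ k.*2.+2) `^ (1 + 2 * p / k.*2.+1%:R) <=
  Kc k * I mu (fun x => v t x ^+ k.*2 * `|ux t x| `^ (p + 1)).
Proof.
move=> S l0 I0 t0 [[U aU vU] _ ly _].
have mvt := measurable_slice t (s_mv S); have mU := ac_measU aU.
have [lv Iv] := L1_contraction p1 S mv0 l0 t0.
have lU : L1 mu U by exact: (@L1_aeeq _ _ _ mu _ _ mU vU lv).
have IU : I mu (fun x => `|U x|) = I mu (fun x => `|v t x|).
  apply: (@I_aeeq _ _ _ mu); [exact: measurableT_comp|exact: measurableT_comp|].
  by apply: (ae_imp vU) => x ->.
have lU2 : L1 mu (fun x => U x ^+ 2).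
  apply: (@L1_aeeq _ _ _ mu _ _ _ _ (s_v2 S t0)); first exact: measurable_funX.
  by apply: (ae_imp vU) => x ->.
have UM := ac_sup p11 aU lU2 (lexx _) ly (lexx _).
have E1 : I mu (fun x => v t x ^+ k.*2.+2) = I mu (fun x => U x ^+ k.*2.+2).
  apply: (@I_aeeq _ _ _ mu); [exact: measurable_funX|exact: measurable_funX|].
  by apply: (ae_imp vU) => x ->.
have E2 : I mu (fun x => v t x ^+ k.*2 * `|ux t x| `^ (p + 1)) = I mu (fun x => U x ^+ k.*2 * `|ux t x| `^ (p + 1)).
  apply: (@I_aeeq _ _ _ mu).
  - by apply: measurable_funM; [exact: measurable_funX|exact: L1_meas ly].
  - by apply: measurable_funM; [exact: measurable_funX|exact: L1_meas ly].
  - by apply: (ae_imp vU) => x ->.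
have Im : I mu (fun x => `|U x|) <= m by rewrite IU (le_trans Iv).
rewrite E1 E2 /Kc; exact: (lq_ode k p1 m0 aU lU Im UM ly).
Qed.

Let c k : R := mv * (k.*2.+2%:R * k.*2.+1%:R) / Kc k.

Let Kc0 k : 0 < Kc k.
Proof. by rewrite /Kc !mulr_gt0// ?powR_gt0// !mulr_gt0. Qed.

Let c0 k : 0 < c k.
Proof. by rewrite divr_gt0// mulr_gt0// mulr_gt0. Qed.

Let E0 v k t : 0 <= I mu (fun x => v t x ^+ k.*2.+2).
Proof. by apply: I_ge0 => x; exact: (even_pow_ge0 k.+1). Qed.

(** The integrated differential inequality: the norm does not increase, so the dissipation at every
    time of []s, t]] dominates the power of the value at the end [t]. *)
Lemma decay_step M v ux gx k s t : sol p mv f1 f2 M v ux gx -> L1 mu (v 0) ->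
  I mu (fun x => `|v 0 x|) <= m -> 0 <= s -> s <= t ->
  c k * (t - s) * I mu (fun x => v t x ^+ k.*2.+2) `^ (1 + 2 * p / k.*2.+1%:R) <=
  I mu (fun x => v s x ^+ k.*2.+2).
Proof.
move=> S l0 I0 s0 st.
set Et := I mu (fun x => v t x ^+ _); set P := Et `^ _.
apply: le_trans (power_entropy p1 S mv0 k s0 st).
apply: (@le_trans _ _ (mv * I mu2 (fun z => ind s t z.1 * (k.*2.+2%:R * k.*2.+1%:R * v z.1 z.2 ^+ k.*2 * `|ux z.1 z.2| `^ (p + 1)))));
  last by rewrite lerDr E0.
have lF := power_diss_L1 k s t S.
set w := k.*2.+2%:R * k.*2.+1%:R in lF *.
have -> : c k * (t - s) * P = mv * (w * (P / Kc k) * (t - s)) by rewrite /c -/w; ring.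
rewrite ler_pM2l// (fubini_I lF).
have [li ii] := I_ind st.
have w0 : 0 < w by rewrite /w.
apply: (@le_trans _ _ (I mu (fun r => (w * (P / Kc k)) * ind s t r))).
  by rewrite IZ// ii.
apply: I_aele; [exact: L1Z|exact: fubini_L1 lF|].
apply: (ae_imp2 (s_good S) (fubini_ae1 lF)) => r gr lr /=.
have [H|H] := boolP ((s < r) && (r <= t)); last first.
  rewrite [ind s t r]indF// mulr0; apply: I_ge0 => x; by rewrite mul0r.
case/andP: H => sr rt; move: lr; rewrite /= [ind s t r]indT// mulr1 => lr.
have r0 := le_lt_trans s0 sr.
have E x : w * (v r x ^+ k.*2 * `|ux r x| `^ (p + 1)) = 1 * (w * v r x ^+ k.*2 * `|ux r x| `^ (p + 1)).
  by rewrite mul1r mulrA.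
have El : L1 mu (fun x => v r x ^+ k.*2 * `|ux r x| `^ (p + 1)).
  apply: (@eq_L1 _ _ _ mu _ _ _ (L1Z w^-1 lr)) => x.
  by rewrite mul1r -mulrA mulKf// gt_eqF.
rewrite -(eq_I mu E) IZ// ler_pM2l// ler_pdivrMr// mulrC.
apply: le_trans (good_ode k S l0 I0 (ltW r0) (gr r0)).
apply: ge0_ler_powR; rewrite ?nnegrE; [|exact: E0|exact: E0|exact: (power_noninc p1 S mv0 k (ltW r0) rt)].
by rewrite addr_ge0// divr_ge0// mulr_ge0// ltW.
Qed.

(** [decay_step] from [t / 2] to [t], multiplied by powers of [t], is the hypothesis of [bootstrap]
    for [t^b E(t)]. The constant involves the solution only through [m] and [K], which is why it can
    be chosen first. *)
Lemma even_decay k : exists2 C, 0 < C & forall M v ux gx, sol p mv f1 f2 M v ux gx ->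
  L1 mu (v 0) -> I mu (fun x => `|v 0 x|) <= m -> {ae mu, forall x, `|v 0 x| <= K} ->
  forall t, 0 <= t ->
  I mu (fun x => v t x ^+ k.*2.+2) <= C * (1 + t) `^ (- (k.*2.+1%:R / (2 * p))).
Proof.
pose b : R := k.*2.+1%:R / (2 * p); pose a : R := 2 * p / k.*2.+1%:R.
have pp : 0 < 2 * p by rewrite mulr_gt0.
have b0 : 0 < b by rewrite divr_gt0.
have a0 : 0 < a by rewrite divr_gt0.
have ab : a^-1 = b by rewrite /a /b invf_div.
(* [2 / c k] comes from the step length [t / 2], and [2^b] from replacing [t^b] by [(t / 2)^b]; [b]
   is the power [1 / a] of [bootstrap]. *)
pose L := (2 / c k * 2 `^ b) `^ b.
have L0 : 0 <= L by exact: powR_ge0.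
(* The undecayed bound [K^(2k+1) m], used for [t <= 1]. *)
pose A := m * K ^+ k.*2.+1.
have A0 : 0 <= A by rewrite mulr_ge0 ?exprn_ge0// ltW.
exists (2 `^ b * (L + A + 1)).
  by rewrite mulr_gt0 ?powR_gt0//; lra.
move=> M v ux gx S l0 I0 K0v t t0.
pose E s := I mu (fun x => v s x ^+ k.*2.+2).
have EA s : 0 <= s -> E s <= A.
  move=> s0; apply: le_trans (power_noninc p1 S mv0 k (lexx 0) s0) _.
  rewrite /A mulrC; apply: (@le_trans _ _ (K ^+ k.*2.+1 * I mu (fun x => `|v 0 x|))).
    rewrite -IZ; last exact: L1_abs.
    apply: I_aele; [exact: (power_L1 S k (lexx 0))|exact: L1Z (L1_abs l0)|].
    apply: (ae_imp K0v) => x xK.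
    have -> : v 0 x ^+ k.*2.+2 = `|v 0 x| ^+ k.*2.+2.
      by rewrite -[k.*2.+2]/(k.+1.*2) -mul2n !exprM real_normK ?num_real.
    by rewrite [X in X <= _]exprSr ler_wpM2r// lerXn2r ?nnegrE.
  by rewrite ler_wpM2l ?exprn_ge0.
have B s : 0 < s -> s `^ b * E s <= L.
  move=> s0; pose KK := 2 / c k * 2 `^ b; pose bb r := r `^ b * E r.
  have KK0 : 0 <= KK by rewrite mulr_ge0 ?powR_ge0// divr_ge0// ltW.
  have h1 r : 0 < r -> r <= s -> 0 <= bb r /\ bb r <= s `^ b * A.
    move=> r0 rs; split; first by rewrite mulr_ge0 ?powR_ge0 ?E0.
    apply: ler_pM; [exact: powR_ge0|exact: E0| |exact: EA (ltW r0)].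
    by apply: ge0_ler_powR; rewrite ?nnegrE ?(ltW r0) ?(ltW s0) ?(ltW b0).
  have h2 r : 0 < r -> r <= s -> bb r `^ (1 + a) <= KK * bb (r / 2).
    move=> r0 _.
    have r2 : 0 <= r / 2 by rewrite divr_ge0// ltW.
    have rr : r / 2 <= r by rewrite ler_pdivrMr// ler_peMr// ?ltW// ltr1n.
    have D := decay_step k S l0 I0 r2 rr.
    rewrite /bb (powRM _ (powR_ge0 _ _) (E0 v k r)) -powRrM.
    have -> : b * (1 + a) = b + 1 by rewrite mulrDr mulr1 -ab mulVf ?gt_eqF.
    rewrite (powRS (ltW r0) b0).
    have rE : r * E r `^ (1 + a) <= 2 / c k * E (r / 2).
      have ck2 : 0 < c k / 2 by rewrite divr_gt0.
      rewrite -(ler_pM2l ck2).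
      have -> : c k / 2 * (2 / c k * E (r / 2)) = E (r / 2) by field; rewrite gt_eqF.
      apply: le_trans D; rewrite -/(E r) -/a le_eqVlt; apply/orP; left; apply/eqP; by field.
    rewrite -mulrA; apply: le_trans (ler_wpM2l (powR_ge0 r b) rE) _.
    have -> : r `^ b = 2 `^ b * (r / 2) `^ b by rewrite -powRM ?ler0n// mulrC divfK.
    by rewrite /KK le_eqVlt; apply/orP; left; apply/eqP; ring.
  by have := bootstrap a0 KK0 h1 h2 s0 (lexx s); rewrite ab.
rewrite -/(E t) powRN -ler_pdivrMr ?invr_gt0 ?powR_gt0 ?ltr_wpDr// invrK mulrC.
have [t1|/ltW t1] := leP t 1.
  apply: (@le_trans _ _ (2 `^ b * A)); last by rewrite ler_wpM2l ?powR_ge0//; lra.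
  apply: ler_pM; rewrite ?powR_ge0 ?E0 ?EA//.
  by apply: ge0_ler_powR; rewrite ?nnegrE ?(ltW b0)//; lra.
apply: (@le_trans _ _ (2 `^ b * L)); last by rewrite ler_wpM2l ?powR_ge0//; lra.
apply: (@le_trans _ _ (2 `^ b * (t `^ b * E t))); last by rewrite ler_wpM2l ?powR_ge0// B//; lra.
rewrite mulrA -powRM// ler_wpM2r ?E0//.
by apply: ge0_ler_powR; rewrite ?nnegrE ?(ltW b0)//; lra.
Qed.

(** Interpolation between the [L^1] norm and an even exponent [Q >= q], by splitting at the height
    [l = (1 + t)^(-1/(2p))]: both parts decay like [l^(q - 1)]. *)
Lemma lq_decay q : 1 <= q -> exists2 C, 0 < C & forall M v ux gx, sol p mv f1 f2 M v ux gx ->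
  L1 mu (v 0) -> I mu (fun x => `|v 0 x|) <= m -> {ae mu, forall x, `|v 0 x| <= K} ->
  forall t, 0 <= t -> L1 mu (fun x => `|v t x| `^ q) /\
  I mu (fun x => `|v t x| `^ q) <= C * (1 + t) `^ (- (1 / (2 * p) * (q - 1))).
Proof.
move=> q1.
pose k := Num.bound q; pose Q : R := k.*2.+2%:R.
have qQ : q <= Q.
  apply: (@le_trans _ _ k%:R); first by apply: ltW; apply: archi_boundP; lra.
  by rewrite ler_nat -addnn -addn2 -addnA leq_addr.
have [C C0 H] := even_decay k.
exists (m + C); first by rewrite addr_gt0.
move=> M v ux gx S l0 I0 K0v t t0; have Hk := H M v ux gx S l0 I0 K0v t t0.
have [lv Iv] := L1_contraction p1 S mv0 l0 t0.
have lQ := power_L1 S k t0.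
have mvt := measurable_slice t (s_mv S).
pose l := (1 + t) `^ (- (1 / (2 * p))).
have l1 : 0 < l by rewrite powR_gt0//; lra.
have evn x : v t x ^+ k.*2.+2 = `|v t x| `^ Q.
  rewrite powR_mulrn//.
  by rewrite -[k.*2.+2]/(k.+1.*2) -mul2n !exprM real_normK ?num_real.
have key x : `|v t x| `^ q <= l `^ (q - 1) * `|v t x| + l `^ (q - Q) * v t x ^+ k.*2.+2.
  rewrite evn; set w := `|v t x|; have w0 : 0 <= w by exact: normr_ge0.
  have n1 : 0 <= l `^ (q - 1) * w by rewrite mulr_ge0 ?powR_ge0.
  have n2 : 0 <= l `^ (q - Q) * w `^ Q by rewrite mulr_ge0 ?powR_ge0.
  have [->|wn] := eqVneq w 0; first by rewrite powR0 ?addr_ge0 ?mulr_ge0 ?powR_ge0// gt_eqF//; lra.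
  have wp : 0 < w by rewrite lt_neqAle eq_sym wn.
  have [wl|/ltW lw] := leP w l.
    apply: (@le_trans _ _ (l `^ (q - 1) * w)); last by rewrite lerDl.
    rewrite -[q in leLHS](subrK 1) powRD ?wn ?implybT// powRr1// ler_wpM2r//.
    by apply: ge0_ler_powR; rewrite ?nnegrE ?(ltW l1)//; lra.
  apply: (@le_trans _ _ (l `^ (q - Q) * w `^ Q)); last by rewrite lerDr.
  rewrite -[q in leLHS](subrK Q) powRD ?wn ?implybT// ler_wpM2r ?powR_ge0//.
  rewrite -opprB !powRN.
  have pg y : 0 < y -> y `^ (Q - q) \is Num.pos by move=> y0; rewrite posrE powR_gt0.
  rewrite (lef_pV2 (pg _ wp) (pg _ l1)).
  by apply: ge0_ler_powR; rewrite ?nnegrE ?(ltW l1) ?subr_ge0.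
have lr := L1D (L1Z (l `^ (q - 1)) (L1_abs lv)) (L1Z (l `^ (q - Q)) lQ).
have lq : L1 mu (fun x => `|v t x| `^ q).
  apply: L1_le lr; first exact: measurable_absX.
  by move=> x; rewrite ger0_norm ?powR_ge0.
split => //; apply: le_trans (I_le lq lr key) _.
rewrite (ID (L1Z (l `^ (q - 1)) (L1_abs lv)) (L1Z (l `^ (q - Q)) lQ)) (IZ _ (L1_abs lv)) (IZ _ lQ).
have t1 : 0 < 1 + t by lra.
have le1 : (1 + t) `^ (- (1 / (2 * p) * (q - 1))) = l `^ (q - 1) by rewrite /l -powRrM mulNr.
have le2 : l `^ (q - Q) * (1 + t) `^ (- (k.*2.+1%:R / (2 * p))) = l `^ (q - 1).
  rewrite /l -!powRrM -powRD ?(gt_eqF t1) ?implybT//; congr (_ `^ _).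
  have -> : k.*2.+1%:R = Q - 1 :> R by rewrite /Q -[k.*2.+2%:R]natr1 addrK.
  by field; rewrite gt_eqF.
rewrite le1 mulrDl; apply: lerD.
  by rewrite mulrC ler_wpM2r ?powR_ge0// (le_trans Iv).
by rewrite -le2 mulrCA ler_wpM2l ?powR_ge0.
Qed.

End Decay.

(** * Decay of the slope *)

Section PowDeriv.
Variable R : realType.
Implicit Types r w x : R.

Lemma is_derive_powR r x : 0 < x -> is_derive x 1 (fun y : R => y `^ (r + 1)) ((r + 1) * x `^ r).
Proof.
move=> x0; have xi : x \in `]0, +oo[ by rewrite in_itv/= andbT.
have D : derivable (fun y : R => y `^ (r + 1)) x 1 by exact: (@derivable_powR R 1 (r + 1) x xi).
apply: (DeriveDef D); rewrite -derive1E powR_derive1//.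
by rewrite addrK.
Qed.

Lemma flux_gt0E r x : 0 < x -> flux r x = x `^ r.
Proof.
move=> x0; rewrite /flux gtr0_norm// -{2}[x]powRr1 ?(ltW x0)// -powRD ?subrK//.
by rewrite (gt_eqF x0) implybT.
Qed.

Lemma fluxN r x : flux r (- x) = - flux r x.
Proof. by rewrite /flux normrN mulrN. Qed.

Lemma flux0 r : flux r 0 = 0 :> R. Proof. by rewrite /flux mulr0. Qed.

Lemma norm_flux_gen r x : 0 < r -> `|flux r x| = `|x| `^ r.
Proof.
move=> r0; have [x0|x0|->] := ltgtP x 0.
- have nx : 0 < - x by rewrite oppr_gt0.
  have -> : flux r x = - flux r (- x) by rewrite fluxN opprK.
  by rewrite normrN (flux_gt0E _ nx) ger0_norm ?powR_ge0// ltr0_norm.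
- by rewrite (flux_gt0E _ x0) ger0_norm ?powR_ge0// gtr0_norm.
- by rewrite flux0 normr0 powR0// gt_eqF.
Qed.

Lemma flux_cont0 r : 0 < r -> {for 0, continuous (flux (R := R) r)}.
Proof.
move=> r0; rewrite /prop_for /continuous_at flux0; apply/cvgrPdist_le => e e0.
apply/nbhs_ballP; exists (e `^ r^-1) => /=; first by rewrite powR_gt0.
move=> z; rewrite /ball/= sub0r normrN => ze.
rewrite sub0r normrN norm_flux_gen// -(powRVK (ltW e0) r0).
by apply: ge0_ler_powR; rewrite ?nnegrE ?(ltW r0) ?powR_ge0// ltW.
Qed.

Lemma flux_cont r : 0 < r -> continuous (flux (R := R) r).
Proof.
move=> r0; have pos (x : R) : 0 < x -> {for x, continuous (flux r)}.
  move=> x0; have c1 : {for x, continuous (fun y : R => y `^ r)}.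
    have D := is_derive_powR (r - 1) x0; move: D; rewrite subrK => -[D _].
    by apply: differentiable_continuous; apply/derivable1_diffP.
  rewrite /prop_for /continuous_at (flux_gt0E _ x0); apply: cvg_trans c1.
  apply: near_eq_cvg; have : \forall z \near x, 0 < z by exact: (cvgr_gt x cvg_id).
  by apply: filterS => z z0; rewrite flux_gt0E.
move=> x; have [x0|x0|->] := ltgtP x 0; [|exact: pos|exact: flux_cont0].
have nx : 0 < - x by rewrite oppr_gt0.
have -> : flux r = (fun y : R => - flux r (- y)) by apply/funext => y; rewrite fluxN opprK.
apply: cvgN; apply: (continuous_comp (f := fun y : R => - y)); last exact: pos.
by apply: cvgN; exact: cvg_id.
Qed.

Lemma is_derive_abs_powR r x : 0 < r ->
  is_derive x 1 (fun y : R => `|y| `^ (r + 1)) ((r + 1) * flux r x).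
Proof.
move=> r0; have [x0|x0|->] := ltgtP x 0.
- have nx : 0 < -1 * x + 0 by lra.
  have D := is_derive_comp_aff (is_derive_powR r nx).
  have E : is_derive x 1 (fun y : R => (-1 * y + 0) `^ (r + 1)) ((r + 1) * flux r x).
    apply: (is_derive_eq D).
    have -> : flux r x = - flux r (-1 * x + 0) by rewrite /flux addr0 mulN1r normrN; ring.
    by rewrite (flux_gt0E _ nx); ring.
  apply: near_eq_is_derive E.
  have : \forall z \near x, z < 0 by exact: (cvgr_lt x cvg_id).
  by apply: filterS => z z0; rewrite ltr0_norm// addr0 mulN1r.
- have D : is_derive x 1 (fun y : R => y `^ (r + 1)) ((r + 1) * flux r x).
    by apply: (is_derive_eq (is_derive_powR r x0)); rewrite flux_gt0E.
  apply: near_eq_is_derive D.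
  have : \forall z \near x, 0 < z by exact: (cvgr_gt x cvg_id).
  by apply: filterS => z z0; rewrite gtr0_norm.
have F0 : flux r 0 = 0 by rewrite /flux mulr0.
rewrite F0 mulr0; apply/is_derive1_caratheodory; exists (flux r); split => //.
  move=> z; rewrite normr0 (@powR0 _ (r + 1)); last by rewrite gt_eqF// addr_gt0.
  rewrite !subr0 powRS// -[in LHS](subrK 1 r).
  have [->|z0] := eqVneq z 0; first by rewrite F0 normr0 mulr0 mul0r.
  rewrite powRD ?normr_eq0 ?z0 ?implybT// powRr1// /flux -!mulrA; congr (_ * _).
  by rewrite -!expr2 real_normK ?num_real.
exact: flux_cont0.
Qed.

Lemma flux_mono r x (y : R) : 0 < r -> x <= y -> flux r x <= flux r y.
Proof.
move=> r0; have pos (a b : R) : 0 <= a -> a <= b -> flux r a <= flux r b.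
  move=> a0 ab; have [b0|b0] := ltP 0 b; last first.
    by have -> : a = b by apply/eqP; rewrite eq_le ab (le_trans b0).
  have [->|an] := eqVneq a 0; first by rewrite flux0 flux_gt0E// powR_ge0.
  rewrite !flux_gt0E//; last by rewrite lt_neqAle eq_sym an.
  by apply: ge0_ler_powR; rewrite ?nnegrE ?(ltW r0) ?(ltW b0).
have [x0|/ltW x0] := leP 0 x; first exact: pos.
have [y0|/ltW y0] := leP 0 y => xy.
  apply: (@le_trans _ _ 0); last by rewrite -(flux0 r) pos.
  by rewrite -oppr_ge0 -fluxN -(flux0 r) pos// oppr_ge0.
by rewrite -lerN2 -!fluxN pos// ?oppr_ge0// lerN2.
Qed.

Lemma flux_convex r (x y : R) : 0 < r ->
  `|x| `^ (r + 1) - `|y| `^ (r + 1) <= (r + 1) * flux r x * (x - y).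
Proof.
move=> r0; have r1 : 0 < r + 1 by rewrite addr_gt0.
have [c [c1 c2 ->]] := mvt y x (fun z => is_derive_abs_powR z r0).
have [yx|/ltW xy] := leP y x.
  rewrite ler_wpM2r ?subr_ge0// ler_pM2l// flux_mono//.
  by move: c2; rewrite (max_idPr yx).
rewrite ler_wnM2r ?subr_le0// ler_pM2l// flux_mono//.
by move: c1; rewrite (min_idPr xy).
Qed.

Lemma fluxK r (x : R) : 0 < r -> flux r^-1 (flux r x) = x.
Proof.
move=> r0; have pos (y : R) : 0 < y -> flux r^-1 (flux r y) = y.
  by move=> y0; rewrite (flux_gt0E _ y0) flux_gt0E ?powR_gt0// powRK// ltW.
have [x0|x0|->] := ltgtP x 0; [|exact: pos|by rewrite !flux0].
have nx : 0 < - x by rewrite oppr_gt0.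
by have := pos _ nx; rewrite !fluxN => /oppr_inj.
Qed.

Lemma norm_flux_pow r (x : R) : 0 < r -> `|flux r x| `^ (r^-1 + 1) = `|x| `^ (r + 1).
Proof.
move=> r0; rewrite norm_flux_gen// -powRrM mulrDr mulr1 mulfV ?gt_eqF// addrC//.
Qed.

End PowDeriv.

(** * Supremum of the slope by interpolation *)

Section SupFlux.
Variable R : realType.
Local Notation mu := (leb1 R).

(** With [J = \int |W| |g|] and [N^(2p) = 2 J], the supremum of [|W|] is at most [N^p]. Then
    [\int W^2 <= N^(p - 1) y], and Cauchy-Schwarz gives [N^(4p) = 4 J^2 <= 4 N^(p - 1) y \int g^2].
    Since [W] is the flux of [h], [N] bounds [|h|] almost everywhere. *)
Lemma sup_flux p (W g h : R -> R) : 1 < p -> ac W g -> measurable_fun setT h ->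
  {ae mu, forall x, flux p (h x) = W x} ->
  L1 mu (fun x => `|h x| `^ (p + 1)) -> L1 mu (fun x => g x ^+ 2) ->
  exists N, [/\ 0 <= N, forall x, `|W x| <= N `^ p, L1 mu (fun x => `|W x| * `|g x|),
    I mu (fun x => `|W x| * `|g x|) = (N `^ p) ^+ 2 / 2 &
    N `^ (3 * p + 1) <= 4 * I mu (fun x => g x ^+ 2) * I mu (fun x => `|h x| `^ (p + 1))].
Proof.
move=> p1 aW mh hW ly lg; have p0 : 0 < p by rewrite (lt_trans _ p1).
pose r := p^-1 + 1; set y := I mu (fun x => `|h x| `^ _); set G := I mu (fun x => g x ^+ 2).
have mW := ac_measU aW; have mg := ac_meas aW.
have pv0 : 0 < p^-1 by rewrite invr_gt0.
have pv1 : p^-1 < 1 by rewrite invf_lt1.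
have r1 : 1 <= r by rewrite /r; lra.
have r2 : r <= 2 by rewrite /r; lra.
have lW : L1 mu (fun x => `|W x| `^ r).
  apply: (@L1_aeeq _ _ _ mu _ _ (measurable_absX r mW) _ ly).
  by apply: (ae_imp hW) => x <-; rewrite norm_flux_pow.
have IW : I mu (fun x => `|W x| `^ r) = y.
  apply: (@I_aeeq _ _ _ mu _ _ (measurable_absX r mW) (measurable_absX _ mh)).
  by apply: (ae_imp hW) => x <-; rewrite norm_flux_pow.
have lg2 : L1 mu (fun x => `|g x| `^ 2) by apply: eq_L1 lg => x; rewrite sqr_powR.
have two1 : (1 : R) <= 2 by rewrite ler1n.
have WM := ac_sup_gen two1 r1 aW lW (lexx _) lg2 (lexx _).
set MW := 2 + _ + _ in WM.
have Wle B x : 0 <= B -> (forall x, `|W x| <= B) -> `|W x| ^+ 2 <= B `^ (2 - r) * `|W x| `^ r.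
  move=> B0 HB; have r0 : 0 < r by apply: lt_le_trans r1.
  have [->|Wn] := eqVneq (W x) 0.
    by rewrite normr0 (powR0 (lt0r_neq0 r0)) mulr0 expr0n.
  have -> : `|W x| ^+ 2 = `|W x| `^ (2 - r) * `|W x| `^ r.
    by rewrite -powRD ?normr_eq0 ?Wn ?implybT// subrK powR_mulrn.
  rewrite ler_wpM2r ?powR_ge0//.
  by apply: ge0_ler_powR; rewrite ?nnegrE ?subr_ge0.
have M0 : 0 <= MW by exact: le_trans (WM 0).
have lW2 : L1 mu (fun x => `|W x| ^+ 2).
  apply: L1_le (L1Z (MW `^ (2 - r)) lW).
    by apply: measurable_funX; exact: measurableT_comp.
  by move=> x; rewrite ger0_norm ?sqr_ge0// Wle.
have maW : measurable_fun setT (fun x => `|W x|) by exact: measurableT_comp.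
have mag : measurable_fun setT (fun x => `|g x|) by exact: measurableT_comp.
have lag : L1 mu (fun x => `|g x| ^+ 2) by apply: eq_L1 lg => x; rewrite real_normK ?num_real.
have [lWg CS] := @cauchy_schwarz _ _ _ mu _ _ maW mag lW2 lag.
have Gag : I mu (fun x => `|g x| ^+ 2) = G by apply: eq_I => x; rewrite real_normK ?num_real.
have fW e x : 0 < e -> exists2 a, a <= x & `|W a| <= e.
  by apply: (@far_small _ r) => //; lra.
have SP := @sup_pow _ W g 1 aW fW lWg.
set J := I mu (fun x => `|W x| * `|g x|) in CS SP *.
have J0 : 0 <= J by apply: I_ge0 => x; rewrite mulr_ge0.
have S0 : 0 <= 2 * J by rewrite mulr_ge0.
have p20 : 0 < 2 * p by rewrite mulr_gt0.
have [N N0 N2] : exists2 N, 0 <= N & N `^ (2 * p) = 2 * J.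
  by exists ((2 * J) `^ (2 * p)^-1); [exact: powR_ge0|exact: powRVK].
have Np2 : (N `^ p) ^+ 2 = 2 * J.
  by rewrite -N2 -(powR_mulrn 2 (powR_ge0 N p)) -powRrM [p * _]mulrC.
have WN x : `|W x| <= N `^ p.
  by rewrite -(@ler_pXn2r _ 2) ?nnegrE ?normr_ge0 ?powR_ge0// Np2; exact: SP.
exists N; split; [exact: N0|exact: WN|exact: lWg|by rewrite Np2 mulrC mulKf|].
(* [|W|^r] is [|h|^(p + 1)] for [r = 1/p + 1], and the excess power satisfies
   [p (2 - r) = p - 1]. *)
have NW : I mu (fun x => `|W x| ^+ 2) <= N `^ (p - 1) * y.
  have -> : N `^ (p - 1) = (N `^ p) `^ (2 - r).
    by rewrite -powRrM; congr (_ `^ _); rewrite /r; field; rewrite gt_eqF.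
  rewrite -IW -IZ//; apply: I_le => //; first exact: L1Z.
  by move=> x; apply: Wle => //; exact: powR_ge0.
have y0 : 0 <= y by apply: I_ge0 => x; exact: powR_ge0.
have G0 : 0 <= G by apply: I_ge0 => x; exact: sqr_ge0.
have [->|Nn] := eqVneq N 0.
  by rewrite powR0 ?mulr_ge0// gt_eqF// addr_gt0// mulr_gt0.
have Np : 0 < N by rewrite lt_neqAle eq_sym Nn.
rewrite -(ler_pM2r (powR_gt0 (p - 1) Np)) -powRD ?Nn ?implybT//.
have -> : 3 * p + 1 + (p - 1) = (2 * p) * 2%:R by ring.
rewrite powRrM N2 powR_mulrn// exprMn.
have : J ^+ 2 <= N `^ (p - 1) * y * G.
  by apply: le_trans CS _; rewrite Gag ler_wpM2r.
have -> : 2 ^+ 2 = 4 :> R by ring.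
move=> H; have -> : 4 * G * y * N `^ (p - 1) = 4 * (N `^ (p - 1) * y * G) by ring.
by rewrite ler_wpM2l.
Qed.

End SupFlux.

(** * Localized slope energy *)

Section SlopeEnergy.
Variable R : realType.
Local Notation mu := (leb1 R).
Local Notation mu2 := (leb2 R).

(** Young's inequality for [N] with exponent [3p + 1] and [c^(3p) = (4 D / m) y^2]: this level turns
    the second term into exactly [m G], and [c y] is the power [1 + 2/(3p)] of [y] up to a
    constant. *)
Lemma interp p m N y G D : 1 < p -> 0 < m -> 0 <= N -> 0 <= y -> 0 <= G -> 0 <= D ->
  N `^ (3 * p + 1) <= 4 * G * y ->
  D * N * y <= m * G + D * (4 * D / m) `^ (3 * p)^-1 * y `^ (1 + 2 / (3 * p)) :> R.
Proof.
move=> p1 m0 N0 y0 G0 D0 H; have p0 : 0 < p by rewrite (lt_trans _ p1).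
have p3 : 0 < 3 * p by rewrite mulr_gt0.
have R0 : 0 <= m * G + D * (4 * D / m) `^ (3 * p)^-1 * y `^ (1 + 2 / (3 * p)).
  by apply: addr_ge0; apply: mulr_ge0; rewrite ?powR_ge0 ?(ltW m0)//; apply: mulr_ge0 => //; exact: powR_ge0.
have [->|Dn] := eqVneq D 0.
  by rewrite !mul0r addr0 mulr_ge0// ltW.
have [yz|yn] := eqVneq y 0; first by move: R0; rewrite yz mulr0.
have Dp : 0 < D by rewrite lt_neqAle eq_sym Dn.
have yp : 0 < y by rewrite lt_neqAle eq_sym yn.
pose E := 4 * D / m; have E0 : 0 < E by rewrite divr_gt0// mulr_gt0.
pose c := (E * y ^+ 2) `^ (3 * p)^-1.
have Ey : 0 < E * y ^+ 2 by rewrite mulr_gt0// exprn_gt0.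
have c0 : 0 < c by exact: powR_gt0.
have cE : c `^ (3 * p) = E * y ^+ 2 by apply: powRVK => //; exact: ltW.
have cy : c * y = E `^ (3 * p)^-1 * y `^ (1 + 2 / (3 * p)).
  rewrite /c (powRM _ (ltW E0) (sqr_ge0 _)) -(powR_mulrn 2 y0) -powRrM -mulrA; congr (_ * _).
  by rewrite addrC powRS// ?divr_gt0//.
have Y := young1 p3 c0 N0.
have : D * y * N <= D * y * (c + (c `^ (3 * p))^-1 * (4 * G * y)).
  rewrite ler_wpM2l ?mulr_ge0// (le_trans Y)// lerD2l ler_wpM2l// invr_ge0 ltW// cE//.
have -> : D * N * y = D * y * N by ring.
move=> /le_trans; apply; rewrite cE -/E -[X in _ <= _ + X]mulrA -cy.
rewrite le_eqVlt; apply/orP; left; apply/eqP; rewrite /E; field.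
by rewrite !gt_eqF.
Qed.

Variables (p mv : R) (f1 f2 : R -> R) (M : R) (v ux gx : R -> R -> R).
Hypotheses (p1 : 1 < p) (mv0 : 0 < mv) (S : sol p mv f1 f2 M v ux gx).
Variables (K F2 : R).
Hypotheses (F20 : 0 <= F2) (HF2 : forall w, `|w| <= K -> `|f2 w| <= F2).
Hypothesis vK : forall t, 0 <= t -> {ae mu, forall x, `|v t x| <= K}.
Variables (c c' : nat -> R -> R) (k : R).
Hypothesis F : cutoff_family c c' k.

Let p0 : 0 < p. Proof. exact: lt_trans p1. Qed.
Let pv0 : 0 < p^-1. Proof. by rewrite invr_gt0. Qed.
Let k0 : 0 <= k. Proof. exact: le_trans (cf_0 F 0 0) (cf_K F 0 0). Qed.

Definition slope t := I mu (fun x => `|ux t x| `^ (p + 1)).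
Definition slope2 t := I mu (fun x => gx t x ^+ 2).
(** The constant of [interp] for [m = mv] and [D = k * F2], the size of the convection term after
    integration by parts. *)
Definition slope_cst : R := k * F2 * (4 * (k * F2) / mv) `^ (3 * p)^-1.
Local Notation sigma := (2 / (3 * p)).

Lemma slope_ge0 t : 0 <= slope t.
Proof. by apply: I_ge0 => x; exact: powR_ge0. Qed.

Lemma slope2_ge0 t : 0 <= slope2 t.
Proof. by apply: I_ge0 => x; exact: sqr_ge0. Qed.

(* Minus the derivative of [c n * flux p ux], the gradient of the localized slope
   energy. *)
Definition mult n t x := - (c n x * gx t x + c' n x * flux p (ux t x)).

(* The convection term is integrated by parts: [|flux p ux|^(1/p + 1)], that is
   [|ux|^(p + 1)], is absolutely continuous with derivative [(1/p + 1) ux gx]. *)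
Lemma slope_flux : exists2 F1, 0 <= F1 & forall n t, 0 <= t -> good_time p v ux gx t ->
  L1 mu (fun x => mult n t x * rhs mv f1 v ux gx t x) ->
  I mu (fun x => mult n t x * rhs mv f1 v ux gx t x) <=
  - mv * I mu (fun x => c n x * gx t x ^+ 2) + (mv * slope2 t + slope_cst * slope t `^ (1 + sigma)) +
  k / n.+1%:R * (mv * (1 + 4 * slope2 t * slope t) + 2 * F1 * slope t).
Proof.
have cf1 := is_derive_cont (s_f1 S).
have [F1 F10 HF1] := cont_bnd (- M) M cf1; exists F1 => // n t t0 G lF.
have [[U aU vU] [W aW fW] ly lg] := G.
have mux := measurable_slice t (s_mux S).
have [N [N0 WN lWg IWg Nb]] := sup_flux p1 aW mux fW ly lg.
set y := slope t; set g2 := slope2 t.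
have y0 : 0 <= y := slope_ge0 t.
have g0 : 0 <= g2 := slope2_ge0 t.
have Nb' : N `^ (3 * p + 1) <= 4 * g2 * y by exact: Nb.
pose kn := k / n.+1%:R.
have kn0 : 0 <= kn by rewrite divr_ge0.
have cc := is_derive_cont (cf_d F n).
have mc : measurable_fun setT (c n) by exact: continuous_measurable_fun.
have ac_c := ac_C1 (cf_d F n) (@cf_c _ _ _ _ F n).
have ac_f := ac_chain (s_f1 S) (s_f2 S) aU.
have cfl : continuous (fun z : R => (p^-1 + 1) * flux p^-1 z).
  by move=> z; apply: cvgM; [exact: cvg_cst|exact: flux_cont].
have ac_Y := ac_chain (fun z => is_derive_abs_powR z pv0) cfl aW.
have aG := acM ac_c (acM ac_f ac_Y).
have out x : 2 * n.+1%:R <= `|x| -> c n x = 0 /\ c' n x = 0.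
  by move=> h; rewrite (@cf_s _ _ _ _ F n)// (@cf_s' _ _ _ _ F n).
have [lG IG] := ac_supp (L := 2 * n.+1%:R) aG
  (fun x h => etrans (congr1 (fun z => z * _) (out x h).1) (mul0r _))
  (fun x h => etrans (congr2 (fun z z' => z * _ + z' * _) (out x h).2 (out x h).1)
     (etrans (congr2 +%R (mul0r _) (mul0r _)) (addr0 0))).
set Gf := (fun x : R => c' n x * _ + _) in lG IG.
have lcg : L1 mu (fun x => c n x * gx t x ^+ 2).
  apply: L1_le (L1Z k lg); first by apply: measurable_funM => //; exact: L1_meas lg.
  move=> x; rewrite normrM (ger0_norm (cf_0 F n x)) (ger0_norm (sqr_ge0 _)) ler_wpM2r ?sqr_ge0//.
  exact: cf_K F _ _.
(* Since [r * (p^-1 + 1) = 1], adding [r * Gf], whose integral is 0, cancels the product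
   [c * f1 v * ux * gx]; in its place remain terms with [c'] and one with [f2 v * ux]. *)
pose r := (p^-1 + 1)^-1.
have p11 : 0 < p^-1 + 1 by rewrite addr_gt0.
have r0 : 0 < r by rewrite invr_gt0.
have r1 : r <= 1 by rewrite invf_le1// lerDr ltW.
(* The terms with [c'] cost at most [2 kn F1] and the one with [f2] at most [k F2 N], each times
   [|ux|^(p + 1)]; [N] bounds [|ux|]. *)
pose A := 2 * kn * F1 + k * F2 * N.
have lA := L1Z A ly; have lB := L1Z (kn * mv) lWg; have lC := L1Z (- mv) lcg; have lD := L1Z r lG.
apply: (@le_trans _ _ (I mu (fun x => (- mv * (c n x * gx t x ^+ 2) + r * Gf x) +
   (A * `|ux t x| `^ (p + 1) + kn * mv * (`|W x| * `|gx t x|))))).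
  apply: I_aele => //; first exact: L1D (L1D lC lD) (L1D lA lB).
  apply: (ae_imp3 vU fW (vK t0)) => x vx fx vKx.
  have uN : `|ux t x| <= N.
    have h : `|ux t x| `^ p <= N `^ p by rewrite -norm_flux// fx.
    by rewrite -(powRK (normr_ge0 (ux t x)) p0) -(powRK N0 p0) ge0_ler_powR ?nnegrE ?powR_ge0// ltW.
  rewrite /Gf -vx -fx (norm_flux_pow _ p0) (fluxK _ p0) /mult /rhs norm_flux//.
  have hY : ux t x * flux p (ux t x) = `|ux t x| `^ (p + 1) by exact: flux_mul.
  have b1 := HF1 (v t x).
  have bf1 : `|f1 (v t x)| <= F1.
    by have := s_M S t x; rewrite ler_norml => /andP[h1 h2]; exact: HF1.
  have bf2 : `|f2 (v t x)| <= F2 by exact: HF2.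
  have bc' := cf_b F n x; have bc0 := cf_0 F n x; have bck := cf_K F n x.
  have nfl : `|flux p (ux t x)| = `|ux t x| `^ p by exact: norm_flux.
  set Y := _ `^ (p + 1) in hY *; have Y0 : 0 <= Y by exact: powR_ge0.
  set a1 := f1 _ in bf1 *; set a2 := f2 _ in bf2 *.
  set w := ux t x in uN hY nfl *; set fl := flux p w in hY nfl *; set g := gx t x.
  have e1 : `|c' n x * (a1 * Y)| <= kn * F1 * Y.
    by rewrite !normrM mulrA (ger0_norm Y0) ler_wpM2r//; apply: ler_pM.
  have e2 : `|c n x * (a2 * w * Y)| <= k * F2 * N * Y.
    rewrite !normrM (ger0_norm bc0) (ger0_norm Y0) !mulrA ler_wpM2r//.
    by rewrite ler_pM ?mulr_ge0// ler_pM.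
  have e3 : `|c' n x * (fl * g)| <= kn * (`|w| `^ p * `|g|).
    by rewrite (normrM (c' n x)) (normrM fl) nfl ler_wpM2r// mulr_ge0// powR_ge0.
  move: e1 e2 e3; rewrite !ler_norml => /andP[e1l e1u] /andP[e2l e2u] /andP[e3l e3u].
  have rE : r * (p^-1 + 1) = 1 by rewrite mulVf// gt_eqF.
  have e3m := ler_wpM2l (ltW mv0) e3l.
  have e4 : (1 - r) * (c' n x * (a1 * Y)) <= kn * F1 * Y.
    have h0 : 0 <= kn * F1 * Y by rewrite !mulr_ge0.
    have r1' : 0 <= 1 - r by rewrite subr_ge0.
    by apply: le_trans (ler_wpM2l r1' e1u) _; rewrite ler_piMl// lerBlDr lerDl ltW.
  have e5 : - r * (c n x * (a2 * w * Y)) <= k * F2 * N * Y.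
    have h0 : 0 <= k * F2 * N * Y by rewrite !mulr_ge0.
    rewrite mulNr -mulrN; move: e2l; rewrite lerNl => e2l.
    by apply: le_trans (ler_wpM2l (ltW r0) e2l) _; rewrite ler_piMl.
  have e6 : 0 <= kn * F1 * Y by rewrite !mulr_ge0.
  have -> : r * (c' n x * (a1 * Y) + c n x * (a2 * w * Y + a1 * ((p^-1 + 1) * w * g))) =
     r * (c' n x * (a1 * Y)) + r * (c n x * (a2 * w * Y)) + r * (p^-1 + 1) * (c n x * a1 * w * g) by ring.
  have hY' : c' n x * a1 * (w * fl) = c' n x * a1 * Y by rewrite hY.
  rewrite rE mul1r /A; move: hY' e3m e4 e5 e6; clear; lra.
rewrite (ID (L1D lC lD) (L1D lA lB)) (ID lC lD) (ID lA lB) (IZ _ lcg) (IZ _ lG) (IZ _ ly) (IZ _ lWg).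
rewrite IG mulr0 addr0 -addrA lerD2l -/y IWg /A -/kn.
have h1 : k * F2 * N * y <= mv * g2 + slope_cst * y `^ (1 + sigma).
  by apply: (interp p1 mv0 N0 y0 g0 _ Nb'); rewrite mulr_ge0.
have h2 : (N `^ p) ^+ 2 <= 1 + 4 * g2 * y.
  have [N1|/ltW N1] := leP N 1.
    apply: (@le_trans _ _ 1); last by rewrite lerDl !mulr_ge0.
    have one : (1 : R) `^ p = 1 by rewrite powR1.
    rewrite expr_le1 ?powR_ge0// -[leRHS]one.
    by apply: ge0_ler_powR; rewrite ?nnegrE ?(ltW p0).
  apply: (@le_trans _ _ (N `^ (3 * p + 1))); last by rewrite (le_trans Nb')// lerDr.
  rewrite -(powR_mulrn 2 (powR_ge0 N p)) -powRrM; apply: ler_powR => //.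
  by move: p0; lra.
have h3 : kn * mv * ((N `^ p) ^+ 2 / 2) <= kn * (mv * (1 + 4 * g2 * y)).
  rewrite -mulrA ler_wpM2l// ler_wpM2l ?(ltW mv0)// ler_pdivrMr//.
  by apply: le_trans h2 _; rewrite ler_peMr ?ler1n// addr_ge0// !mulr_ge0.
rewrite -/kn -/g2.
move: h1 h3; set Z := slope_cst * _; set X := (N `^ p) ^+ 2 / 2 => h1 h3.
by rewrite -[I mu _]/y; lra.
Qed.


Lemma measurable_mult n : measurable_fun setT (fun z : R * R => mult n z.1 z.2).
Proof.
have mc : measurable_fun setT (c n) by exact: continuous_measurable_fun (is_derive_cont (cf_d F n)).
have mc' : measurable_fun setT (c' n) by exact: continuous_measurable_fun (@cf_c _ _ _ _ F n).
have mfl : measurable_fun setT (flux (R := R) p) by exact: continuous_measurable_fun (flux_cont p0).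
apply: measurableT_comp => //; apply: measurable_funD; apply: measurable_funM.
- by apply: (measurableT_comp mc); exact: measurable_snd.
- exact: s_mgx S.
- by apply: (measurableT_comp mc'); exact: measurable_snd.
- exact: (measurableT_comp mfl (s_mux S)).
Qed.

Lemma slope_L1 : L1 mu slope /\ L1 mu slope2.
Proof. by split; [exact: fubini_L1 (s_y S)|exact: fubini_L1 (s_g S)]. Qed.

Lemma mult_out n t x : ~~ ((- (2 * n.+1%:R) < x) && (x <= 2 * n.+1%:R)) -> mult n t x = 0.
Proof.
move=> H; have Lx : 2 * n.+1%:R <= `|x|.
  move: H; rewrite negb_and -!leNgt -ltNge => /orP[H|/ltW H].
    by rewrite -normrN (le_trans _ (ler_norm _))// lerNr.
  by rewrite (le_trans H)// ler_norm.
by rewrite /mult (@cf_s _ _ _ _ F n)// (@cf_s' _ _ _ _ F n)// !mul0r addr0 oppr0.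
Qed.

(** [energy] asks for a square integrable gradient. The flux part is bounded by [N^p] on the support
    of the cutoff, and [N^(2p) <= 1 + N^(3p + 1)] is controlled by [sup_flux]. *)
Lemma mult_L2 n t : good_time p v ux gx t ->
  L1 mu (fun x => mult n t x ^+ 2) /\
  I mu (fun x => mult n t x ^+ 2) <=
  2 * (k ^+ 2 * slope2 t) + 2 * ((k / n.+1%:R) ^+ 2 * (1 + 4 * slope2 t * slope t) * (4 * n.+1%:R)).
Proof.
move=> [_ [W aW fW] ly lg].
have mux := measurable_slice t (s_mux S).
have [N [N0 WN _ _ Nb]] := sup_flux p1 aW mux fW ly lg.
have y0 := slope_ge0 t; have g0 := slope2_ge0 t.
have h2 : (N `^ p) ^+ 2 <= 1 + 4 * slope2 t * slope t.
  have [N1|/ltW N1] := leP N 1.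
    apply: (@le_trans _ _ 1); last by rewrite lerDl !mulr_ge0.
    have one : (1 : R) `^ p = 1 by rewrite powR1.
    rewrite expr_le1 ?powR_ge0// -[leRHS]one.
    by apply: ge0_ler_powR; rewrite ?nnegrE ?(ltW p0).
  apply: (@le_trans _ _ (N `^ (3 * p + 1))); last by rewrite (le_trans Nb)// lerDr.
  rewrite -(powR_mulrn 2 (powR_ge0 N p)) -powRrM; apply: ler_powR => //.
  by move: p0; lra.
pose L : R := 2 * n.+1%:R.
have LL : - L <= L by rewrite -subr_ge0 opprK addr_ge0// mulr_ge0.
have [li ii] := I_ind LL.
set Z := 1 + _ in h2 *; pose D := (k / n.+1%:R) ^+ 2 * Z.
have kn0 : 0 <= k / n.+1%:R by rewrite divr_ge0.
have b : {ae mu, forall x, `|mult n t x ^+ 2| <= 2 * (k ^+ 2 * gx t x ^+ 2) + 2 * D * ind (- L) L x}.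
  apply: (ae_imp fW) => x fx; rewrite ger0_norm ?sqr_ge0//.
  have [H|H] := boolP ((- L < x) && (x <= L)); last first.
    rewrite mult_out// (indF H) mulr0 addr0 expr0n/=.
    by apply: mulr_ge0 => //; apply: mulr_ge0; exact: sqr_ge0.
  case/andP: H => x1 x2; rewrite indT// mulr1 /mult sqrrN.
  have e1 : (c n x * gx t x) ^+ 2 <= k ^+ 2 * gx t x ^+ 2.
    rewrite exprMn ler_wpM2r ?sqr_ge0// lerXn2r ?nnegrE//; [exact: cf_0 F _ _|exact: cf_K F _ _].
  have e2 : (c' n x * flux p (ux t x)) ^+ 2 <= D.
    rewrite -[leLHS]real_normK ?num_real// normrM exprMn /D fx.
    apply: ler_pM; rewrite ?sqr_ge0//.
      by rewrite lerXn2r ?nnegrE//; exact: cf_b F _ _.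
    by apply: le_trans h2; rewrite lerXn2r ?nnegrE ?powR_ge0.
  by move: e1 e2; have := sqr_ge0 (c n x * gx t x - c' n x * flux p (ux t x)); nra.
have lb := L1D (L1Z 2 (L1Z (k ^+ 2) lg)) (L1Z (2 * D) li).
have mm : measurable_fun setT (fun x => mult n t x ^+ 2).
  by apply: measurable_funX; exact: measurable_slice (measurable_mult n).
have lm := @L1_aele _ _ _ mu _ _ mm b lb.
split => //; apply: le_trans (@I_aele _ _ _ mu _ _ lm lb _) _.
  by apply: (ae_imp b) => x; apply: le_trans; exact: ler_norm.
rewrite (ID (L1Z 2 (L1Z (k ^+ 2) lg)) (L1Z (2 * D) li)) (IZ _ (L1Z _ lg)) (IZ _ lg) (IZ _ li) ii.
by rewrite lerD2l /D /L le_eqVlt; apply/orP; left; apply/eqP; ring.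
Qed.

(** Convexity of [|.|^(p + 1)] at the later slope, the difference of slopes being integrated by
    parts against [c * flux]. The earlier slope is a separate [hs], so that the initial time, at
    which [ux] is set to 0, is covered by the slope of the datum. *)
Lemma slope_step n t s (hs Us : R -> R) : good_time p v ux gx t -> ac Us hs -> {ae mu, forall x, v s x = Us x} ->
  measurable_fun setT (v s) ->
  L1 mu (fun x => c n x * `|ux t x| `^ (p + 1)) -> L1 mu (fun x => c n x * `|hs x| `^ (p + 1)) ->
  (p + 1)^-1 * I mu (fun x => c n x * `|ux t x| `^ (p + 1)) -
  (p + 1)^-1 * I mu (fun x => c n x * `|hs x| `^ (p + 1)) <=
  I mu (fun x => mult n t x * (v t x - v s x)).
Proof.
move=> [[U aU vU] [W aW fW] ly lg] aUs vUs mvs lt_ ls.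
have p10 : 0 < p + 1 by rewrite addr_gt0.
have mvt := measurable_slice t (s_mv S).
have cc := is_derive_cont (cf_d F n).
have ac_c := ac_C1 (cf_d F n) (@cf_c _ _ _ _ F n).
have aD : ac (fun x => U x - Us x) (fun x => ux t x - hs x).
  by apply: (ac_ext (acD aU (acZ (-1) aUs))) => x; rewrite mulN1r.
have aG := acM (acM ac_c aW) aD.
have out x : 2 * n.+1%:R <= `|x| -> c n x = 0 /\ c' n x = 0.
  by move=> h; rewrite (@cf_s _ _ _ _ F n)// (@cf_s' _ _ _ _ F n).
have P1 x : 2 * n.+1%:R <= `|x| -> c n x * W x * (U x - Us x) = 0.
  by move=> /out[-> _]; rewrite !mul0r.
have P2 x : 2 * n.+1%:R <= `|x| ->
    (c' n x * W x + c n x * gx t x) * (U x - Us x) + c n x * W x * (ux t x - hs x) = 0.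
  by move=> /out[-> ->]; rewrite !(mul0r, addr0).
have [lG IG] := ac_supp aG P1 P2.
have aP := acM ac_c aW.
have cP : continuous (fun x => U x - Us x) := ac_cont aD.
have LL : - (2 * n.+1%:R) <= 2 * n.+1%:R :> R by rewrite -subr_ge0 opprK addr_ge0// mulr_ge0.
have lM : L1 mu (fun x => (U x - Us x) * (c' n x * W x + c n x * gx t x)).
  have [C C0 HC] := cont_bnd (- (2 * n.+1%:R)) (2 * n.+1%:R) cP.
  apply: (L1_le _ _ (L1Z C (L1_abs (aP _ _ LL).1))).
    by apply: measurable_funM; [exact: ac_measU aD|exact: ac_meas aP].
  move=> x; rewrite [`|ind _ _ _ * _|]normrM (ger0_norm (ind_ge0 _ _ _)).
  have [H|H] := boolP ((- (2 * n.+1%:R) < x) && (x <= 2 * n.+1%:R)).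
    by case/andP: H => h1 h2; rewrite indT// mul1r normrM ler_wpM2r// HC// ltW.
  rewrite (indF H); have Lx : 2 * n.+1%:R <= `|x|.
    move: H; rewrite negb_and -!leNgt -ltNge => /orP[H|/ltW H].
      by rewrite -normrN (le_trans _ (ler_norm _))// lerNr.
    by rewrite (le_trans H)// ler_norm.
  by have [-> ->] := out x Lx; rewrite !mul0r addr0 mulr0 normr0 mulr0.
have mm := measurable_slice t (measurable_mult n).
have E : I mu (fun x => mult n t x * (v t x - v s x)) =
   I mu (fun x => - ((U x - Us x) * (c' n x * W x + c n x * gx t x))).
  apply: (@I_aeeq _ _ _ mu).
  - by apply: measurable_funM => //; exact: measurable_funB.
  - by apply: measurableT_comp => //; exact: L1_meas lM.
  - by apply: (ae_imp3 vU vUs fW) => x -> -> fx; rewrite /mult fx; ring.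
rewrite E -(IZ _ lt_) -(IZ _ ls) -(IB (L1Z _ lt_) (L1Z _ ls)).
rewrite -[leRHS]addr0 -IG -(ID (L1N lM) lG).
apply: I_aele; [exact: L1B (L1Z _ lt_) (L1Z _ ls)|exact: L1D (L1N lM) lG|].
apply: (ae_imp fW) => x fx /=.
have -> : - ((U x - Us x) * (c' n x * W x + c n x * gx t x)) +
   ((c' n x * W x + c n x * gx t x) * (U x - Us x) + c n x * W x * (ux t x - hs x)) =
   c n x * (flux p (ux t x) * (ux t x - hs x)) by rewrite fx; ring.
rewrite -mulrBr -mulrBr mulrCA ler_wpM2l//; first exact: cf_0 F _ _.
by rewrite ler_pdivrMl// mulrA; exact: flux_convex.
Qed.

End SlopeEnergy.

(** * Integral inequality for the slope *)

Section SlopeIneq.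
Variable R : realType.
Local Notation mu := (leb1 R).
Local Notation mu2 := (leb2 R).
Variables (p mv : R) (f1 f2 : R -> R) (M : R) (v ux gx : R -> R -> R).
Hypotheses (p1 : 1 < p) (mv0 : 0 < mv) (S : sol p mv f1 f2 M v ux gx).
Variables (K F2 : R).
Hypotheses (F20 : 0 <= F2) (HF2 : forall w, `|w| <= K -> `|f2 w| <= F2).
Hypothesis vK : forall t, 0 <= t -> {ae mu, forall x, `|v t x| <= K}.
Variables (c c' : nat -> R -> R) (k : R).
Hypothesis F : cutoff_family c c' k.
Local Notation slope := (slope p ux).
Local Notation slope2 := (slope2 gx).
Local Notation mult := (mult p ux gx c c').
Local Notation sigma := (2 / (3 * p)).
Local Notation A1 := (slope_cst p mv F2 k).

Let p0 : 0 < p. Proof. exact: lt_trans p1. Qed.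
Let p10 : 0 < p + 1. Proof. by rewrite addr_gt0. Qed.
Let k0 : 0 <= k. Proof. exact: le_trans (cf_0 F 0 0) (cf_K F 0 0). Qed.
Let mc n : measurable_fun setT (c n).
Proof. by exact: continuous_measurable_fun (is_derive_cont (cf_d F n)). Qed.

Let L1_cut n (h : R -> R) : L1 mu (fun x => `|h x| `^ (p + 1)) ->
  L1 mu (fun x => c n x * `|h x| `^ (p + 1)) /\
  I mu (fun x => c n x * `|h x| `^ (p + 1)) <= k * I mu (fun x => `|h x| `^ (p + 1)).
Proof.
move=> l; have b x : c n x * `|h x| `^ (p + 1) <= k * `|h x| `^ (p + 1).
  by rewrite ler_wpM2r ?powR_ge0//; exact: cf_K F _ _.
have l' : L1 mu (fun x => c n x * `|h x| `^ (p + 1)).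
  apply: L1_le (L1Z k l); first by apply: measurable_funM; [exact: mc|exact: L1_meas l].
  by move=> x; rewrite ger0_norm// mulr_ge0 ?powR_ge0//; exact: cf_0 F _ _.
by split => //; rewrite -IZ//; apply: I_le => //; exact: L1Z.
Qed.

Let cut_cvg (h : R -> R) : L1 mu (fun x => `|h x| `^ (p + 1)) ->
  I mu (fun x => c n x * `|h x| `^ (p + 1)) @[n --> \oo] --> I mu (fun x => `|h x| `^ (p + 1)).
Proof.
move=> l; apply: (dct _ _ _ (L1Z k l) _).2.
- by move=> n; exact: L1_meas (L1_cut n l).1.
- exact: L1_meas l.
- apply: aeW => x; rewrite -[X in _ --> X]mul1r; apply: cvgMl; exact: cf_1 F x.
- move=> n; apply: aeW => x; rewrite normrM (ger0_norm (cf_0 F n _)) (ger0_norm (powR_ge0 _ _)).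
  by rewrite ler_wpM2r ?powR_ge0//; exact: cf_K F _ _.
Qed.

Lemma slope_bound : exists2 Y, 0 <= Y & {ae mu, forall t, 0 < t -> slope t <= Y}.
Proof.
have [Y HY] := s_yb S; exists `|Y| => //; apply: (ae_imp HY) => t H t0.
exact: le_trans (H t0) (ler_norm Y).
Qed.

Lemma L1_slope_pow a b : 0 <= a -> L1 mu (fun t => ind a b t * slope t `^ (1 + sigma)).
Proof.
move=> a0; have [Y Y0 HY] := slope_bound; have [lY _] := slope_L1 S.
have s0 : 0 < sigma by rewrite divr_gt0// mulr_gt0.
apply: (L1_aele _ _ (L1Z (Y `^ sigma) lY)).
  apply: measurable_funM; first exact: measurable_ind.
  by apply: (measurableT_comp (@measurable_powR R _)); exact: L1_meas lY.
apply: (ae_imp HY) => t Ht; have y0 := slope_ge0 p ux t.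
have R0 : 0 <= Y `^ sigma * slope t by rewrite mulr_ge0 ?powR_ge0.
rewrite normrM (ger0_norm (ind_ge0 _ _ _)) (ger0_norm (powR_ge0 _ _)).
have [H|H] := boolP ((a < t) && (t <= b)); last by rewrite (indF H) mul0r.
case/andP: H => at_ tb; rewrite (indT at_ tb) mul1r addrC powRS// ler_wpM2r//.
by apply: ge0_ler_powR; rewrite ?nnegrE ?(ltW s0)// Ht// (le_lt_trans a0).
Qed.

(** The dissipation enters with the cutoff and a minus sign, the part spent by [interp] without
    cutoff and with a plus sign; they cancel as the cutoff tends to 1. The inequality holds for
    almost every [b], those being Lebesgue points of the localized energies. *)
Lemma slope_ineq a (ha Ua : R -> R) : 0 <= a -> ac Ua ha -> {ae mu, forall x, v a x = Ua x} ->
  L1 mu (fun x => `|ha x| `^ (p + 1)) ->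
  {ae mu, forall b, a < b -> slope b <= I mu (fun x => `|ha x| `^ (p + 1)) +
    (p + 1) * A1 * I mu (fun t => ind a b t * slope t `^ (1 + sigma))}.
Proof.
move=> a0 aUa vUa lha; have [Y Y0 HY] := slope_bound; have [lY lG] := slope_L1 S.
have [F1 F10 HF] := slope_flux p1 mv0 S F20 HF2 vK F.
pose q n (h : R -> R) := (p + 1)^-1 * I mu (fun x => c n x * `|h x| `^ (p + 1)).
(* At and before [a] the energy is that of the prescribed slope [ha], which makes [Q] constant there
   and gives [a = 0] a meaning. *)
pose Q n t := if t <= a then q n ha else q n (ux t).
have Qca n t : t <= a -> Q n t = Q n a by move=> ta; rewrite /Q ta lexx.
have mQ n : measurable_fun setT (Q n).
  apply: measurable_fun_ifT.
  - by apply: measurable_fun_ler => //; exact: measurable_cst.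
  - exact: measurable_cst.
  - apply: measurable_funM; first exact: measurable_cst.
    apply: (@measurable_I1 _ _ _ _ _ mu (fun z => c n z.2 * `|ux z.1 z.2| `^ (p + 1))).
    apply: measurable_funM; first by apply: (measurableT_comp (mc n)); exact: measurable_snd.
    exact: L1_meas (s_y S).
have lQ n : locL1 (Q n).
  move=> s t st; have [li _] := I_ind st.
  apply: (L1_aele _ _ (L1D (L1Z `|q n ha| li) (L1Z ((p + 1)^-1 * k) lY))).
    by apply: measurable_funM; [exact: measurable_ind|exact: mQ].
  apply: (ae_imp (fubini_ae1 (s_y S))) => r lr.
  have y0 := slope_ge0 p ux r.
  have ks0 : 0 <= (p + 1)^-1 * k * slope r by rewrite !mulr_ge0// invr_ge0 ltW.
  have qr : `|q n (ux r)| <= (p + 1)^-1 * k * slope r.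
    rewrite ger0_norm; last first.
      rewrite mulr_ge0 ?invr_ge0 ?(ltW p10)//; apply: I_ge0 => x.
      by rewrite mulr_ge0 ?powR_ge0//; exact: cf_0 F _ _.
    by rewrite /q -mulrA ler_wpM2l ?invr_ge0 ?(ltW p10)//; exact: (L1_cut n lr).2.
  rewrite normrM (ger0_norm (ind_ge0 _ _ _)) /Q /=; case: ifP => _.
    by rewrite mulrC lerDl.
  apply: (@le_trans _ _ `|q n (ux r)|); first by rewrite ler_piMl// ind_le1.
  by apply: le_trans qr _; rewrite lerDr mulr_ge0// ind_ge0.
(* [Q n] is not continuous, so the convergence of its averages is taken from Lebesgue
   differentiation, for all [n] off one null set. *)
have leb : {ae mu, forall b, forall n,
    (m.+1%:R^-1)^-1 * I mu (fun t => ind (b - m.+1%:R^-1) b t * Q n t) @[m --> \oo] --> Q n b}.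
  apply/ae_foralln => n; apply: (ae_imp (ae_deriv (lQ n))) => b Hb.
  by apply: (Hb (fun m => m.+1%:R^-1)) => [m|]; [rewrite invr_gt0|exact: cvg_harmonic].
apply: (ae_imp3 leb (s_good S) HY) => b Qb gb _ ab.
have b0 := le_lt_trans a0 ab; have {}gb := gb b0.
have aLb := ltW ab; have [li ii] := I_ind aLb.
have lP := L1_slope_pow b a0.
have lG' := L1_indM a b lG; have lY' := L1_indM a b lY.
set P := I mu (fun t => ind a b t * slope t `^ _).
pose Er t := mv * (ind a b t + 4 * Y * (ind a b t * slope2 t)) + 2 * F1 * (ind a b t * slope t).
have lEr : L1 mu Er := L1D (L1Z mv (L1D li (L1Z (4 * Y) lG'))) (L1Z (2 * F1) lY').
pose Dz n z := ind a b z.1 * (c n z.2 * gx z.1 z.2 ^+ 2).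
have mi : measurable_fun setT (fun z : R * R => ind a b z.1) by exact: measurable_ind.
have lg0 : L1 mu2 (fun z => ind a b z.1 * gx z.1 z.2 ^+ 2).
  apply: L1_le (L1_abs (s_g S)); first by apply: measurable_funM; [exact: mi|exact: L1_meas (s_g S)].
  by move=> z; rewrite normrM (ger0_norm (ind_ge0 _ _ _)) ler_piMl// ind_le1.
have bD n z : `|Dz n z| <= k * (ind a b z.1 * gx z.1 z.2 ^+ 2).
  rewrite /Dz ger0_norm; last first.
    by apply: mulr_ge0; [exact: ind_ge0|apply: mulr_ge0; [exact: cf_0 F _ _|exact: sqr_ge0]].
  rewrite [leRHS]mulrCA; apply: ler_wpM2l; first exact: ind_ge0.
  by apply: ler_wpM2r; [exact: sqr_ge0|exact: cf_K F _ _].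
have lD n : L1 mu2 (Dz n).
  apply: (@L1_le _ _ _ mu2 (Dz n) _ _ (bD n) (L1Z k lg0)).
  apply: measurable_funM; first exact: mi.
  apply: measurable_funM; last exact: L1_meas (s_g S).
  by apply: (measurableT_comp (mc n)); exact: measurable_snd.
have cD : I mu2 (Dz n) @[n --> \oo] --> I mu2 (fun z => ind a b z.1 * gx z.1 z.2 ^+ 2).
  apply: (dct _ _ _ (L1Z k lg0) _).2.
  - by move=> n; exact: L1_meas (lD n).
  - exact: L1_meas lg0.
  - apply: aeW => z; apply: cvgM; first exact: cvg_cst.
    by rewrite -[X in _ --> X]mul1r; apply: cvgMl; exact: cf_1 F z.2.
  - by move=> n; apply: aeW => z; exact: bD.
have IG : I mu2 (fun z => ind a b z.1 * gx z.1 z.2 ^+ 2) = I mu (fun t => ind a b t * slope2 t).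
  rewrite (fubini_I lg0); apply: (@I_aeeq _ _ _ mu).
  - exact: L1_meas (fubini_L1 lg0).
  - exact: L1_meas lG'.
  - by apply: (ae_imp (fubini_ae1 (s_g S))) => t lt_ /=; rewrite IZ.
have key n : Q n b - Q n a <= - mv * I mu2 (Dz n) +
    (mv * I mu (fun t => ind a b t * slope2 t) + A1 * P) + k / n.+1%:R * I mu Er.
  pose Bz t x := ind a b t * mult n t x.
  have mm : measurable_fun setT (fun z : R * R => mult n z.1 z.2) by exact: (measurable_mult p1 S F).
  have mB : measurable_fun setT (fun z : R * R => Bz z.1 z.2) by apply: measurable_funM; [exact: mi|exact: mm].
  have B0 t x : ~~ ((a < t) && (t <= b)) -> Bz t x = 0 by move=> H; rewrite /Bz indF// mul0r.
  have BL t x : ~~ ((- (2 * n.+1%:R) < x) && (x <= 2 * n.+1%:R)) -> Bz t x = 0.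
    by move=> H; rewrite /Bz (mult_out p ux gx F _ H) mulr0.
  have lB : L1 mu2 (fun z => Bz z.1 z.2 ^+ 2).
    have mB2 : measurable_fun setT (fun z : R * R => Bz z.1 z.2 ^+ 2) by exact: measurable_funX.
    pose kn := k / n.+1%:R.
    pose Bd t := 2 * (k ^+ 2 * slope2 t) +
      (2 * kn ^+ 2 * (4 * n.+1%:R)) * (ind a b t + 4 * Y * slope2 t).
    have lBd : L1 mu Bd := L1D (L1Z 2 (L1Z (k ^+ 2) lG)) (L1Z (2 * kn ^+ 2 * (4 * n.+1%:R)) (L1D li (L1Z (4 * Y) lG))).
    have ind2 t : ind a b t ^+ 2 = ind a b t by rewrite expr2 ind_idem.
    have ae1 : {ae mu, forall t, L1 mu (fun x => Bz t x ^+ 2) /\ `|I mu (fun x => Bz t x ^+ 2)| <= Bd t}.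
      apply: (ae_imp2 (s_good S) HY) => t gt_ Yt.
      have g0 := slope2_ge0 gx t; have y0 := slope_ge0 p ux t.
      have [H|H] := boolP ((a < t) && (t <= b)); last first.
        have E x : 0 = Bz t x ^+ 2 by rewrite B0// expr0n.
        split; first exact: (@eq_L1 _ _ _ mu _ _ E (L1_0 mu)).
        rewrite -(@eq_I _ _ _ mu _ _ E) I_0 normr0 /Bd addr_ge0//.
          by rewrite mulr_ge0// mulr_ge0// sqr_ge0.
        by rewrite mulr_ge0 ?addr_ge0 ?ind_ge0// !mulr_ge0// ?sqr_ge0.
      case/andP: H => at_ tb; have t0 := le_lt_trans a0 at_.
      have E x : mult n t x ^+ 2 = Bz t x ^+ 2 by rewrite /Bz indT// mul1r.
      have [l i] := mult_L2 p1 S F n (gt_ t0).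
      split; first exact: (@eq_L1 _ _ _ mu _ _ E l).
      rewrite -(@eq_I _ _ _ mu _ _ E) ger0_norm; last by apply: I_ge0 => x; exact: sqr_ge0.
      apply: le_trans i _; rewrite lerD2l (indT at_ tb) -/kn.
      have -> : 2 * (kn ^+ 2 * (1 + 4 * slope2 t * slope t) * (4 * n.+1%:R)) =
        2 * kn ^+ 2 * (4 * n.+1%:R) * (1 + 4 * slope t * slope2 t) by ring.
      rewrite ler_wpM2l//; first by rewrite !mulr_ge0// sqr_ge0.
      by rewrite lerD2l ler_wpM2r// ler_wpM2l// Yt.
    apply: tonelli_L1 => //.
    - by move=> z; exact: sqr_ge0.
    - by apply: (ae_imp ae1) => t [].
    - apply: (@L1_aele _ _ _ mu _ _ _ _ lBd).
        exact: (@measurable_I1 _ _ _ _ _ mu (fun z => Bz z.1 z.2 ^+ 2)).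
      by apply: (ae_imp ae1) => t [].
  have HQ t s : a < t -> t <= b -> a <= s -> s <= t -> good_time p v ux gx t -> good_time p v ux gx s \/ s = a ->
     Q n t - Q n s <= I mu (fun x => Bz t x * (v t x - v s x)).
    move=> at_ tb as_ st gt_ Gs.
    have E x : mult n t x * (v t x - v s x) = Bz t x * (v t x - v s x) by rewrite /Bz indT// mul1r.
    have Qt : Q n t = q n (ux t) by rewrite /Q leNgt at_.
    rewrite -(@eq_I _ _ _ mu _ _ E) Qt.
    have lt_ := (L1_cut n (gt_y gt_)).1.
    have mvs := measurable_slice s (s_mv S).
    rewrite /Q; case: ifPn => [sa|]; last first.
      rewrite -ltNge => as'; case: Gs => [gs|sa]; last by move: as'; rewrite sa ltxx.
      have [[Us aUs vUs] _ lys _] := gs.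
      exact: (slope_step p1 S F gt_ aUs vUs mvs lt_ (L1_cut n lys).1).
    have sE : s = a by apply/eqP; rewrite eq_le sa as_.
    move: mvs; rewrite sE => mvs.
    exact: (slope_step p1 S F gt_ aUa vUa mvs lt_ (L1_cut n lha).1).
  have [l i] := energy p1 S a0 ab mB B0 BL lB (lQ n) (Qca n) (Qb n) (s_good S) HQ.
  apply: le_trans i _; rewrite (fubini_I l) (fubini_I (lD n)).
  have lDt := fubini_L1 (lD n).
  pose Rh t := (- mv * I mu (fun x => Dz n (t, x)) + (mv * (ind a b t * slope2 t) +
    A1 * (ind a b t * slope t `^ (1 + sigma)))) + k / n.+1%:R * Er t.
  have lR1 := L1D (L1Z mv lG') (L1Z A1 lP).
  have lRh : L1 mu Rh := L1D (L1D (L1Z (- mv) lDt) lR1) (L1Z (k / n.+1%:R) lEr).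
  apply: (@le_trans _ _ (I mu Rh)); last first.
    rewrite (ID (L1D (L1Z (- mv) lDt) lR1) (L1Z (k / n.+1%:R) lEr)) (ID (L1Z (- mv) lDt) lR1).
    by rewrite (ID (L1Z mv lG') (L1Z A1 lP)) (IZ _ lDt) (IZ _ lG') (IZ _ lP) (IZ _ lEr).
  apply: I_aele => //; first exact: fubini_L1 l.
  apply: (ae_imp3 (fubini_ae1 l) HY (s_good S)) => t lt_ Yt gt_ /=.
  have [H|H] := boolP ((a < t) && (t <= b)); last first.
    rewrite (@eq_I _ _ _ mu _ (fun=> 0)); last by move=> x; rewrite B0// mul0r.
    rewrite I_0 /Rh (@eq_I _ _ _ mu _ (fun=> 0)); last by move=> x; rewrite /Dz indF// mul0r.
    by rewrite I_0 /Er (indF H) !(mul0r, mulr0, addr0).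
  case/andP: H => at_ tb; have t0 := le_lt_trans a0 at_.
  have i1 : ind a b t = 1 by rewrite indT.
  have E1 x : Bz t x * rhs mv f1 v ux gx t x = mult n t x * rhs mv f1 v ux gx t x.
    by rewrite /Bz i1 mul1r.
  have E2 x : Dz n (t, x) = c n x * gx t x ^+ 2 by rewrite /Dz i1 mul1r.
  rewrite /Rh (@eq_I _ _ _ mu _ _ E1) (@eq_I _ _ _ mu _ _ E2) /Er i1 !mul1r.
  have l1 := @eq_L1 _ _ _ mu _ _ E1 lt_.
  apply: le_trans (HF n t (ltW t0) (gt_ t0) l1) _.
  rewrite lerD2l; apply: ler_wpM2l; first by rewrite divr_ge0.
  rewrite lerD2r; apply: ler_wpM2l; first exact: ltW.
  rewrite lerD2l; have -> : 4 * slope2 t * slope t = 4 * slope t * slope2 t by ring.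
  by rewrite ler_wpM2r ?slope2_ge0// ler_wpM2l// Yt.
have cQ h : L1 mu (fun x => `|h x| `^ (p + 1)) -> q n h @[n --> \oo] -->
    (p + 1)^-1 * I mu (fun x => `|h x| `^ (p + 1)).
  by move=> lh; apply: cvgM; [exact: cvg_cst|exact: cut_cvg].
have Qbb n : Q n b = q n (ux b) by rewrite /Q leNgt ab.
have Qaa n : Q n a = q n ha by rewrite /Q lexx.
have ch : k / n.+1%:R * I mu Er @[n --> \oo] --> k * 0 * I mu Er.
  by apply: cvgMl; apply: cvgMr; exact: cvg_harmonic.
have Lim := cvgB (cvgB (cQ _ (gt_y gb)) (cQ _ lha))
  (cvgD (cvgD (cvgM (cvg_cst (- mv)) cD) (cvg_cst (mv * I mu (fun t => ind a b t * slope2 t) + A1 * P))) ch).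
(* The limit of [key]: the first and second terms in the bracket cancel, and the last one is 0. *)
have : (p + 1)^-1 * slope b - (p + 1)^-1 * I mu (fun x => `|ha x| `^ (p + 1)) -
   (- mv * I mu (fun t => ind a b t * slope2 t) + (mv * I mu (fun t => ind a b t * slope2 t) + A1 * P) + k * 0 * I mu Er) <= 0.
  rewrite -{1}IG; apply: (@cvg_le_cst _ (fun n => q n (ux b) - q n ha - (- mv * I mu2 (Dz n) +
    (mv * I mu (fun t => ind a b t * slope2 t) + A1 * P) + k / n.+1%:R * I mu Er))).
    exact: Lim.
  by move=> n; rewrite subr_le0 -Qbb -Qaa key.
set X := (p + 1)^-1 * slope b; set Z := (p + 1)^-1 * _ => H.
have H2 : X <= Z + A1 * P.
  by rewrite -subr_le0; apply: le_trans H; rewrite le_eqVlt; apply/orP; left; apply/eqP; ring.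
have := ler_wpM2l (ltW p10) H2; rewrite /X mulVKf ?gt_eqF// mulrDr /Z mulVKf ?gt_eqF//.
by rewrite mulrA.
Qed.

End SlopeIneq.

(** * Nonlinear Gronwall inequality on windows *)

Section Bihari.
Variable R : realType.
Local Notation mu := (leb1 R).
Variables (y : R -> R) (C1 s : R).
Hypotheses (C10 : 0 <= C1) (s1 : 1 <= s) (y0 : forall t, 0 <= y t) (ly : L1 mu y)
  (lys : forall a b, 0 <= a -> L1 mu (fun t => ind a b t * y t `^ s)).

(** The majorant [Phi = m + C1 \int_a y^s] is continuous. If it exceeded [2 m], it would equal [2 m]
    at some [x]; up to [x] then [y <= 2 m], so [Phi x <= m + C1 h (2 m)^s < 2 m]. *)
Lemma window a m h Y : 0 <= a -> 0 < m -> 0 < h -> Y <= m ->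
  {ae mu, forall b, a < b -> y b <= Y + C1 * I mu (fun t => ind a b t * y t `^ s)} ->
  C1 * h * (2 * m) `^ s < m ->
  {ae mu, forall b, a < b -> b <= a + h -> y b <= 2 * m}.
Proof.
move=> a0 m0 h0 Ym H Hm.
pose g t := ind a (a + h) t * y t `^ s.
have lg : L1 mu g := lys (a + h) a0.
have g0 t : 0 <= g t by rewrite mulr_ge0 ?ind_ge0 ?powR_ge0.
have aH : ac (prim g) g by apply: ac_prim => u w _; exact: L1_indM.
have cH := ac_cont aH.
have IE b : a <= b -> b <= a + h -> I mu (fun t => ind a b t * y t `^ s) = prim g b - prim g a.
  move=> ab bh; rewrite (ac_I aH ab); apply: eq_I => t.
  by rewrite /g mulrA ind_sub.
have mono u w : u <= w -> prim g u <= prim g w.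
  move=> uw; rewrite -subr_ge0 (ac_I aH uw); apply: I_ge0 => t.
  by rewrite mulr_ge0// ind_ge0.
have claim b : a < b -> b <= a + h -> m + C1 * (prim g b - prim g a) <= 2 * m.
  move=> ab bh; rewrite leNgt; apply/negP => big.
  pose Phi x := m + C1 * (prim g x - prim g a).
  have cPhi : {within `[a, b], continuous Phi}.
    apply: continuous_subspaceT => x; apply: cvgD; first exact: cvg_cst.
    apply: cvgM; first exact: cvg_cst.
    by apply: cvgB; [exact: cH|exact: cvg_cst].
  have Pa : Phi a = m by rewrite /Phi subrr mulr0 addr0.
  have [|x] := IVT (ltW ab) cPhi (v := 2 * m).
    rewrite Pa; have mP : m <= Phi b by rewrite /Phi lerDl mulr_ge0// subr_ge0 mono// ltW.
    by rewrite (min_idPl mP) (max_idPr mP) (ltW big) andbT; lra.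
  rewrite in_itv/= => /andP[ax xb] Px.
  have xh := le_trans xb bh.
  have [li ii] := I_ind ax.
  have : I mu (fun t => ind a x t * y t `^ s) <= (2 * m) `^ s * (x - a).
    rewrite -ii -IZ//; apply: I_aele; [exact: lys|exact: L1Z|apply: (ae_imp H) => r Hr].
    rewrite mulrC /ind; case: ifP => [/andP[ar rx]|_]; last by rewrite !mulr0.
    rewrite !mulr1; apply: ge0_ler_powR; rewrite ?nnegrE ?y0//; [exact: le_trans s1|by rewrite mulr_ge0// ltW|].
    apply: le_trans (Hr ar) _.
    rewrite IE ?(ltW ar)//; last by rewrite (le_trans rx).
    rewrite -Px /Phi; apply: lerD => //; apply: ler_wpM2l => //.
    by rewrite lerD2r mono.
  rewrite IE// => Hx.
  have e1 : C1 * (prim g x - prim g a) <= C1 * h * (2 * m) `^ s.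
    rewrite -mulrA; apply: ler_wpM2l => //; apply: le_trans Hx _.
    by rewrite mulrC ler_wpM2r ?powR_ge0//; lra.
  by move: Px e1 Hm; rewrite /Phi; set Z := C1 * (_ - _); set W := C1 * h * _; lra.
apply: (ae_imp H) => b Hb ab bh.
apply: le_trans (Hb ab) _; rewrite (IE _ (ltW ab) bh).
by apply: le_trans (claim b ab bh); rewrite lerD2r.
Qed.

Hypothesis start : {ae mu, forall a, 0 < a -> {ae mu, forall b, a < b ->
  y b <= y a + C1 * I mu (fun t => ind a b t * y t `^ s)}}.

(** If [y] exceeded [m = 4 kap / h] at almost all times of the half window before [tau], its
    integral would be at least [2 kap]. So a starting time [a] with [y a <= m] exists there, and the
    window of length [h] from [a] covers []tau, tau + h / 2]]. *)
Lemma window_avg tau h kap : 0 < h -> h <= tau -> 0 < kap ->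
  I mu (fun t => ind (tau - h / 2) tau t * y t) <= kap ->
  C1 * h * (8 * kap / h) `^ s < 4 * kap / h ->
  {ae mu, forall b, tau < b -> b <= tau + h / 2 -> y b <= 8 * kap / h}.
Proof.
move=> h0 ht k0 Ik Hm.
pose m := 4 * kap / h.
have m0 : 0 < m by rewrite divr_gt0// mulr_gt0.
have m2 : 2 * m = 8 * kap / h by rewrite /m; field; rewrite gt_eqF.
have h20 : 0 < h / 2 by rewrite divr_gt0.
have th : tau - h / 2 <= tau by rewrite lerBlDr lerDl ltW.
have th0 : 0 <= tau - h / 2.
  by rewrite subr_ge0 (le_trans _ ht)// ler_pdivrMr// ler_peMr ?(ltW h0)// ler1n.
have [li ii] := I_ind th.
have [a [aI Ga Ya]] : exists a, [/\ tau - h / 2 < a < tau, {ae mu, forall b, a < b ->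
    y b <= y a + C1 * I mu (fun t => ind a b t * y t `^ s)} & y a <= m].
  apply: contrapT => HN.
  have : m * (h / 2) <= kap.
    have hh : tau - (tau - h / 2) = h / 2 by rewrite opprB addrCA subrr addr0.
    apply: le_trans Ik; rewrite -[X in m * X]hh -ii -IZ//; apply: I_aele; [exact: L1Z|exact: L1_indM|].
    apply: (ae_imp2 start (ae_neq tau)) => t St tn.
    have [/andP[t1 t2]|H] := boolP ((tau - h / 2 < t) && (t <= tau)); last first.
      by rewrite (indF H) mulr0 mul0r.
    rewrite (indT t1 t2) mulr1 mul1r leNgt; apply/negP => yt; apply: HN; exists t; split.
    - by rewrite t1 lt_neqAle tn t2.
    - by apply: St; exact: le_lt_trans th0 t1.
    - exact: ltW.
  have -> : m * (h / 2) = 2 * kap by rewrite /m; field; rewrite gt_eqF.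
  by move: k0; lra.
case/andP: aI => a1 a2.
have a0 : 0 <= a by rewrite (le_trans th0)// ltW.
have Hm' : C1 * h * (2 * m) `^ s < m by rewrite m2.
have W := window a0 m0 h0 Ya Ga Hm'.
apply: (ae_imp W) => b Hb tb bh; rewrite -m2; apply: Hb.
  exact: lt_trans tb.
apply: le_trans bh _; rewrite -lerBlDr.
have -> : tau + h / 2 - h = tau - h / 2 by field.
exact: ltW.
Qed.

End Bihari.

Section BihariDecay.
Variable R : realType.
Local Notation mu := (leb1 R).

Lemma powR_anti (x y r : R) : 0 < x -> x <= y -> 0 <= r -> y `^ (- r) <= x `^ (- r).
Proof.
move=> x0 xy r0; have y0 := lt_le_trans x0 xy; rewrite !powRN.
rewrite lef_pV2 ?posrE ?powR_gt0//; apply: ge0_ler_powR => //; rewrite ?nnegrE ltW//.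
Qed.

(** Division of the smallness condition by [4 kap / h] isolates the quantity [kap^sg * h^(1 - sg)],
    which has to stay bounded as time grows. *)
Lemma window_cond (C1 sg h kap : R) : 0 < h -> 0 < kap -> 0 < sg ->
  C1 * 2 * ((8 * kap) `^ sg * h `^ (1 - sg)) < 1 ->
  C1 * h * (8 * kap / h) `^ (1 + sg) < 4 * kap / h.
Proof.
move=> h0 k0 s0 H; have kh : 0 < 4 * kap / h by rewrite divr_gt0// mulr_gt0.
have kh8 : 0 <= 8 * kap / h by rewrite ltW// divr_gt0// mulr_gt0.
have E : h * (8 * kap / h) `^ sg = (8 * kap) `^ sg * h `^ (1 - sg).
  have k8 : 0 <= 8 * kap by rewrite mulr_ge0// ltW.
  have hi : 0 <= h^-1 by rewrite invr_ge0 ltW.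
  rewrite (powRM _ k8 hi) mulrCA; congr (_ * _).
  rewrite -(powR_inv1 (ltW h0)) -powRrM mulN1r -{1}(powRr1 (ltW h0)) -powRD//.
  by rewrite (gt_eqF h0) implybT.
rewrite addrC (powRS kh8 s0).
have -> : C1 * h * ((8 * kap / h) `^ sg * (8 * kap / h)) =
   C1 * 2 * (h * (8 * kap / h) `^ sg) * (4 * kap / h) by field; rewrite gt_eqF.
by rewrite E -[ltRHS]mul1r ltr_pM2r.
Qed.

(** Three kinds of windows cover all times: growing ones around [tau >= 1] give the rate, ones of
    fixed length bound [y] from [c1] on, and the one starting at 0 uses the initial bound [Y0]. *)
Lemma bihari_decay (p C1 Y0 Kk : R) : 1 < p -> 0 <= C1 -> 0 <= Y0 -> 0 < Kk ->
  exists2 C, 0 < C & forall y : R -> R, (forall t, 0 <= y t) -> L1 mu y ->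
  (forall a b, 0 <= a -> L1 mu (fun t => ind a b t * y t `^ (1 + 2 / (3 * p)))) ->
  {ae mu, forall a, 0 < a -> {ae mu, forall b, a < b ->
    y b <= y a + C1 * I mu (fun t => ind a b t * y t `^ (1 + 2 / (3 * p)))}} ->
  {ae mu, forall b, 0 < b ->
    y b <= Y0 + C1 * I mu (fun t => ind 0 b t * y t `^ (1 + 2 / (3 * p)))} ->
  (forall a b, 0 <= a -> a <= b -> I mu (fun t => ind a b t * y t) <= Kk * (1 + a) `^ (- (1 / (2 * p)))) ->
  {ae mu, forall t, 0 < t -> y t <= C * (1 + t) `^ (- (3 / (2 * (3 * p - 2))))}.
Proof.
move=> p1 C10 Y00 Kk0; have p0 : 0 < p by rewrite (lt_trans _ p1).
have p32 : 0 < 3 * p - 2 by lra.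
set sg := 2 / (3 * p); set s := 1 + sg; set bt := 1 / (2 * p); set e := 3 / _.
have p3 : 0 < 3 * p by rewrite mulr_gt0.
have sg0 : 0 < sg by rewrite divr_gt0.
have sg1 : sg < 1 by rewrite ltr_pdivrMr// mul1r; lra.
have e0 : 0 < e by rewrite divr_gt0// mulr_gt0.
have bt0 : 0 < bt by rewrite divr_gt0// mulr_gt0.
have s1 : 1 <= s by rewrite lerDl ltW.
have sg1' : 0 < 1 - sg by rewrite subr_gt0.
(* The solution of [bt * sg = th * (1 - sg)]: for averages of size [tau^(-bt)] and windows of length
   [tau^th] the smallness condition does not depend on [tau]. The rate is [e = bt + th]. *)
pose th := 1 / (p * (3 * p - 2)).
have pp : 0 < p * (3 * p - 2) by rewrite mulr_gt0.
have th0 : 0 < th by rewrite divr_gt0.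
have th1 : th <= 1.
  by rewrite ler_pdivrMr// mul1r; nra.
(* The averages start at [tau - h / 2 >= tau / 2], which costs the factor [2^bt]. *)
pose K2 := Kk * 2 `^ bt.
have K20 : 0 < K2 by rewrite mulr_gt0// powR_gt0.
have KK2 : Kk <= K2.
  rewrite ler_peMr ?(ltW Kk0)//; have one : (2 : R) `^ 0 = 1 by rewrite powRr0.
  by rewrite -[X in X <= _]one; apply: ler_powR; rewrite ?ler1n// ltW.
pose B := C1 * 2 * (8 * K2) `^ sg + 1.
have B0 : 0 < B by rewrite ltr_wpDl// !mulr_ge0// powR_ge0.
(* [B * c0 `^ (1 - sg) < 1] is the hypothesis of [window_cond] for the windows
   of length [c0 * tau `^ th] and the average [K2 * tau `^ (- bt)]. *)
pose c0 := Num.min 1 ((2 * B)^-1 `^ (1 - sg)^-1).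
have c00 : 0 < c0 by rewrite lt_min ltr01 powR_gt0// invr_gt0 mulr_gt0.
have c01 : c0 <= 1 by rewrite ge_min lexx.
have c0B : B * c0 `^ (1 - sg) < 1.
  apply: (@le_lt_trans _ _ (B * (2 * B)^-1)); last first.
    have -> : B * (2 * B)^-1 = 2^-1 by field; rewrite gt_eqF.
    by rewrite invf_lt1// ltr1n.
  apply: ler_wpM2l; first exact: ltW.
  rewrite -[leRHS](@powRVK _ _ (1 - sg)) ?invr_ge0 ?mulr_ge0 ?(ltW B0)//.
  apply: ge0_ler_powR; rewrite ?nnegrE ?(ltW sg1') ?(ltW c00) ?powR_ge0//.
  by rewrite ge_min lexx orbT.
have B1 (kap h : R) : 0 < h -> (8 * kap) `^ sg * h `^ (1 - sg) <= (8 * K2) `^ sg * c0 `^ (1 - sg) ->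
    C1 * 2 * ((8 * kap) `^ sg * h `^ (1 - sg)) < 1.
  move=> h0 H; apply: le_lt_trans c0B; apply: (@le_trans _ _ (C1 * 2 * ((8 * K2) `^ sg * c0 `^ (1 - sg)))).
    by apply: ler_wpM2l => //; rewrite mulr_ge0.
  by rewrite mulrA ler_wpM2r ?powR_ge0// /B lerDl.
pose m := Y0 + 1; have m0 : 0 < m by rewrite ltr_wpDl.
(* A length for which [window] applies from time 0 with a starting value at most [m]. *)
pose h0 := m / (C1 * (2 * m) `^ s + 1).
have D0 : 0 < C1 * (2 * m) `^ s + 1 by rewrite ltr_wpDl// mulr_ge0// powR_ge0.
have h00 : 0 < h0 by rewrite divr_gt0.
pose c1 := Num.min c0 (h0).
have c10 : 0 < c1 by rewrite lt_min c00.
have c1c0 : c1 <= c0 by rewrite ge_min lexx.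
have c1h0 : c1 <= h0 by rewrite ge_min lexx orbT.
have hm : C1 * c1 * (2 * m) `^ s < m.
  apply: (@le_lt_trans _ _ (C1 * (2 * m) `^ s * h0)).
    by rewrite mulrAC ler_wpM2l// mulr_ge0// powR_ge0.
  by rewrite /h0 mulrA ltr_pdivrMr// [ltRHS]mulrC ltr_pM2r// ltrDl.
(* [Cb] bounds [y] up to time 1, by the fixed windows or by the initial one. The factor [4^e] in
   [Ca] pays for [tau >= (1 + b) / 4]. *)
pose Cb := Num.max (8 * K2 / c1) (2 * m); pose Ca := 8 * K2 / c0 * 4 `^ e.
have Cb0 : 0 < Cb by rewrite lt_max divr_gt0// mulr_gt0.
have Ca0 : 0 < Ca by rewrite mulr_gt0 ?powR_gt0// divr_gt0// mulr_gt0.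
exists (Ca + Cb * 3 `^ e); first by rewrite addr_gt0// mulr_gt0// powR_gt0.
move=> y y0 ly lys st st0 Hk.
(* Windows are taken at rational [tau], so that a single null set serves all of them. *)
have W1 (q : rat) : {ae mu, forall b, 1 <= ratr q :> R -> ratr q < b ->
    b <= ratr q + c0 / 2 -> y b <= Ca * (1 + b) `^ (- e)}.
  have [t1|t1] := leP (1 : R) (ratr q); last first.
    have ff : forall b : R, false -> ratr q < b -> b <= ratr q + c0 / 2 -> y b <= Ca * (1 + b) `^ (- e) by [].
    by have : {ae mu, forall b : R, false -> ratr q < b -> b <= ratr q + c0 / 2 -> y b <= Ca * (1 + b) `^ (- e)}
      by exact: aeW.
  set tau : R := ratr q in t1 *; have t0 : 0 < tau by exact: lt_le_trans t1.
  pose h := c0 * tau `^ th; pose kap := K2 * tau `^ (- bt).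
  have tt := powR_gt0 th t0; have tb := powR_gt0 (- bt) t0.
  have hp : 0 < h by rewrite mulr_gt0.
  have kp : 0 < kap by rewrite mulr_gt0.
  have tt1 : 1 <= tau `^ th.
    have one : (1 : R) `^ th = 1 by rewrite powR1.
    by rewrite -[X in X <= _]one; apply: ge0_ler_powR; rewrite ?nnegrE ?(ltW th0) ?(ltW t0).
  have ttau : tau `^ th <= tau.
    by rewrite -[leRHS](powRr1 (ltW t0)); apply: ler_powR.
  have htau : h <= tau by apply: le_trans ttau; rewrite /h ler_piMl// ltW.
  have hc0 : c0 <= h by rewrite /h ler_peMr// ltW.
  have ht : tau - h / 2 <= tau by rewrite lerBlDr lerDl divr_ge0// ltW.
  have ht0 : tau / 2 <= tau - h / 2.
    rewrite lerBrDr -mulrDl ler_pdivrMr// mulr_natr mulr2n lerD2l//.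
  have tau20 : 0 < tau / 2 by rewrite divr_gt0.
  have Ik : I mu (fun t => ind (tau - h / 2) tau t * y t) <= kap.
    apply: le_trans (Hk _ _ (le_trans (ltW tau20) ht0) ht) _.
    rewrite /kap /K2 -mulrA; apply: ler_wpM2l; first exact: ltW.
    have -> : 2 `^ bt * tau `^ (- bt) = (tau / 2) `^ (- bt).
      rewrite (powRM _ (ltW t0)) ?invr_ge0// -(powR_inv1 (ler0n R 2)) -powRrM mulN1r opprK.
      exact: mulrC.
    apply: powR_anti => //; last exact: ltW.
    by apply: le_trans ht0 _; rewrite lerDr.
  have E8 : (8 * kap) `^ sg * h `^ (1 - sg) <= (8 * K2) `^ sg * c0 `^ (1 - sg).
    have k2 : 0 <= 8 * K2 by rewrite mulr_ge0// ltW.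
    rewrite /kap /h mulrA (powRM _ k2 (powR_ge0 _ _)) (powRM _ (ltW c00) (powR_ge0 _ _)) -!powRrM.
    have e0' : tau `^ (- bt * sg) * tau `^ (th * (1 - sg)) = 1.
      rewrite -powRD ?(gt_eqF t0) ?implybT//.
      have -> : - bt * sg + th * (1 - sg) = 0.
        by rewrite /th /bt /sg; field; rewrite !gt_eqF.
      by rewrite powRr0.
    by rewrite mulrACA e0' mulr1.
  have W := window_avg C10 s1 y0 ly lys st hp htau kp Ik (window_cond hp kp sg0 (B1 _ _ hp E8)).
  apply: (ae_imp W) => b Hb _ tb1 tb2.
  have bh : b <= tau + h / 2.
    by apply: le_trans tb2 _; rewrite lerD2l ler_pM2r ?invr_gt0.
  apply: le_trans (Hb tb1 bh) _.
  have -> : 8 * kap / h = 8 * K2 / c0 * tau `^ (- e).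
    have -> : - e = - bt - th by rewrite /e /bt /th; field; rewrite !gt_eqF.
    have cnd : (- bt - th == 0) ==> (tau != 0) by rewrite (gt_eqF t0) implybT.
    rewrite /kap /h (powRD cnd) (powRN _ th); field.
    by rewrite !gt_eqF.
  rewrite /Ca -(mulrA (8 * K2 / c0)); apply: ler_wpM2l; first by rewrite divr_ge0 ?mulr_ge0// ltW.
  have b4 : 0 <= (1 + b) / 4.
    by rewrite divr_ge0// addr_ge0// (le_trans (ltW t0))// ltW.
  have -> : 4 `^ e * (1 + b) `^ (- e) = ((1 + b) / 4) `^ (- e).
    have b1 : 0 <= 1 + b by rewrite addr_ge0// (le_trans (ltW t0))// ltW.
    rewrite (powRM _ b1) ?invr_ge0// -(powR_inv1 (ler0n R 4)) -powRrM mulN1r opprK.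
    exact: mulrC.
  apply: powR_anti; [|by clear -bh htau t1; lra|exact: ltW].
  by clear -t1 tb1; lra.
have W2 (q : rat) : {ae mu, forall b, c1 <= ratr q :> R -> ratr q < b ->
    b <= ratr q + c1 / 2 -> y b <= Cb}.
  have [t1|t1] := leP c1 (ratr q); last first.
    by have : {ae mu, forall b : R, false -> ratr q < b -> b <= ratr q + c1 / 2 -> y b <= Cb}
      by exact: aeW.
  set tau : R := ratr q in t1 *.
  have ht : tau - c1 / 2 <= tau by rewrite lerBlDr lerDl divr_ge0// ltW.
  have ht0 : 0 <= tau - c1 / 2 by clear -t1 c10; lra.
  have Ik : I mu (fun t => ind (tau - c1 / 2) tau t * y t) <= K2.
    apply: le_trans (Hk _ _ ht0 ht) _; apply: le_trans KK2.
    rewrite ler_piMr ?(ltW Kk0)//.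
    have one : (1 : R) `^ (- bt) = 1 by rewrite powR1.
    by rewrite -[leRHS]one; apply: powR_anti; rewrite ?lerDl ?(ltW bt0).
  have E8 : (8 * K2) `^ sg * c1 `^ (1 - sg) <= (8 * K2) `^ sg * c0 `^ (1 - sg).
    rewrite ler_wpM2l ?powR_ge0//.
    by apply: ge0_ler_powR; rewrite ?nnegrE ?(ltW sg1') ?(ltW c10) ?(ltW c00).
  have W := window_avg C10 s1 y0 ly lys st c10 t1 K20 Ik (window_cond c10 K20 sg0 (B1 _ _ c10 E8)).
  apply: (ae_imp W) => b Hb _ tb1 tb2.
  by apply: le_trans (Hb tb1 tb2) _; rewrite le_max lexx.
have Ym : Y0 <= m by rewrite lerDl.
have W3 := window C10 s1 y0 lys (lexx 0) m0 c10 Ym st0 hm.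
have A1 : {ae mu, forall b, forall q : rat, 1 <= ratr q :> R -> ratr q < b ->
    b <= ratr q + c0 / 2 -> y b <= Ca * (1 + b) `^ (- e)} by exact: ae_countable.
have A2 : {ae mu, forall b, forall q : rat, c1 <= ratr q :> R -> ratr q < b ->
    b <= ratr q + c1 / 2 -> y b <= Cb} by exact: ae_countable.
apply: (ae_imp3 A1 A2 W3) => t Ha Hb Hc t0.
have ye0 := powR_ge0 (1 + t) (- e).
have near (c : R) (d : R) : 0 < d -> c < t -> exists q : rat, [/\ c < ratr q, ratr q < t & t <= ratr q + d].
  move=> d0 ct; have lt1 : Num.max c (t - d) < t by rewrite gt_max ct ltrBlDr ltrDl.
  have [q] := rat_in_itvoo lt1; rewrite in_itv/= gt_max => /andP[/andP[q1 q2] q3].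
  by exists q; split => //; rewrite -lerBlDr ltW.
have [t1|t1] := ltP 1 t.
  have [q [q1 q2 q3]] := near 1 (c0 / 2) (divr_gt0 c00 (ltr0n R 2)) t1.
  apply: le_trans (Ha q (ltW q1) q2 q3) _.
  by rewrite ler_wpM2r// lerDl mulr_ge0 ?powR_ge0// ltW.
have yb : y t <= Cb.
  have [tc|tc] := ltP c1 t.
    have [q [q1 q2 q3]] := near c1 (c1 / 2) (divr_gt0 c10 (ltr0n R 2)) tc.
    exact: Hb q (ltW q1) q2 q3.
  by rewrite (le_trans (Hc t0 _)) ?add0r// le_max lexx orbT.
apply: le_trans yb _.
apply: (@le_trans _ _ (Cb * 3 `^ e * (1 + t) `^ (- e))); last first.
  by rewrite ler_wpM2r// lerDr ltW.
rewrite -mulrA ler_peMr ?(ltW Cb0)//.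
rewrite powRN ler_pdivlMr ?powR_gt0 ?addr_gt0// mul1r.
by apply: ge0_ler_powR; rewrite ?nnegrE ?(ltW e0)//; clear -t0 t1; lra.
Qed.

End BihariDecay.

(** * Decay of the slope and of the supremum *)

Section SlopeDecay.
Variable R : realType.
Local Notation mu := (leb1 R).
Local Notation mu2 := (leb2 R).
Variables (p mv : R) (f1 f2 : R -> R) (m K Y0 : R).
Hypotheses (p1 : 1 < p) (mv0 : 0 < mv) (m0 : 0 < m) (K0 : 0 <= K) (Y00 : 0 <= Y0).
Hypothesis cf2 : continuous f2.
Implicit Types (v ux gx : R -> R -> R) (t s M : R).

Let p0 : 0 < p. Proof. exact: lt_trans p1. Qed.

(** A solution whose initial data obey the bounds [m], [K], [Y0], on which alone, besides the
    equation, the constants below depend. The initial slope is a datum since [ux] carries no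
    information at time 0. *)
Record admissible M v ux gx : Prop := Admissible {
  ad_sol : sol p mv f1 f2 M v ux gx ;
  ad_L1 : L1 mu (v 0) ;
  ad_m : I mu (fun x => `|v 0 x|) <= m ;
  ad_K : {ae mu, forall x, `|v 0 x| <= K} ;
  ad_Y : exists U h, [/\ ac U h, {ae mu, forall x, v 0 x = U x},
    L1 mu (fun x => `|h x| `^ (p + 1)) & I mu (fun x => `|h x| `^ (p + 1)) <= Y0] }.

(** The entropy [v^2] has the second derivative 2, so its dissipation is the slope itself: the tail
    is controlled by [\int v(a)^2], which decays like [(1 + a)^(-1/(2p))]. *)
Lemma slope_integral : exists2 C, 0 < C & forall M v ux gx, admissible M v ux gx ->
  forall a b, 0 <= a -> a <= b ->
  I mu (fun t => ind a b t * slope p ux t) <= C * (1 + a) `^ (- (1 / (2 * p))).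
Proof.
have [C C0 HC] := even_decay f1 f2 p1 mv0 m0 K0 0.
exists (C / (2 * mv)); first by rewrite divr_gt0// mulr_gt0.
move=> M v ux gx [S l0 I0 Kv _] a b a0 ab.
have E := power_entropy p1 S mv0 0 a0 ab.
have D := HC M v ux gx S l0 I0 Kv a a0.
have lF := power_diss_L1 0 a b S.
have [lY _] := slope_L1 S.
have eF : I mu2 (fun z => ind a b z.1 * (0.*2.+2%:R * 0.*2.+1%:R * v z.1 z.2 ^+ 0.*2 * `|ux z.1 z.2| `^ (p + 1))) =
    2 * I mu (fun t => ind a b t * slope p ux t).
  rewrite (fubini_I lF) -IZ; last exact: L1_indM.
  apply: (@I_aeeq _ _ _ mu).
  - exact: L1_meas (fubini_L1 lF).
  - exact: L1_meas (L1Z 2 (L1_indM a b lY)).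
  - apply: (ae_imp (fubini_ae1 (s_y S))) => t lt_ /=.
    rewrite mulrCA /slope -IZ// -IZ; last exact: L1Z.
    by apply: eq_I => x; rewrite expr0 !mulr1 [0.*2.+2%:R]/(2%:R).
rewrite eF in E.
have E0 : 0 <= I mu (fun x => v b x ^+ 0.*2.+2) by apply: I_ge0 => x; exact: sqr_ge0.
have H : mv * (2 * I mu (fun t => ind a b t * slope p ux t)) <= C * (1 + a) `^ (- (0.*2.+1%:R / (2 * p))).
  by apply: le_trans D; apply: le_trans E; rewrite lerDr.
rewrite mulrAC ler_pdivlMr ?mulr_gt0//; apply: le_trans H.
by rewrite le_eqVlt; apply/orP; left; apply/eqP; ring.
Qed.

Lemma slope_decay : exists2 C, 0 < C & forall M v ux gx, admissible M v ux gx ->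
  {ae mu, forall t, 0 < t -> slope p ux t <= C * (1 + t) `^ (- (3 / (2 * (3 * p - 2))))}.
Proof.
have [Kk Kk0 HKk] := slope_integral.
have [F2 F20 HF2'] := cont_bnd (- K) K cf2.
have HF2 w : `|w| <= K -> `|f2 w| <= F2 by rewrite ler_norml => /andP[]; exact: HF2'.
have [c [c' [k F]]] := @cutoff_exists R.
have k0 : 0 <= k by exact: le_trans (cf_0 F 0 0) (cf_K F 0 0).
pose C1 := (p + 1) * slope_cst p mv F2 k.
have C10 : 0 <= C1.
  by rewrite mulr_ge0 ?addr_ge0 ?(ltW p0)// mulr_ge0 ?powR_ge0// mulr_ge0.
have [C C0 HC] := bihari_decay p1 C10 Y00 Kk0.
exists C => // M v ux gx A; have [S l0 I0 Kv [U [h [aU vU lh Ih]]]] := A.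
have vK t : 0 <= t -> {ae mu, forall x, `|v t x| <= K}.
  by move=> t0; exact: (max_principle p1 S mv0 K0 Kv t0).
have [lY _] := slope_L1 S.
apply: HC => //.
- exact: slope_ge0.
- by move=> a b a0; apply: (L1_slope_pow p1 S).
- apply: (ae_imp (s_good S)) => a ga a0; have [[Ua aUa vUa] _ ly _] := ga a0.
  exact: (slope_ineq p1 mv0 S F20 HF2 vK F (ltW a0) aUa vUa ly).
- have H := slope_ineq p1 mv0 S F20 HF2 vK F (lexx 0) aU vU lh.
  by apply: (ae_imp H) => b Hb b0; apply: le_trans (Hb b0) _; rewrite lerD2r.
- exact: HKk A.
Qed.

(** [sup_pow] with [|h|] split by [young1]; here the slope bound [Y] is used to absorb half of
    [N^(q+2)], and the other half is bounded by [c E] with [c] a negative power of [N]. *)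
Lemma sup_energy q (U h : R -> R) (E Y : R) : 0 < Y -> ac U h -> L1 mu (fun x => U x ^+ 2) ->
  L1 mu (fun x => `|h x| `^ (p + 1)) -> I mu (fun x => `|h x| `^ (p + 1)) <= Y ->
  L1 mu (fun x => `|U x| ^+ q.+1) -> I mu (fun x => `|U x| ^+ q.+1) <= E ->
  exists N, [/\ 0 <= N, forall x, `|U x| <= N &
    N `^ (q.+2%:R + p^-1) <= 2 * q.+2%:R * (2 * q.+2%:R * Y) `^ p^-1 * E].
Proof.
move=> Yp aU lU2 lh IY lUq IE; have mU := ac_measU aU; have mh := ac_meas aU.
have p11 : 1 <= p + 1 by rewrite lerDr ltW.
have pv0 : 0 < p^-1 by rewrite invr_gt0.
have UM := ac_sup p11 aU lU2 (lexx _) lh (lexx _).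
set B := 2 + _ + _ in UM.
have B0 : 0 <= B by exact: le_trans (UM 0).
have mUq : measurable_fun setT (fun x => `|U x| ^+ q.+1) by exact: L1_meas lUq.
have mah : measurable_fun setT (fun x => `|h x|) by exact: measurableT_comp.
have Uq0 x : 0 <= `|U x| ^+ q.+1 := exprn_ge0 q.+1 (normr_ge0 (U x)).
have lUh : L1 mu (fun x => `|U x| ^+ q.+1 * `|h x| `^ (p + 1)).
  apply: L1_le (L1Z (B ^+ q.+1) lh); first by apply: measurable_funM => //; exact: L1_meas lh.
  move=> x; rewrite (ger0_norm (mulr_ge0 (Uq0 x) (powR_ge0 _ _))).
  by rewrite ler_wpM2r ?powR_ge0// lerXn2r ?nnegrE.
have lJ : L1 mu (fun x => `|U x| ^+ q.+1 * `|h x|).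
  apply: L1_le (L1D lUq lUh); first exact: measurable_funM.
  move=> x; rewrite (ger0_norm (mulr_ge0 (Uq0 x) (normr_ge0 (h x)))).
  by have := ler_wpM2l (Uq0 x) (powR_ge1D (normr_ge0 (h x)) p11); rewrite mulrDr mulr1.
have fU e x : 0 < e -> exists2 a, a <= x & `|U a| <= e.
  by apply: (@far_small _ 2) => //; apply: eq_L1 lU2 => y; rewrite sqr_powR.
have SP := sup_pow aU fU lJ; set J := I mu (fun x => _ * `|h x|) in SP.
have J0 : 0 <= J by apply: I_ge0 => x; exact: (mulr_ge0 (Uq0 x) (normr_ge0 (h x))).
have E0 : 0 <= E by apply: le_trans IE; exact: I_ge0.
pose n := q.+2%:R : R; have n0 : 0 < n by [].
have [N N0 NE] : exists2 N, 0 <= N & N ^+ q.+2 = n * J.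
  exists ((n * J) `^ n^-1); first exact: powR_ge0.
  by rewrite -(powR_mulrn q.+2 (powR_ge0 _ _)) powRVK// mulr_ge0// ltW.
have UN x : `|U x| <= N by rewrite -(@ler_pXn2r _ q.+2) ?nnegrE// NE; exact: SP.
exists N; split => //; rewrite -/n.
have nY : 0 < 2 * n * Y by rewrite !mulr_gt0.
have [->|Nn] := eqVneq N 0.
  rewrite powR0; last by rewrite gt_eqF// addr_gt0.
  by rewrite mulr_ge0// mulr_ge0 ?powR_ge0// mulr_ge0// ltW.
have Np : 0 < N by rewrite lt_neqAle eq_sym Nn.
(* [c^p = 2 n Y / N] makes the slope term of Young's inequality equal to half of [N^(q+2)] after
   multiplication by [n]. *)
pose c := (2 * n * Y / N) `^ p^-1.
have cN : 0 < 2 * n * Y / N by rewrite divr_gt0.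
have c0 : 0 < c by exact: powR_gt0.
have cp : (c `^ p)^-1 = N / (2 * n * Y).
  by rewrite -{1}(invrK p) powRK ?invr_gt0// ?invf_div// ltW.
have JD : J <= c * E + N / (2 * n * Y) * (N ^+ q.+1 * Y).
  apply: (@le_trans _ _ (c * I mu (fun x => `|U x| ^+ q.+1) + (c `^ p)^-1 * I mu (fun x => `|U x| ^+ q.+1 * `|h x| `^ (p + 1)))).
    rewrite -(IZ c lUq) -(IZ _ lUh) -(ID (L1Z c lUq) (L1Z _ lUh)).
    apply: I_le => //; first exact: (L1D (L1Z c lUq) (L1Z _ lUh)).
    move=> x; apply: le_trans (ler_wpM2l (Uq0 x) (young1 p0 c0 (normr_ge0 (h x)))) _.
    by rewrite le_eqVlt; apply/orP; left; apply/eqP; ring.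
  rewrite cp; apply: lerD; first by apply: ler_wpM2l => //; exact: ltW.
  apply: ler_wpM2l; first by rewrite divr_ge0// ltW.
  apply: (@le_trans _ _ (N ^+ q.+1 * I mu (fun x => `|h x| `^ (p + 1)))).
    rewrite -IZ//; apply: I_le => //; first exact: L1Z.
    by move=> x; rewrite ler_wpM2r ?powR_ge0// lerXn2r ?nnegrE.
  by apply: ler_wpM2l => //; exact: exprn_ge0.
have h1 : N ^+ q.+2 <= 2 * n * c * E.
  have := ler_wpM2l (ltW n0) JD; rewrite -NE.
  have -> : n * (c * E + N / (2 * n * Y) * (N ^+ q.+1 * Y)) = n * c * E + N ^+ q.+2 / 2.
    by rewrite [N ^+ q.+2]exprS; field; rewrite !gt_eqF.
  by set W := n * c * E; have -> : 2 * n * c * E = 2 * W by [rewrite /W; ring|]; lra.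
have -> : N `^ (n + p^-1) = N ^+ q.+2 * N `^ p^-1.
  by rewrite powRD ?Nn ?implybT// powR_mulrn.
have h2 : c * N `^ p^-1 = (2 * n * Y) `^ p^-1.
  by rewrite /c -powRM ?(ltW cN)// divfK.
apply: le_trans (ler_wpM2r (powR_ge0 _ _) h1) _; rewrite -h2.
by rewrite le_eqVlt; apply/orP; left; apply/eqP; ring.
Qed.

(** [sup_energy] turns the decay of the norm of exponent [2k + 2] into the rate [gam], which tends
    to [1/(2p)] as [k] grows. This gives the bound at good times, and [L2_close_bnd] gives it at all
    times. *)
Lemma sup_decay eps : 0 < eps -> exists2 C, 0 < C & forall M v ux gx, admissible M v ux gx ->
  forall t, 0 <= t -> {ae mu, forall x, `|v t x| <= C * (1 + t) `^ (- (1 / (2 * p)) + eps)}.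
Proof.
move=> e0; have [Y Yp HY] := slope_decay.
(* The deficit [1/(2p) - gam] equals [(2 + 1/p) / (2 p w)] with [w >= k], hence is at most
   [3 / (2 p k)]. *)
pose k := Num.bound (3 / (2 * p * eps)).
have [C C0 HC] := even_decay f1 f2 p1 mv0 m0 K0 k.
pose q := k.*2.+1; pose n : R := q.+2%:R; pose w : R := n + p^-1.
have pv0 : 0 < p^-1 by rewrite invr_gt0.
have w0 : 0 < w by rewrite addr_gt0.
have p20 : 0 < 2 * p by rewrite mulr_gt0.
have Q0 : 0 < k.*2.+1%:R :> R by [].
pose gam : R := k.*2.+1%:R / (2 * p) / w.
have g0 : 0 < gam by rewrite divr_gt0// divr_gt0.
pose D := 2 * q.+2%:R * (2 * q.+2%:R * Y) `^ p^-1 * C.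
have D0 : 0 < D by rewrite !mulr_gt0// powR_gt0// !mulr_gt0.
exists (D `^ w^-1); first exact: powR_gt0.
move=> M v ux gx A t t0; have [S l0 I0 Kv _] := A.
have gle : (1 + t) `^ (- gam) <= (1 + t) `^ (- (1 / (2 * p)) + eps).
  apply: ler_powR; first by rewrite lerDl.
  rewrite -lerN2 opprK opprD opprK lerBlDl -lerBlDr.
  have -> : 1 / (2 * p) - gam = (3 + p^-1 - 1) / (2 * p * w).
    have wE : w = k.*2.+1%:R + 2 + p^-1 by rewrite /w /n /q -addn2 natrD.
    have wn : k.*2.+1%:R + 2 + p^-1 != 0 by rewrite -wE gt_eqF.
    rewrite /gam; have -> : k.*2.+1%:R = w - 2 - p^-1 by rewrite wE; ring.
    by field; rewrite !gt_eqF.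
  rewrite ler_pdivrMr ?mulr_gt0//.
  have kw : 3 / (2 * p * eps) <= w.
    apply: (@le_trans _ _ k%:R); first by apply: ltW; apply: archi_boundP; rewrite divr_ge0// ltW// mulr_gt0.
    apply: (@le_trans _ _ n); last by rewrite lerDl ltW.
    by rewrite ler_nat /q -addnn -addn3 -addnA leq_addr.
  move: kw; rewrite ler_pdivrMr ?mulr_gt0// => kw.
  apply: (@le_trans _ _ 3); last by apply: le_trans kw _; rewrite le_eqVlt; apply/orP; left; apply/eqP; ring.
  by rewrite lerBlDr lerD2l invf_le1// ltW.
have good : {ae mu, forall s, 0 < s -> {ae mu, forall x, `|v s x| <= D `^ w^-1 * (1 + s) `^ (- gam)}}.
  apply: (ae_imp2 (s_good S) (HY M v ux gx A)) => s gs Ys sp.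
  have [[U aU vU] _ ly _] := gs sp.
  have mvs := measurable_slice s (s_mv S); have mU := ac_measU aU.
  have lU2 : L1 mu (fun x => U x ^+ 2).
    apply: (@L1_aeeq _ _ _ mu _ _ _ _ (s_v2 S (ltW sp))); first exact: measurable_funX.
    by apply: (ae_imp vU) => x ->.
  have IY : I mu (fun x => `|ux s x| `^ (p + 1)) <= Y.
    apply: le_trans (Ys sp) _; rewrite ler_piMr ?(ltW Yp)//.
    have one : (1 : R) `^ (- (3 / (2 * (3 * p - 2)))) = 1 by rewrite powR1.
    rewrite -[leRHS]one; apply: powR_anti => //; first by rewrite lerDl ltW.
    by rewrite divr_ge0// mulr_ge0//; move: p1; lra.
  have mUq : measurable_fun setT (fun x => `|U x| ^+ q.+1) by apply: measurable_funX; exact: measurableT_comp.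
  have ev x : v s x ^+ k.*2.+2 = `|v s x| ^+ q.+1.
    by rewrite /q -[k.*2.+2]/(k.+1.*2) -mul2n !exprM real_normK ?num_real.
  have evU : {ae mu, forall x, v s x ^+ k.*2.+2 = `|U x| ^+ q.+1}.
    by apply: (ae_imp vU) => x vx; rewrite ev vx.
  have lUq : L1 mu (fun x => `|U x| ^+ q.+1).
    exact: (@L1_aeeq _ _ _ mu _ _ mUq evU (power_L1 S k (ltW sp))).
  have IUq : I mu (fun x => `|U x| ^+ q.+1) <= C * (1 + s) `^ (- (k.*2.+1%:R / (2 * p))).
    rewrite -(@I_aeeq _ _ _ mu _ _ (L1_meas (power_L1 S k (ltW sp))) mUq evU).
    exact: (HC M v ux gx S l0 I0 Kv s (ltW sp)).
  have [N [N0 UN Nb]] := sup_energy Yp aU lU2 ly IY lUq IUq.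
  apply: (ae_imp vU) => x ->; apply: le_trans (UN x) _.
  rewrite -(powRK N0 w0) /gam.
  have -> : (1 + s) `^ (- (k.*2.+1%:R / (2 * p) / w)) = ((1 + s) `^ (- (k.*2.+1%:R / (2 * p)))) `^ w^-1.
    by rewrite -powRrM mulNr.
  rewrite -(powRM _ (ltW D0) (powR_ge0 _ _)).
  apply: ge0_ler_powR; rewrite ?nnegrE ?invr_ge0 ?(ltW w0) ?powR_ge0//.
    by rewrite mulr_ge0 ?powR_ge0// ltW.
  by apply: le_trans Nb _; rewrite /D mulrA.
have [tn [tn1 tn2]] := ae_seq good t0.
have mvt := measurable_slice t (s_mv S).
have tn0 i : 0 <= tn i by rewrite (le_trans t0)// ltW// (tn1 i).1.
have B0 : 0 <= D `^ w^-1 * (1 + t) `^ (- gam) by rewrite mulr_ge0 ?powR_ge0.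
have L2 i : L1 mu (fun x => (v (tn i) x - v t x) ^+ 2).
  exact: L1_sqrB (measurable_slice (tn i) (s_mv S)) mvt (s_v2 S (tn0 i)) (s_v2 S t0).
have bn i : {ae mu, forall x, `|v (tn i) x| <= D `^ w^-1 * (1 + t) `^ (- gam)}.
  have [ti Hi] := tn1 i; apply: (ae_imp Hi) => x /le_trans; apply.
  apply: ler_wpM2l; first exact: powR_ge0.
  by apply: powR_anti; rewrite ?(ltW g0) ?ltr_wpDr// lerD2l ltW.
have H := L2_close_bnd B0 mvt L2 bn (s_cont S t0 tn0 tn2).
by apply: (ae_imp H) => x /le_trans; apply; apply: ler_wpM2l => //; exact: powR_ge0.
Qed.

End SlopeDecay.

(** * Closedness of slope bounds *)

Section FastConvergence.
Context d (T : measurableType d) (R : realType) (m : {measure set T -> \bar R}).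
Implicit Types (f : nat -> T -> R).

Lemma sum_half_le (n : nat) : \sum_(0 <= i < n) (2 : R) ^- i <= 2.
Proof.
have -> : \sum_(0 <= i < n) (2 : R) ^- i = 2 - 2 * 2 ^- n.
  elim: n => [|n IH]; first by rewrite big_nil expr0 invr1 mulr1 subrr.
  rewrite big_nat_recr//= IH exprS; field; exact: expf_neq0.
by rewrite lerBlDr lerDl mulr_ge0// invr_ge0 exprn_ge0.
Qed.

(** The sum of the series has integral at most 2 by monotone convergence, so it is finite almost
    everywhere. Geometric [L^1] bounds thus give pointwise convergence. *)
Lemma ae_sum_bounded f : (forall n, L1 m (f n)) -> (forall n x, 0 <= f n x) ->
  (forall n, I m (f n) <= 2 ^- n) ->
  {ae m, forall x, exists C, forall n, \sum_(0 <= i < n) f i x <= C}.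
Proof.
move=> lf f0 If.
pose F n x := (f n x)%:E.
have mF n : measurable_fun setT (F n) by apply/measurable_EFinP; exact: L1_meas (lf n).
have F0 n x : setT x -> (0 <= F n x)%E by rewrite lee_fin.
have E : (\int[m]_x (\sum_(n <oo) F n x) <= 2%:E)%E.
  rewrite (integral_nneseries _ measurableT mF F0); apply: lime_le.
    by apply: is_cvg_nneseries => n _ _; apply: integral_ge0 => x _; rewrite lee_fin.
  apply: nearW => n; rewrite (eq_bigr (fun i => (I m (f i))%:E)); last first.
    by move=> i _; rewrite EFin_I.
  rewrite sumEFin lee_fin; apply: le_trans (sum_half_le n).
  by apply: ler_sum => i _; exact: If.
have mS : measurable_fun setT (fun x => \sum_(n <oo) F n x)%E.
  by apply: ge0_emeasurable_sum => // n x _ _; rewrite lee_fin.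
have S0 x : (0 <= \sum_(n <oo) F n x)%E by apply: nneseries_ge0 => n _ _; rewrite lee_fin.
have iS : m.-integrable setT (fun x => \sum_(n <oo) F n x)%E.
  apply/integrableP; split => //.
  by under eq_integral do rewrite gee0_abs//; exact: le_lt_trans E (ltry _).
have ae := integrable_ae measurableT iS.
move: ae; apply: filterS => x /(_ Logic.I) fin.
exists (fine (\sum_(n <oo) F n x)%E) => n.
rewrite -lee_fin fineK// -sumEFin.
by apply: nneseries_lim_ge => i _ _; rewrite lee_fin.
Qed.

Lemma bounded_sum_cvg0 (u : nat -> R) (C : R) : (forall n, 0 <= u n) ->
  (forall n, \sum_(0 <= i < n) u i <= C) -> u n @[n --> \oo] --> 0.
Proof.
move=> u0 H; apply: cvg_series_cvg_0; apply: nondecreasing_is_cvgn.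
  by apply/nondecreasing_seqP => n; rewrite seriesSr lerDl.
by exists C => _ [n _ <-]; exact: H.
Qed.

Lemma bounded_variation_cvg (u : nat -> R) (C : R) :
  (forall n, \sum_(0 <= i < n) `|u i.+1 - u i| <= C) -> cvgn u.
Proof.
move=> H; have c : cvgn (series (telescope u)).
  have c' : cvgn (series (fun i => `|u i.+1 - u i|)).
    apply: nondecreasing_is_cvgn.
      by apply/nondecreasing_seqP => n; rewrite seriesSr lerDl.
    by exists C => _ [n _ <-]; exact: H.
  exact: (@normed_cvg R R^o (telescope u) c').
have E : u = (fun n => u 0%N + series (telescope u) n).
  by apply/funext => n; rewrite (eq_sum_telescope u n).
by rewrite E; apply: is_cvgD => //; exact: is_cvg_cst.
Qed.

(** Multiplication by the indicator of the complement of a measurable null set makes the sequence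
    converge everywhere, so that its limit is measurable. *)
Lemma ae_limit f : (forall n, measurable_fun setT (f n)) ->
  {ae m, forall x, cvgn (fun n => f n x)} ->
  exists2 h : T -> R, measurable_fun setT h & {ae m, forall x, f n x @[n --> \oo] --> h x}.
Proof.
move=> mf [N [mN N0 PN]].
have nN x : ~ N x -> cvgn (fun n => f n x) by move=> nx; apply: contrapT => H; apply: nx; exact: PN.
pose g n x := f n x * \1_(~` N) x.
have mi : measurable_fun setT (\1_(~` N) : T -> R) by apply: measurable_indic; exact: measurableC.
exists (fun x => limn (fun n => g n x)).
  apply: (@measurable_fun_cvg _ _ _ setT g) => [n|x _]; first exact: measurable_funM.
  have [Nx|Nx] := pselect (N x).
    rewrite (_ : (fun n => g n x) = (fun=> 0)); first exact: is_cvg_cst.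
    by apply/funext => n; rewrite /g indicE memNset ?mulr0//= => /(_ Nx).
  rewrite (_ : (fun n => g n x) = (fun n => f n x)); first exact: nN.
  by apply/funext => n; rewrite /g indicE mem_set ?mulr1.
exists N; split => // x /= H; apply: contrapT => Nx; apply: H.
have := nN x Nx; rewrite (_ : (fun n => g n x) = (fun n => f n x)).
  by move=> c; exact: c.
by apply/funext => n; rewrite /g indicE mem_set ?mulr1.
Qed.

End FastConvergence.

(** * Slope bounds are closed under convergence in the mean *)

Section Closed.
Variable R : realType.
Local Notation mu := (leb1 R).

(** A positive weight, the derivative of the arctangent, that is integrable and square integrable.
    With it every [w] with [|w|^r] integrable, [r >= 2], lies in a weighted [L^2] space over the
    whole line. *)
Let sg (x : R) : R := (1 + x ^+ 2)^-1.
Let s1 (x : R) : 0 < 1 + x ^+ 2. Proof. by rewrite ltr_pwDl// sqr_ge0. Qed.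
Let sg0 x : 0 < sg x. Proof. by rewrite invr_gt0. Qed.
Let sg1 x : sg x <= 1. Proof. by rewrite invf_le1// lerDl sqr_ge0. Qed.
Let cs : continuous (fun x : R => 1 + x ^+ 2).
Proof. by move=> x; apply: cvgD; [exact: cvg_cst|exact: exprn_continuous]. Qed.
Let csg : continuous sg.
Proof. by move=> x; apply: cvgV; [rewrite gt_eqF|exact: cs]. Qed.
Let msg : measurable_fun setT sg. Proof. exact: continuous_measurable_fun csg. Qed.

Let L1sg : L1 mu sg.
Proof.
have aA : ac (@atan R) sg by apply: ac_C1 => //; move=> x; exact: is_derive1_atan.
suff : L1 mu sg /\ I mu sg <= pi by case.
apply: (@real_fatou _ _ _ mu (fun n x => ind (- n%:R) n%:R x * sg x)) => //.
- by move=> n; apply: (aA _ _ _).1; rewrite (@le_trans _ _ 0)// oppr_le0.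
- by move=> n x; rewrite mulr_ge0 ?ind_ge0// ltW.
- move=> n; have nn : - n%:R <= n%:R :> R by rewrite (@le_trans _ _ 0)// oppr_le0.
  rewrite -(ac_I aA nn); have := atan_ltpi2 (n%:R : R); have := atan_gtNpi2 (- n%:R : R); lra.
- apply: aeW => x; apply: cvg_near_cst; near=> n; rewrite indT ?mul1r//.
    by rewrite ltrNl; near: n; exact: nbhs_infty_gtr.
  by near: n; exact: nbhs_infty_ger.
Unshelve. all: by end_near.
Qed.

Let L1sg2 : L1 mu (fun x => sg x ^+ 2).
Proof.
apply: L1_le L1sg; first exact: measurable_funX.
by move=> x; rewrite ger0_norm ?sqr_ge0// expr2 ler_piMl// ltW.
Qed.

Variables (r Y : R) (g : R -> R).
Hypotheses (r2 : 2 <= r) (mg : measurable_fun setT g).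

Let r1 : 1 <= r. Proof. by rewrite (le_trans _ r2)// ler1n. Qed.

Record near_class (e : R) (W w : R -> R) : Prop := NearClass {
  nc_ac : ac W w ;
  nc_L2 : L1 mu (fun x => (W x - g x) ^+ 2) ;
  nc_I2 : I mu (fun x => (W x - g x) ^+ 2) <= e ;
  nc_Lr : L1 mu (fun x => `|w x| `^ r) ;
  nc_Ir : I mu (fun x => `|w x| `^ r) <= Y }.

Let sqr_le (x : R) : x ^+ 2 <= 1 + `|x| `^ r.
Proof.
rewrite -[x ^+ 2]real_normK ?num_real//; have [x1|/ltW x1] := leP `|x| 1.
  by rewrite (@le_trans _ _ 1) ?expr_le1// lerDl powR_ge0.
by rewrite (@le_trans _ _ (`|x| `^ r)) ?lerDr// -powR_mulrn// ler_powR.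
Qed.

Definition Phi (w : R -> R) := I mu (fun x => (sg x * w x) ^+ 2).

Let Phi_L1 (w : R -> R) : measurable_fun setT w -> L1 mu (fun x => `|w x| `^ r) ->
  L1 mu (fun x => (sg x * w x) ^+ 2) /\ Phi w <= I mu (fun x => sg x ^+ 2) + I mu (fun x => `|w x| `^ r).
Proof.
move=> mw lw.
have b x : (sg x * w x) ^+ 2 <= sg x ^+ 2 + `|w x| `^ r.
  rewrite exprMn; apply: le_trans (ler_wpM2l (sqr_ge0 _) (sqr_le (w x))) _.
  rewrite mulrDr mulr1 lerD2l ler_piMl ?powR_ge0// expr_le1//; exact: ltW.
have l : L1 mu (fun x => (sg x * w x) ^+ 2).
  apply: L1_le (L1D L1sg2 lw); first by apply: measurable_funX; exact: measurable_funM.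
  by move=> x; rewrite ger0_norm ?sqr_ge0.
split => //; rewrite -ID//; apply: I_le => //; exact: L1D.
Qed.

Lemma convex_powR (x y : R) : `|(x + y) / 2| `^ r <= (`|x| `^ r + `|y| `^ r) / 2.
Proof.
have r0 : 0 < r - 1 by rewrite subr_gt0 (lt_le_trans _ r2)// ltr1n.
have h1 := flux_convex ((x + y) / 2) x r0; have h2 := flux_convex ((x + y) / 2) y r0.
rewrite !subrK in h1 h2; set z := (x + y) / 2 in h1 h2 *.
have zE : (z - x) + (z - y) = 0 by rewrite /z; field.
have : `|z| `^ r - `|x| `^ r + (`|z| `^ r - `|y| `^ r) <= 0.
  by apply: le_trans (lerD h1 h2) _; rewrite -mulrDr zE mulr0.
by rewrite ler_pdivlMr// mulr_natr mulr2n; set a := _ `^ r; set b := _ `^ r; set c := _ `^ r; lra.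
Qed.

(** Convexity of the square and of [|.|^r]; the midpoint is the competitor in the parallelogram
    argument. *)
Lemma near_class_mid e (W1 w1 W2 w2 : R -> R) : near_class e W1 w1 -> near_class e W2 w2 ->
  near_class e (fun x => (W1 x + W2 x) / 2) (fun x => (w1 x + w2 x) / 2).
Proof.
move=> [a1 l1 i1 p1 j1] [a2 l2 i2 p2 j2].
have a : ac (fun x => (W1 x + W2 x) / 2) (fun x => (w1 x + w2 x) / 2).
  by apply: (ac_ext (acZ 2^-1 (acD a1 a2))) => x; rewrite mulrC.
have b x : ((W1 x + W2 x) / 2 - g x) ^+ 2 <= 2^-1 * ((W1 x - g x) ^+ 2 + (W2 x - g x) ^+ 2).
  by have := sqr_ge0 ((W1 x - g x) - (W2 x - g x)); lra.
have lb := L1Z 2^-1 (L1D l1 l2); have lp := L1Z 2^-1 (L1D p1 p2).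
have l : L1 mu (fun x => ((W1 x + W2 x) / 2 - g x) ^+ 2).
  apply: L1_le lb; last by move=> x; rewrite ger0_norm ?sqr_ge0.
  by apply: measurable_funX; apply: measurable_funB => //; exact: ac_measU a.
have lr : L1 mu (fun x => `|(w1 x + w2 x) / 2| `^ r).
  apply: L1_le lp; first by apply: measurable_absX; exact: ac_meas a.
  by move=> x; rewrite ger0_norm ?powR_ge0// [leRHS]mulrC; exact: convex_powR.
split; [exact: a|exact: l| |exact: lr|].
  apply: le_trans (I_le l lb b) _; rewrite IZ ?ID//; last exact: L1D.
  by move: i1 i2; lra.
apply: le_trans (I_le lr lp _) _; first by move=> x; rewrite [leRHS]mulrC; exact: convex_powR.
rewrite IZ ?ID//; last exact: L1D.
by move: j1 j2; lra.
Qed.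

Lemma parallelogram (w1 w2 : R -> R) : measurable_fun setT w1 -> measurable_fun setT w2 ->
  L1 mu (fun x => (sg x * w1 x) ^+ 2) -> L1 mu (fun x => (sg x * w2 x) ^+ 2) ->
  L1 mu (fun x => (sg x * (w1 x - w2 x)) ^+ 2) /\
  I mu (fun x => (sg x * (w1 x - w2 x)) ^+ 2) =
    2 * (Phi w1 + Phi w2) - 4 * Phi (fun x => (w1 x + w2 x) / 2).
Proof.
move=> m1 m2 l1 l2.
have lm : L1 mu (fun x => (sg x * ((w1 x + w2 x) / 2)) ^+ 2).
  apply: L1_le (L1D l1 l2).
    apply: measurable_funX; apply: measurable_funM => //.
    by apply: measurable_funM; [exact: measurable_funD|exact: measurable_cst].
  move=> x; rewrite ger0_norm ?sqr_ge0//.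
  by have := sqr_ge0 (sg x * w1 x - sg x * w2 x); have := sqr_ge0 (sg x * w1 x + sg x * w2 x); lra.
have E x : 2 * ((sg x * w1 x) ^+ 2 + (sg x * w2 x) ^+ 2) - 4 * (sg x * ((w1 x + w2 x) / 2)) ^+ 2 =
   (sg x * (w1 x - w2 x)) ^+ 2 by field.
have L := L1B (L1Z 2 (L1D l1 l2)) (L1Z 4 lm).
split; first exact: (@eq_L1 _ _ _ mu _ _ E L).
by rewrite -(eq_I mu E) (IB (L1Z 2 (L1D l1 l2)) (L1Z 4 lm)) (IZ _ (L1D l1 l2)) (IZ _ lm) (ID l1 l2).
Qed.

Let Phi_ge0 w : 0 <= Phi w. Proof. by apply: I_ge0 => x; exact: sqr_ge0. Qed.

(* Minimizing the quadratic [Phi] over shrinking [L^2]-neighbourhoods of [g] makes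
   the slopes converge strongly, which replaces weak compactness. *)
Lemma ac_closed : (forall e, 0 < e -> exists W w, near_class e W w) ->
  exists U h, [/\ ac U h, {ae mu, forall x, g x = U x}, L1 mu (fun x => `|h x| `^ r) &
    I mu (fun x => `|h x| `^ r) <= Y].
Proof.
move=> ex; pose lv n : R := 2 ^- n.
have lv0 n : 0 < lv n by rewrite invr_gt0 exprn_gt0.
have lvS i j : (i <= j)%N -> lv j <= lv i.
  move=> ij; rewrite /lv lef_pV2 ?posrE ?exprn_gt0//.
  by rewrite ler_weXn2l// ler1n.
pose A n := [set Phi w | w in [set w | exists W, near_class (lv n) W w]].
have hA n : has_inf (A n).
  split; last by exists 0 => _ [w _ <-].
  by have [W [w H]] := ex _ (lv0 n); exists (Phi w), w => //; exists W.
pose J n := inf (A n).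
have JP n W w : near_class (lv n) W w -> J n <= Phi w.
  move=> H; apply: ge_inf; first exact: (hA n).2.
  by exists w => //; exists W.
have J0 n : 0 <= J n by apply: lb_le_inf; [exact: (hA n).1|move=> _ [w _ <-]].
have up i j W w : (i <= j)%N -> near_class (lv j) W w -> near_class (lv i) W w.
  by move=> ij [h1 h2 h3 h4 h5]; split => //; exact: le_trans h3 (lvS _ _ ij).
have JS i j : (i <= j)%N -> J i <= J j.
  move=> ij; apply: lb_le_inf; first exact: (hA j).1.
  by move=> _ [w [W H] <-]; apply: JP (up _ _ _ _ ij H).
have ch n : exists Ww : (R -> R) * (R -> R), near_class (lv n) Ww.1 Ww.2 /\ Phi Ww.2 <= J n + lv n.
  have [_ [w [W H] <-] Hw] := inf_adherent (lv0 n) (hA n).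
  by exists (W, w); split => //; exact: ltW.
pose W n := (sval (cid (ch n))).1; pose w n := (sval (cid (ch n))).2.
have NC n : near_class (lv n) (W n) (w n) by exact: (svalP (cid (ch n))).1.
have Pw n : Phi (w n) <= J n + lv n by exact: (svalP (cid (ch n))).2.
have mw n : measurable_fun setT (w n) := ac_meas (nc_ac (NC n)).
have lPhi n := (Phi_L1 (mw n) (nc_Lr (NC n))).1.
pose Z := I mu (fun x => sg x ^+ 2) + Y.
have JZ n : J n <= Z.
  apply: le_trans (JP _ _ _ (NC n)) _; apply: le_trans (Phi_L1 (mw n) (nc_Lr (NC n))).2 _.
  by rewrite lerD2l (nc_Ir (NC n)).
have cJ : cvgn J.
  apply: nondecreasing_is_cvgn; first by move=> i j; exact: JS.
  by exists Z => _ [n _ <-].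
pose Jl := limn J.
have JJl n : J n <= Jl.
  by apply: nondecreasing_cvgn_le => // i j; exact: JS.
pose dd n := 2 * (Jl - J n) + 4 * lv n.
have dd0 : dd n @[n --> \oo] --> 0.
  have c1 : lv n @[n --> \oo] --> 0.
    rewrite (_ : lv = GRing.exp (2^-1 : R)); last by apply/funext => n; rewrite /lv exprVn.
    by apply: cvg_expr; rewrite gtr0_norm// invf_lt1// ltr1n.
  have -> : 0 = 2 * (Jl - Jl) + 4 * 0 :> R by rewrite subrr !mulr0 addr0.
  apply: cvgD; apply: cvgM; [exact: cvg_cst| |exact: cvg_cst|exact: c1].
  by apply: cvgB; [exact: cvg_cst|exact: cJ].
(* The midpoint of [w i] and [w j] belongs to the larger class [i], so its [Phi] is at least [J i];
   the parallelogram identity turns near minimality into a Cauchy estimate. *)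
have D i j : (i <= j)%N -> I mu (fun x => (sg x * (w i x - w j x)) ^+ 2) <= dd i.
  move=> ij; have [_ ->] := parallelogram (mw i) (mw j) (lPhi i) (lPhi j).
  have h := JP _ _ _ (near_class_mid (NC i) (up _ _ _ _ ij (NC j))).
  have h1 := Pw i; have h2 := Pw j; have h3 := JJl j; have h4 := lvS _ _ ij.
  by rewrite /dd; move: h h1 h2 h3 h4; set P := Phi (fun x => _); lra.
pose B := I mu (fun x => sg x ^+ 2) + 1.
have sg20 : 0 <= I mu (fun x => sg x ^+ 2) by apply: I_ge0 => x; exact: sqr_ge0.
have B0 : 0 < B by rewrite ltr_wpDl.
have chN k : exists N : nat, forall n, (N <= n)%N -> B * dd n <= (lv k) ^+ 2.
  have e0 : 0 < lv k ^+ 2 / B by rewrite divr_gt0// exprn_gt0.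
  have [N _ HN] : \forall n \near \oo, dd n <= lv k ^+ 2 / B by apply: (cvgr_le 0).
  by exists N => n /HN; rewrite ler_pdivlMr// mulrC.
pose N k := sval (cid (chN k)).
have NP k n : (N k <= n)%N -> B * dd n <= lv k ^+ 2 by exact: (svalP (cid (chN k))).
(* A monotone subsequence beyond each [N k], for summable slope increments. The added 1 gives
   [k <= nk k], which keeps the squared distances to [g] summable as well. *)
pose nk k := (\sum_(i < k.+1) (N i + 1))%N.
have nkS k : (nk k <= nk k.+1)%N by rewrite /nk [leqRHS]big_ord_recr/= leq_addr.
have nkm i j : (i <= j)%N -> (nk i <= nk j)%N.
  by move=> ij; exact: (homo_leq leqnn (fun y x z => @leq_trans y x z) nkS ij).
have nkN k : (N k <= nk k)%N by rewrite /nk big_ord_recr/= addnA -addnA addnCA leq_addr.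
have nkk k : (k <= nk k)%N.
  by elim: k => // k IH; rewrite /nk big_ord_recr/= -/(nk k) addnA addn1 ltnS (leq_trans IH)// leq_addr.
have fast k : L1 mu (fun x => sg x * (sg x * `|w (nk k.+1) x - w (nk k) x|)) /\
    I mu (fun x => sg x * (sg x * `|w (nk k.+1) x - w (nk k) x|)) <= 2 ^- k.
  have md : measurable_fun setT (fun x => sg x * `|w (nk k.+1) x - w (nk k) x|).
    by apply: measurable_funM => //; apply: measurableT_comp => //; exact: measurable_funB.
  have [l _] := parallelogram (mw (nk k)) (mw (nk k.+1)) (lPhi _) (lPhi _).
  have E x : (sg x * (w (nk k) x - w (nk k.+1) x)) ^+ 2 = (sg x * `|w (nk k.+1) x - w (nk k) x|) ^+ 2.
    by rewrite !exprMn real_normK ?num_real//; ring.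
  have [l1 i1] := @cauchy_schwarz _ _ _ mu _ _ msg md L1sg2 (@eq_L1 _ _ _ mu _ _ E l).
  split => //; set X := I mu _ in i1 *.
  have X0 : 0 <= X by apply: I_ge0 => x; rewrite !mulr_ge0// ltW.
  rewrite -(@ler_pXn2r _ 2) ?nnegrE ?(ltW (lv0 k))//; apply: le_trans i1 _.
  apply: le_trans (NP k (nk k) (nkN k)); rewrite -(@eq_I _ _ _ mu _ _ E).
  apply: ler_pM => //; [by apply: I_ge0 => x; exact: sqr_ge0|by rewrite lerDl|exact: D].
have aeb : {ae mu, forall x, exists C, forall n,
    \sum_(0 <= i < n) (sg x * (sg x * `|w (nk i.+1) x - w (nk i) x|)) <= C}.
  apply: ae_sum_bounded; [by move=> k; exact: (fast k).1| |by move=> k; exact: (fast k).2].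
  by move=> k x; rewrite !mulr_ge0// ltW.
have aec : {ae mu, forall x, cvgn (fun k => w (nk k) x)}.
  apply: (ae_imp aeb) => x [C HC]; apply: (@bounded_variation_cvg _ _ (C / (sg x * sg x))) => n.
  rewrite ler_pdivlMr ?mulr_gt0// mulrC mulr_sumr; apply: le_trans (HC n).
  by apply: ler_sum => i _; rewrite mulrA.
have [h mh wh] : exists2 h : R -> R, measurable_fun setT h &
    {ae mu, forall x, w (nk k) x @[k --> \oo] --> h x}.
  exact: (@ae_limit _ _ _ mu (fun k => w (nk k)) (fun k => mw (nk k)) aec).
have [lh Ih] : L1 mu (fun x => `|h x| `^ r) /\ I mu (fun x => `|h x| `^ r) <= Y.
  apply: (@real_fatou _ _ _ mu (fun k x => `|w (nk k) x| `^ r)).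
  - by move=> k; exact: nc_Lr (NC _).
  - by move=> k x; exact: powR_ge0.
  - exact: measurable_absX.
  - by move=> k; exact: nc_Ir (NC _).
  - apply: (ae_imp wh) => x cx.
    have r1' : 0 < r - 1 by rewrite subr_gt0 (lt_le_trans _ r2)// ltr1n.
    have c : continuous (fun z : R => `|z| `^ (r - 1 + 1)) := is_derive_cont (fun z => is_derive_abs_powR z r1').
    rewrite subrK in c; exact: (cvg_comp _ _ cx (c (h x))).
have Dh k : L1 mu (fun x => (sg x * (w (nk k) x - h x)) ^+ 2) /\
    I mu (fun x => (sg x * (w (nk k) x - h x)) ^+ 2) <= dd (nk k).
  apply: (@real_fatou _ _ _ mu (fun j x => (sg x * (w (nk k) x - w (nk (k + j)%N) x)) ^+ 2)).
  - by move=> j; exact: (parallelogram (mw _) (mw _) (lPhi _) (lPhi _)).1.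
  - by move=> j x; exact: sqr_ge0.
  - by apply: measurable_funX; apply: measurable_funM => //; apply: measurable_funB; [exact: mw|exact: mh].
  - by move=> j; apply: D; apply: nkm; exact: leq_addr.
  - apply: (ae_imp wh) => x cx.
    have cx' : w (nk (k + j)%N) x @[j --> \oo] --> h x.
      rewrite (_ : (fun j => _) = (fun j => w (nk (j + k)%N) x)); last by apply/funext => j; rewrite addnC.
      by move: cx; rewrite -(cvg_shiftn k).
    have c2 : sg x * (w (nk k) x - w (nk (k + j)%N) x) @[j --> \oo] --> sg x * (w (nk k) x - h x).
      by apply: cvgM; [exact: cvg_cst|apply: cvgB; [exact: cvg_cst|exact: cx']].
    exact: (cvg_comp _ _ c2 (@exprn_continuous _ 2 _)).
have ddk : dd (nk k) @[k --> \oo] --> 0.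
  have nkoo : nk k @[k --> \oo] --> \oo.
    move=> P [n0 _ H]; exists n0 => // k /= n0k; apply: H => /=; exact: leq_trans n0k (nkk k).
  exact: (cvg_comp _ _ nkoo dd0).
have lhloc : locL1 h.
  move=> a b ab; have [li _] := I_ind ab.
  apply: L1_le (L1D li lh).
    by apply: measurable_funM => //; exact: measurable_ind.
  move=> x; rewrite /ind; case: ifP => _; last by rewrite mul0r normr0 add0r powR_ge0.
  by rewrite mul1r powR_ge1D.
pose H := prim h; have aH : ac H h := ac_prim lhloc.
have cvI a b : a <= b -> I mu (fun x => ind a b x * w (nk k) x) @[k --> \oo] --> I mu (fun x => ind a b x * h x).
  (* On a bounded interval the factor [1 + x^2] undoes the weight, so weighted strong convergence
     gives convergence of the integrals. *)
  move=> ab; pose q x := ind a b x * (1 + x ^+ 2).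
  have mi : measurable_fun setT (ind a b) by exact: measurable_ind.
  have mcs : measurable_fun setT (fun x : R => 1 + x ^+ 2) by exact: continuous_measurable_fun cs.
  have mq : measurable_fun setT q by exact: measurable_funM.
  have lq : L1 mu (fun x => q x ^+ 2).
    have c2 : continuous (fun x : R => (1 + x ^+ 2) ^+ 2) by move=> x; exact: (cvgM (@cs x) (@cs x)).
    apply: eq_L1 (cont_locL1 c2 ab) => x; rewrite /q exprMn; congr (_ * _).
    by rewrite expr2 ind_idem.
  have md k : measurable_fun setT (fun x => sg x * (w (nk k) x - h x)).
    by apply: measurable_funM => //; apply: measurable_funB; [exact: mw|exact: mh].
  have c0 : I mu (fun x => (sg x * (w (nk k) x - h x)) ^+ 2) @[k --> \oo] --> 0.
    apply: (squeeze_cvgr _ (cvg_cst 0) ddk); apply: nearW => k.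
    by rewrite (Dh k).2 andbT; apply: I_ge0 => x; exact: sqr_ge0.
  have := cvg_L2_weak mq lq md (fun k => (Dh k).1) c0.
  have lw k : L1 mu (fun x => ind a b x * w (nk k) x) := (nc_ac (NC _) ab).1.
  have lhab := lhloc _ _ ab.
  rewrite (_ : (fun k => _) = (fun k => I mu (fun x => ind a b x * w (nk k) x) - I mu (fun x => ind a b x * h x))).
    move=> c; have c1 := cvgD c (cvg_cst (I mu (fun x => ind a b x * h x))).
    rewrite add0r in c1.
    rewrite (_ : (fun k => _) = (fun k => I mu (fun x => ind a b x * w (nk k) x) -
      I mu (fun x => ind a b x * h x) + I mu (fun x => ind a b x * h x))); first exact: c1.
    by apply/funext => k; rewrite subrK.
  apply/funext => k; rewrite -IB//; apply: eq_I => x.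
  by rewrite /q /sg; field; exact: lt0r_neq0.
have aeW0 : {ae mu, forall x, W (nk k) x @[k --> \oo] --> g x}.
  have aeb2 : {ae mu, forall x, exists C, forall n, \sum_(0 <= i < n) (W (nk i) x - g x) ^+ 2 <= C}.
    apply: ae_sum_bounded; [by move=> k; exact: nc_L2 (NC _)|by move=> k x; exact: sqr_ge0|].
    by move=> k; apply: le_trans (nc_I2 (NC _)) (lvS _ _ (nkk k)).
  apply: (ae_imp aeb2) => x [C HC].
  have c0 : (W (nk k) x - g x) ^+ 2 @[k --> \oo] --> 0.
    by apply: (bounded_sum_cvg0 _ HC) => k; exact: sqr_ge0.
  apply/cvgrPdist_lt => e e0; have e2 : 0 < e ^+ 2 by rewrite exprn_gt0.
  move/cvgr0Pnorm_lt/(_ _ e2): c0; apply: filterS => k.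
  by rewrite normrX ltr_pXn2r ?nnegrE ?(ltW e0)// distrC.
have aeW1 : {ae mu, forall x, 0 < x -> W (nk k) x @[k --> \oo] --> g x}.
  by apply: (ae_imp aeW0) => x Hx _.
(* One point of convergence fixes the constant of integration; from there the functions converge at
   every point. *)
have [x0 _ Wx0] := ae_pick aeW1 (lexx 0) (@ltr01 R).
pose U x := H x + (g x0 - H x0).
have aU : ac U h by apply: (ac_ext (acD aH (ac_cst (g x0 - H x0)))) => // x; rewrite addr0.
have WU x : W (nk k) x @[k --> \oo] --> U x.
  have [xx|/ltW xx] := leP x0 x.
    have c := cvgD Wx0 (cvI _ _ xx).
    rewrite -(ac_I aH xx) in c; have -> : U x = g x0 + (H x - H x0) by rewrite /U; ring.
    rewrite (_ : (fun k => _) = (fun k => W (nk k) x0 + I mu (fun y => ind x0 x y * w (nk k) y))); first exact: c.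
    by apply/funext => k; rewrite -(ac_I (nc_ac (NC _)) xx) addrC subrK.
  have c := cvgB Wx0 (cvI _ _ xx).
  rewrite -(ac_I aH xx) in c; have -> : U x = g x0 - (H x0 - H x) by rewrite /U; ring.
  rewrite (_ : (fun k => _) = (fun k => W (nk k) x0 - I mu (fun y => ind x x0 y * w (nk k) y))); first exact: c.
  by apply/funext => k; rewrite -(ac_I (nc_ac (NC _)) xx) opprB addrC subrK.
exists U, h; split => //.
by apply: (ae_imp aeW0) => x c; exact: (cvg_unique _ c (WU x)).
Qed.

End Closed.

(** * Weak derivatives and absolutely continuous representatives *)

Section WeakDerivative.
Variable R : realType.
Local Notation mu := (leb1 R).

Lemma locally_integrable_locL1 (g : R -> R) : locally_integrable [set: R] g ->
  measurable_fun setT g /\ locL1 g.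
Proof.
move=> [mg _ ig]; split => // a b ab.
have mi : measurable_fun setT (fun x => ind a b x * g x).
  by apply: measurable_funM => //; exact: measurable_ind.
apply/integrableP; split; first exact/measurable_EFinP.
apply: le_lt_trans (ig `[a, b]%classic (@subsetT _ _) (@segment_compact _ a b)).
rewrite [leRHS]integral_mkcond; apply: ge0_le_integral => //.
- by apply/measurable_EFinP; exact: measurableT_comp.
- apply/(measurable_restrictT _ _).1; first exact: measurable_itv.
  by apply/measurable_EFinP; apply: measurableT_comp => //; exact: measurable_funS mg.
- move=> x _ /=; rewrite patchE mem_setE in_itv/= /ind.
  have [/andP[h1 h2]|h] := boolP ((a < x) && (x <= b)).
    by rewrite (ltW h1) h2 mul1r.
  by rewrite mul0r normr0; case: ifP => // _; rewrite lee_fin.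
Qed.

Lemma locL1_locally_integrable (g : R -> R) : measurable_fun setT g -> locL1 g ->
  locally_integrable [set: R] g.
Proof.
move=> mg lg; split => //; first exact: openT.
move=> K _ cK.
have [M [_ HM]] := compact_bounded cK.
pose L := `|M| + 1.
have L0 : 0 <= L by rewrite addr_ge0.
have KL x : K x -> `|x| <= L.
  by apply: (HM L); rewrite /L (le_lt_trans (ler_norm M))// ltrDl.
have LL : - (L + 1) <= L + 1 by lra.
have mK : measurable K by exact: compact_measurable.
have l := L1_abs (lg _ _ LL).
apply: (@le_lt_trans _ _ (\int[mu]_x (`|ind (- (L + 1)) (L + 1) x * g x|)%:E)%E); last first.
  by apply: (L1_ge0_lty l) => x; exact: normr_ge0.
rewrite integral_mkcond; apply: ge0_le_integral => //.
- by move=> x _; rewrite patchE; case: ifP => // _; exact: lee_fin.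
- apply/(measurable_restrictT _ mK).
  by apply/measurable_EFinP; apply: measurableT_comp => //; exact: measurable_funS mg.
- by apply/measurable_EFinP; exact: L1_meas l.
- move=> x _; rewrite patchE; case: ifPn => [/set_mem /KL xL|_]; last by rewrite lee_fin.
  move: xL; rewrite ler_norml => /andP[x1 x2]; rewrite indT ?mul1r//; lra.
Qed.

(** [tst] is an admissible test with derivative [dtst], so this is du Bois-Reymond on the whole
    line, with the primitive of [dg] as the model. *)
Lemma weak_derivative_ac (g dg : R -> R) : weak_derivative g dg ->
  exists2 U, ac U dg & {ae mu, forall x, g x = U x}.
Proof.
move=> [lg ldg H]; have [mg Lg] := locally_integrable_locL1 lg.
have [mdg Ldg] := locally_integrable_locL1 ldg.
have aP := ac_prim Ldg.
have [K HK] : exists K, {ae mu, forall x, (-oo < x%:E)%E -> g x = prim dg x + K}.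
  apply: (@du_bois_reymond _ _ 0 g (prim dg) dg) => //; first exact: ltNyr.
    by move=> a b _ ab; exact: Lg.
  move=> p q n _ pq.
  have T : test_function [set: R] (tst 0 (ratr p) (ratr q) n).
    by apply: (test_function_smooth1 (smooth1_tst _ _ _ _)) => x; exact: tst_out (ltW pq).
  have D x : derive1 (tst 0 (ratr p) (ratr q) n) x = dtst 0 (ratr p) (ratr q) n x.
    by rewrite derive1E; have [_ ->] := is_derive_tst 0 (ratr p) (ratr q) n x.
  have E1 x : g x * derive1 (tst 0 (ratr p) (ratr q) n) x = dtst 0 (ratr p) (ratr q) n x * g x.
    by rewrite D mulrC.
  have E2 x : dg x * tst 0 (ratr p) (ratr q) n x = tst 0 (ratr p) (ratr q) n x * dg x.
    by rewrite mulrC.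
  by rewrite -(eq_I mu E1) -(eq_I mu E2); exact: H.
exists (fun x => prim dg x + K).
  by apply: (ac_ext (acD aP (ac_cst K))) => // x; rewrite addr0.
by apply: (ae_imp HK) => x; apply; exact: ltNyr.
Qed.

Lemma ac_weak_derivative (g U h : R -> R) : measurable_fun setT g -> ac U h ->
  {ae mu, forall x, g x = U x} -> weak_derivative g h.
Proof.
move=> mg aU gU; have mU := ac_measU aU; have lU := cont_locL1 (ac_cont aU).
have lg : locL1 g.
  move=> a b ab; apply: (@L1_aeeq _ _ _ mu _ _ _ _ (lU a b ab)).
    by apply: measurable_funM => //; exact: measurable_ind.
  by apply: (ae_imp gU) => x ->.
split; [exact: locL1_locally_integrable|exact: locL1_locally_integrable (ac_meas aU) (ac_loc aU)|].
move=> phi [sm [K [cK _] K0]].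
have [c0 d0] := sm [::]; have [c1 _] := sm [:: 1].
have dphi (x : R) : is_derive x 1 phi (derive1 phi x).
  by rewrite derive1E; exact: derivableP.
have cphi : continuous (derive1 phi).
  by rewrite (_ : derive1 phi = 'D_1 phi); [exact: c1|apply/funext => x; rewrite derive1E].
have [M [_ HM]] := compact_bounded cK.
pose L := `|M| + 1.
have out x : L < `|x| -> phi x = 0.
  move=> Lx; apply: K0 => Kx; move: Lx; apply/negP; rewrite -leNgt.
  by apply: (HM L) => //; rewrite /L (le_lt_trans (ler_norm M))// ltrDl.
have s1 : supp phi (L + 1) by move=> x Lx; apply: out; apply: lt_le_trans Lx; rewrite ltrDl.
have s2 : supp (derive1 phi) (L + 1).
  move=> x Lx; have Lx' : L < `|x| by apply: lt_le_trans Lx; rewrite ltrDl.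
  have D0 : is_derive x 1 (fun=> 0 : R) 0 by exact: is_derive_cst.
  have D2 : is_derive x 1 phi 0.
    apply: near_eq_is_derive D0.
    have : \forall z \near x, L < `|z|.
      have cn : `|z| @[z --> x] --> `|x| by apply: cvg_norm; exact: cvg_id.
      exact: (cvgr_gt _ cn).
    by apply: filterS => z /out.
  by rewrite derive1E; have [_ ->] := D2.
have [l1 l2 e] := ibp (ac_C1 dphi cphi) cphi s1 s2 aU.
have mphi : measurable_fun setT phi by exact: continuous_measurable_fun.
have mdphi : measurable_fun setT (derive1 phi) by exact: continuous_measurable_fun.
have E1 : I mu (fun x => g x * derive1 phi x) = I mu (fun x => derive1 phi x * U x).
  apply: (@I_aeeq _ _ _ mu); [exact: measurable_funM|exact: measurable_funM|].
  by apply: (ae_imp gU) => x ->; rewrite mulrC.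
have E2 x : phi x * h x = h x * phi x by rewrite mulrC.
by rewrite (eq_I mu E2) in e; rewrite -[LHS]/(I mu _) E1 e.
Qed.

Lemma Lnorm_oo (g : R -> R) (C : R) : 0 <= C -> {ae mu, forall x, `|g x| <= C} ->
  (Lnorm_R +oo g <= C%:E)%E.
Proof.
move=> C0 H; rewrite /Lnorm_R unlock /Lnorm/=; case: ifPn => _; last by rewrite lee_fin.
by apply/ess_supP; apply: (ae_imp H) => x; rewrite /= lee_fin.
Qed.

End WeakDerivative.

(** * The three decay estimates *)

Theorem theorem1p2 (R : realType) (p mu : R) (f : R -> R) (ut : R)
    (u0 : R -> R) (p1 : 1 < p) (mu0 : 0 < mu)
    (fC3 : of_class_C3 f) (f0 : f 0 = 0) (df0 : derive1 f 0 = 0)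
    (f_convex : forall y, 0 < derive1n 2 f y)
    (u0L1 : (fun x => u0 x - ut) \in Lfun (leb1 R) 1%:E)
    (u0L2 : (fun x => u0 x - ut) \in Lfun (leb1 R) 2%:E)
    (du0L : exists2 du0 : R -> R, weak_derivative u0 du0 &
      du0 \in Lfun (leb1 R) (p + 1)%:E) :
  (forall q : R, 1 <= q ->
    (exists2 C : R, 0 < C &
      forall u ux gx, global_weak_solution p mu f ut u0 u ux gx ->
      forall t, 0 <= t ->
        (Lnorm_R q%:E (fun x => u t x - ut)%R <=
          (C * (1 + t) `^ (- (1 / (2 * p) * (1 - 1 / q))))%:E)%E) /\
    (forall eps : R, 0 < eps ->
      exists2 C : R, 0 < C &
      forall u ux gx, global_weak_solution p mu f ut u0 u ux gx ->
      forall t, 0 <= t ->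
        (Lnorm_R +oo (fun x => u t x - ut)%R <=
          (C * (1 + t) `^ (- (1 / (2 * p)) + eps))%:E)%E)) /\
  (forall eps : R, 0 < eps ->
    exists2 C : R, 0 < C &
    forall u ux gx, global_weak_solution p mu f ut u0 u ux gx ->
    forall t, 0 <= t ->
      exists2 dut : R -> R, weak_derivative (u t) dut &
        (Lnorm_R (p + 1)%:E dut <=
          (C * (1 + t) `^
            (- (3 / (2 * (p + 1) * (3 * p - 2))) + eps))%:E)%E).
Proof.
have p0 : 0 < p by rewrite (lt_trans _ p1).
have p10 : 0 < p + 1 by rewrite addr_gt0.
have p11 : 1 <= p + 1 by rewrite lerDr ltW.
have p32 : 0 < 3 * p - 2 by lra.
case: du0L => du0 Hdu0 Ldu0.
have [_ lY] := Lfun_L1 p11 Ldu0.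
have [U0 aU0 u0U0] := weak_derivative_ac Hdu0.
have [mu0' l1] := Lfun_L1 (lexx 1) u0L1.
have [_ l2] := Lfun_L1 (ler1n _ 2 : (1 : R) <= 2) u0L2.
pose z x := u0 x - ut; pose Z x := U0 x - ut.
have aZ : ac Z du0 by apply: (ac_ext (acD aU0 (ac_cst (- ut)))) => // x; rewrite addr0.
have zZ : {ae leb1 R, forall x, z x = Z x} by apply: (ae_imp u0U0) => x; rewrite /z /Z => ->.
have lz : L1 (leb1 R) z.
  by apply: L1_le l1 => // x; rewrite powRr1.
(* The added 1 makes [m] positive also for a constant datum. *)
pose m := I (leb1 R) (fun x => `|z x|) + 1.
have m0 : 0 < m by rewrite ltr_wpDl// I_ge0.
have lZ2 : L1 (leb1 R) (fun x => Z x ^+ 2).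
  apply: (@L1_aeeq _ _ _ (leb1 R) _ _ _ _ l2); first by apply: measurable_funX; exact: ac_measU aZ.
  by apply: (ae_imp zZ) => x <-; rewrite sqr_powR.
pose Y0 := I (leb1 R) (fun x => `|du0 x| `^ (p + 1)).
have Y00 : 0 <= Y0 by apply: I_ge0 => x; exact: powR_ge0.
(* The supremum of the datum is bounded by its [L^2] norm and its slope, so [K] depends on [u0]
   alone. *)
have ZK := ac_sup p11 aZ lZ2 (lexx _) lY (lexx _).
set K := 2 + _ + _ in ZK.
have K0 : 0 <= K by exact: le_trans (ZK 0).
pose f1 w := derive1n 1 f (ut + w); pose f2 w := derive1n 2 f (ut + w).
have cf2 : continuous f2.
  move=> w; apply: (continuous_comp (f := fun w => ut + w)).
    by apply: cvgD; [exact: cvg_cst|exact: cvg_id].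
  by apply: differentiable_continuous; apply/derivable1_diffP; exact: (fC3.1 2%N).
(* All constants are fixed before this point; a solution enters only through [admissible] and
   agreement almost everywhere at each time. *)
have adm u ux gx : global_weak_solution p mu f ut u0 u ux gx ->
    exists M w uX gX, admissible p mu f1 f2 m K Y0 M w uX gX /\
    forall t, 0 <= t -> measurable_fun setT (u t) /\ {ae leb1 R, forall x, w t x = u t x - ut}.
  move=> S; have [M [w [uX [gX [sl wu]]]]] := gws_sol p1 fC3 S.
  have mw0 := measurable_slice 0 (s_mv sl).
  have wz : {ae leb1 R, forall x, w 0 x = z x}.
    by apply: (ae_imp2 (wu 0 (lexx 0)) (gws_init S)) => x -> ->.
  exists M, w, uX, gX; split; last first.
    move=> t t0; split; last exact: wu.
    have [mt _] := Lfun_L1 (ler1n _ 2 : (1 : R) <= 2) ((gws_u_C0 S).1 t t0).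
    rewrite (_ : u t = (fun x => (u t x - ut) + ut)); last by apply/funext => x; rewrite subrK.
    by apply: measurable_funD => //; exact: measurable_cst.
  have mz := L1_meas lz.
  have zw : {ae leb1 R, forall x, z x = w 0 x} by apply: (ae_imp wz) => x ->.
  split => //.
  - exact: (@L1_aeeq _ _ _ (leb1 R) _ _ mw0 zw lz).
  - rewrite (@I_aeeq _ _ _ (leb1 R) _ (fun x => `|z x|)).
    + by rewrite /m lerDl.
    + exact: measurableT_comp.
    + exact: measurableT_comp.
    + by apply: (ae_imp wz) => x ->.
  - by apply: (ae_imp2 wz zZ) => x -> ->.
  - by exists Z, du0; split => //; apply: (ae_imp2 wz zZ) => x -> ->.
split=> [q q1|eps eps0]; last first.
  have [C C0 HC] := slope_decay f1 p1 mu0 m0 K0 Y00 cf2.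
  pose e := 3 / (2 * (3 * p - 2)).
  have e0 : 0 < e by rewrite divr_gt0// mulr_gt0.
  exists (C `^ (p + 1)^-1); first exact: powR_gt0.
  move=> u ux gx S t t0; have [M [w [uX [gX [A wu]]]]] := adm u ux gx S.
  have sl := ad_sol A; have [mut wut] := wu t t0.
  have mwt := measurable_slice t (s_mv sl).
  pose Y := C * (1 + t) `^ (- e).
  have Y0' : 0 <= Y by rewrite mulr_ge0 ?powR_ge0// ltW.
  have r2 : 2 <= p + 1 by move: p1; lra.
  (* Good times decreasing to [t] provide members of the class: their slope bound at a later time is
     at most [Y] because the rate is decreasing, and [L^2] continuity makes them close to [w t]. *)
  have near e' : 0 < e' -> exists W w', near_class (p + 1) Y (w t) e' W w'.
    move=> e'0; have good : {ae leb1 R, forall s, 0 < s -> good_time p w uX gX s /\ slope p uX s <= C * (1 + s) `^ (- e)}.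
      by apply: (ae_imp2 (s_good sl) (HC M w uX gX A)) => s h1 h2 s0; split; [exact: h1|exact: h2].
    have [tn [tn1 tn2]] := ae_seq good t0.
    have tn0 i : 0 <= tn i by rewrite (le_trans t0)// ltW// (tn1 i).1.
    have cn := s_cont sl t0 tn0 tn2.
    have [n _ /(_ n (leqnn n)) Hn] : \forall n \near \oo, I (leb1 R) (fun x => (w (tn n) x - w t x) ^+ 2) <= e'.
      by apply: (cvgr_le 0).
    have [tni [[[U aU vU] _ ly _] sY]] := tn1 n.
    have mwn := measurable_slice (tn n) (s_mv sl).
    have lw := L1_sqrB mwn mwt (s_v2 sl (tn0 n)) (s_v2 sl t0).
    have mUw : measurable_fun setT (fun x => (U x - w t x) ^+ 2).
      by apply: measurable_funX; apply: measurable_funB => //; exact: ac_measU aU.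
    have aeU : {ae leb1 R, forall x, (w (tn n) x - w t x) ^+ 2 = (U x - w t x) ^+ 2}.
      by apply: (ae_imp vU) => x ->.
    exists U, (uX (tn n)); split => //.
    - exact: (@L1_aeeq _ _ _ (leb1 R) _ _ mUw aeU lw).
    - by rewrite -(@I_aeeq _ _ _ (leb1 R) _ _ (L1_meas lw) mUw aeU).
    - apply: le_trans sY _; apply: ler_wpM2l; first exact: ltW.
      by apply: powR_anti; rewrite ?(ltW e0) ?ltr_wpDr// lerD2l ltW.
  have [U [h [aU wU lh Ih]]] := ac_closed r2 mwt near.
  exists h.
    apply: (@ac_weak_derivative _ (u t) (fun x => U x + ut)) => //.
      by apply: (ac_ext (acD aU (ac_cst ut))) => // x; rewrite addr0.
    by apply: (ae_imp2 wut wU) => x h1 h2; rewrite -h2 h1 subrK.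
  apply: le_trans (L1_Lnorm p10 Y0' lh Ih) _; rewrite lee_fin.
  rewrite /Y (powRM _ (ltW C0) (powR_ge0 _ _)) -powRrM; apply: ler_wpM2l; first exact: powR_ge0.
  apply: ler_powR; first by rewrite lerDl.
  have -> : - e / (p + 1) = - (3 / (2 * (p + 1) * (3 * p - 2))).
    by rewrite /e; field; rewrite !gt_eqF.
  by rewrite lerDl ltW.
split=> [|eps eps0].
  have q0 : 0 < q by rewrite (lt_le_trans ltr01).
  have [C C0 HC] := lq_decay f1 f2 p1 mu0 m0 K0 q1.
  exists (C `^ q^-1); first exact: powR_gt0.
  move=> u ux gx S t t0; have [M [w [uX [gX [A wu]]]]] := adm u ux gx S.
  have [mut wut] := wu t t0.
  have [lw Iw] := HC M w uX gX (ad_sol A) (ad_L1 A) (ad_m A) (ad_K A) t t0.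
  have muq : measurable_fun setT (fun x => `|u t x - ut| `^ q).
    by apply: measurable_absX; apply: measurable_funB => //; exact: measurable_cst.
  have E : {ae leb1 R, forall x, `|w t x| `^ q = `|u t x - ut| `^ q} by apply: (ae_imp wut) => x ->.
  have lu := @L1_aeeq _ _ _ (leb1 R) _ _ muq E lw.
  have B0 : 0 <= C * (1 + t) `^ (- (1 / (2 * p) * (q - 1))) by rewrite mulr_ge0 ?powR_ge0// ltW.
  have Iu : I (leb1 R) (fun x => `|u t x - ut| `^ q) <= C * (1 + t) `^ (- (1 / (2 * p) * (q - 1))).
    by rewrite -(@I_aeeq _ _ _ (leb1 R) _ _ (L1_meas lw) muq E).
  apply: le_trans (L1_Lnorm q0 B0 lu Iu) _; rewrite lee_fin.
  rewrite (powRM _ (ltW C0) (powR_ge0 _ _)) -powRrM.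
  have -> : - (1 / (2 * p) * (q - 1)) / q = - (1 / (2 * p) * (1 - 1 / q)).
    by field; rewrite !gt_eqF.
  exact: lexx.
have [C C0 HC] := sup_decay f1 p1 mu0 m0 K0 Y00 cf2 eps0.
exists C => // u ux gx S t t0; have [M [w [uX [gX [A wu]]]]] := adm u ux gx S.
have [mut wut] := wu t t0.
apply: Lnorm_oo; first by rewrite mulr_ge0 ?powR_ge0// ltW.
by apply: (ae_imp2 wut (HC M w uX gX A t t0)) => x ->.
Qed.
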